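(* Let $(A,\Delta)$ be a $C^{*}$-quantum group such that the $C^{*}$-algebra $A$ has the slice map property. Then every injective, weakly continuous, regular partial coaction $\delta_C$ of $(A,\Delta)$ on a $C^{*}$-algebra $C$ has a minimal dilation, and this minimal dilation is unique up to isomorphism of dilations of $\delta_C$.
   Context: Conventions: tensor products of $C^{*}$-algebras are minimal; $M(A)$ is the multiplier algebra with unit $1_A$; $A^{*}$ is the space of bounded linear functionals; $[F]$ is the closed linear span of $F$. Maps on tensor products are extended to multipliers in the usual way. A $C^{*}$-bialgebra is a $C^{*}$-algebra $A$ with a nondegenerate $*$-homomorphism $\Delta\colon A\to M(A\otimes A)$ such that $(\Delta\otimes \mathrm{id}_A)\Delta=(\mathrm{id}_A\otimes\Delta)\Delta$. A $C^{*}$-quantum group is a $C^{*}$-bialgebra arising as follows from a modular (or manageable) multiplicative unitary $W\in\mathcal B(H\otimes H)$ ($H$ a Hilbert space): $A=[(\omega\otimes \mathrm{id}_H)W:\omega\in\mathcal B(H)_*]$ and $\Delta(a)=W(a\otimes 1_H)W^{*}$. Here $W$ is multiplicative if $W_{23}W_{12}=W_{12}W_{13}W_{23}$; it is modular (in the sense of Sołtan and Woronowicz) if there are injective positive self-adjoint operators $Q,\hat Q$ on $H$ and a unitary $\tilde W$ on $\overline H\otimes H$ with $W(\hat Q\otimes Q)W^{*}=\hat Q\otimes Q$ and $\langle x\otimes u, W(z\otimes y)\rangle=\langle \bar z\otimes Qu,\tilde W(\bar x\otimes Q^{-1}y)\rangle$ for all $x,z\in H$, $u\in D(Q)$, $y\in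 D(Q^{-1})$; manageable means one can take $\hat Q=Q$. $A$ has the slice map property if for every $C^{*}$-algebra $B$ and every $C^{*}$-subalgebra $C\subseteq B$, every $x\in B\otimes A$ with $(\mathrm{id}\otimes\omega)(x)\in C$ for all $\omega\in A^{*}$ lies in $C\otimes A$. A $*$-homomorphism $\pi\colon B\to M(C)$ is strict if it is strictly continuous on the unit ball; it then extends to a $*$-homomorphism $M(B)\to M(C)$, strictly continuous on the unit ball, also denoted $\pi$. A partial coaction of $(A,\Delta)$ on a $C^{*}$-algebra $C$ is a strict $*$-homomorphism $\delta\colon C\to M(C\otimes A)$ with $\delta(C)(1_C\otimes A)\subseteq C\otimes A$ and $(\delta\otimes\mathrm{id}_A)\delta(c)=(\delta(1_C)\otimes 1_A)(\mathrm{id}_C\otimes\Delta)\delta(c)$ for all $c\in C$. For $\omega\in A^{*}$, $\omega\triangleright T:=(\mathrm{id}\otimes\omega)\delta(T)$. It is weakly continuous if $[A^{*}\triangleright C]=C$, and regular if $(\mathrm{id}_C\otimes\Delta)(\delta(C))\cdot(1_C\otimes 1_A\otimes A)\subseteq M(C\otimes A)\otimes A$. A coaction of $(A,\Delta)$ on a $C^{*}$-algebra $B$ is an injective $*$-homomorphism $\delta_B\colon B\to M(B\otimes A)$ with $\delta_B(B)(1_B\otimes A)\subseteq B\otimes A$ and $(\delta_B\otimes\mathrm{id}_A)\delta_B=(\mathrm{id}_B\otimes\Delta)\delta_B$, i.e. $(\delta_B\otimes\mathrm{id}_A)(\delta_B(b)(1_B\otimes a))=(\mathrm{id}_B\otimes\Delta)(\delta_B(b))(1_B\otimes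 1_A\otimes a)$ for all $b\in B,a\in A$; again $\omega\triangleright b:=(\mathrm{id}_B\otimes\omega)\delta_B(b)$. A dilation of a partial coaction $\delta_C$ on $C$ is a triple $(B,\delta_B,\iota)$ of a $C^{*}$-algebra $B$, a coaction $\delta_B$ of $(A,\Delta)$ on $B$ and an injective $*$-homomorphism $\iota\colon C\to B$ with $\delta_B(\iota(c))(\iota(c')\otimes a)=(\iota\otimes\mathrm{id}_A)(\delta_C(c)(c'\otimes a))$ for all $c,c'\in C$, $a\in A$. It is minimal if $\iota(C)$ and $A^{*}\triangleright\iota(C)$ generate $B$ as a $C^{*}$-algebra. A morphism of dilations $(B,\delta_B,\iota^B)\to(D,\delta_D,\iota^D)$ of $\delta_C$ is a $*$-homomorphism $\phi\colon B\to D$ with $\phi\circ\iota^B=\iota^D$ and $\delta_D(\phi(b))(1_D\otimes a)=(\phi\otimes\mathrm{id}_A)(\delta_B(b)(1_B\otimes a))$ for all $b\in B,a\in A$. *)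

(* Defs.v *)
From HB Require Import structures.
From mathcomp Require Import all_boot all_order all_algebra.
From mathcomp Require Import all_classical all_reals all_analysis.
From mathcomp Require Import complex.

Set Implicit Arguments.
Unset Strict Implicit.
Unset Printing Implicit Defensive.

Import Order.TTheory GRing.Theory Num.Theory numFieldNormedType.Exports.

Local Open Scope classical_set_scope.
Local Open Scope ring_scope.

(* Conventions.  All scalars are complex numbers [R[i]], with [R : realType];
   norms take their values in the nonnegative reals of [R[i]].

   Minimal tensor products of C*-algebras, and tensor products of Hilbert
   spaces, are given by their canonical map [t : B -> A -> T] together with a
   predicate that determines [T] up to a unique isomorphism.  Objects that are
   determined uniquely by a property (slice maps, tensor products of morphisms,
   extensions to multiplier algebras) are picked with [xget]; its first
   argument is a dummy value. *)

HB.mixin Record Lmodule_isStarAlg (R : realType) V of GRing.Lmodule R[i] V := {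
  smul : V -> V -> V ;
  sstar : V -> V ;
  smulA : associative smul ;
  smul_linearl : forall y, linear (fun x : V => smul x y) ;
  smul_linearr : forall x, linear (fun y : V => smul x y) ;
  sstarK : involutive sstar ;
  sstar_antilinear : forall (z : R[i]) x y,
    sstar (z *: x + y) = z^* *: sstar x + sstar y ;
  sstarM : forall x y, sstar (smul x y) = smul (sstar y) (sstar x)
}.

#[short(type="starAlgType")]
HB.structure Definition StarAlg (R : realType) :=
  {V of GRing.Lmodule R[i] V & Lmodule_isStarAlg R V}.

HB.mixin Record StarAlg_isCstar (R : realType) V
    of CompleteNormedModule R[i] V & StarAlg R V := {
  norm_smul : forall x y : V, `|smul x y| <= `|x| * `|y| ;
  norm_cstar : forall x : V, `|smul (sstar x) x| = `|x| ^+ 2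
}.

#[short(type="cstarAlgType")]
HB.structure Definition CstarAlg (R : realType) :=
  {V of CompleteNormedModule R[i] V & StarAlg R V & StarAlg_isCstar R V}.

Declare Scope cstar_scope.
Delimit Scope cstar_scope with cstar.
Infix "⋅" := smul (at level 40, left associativity) : cstar_scope.
Notation "x ^⋆" := (sstar x) (at level 2, format "x ^⋆") : cstar_scope.
Local Open Scope cstar_scope.

Lemma smulDl (R : realType) (V : starAlgType R) (x x' y : V) :
  (x + x') ⋅ y = x ⋅ y + x' ⋅ y.
Proof. by have := smul_linearl y 1 x x'; rewrite !scale1r. Qed.

Lemma smulDr (R : realType) (V : starAlgType R) (x y y' : V) :
  x ⋅ (y + y') = x ⋅ y + x ⋅ y'.
Proof. by have := smul_linearr x 1 y y'; rewrite !scale1r. Qed.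

Lemma smul0l (R : realType) (V : starAlgType R) (y : V) : 0 ⋅ y = 0.
Proof. by apply: (@addrI _ (0 ⋅ y)); rewrite -smulDl !addr0. Qed.

Lemma smul0r (R : realType) (V : starAlgType R) (x : V) : x ⋅ 0 = 0.
Proof. by apply: (@addrI _ (x ⋅ 0)); rewrite -smulDr !addr0. Qed.

Lemma smulNl (R : realType) (V : starAlgType R) (x y : V) : (- x) ⋅ y = - (x ⋅ y).
Proof. by apply: (@addrI _ (x ⋅ y)); rewrite -smulDl !subrr smul0l. Qed.

Lemma smulNr (R : realType) (V : starAlgType R) (x y : V) : x ⋅ (- y) = - (x ⋅ y).
Proof. by apply: (@addrI _ (x ⋅ y)); rewrite -smulDr !subrr smul0r. Qed.

Lemma smulZl (R : realType) (V : starAlgType R) (z : R[i]) (x y : V) :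
  (z *: x) ⋅ y = z *: (x ⋅ y).
Proof. by have := smul_linearl y z x 0; rewrite /= !addr0 smul0l addr0. Qed.

Lemma smulZr (R : realType) (V : starAlgType R) (z : R[i]) (x y : V) :
  x ⋅ (z *: y) = z *: (x ⋅ y).
Proof. by have := smul_linearr x z y 0; rewrite /= !addr0 smul0r addr0. Qed.

Lemma sstarD (R : realType) (V : starAlgType R) (x y : V) :
  (x + y)^⋆ = x^⋆ + y^⋆.
Proof. by have := sstar_antilinear 1 x y; rewrite rmorph1 !scale1r. Qed.

Lemma sstar0 (R : realType) (V : starAlgType R) : (0 : V)^⋆ = 0.
Proof. by apply: (@addrI _ (0 : V)^⋆); rewrite -sstarD !addr0. Qed.

Lemma sstarZ (R : realType) (V : starAlgType R) (z : R[i]) (x : V) :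
  (z *: x)^⋆ = z^* *: x^⋆.
Proof. by rewrite -[z *: x]addr0 sstar_antilinear sstar0 addr0. Qed.

Definition star_hom (R : realType) (X Y : starAlgType R) (f : X -> Y) : Prop :=
  [/\ linear f,
      forall x y, f (x ⋅ y) = f x ⋅ f y
    & forall x, f x^⋆ = (f x)^⋆].

Definition lspan (R : realType) (V : lmodType R[i]) (X : set V) : set V :=
  [set v | exists n (z : 'I_n -> R[i]) (x : 'I_n -> V),
     (forall i, X (x i)) /\ v = \sum_(i < n) z i *: x i].

Definition cspan (R : realType) (V : normedModType R[i]) (X : set V) : set V :=
  closure (lspan X).

Definition bounded_linear (R : realType) (V W : normedModType R[i])
    (f : V -> W) : Prop :=
  linear f /\ exists M : R[i], forall v, `|f v| <= M * `|v|.

Definition bounded_functional (R : realType) (A : normedModType R[i])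
    (w : A -> R[i]) : Prop :=
  scalar w /\ exists M : R[i], forall a, `|w a| <= M * `|a|.

Definition op_cspan (R : realType) (V : normedModType R[i]) (X : set (V -> V)) :
    set (V -> V) :=
  [set f | forall e : R[i], 0 < e ->
     exists2 g : V -> V, lspan X g & forall v, `|f v - g v| <= e * `|v|].

Definition sub_cstar (R : realType) (B : cstarAlgType R) (D : set B) : Prop :=
  [/\ closed D, D 0,
      forall (z : R[i]) x y, D x -> D y -> D (z *: x + y),
      forall x y, D x -> D y -> D (x ⋅ y)
    & forall x, D x -> D x^⋆].

Definition cstar_generated (R : realType) (B : cstarAlgType R) (X : set B) :
    set B :=
  \bigcap_(D in [set D | sub_cstar D /\ X `<=` D]) D.

(* Double centralizers.  Linearity and boundedness of [ml] and [mr] are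
   automatic, and each of the two maps determines the other one. *)
Record multiplier (R : realType) (A : cstarAlgType R) := Multiplier {
  ml : A -> A ;
  mr : A -> A ;
  mlrP : forall x y, x ⋅ ml y = mr x ⋅ y
}.

Section MultiplierAlgebra.
Variables (R : realType) (A : cstarAlgType R).
Local Notation M := (multiplier A).

HB.instance Definition _ := gen_eqMixin M.
HB.instance Definition _ := gen_choiceMixin M.

Lemma multiplier_ext (m n : M) : ml m =1 ml n -> mr m =1 mr n -> m = n.
Proof.
case: m n => [l r p] [l' r' p'] /= /funext e /funext e'; subst.
by congr Multiplier; exact: Prop_irrelevance.
Qed.

Lemma cstar_eq0 (x : A) : x^⋆ ⋅ x = 0 -> x = 0.
Proof.
move=> h; have /eqP : `|x| ^+ 2 = 0 by rewrite -norm_cstar h normr0.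
by rewrite expf_eq0 /= normr_eq0 => /eqP.
Qed.

Lemma cstar_injl (x y : A) : (forall c, c ⋅ x = c ⋅ y) -> x = y.
Proof.
move=> h; apply/subr0_eq/cstar_eq0.
by rewrite smulDr smulNr h subrr.
Qed.

Lemma ml_linear (m : M) : linear (ml m).
Proof.
move=> z x y; apply: cstar_injl => c.
by rewrite mlrP !smulDr !smulZr !mlrP.
Qed.

Lemma sstar_inj (x y : A) : x^⋆ = y^⋆ -> x = y.
Proof. by move=> /(congr1 sstar); rewrite !sstarK. Qed.

Lemma cstar_injr (x y : A) : (forall c, x ⋅ c = y ⋅ c) -> x = y.
Proof.
move=> h; apply: sstar_inj; apply: cstar_injl => c.
by rewrite -[c]sstarK -!sstarM h.
Qed.

Lemma mr_linear (m : M) : linear (mr m).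
Proof.
move=> z x y; apply: cstar_injr => c.
by rewrite -mlrP !smulDl !smulZl !mlrP.
Qed.

Lemma ml_mul (m : M) x y : ml m (x ⋅ y) = ml m x ⋅ y.
Proof. by apply: cstar_injl => c; rewrite mlrP !smulA mlrP. Qed.

Lemma mr_mul (m : M) x y : mr m (x ⋅ y) = x ⋅ mr m y.
Proof. by apply: cstar_injr => c; rewrite -mlrP -!smulA mlrP. Qed.

Fact mzeroP (x y : A) : x ⋅ 0 = 0 ⋅ y.
Proof. by rewrite smul0l smul0r. Qed.
Definition mzero : M := Multiplier mzeroP.

Fact maddP (m n : M) x y : x ⋅ (ml m y + ml n y) = (mr m x + mr n x) ⋅ y.
Proof. by rewrite smulDr smulDl !mlrP. Qed.
Definition madd (m n : M) : M := Multiplier (maddP m n).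

Fact moppP (m : M) x y : x ⋅ (- ml m y) = (- mr m x) ⋅ y.
Proof. by rewrite smulNr smulNl mlrP. Qed.
Definition mopp (m : M) : M := Multiplier (moppP m).

Fact mscaleP (z : R[i]) (m : M) x y : x ⋅ (z *: ml m y) = (z *: mr m x) ⋅ y.
Proof. by rewrite smulZr smulZl mlrP. Qed.
Definition mscale (z : R[i]) (m : M) : M := Multiplier (mscaleP z m).

Fact mmulP (m n : M) x y : x ⋅ ml m (ml n y) = mr n (mr m x) ⋅ y.
Proof. by rewrite !mlrP. Qed.
Definition mmul (m n : M) : M := Multiplier (mmulP m n).

Fact mstarP (m : M) x y : x ⋅ (mr m y^⋆)^⋆ = (ml m x^⋆)^⋆ ⋅ y.
Proof. by apply: sstar_inj; rewrite !sstarM !sstarK mlrP. Qed.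
Definition mstar (m : M) : M := Multiplier (mstarP m).

Definition mone : M := @Multiplier R A id id (fun x y => erefl).

Fact membP (a x y : A) : x ⋅ (a ⋅ y) = (x ⋅ a) ⋅ y.
Proof. exact: smulA. Qed.
Definition memb (a : A) : M := Multiplier (membP a).

Lemma maddA : associative madd.
Proof. by move=> m n p; apply: multiplier_ext => x /=; rewrite addrA. Qed.
Lemma maddC : commutative madd.
Proof. by move=> m n; apply: multiplier_ext => x /=; rewrite addrC. Qed.
Lemma madd0 : left_id mzero madd.
Proof. by move=> m; apply: multiplier_ext => x /=; rewrite add0r. Qed.
Lemma maddN : left_inverse mzero mopp madd.
Proof. by move=> m; apply: multiplier_ext => x /=; rewrite addNr. Qed.

HB.instance Definition _ := GRing.isZmodule.Build M maddA maddC madd0 maddN.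

Lemma mscaleA z z' (m : M) : mscale z (mscale z' m) = mscale (z * z') m.
Proof. by apply: multiplier_ext => x /=; rewrite scalerA. Qed.
Lemma mscale1 : left_id 1 mscale.
Proof. by move=> m; apply: multiplier_ext => x /=; rewrite scale1r. Qed.
Lemma mscaleDr : right_distributive mscale +%R.
Proof. by move=> z m n; apply: multiplier_ext => x /=; rewrite scalerDr. Qed.
Lemma mscaleDl (m : M) : {morph mscale^~ m : z z' / z + z'}.
Proof. by move=> z z'; apply: multiplier_ext => x /=; rewrite scalerDl. Qed.

HB.instance Definition _ :=
  GRing.Zmodule_isLmodule.Build R[i] M mscaleA mscale1 mscaleDr mscaleDl.

Lemma mmulA : associative mmul.
Proof. by move=> m n p; apply: multiplier_ext. Qed.
Lemma mmul_linearl n : linear (fun m : M => mmul m n).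
Proof.
move=> z m m'; apply: multiplier_ext => x //=.
by have := mr_linear n z (mr m x) (mr m' x).
Qed.
Lemma mmul_linearr m : linear (fun n : M => mmul m n).
Proof.
move=> z n n'; apply: multiplier_ext => x //=.
by have := ml_linear m z (ml n x) (ml n' x).
Qed.
Lemma mstarK : involutive mstar.
Proof. by move=> m; apply: multiplier_ext => x /=; rewrite !sstarK. Qed.
Lemma mstar_antilinear (z : R[i]) (m n : M) :
  mstar (z *: m + n) = z^* *: mstar m + mstar n.
Proof. by apply: multiplier_ext => x /=; rewrite sstarD sstarZ. Qed.
Lemma mstarM m n : mstar (mmul m n) = mmul (mstar n) (mstar m).
Proof. by apply: multiplier_ext => x /=; rewrite !sstarK. Qed.

HB.instance Definition _ := Lmodule_isStarAlg.Build R M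
  mmulA mmul_linearl mmul_linearr mstarK mstar_antilinear mstarM.

End MultiplierAlgebra.

Definition mnorm_le (R : realType) (A : cstarAlgType R) (m : multiplier A)
    (e : R[i]) : Prop :=
  forall a, `|ml m a| <= e * `|a|.

Definition mcspan (R : realType) (A : cstarAlgType R)
    (X : set (multiplier A)) : set (multiplier A) :=
  [set m | forall e : R[i], 0 < e ->
     exists2 n, lspan X n & mnorm_le (m - n) e].

Definition strict_cvg (R : realType) (A : cstarAlgType R)
    (F : set_system (multiplier A)) (m : multiplier A) : Prop :=
  forall a, ml n a @[n --> F] --> ml m a /\ mr n a @[n --> F] --> mr m a.

(* strict continuity on the unit ball *)
Definition strict (R : realType) (B C : cstarAlgType R)
    (p : B -> multiplier C) : Prop :=
  forall (F : set_system B) (b : B), Filter F ->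
    F [set x | `|x| <= 1] -> `|b| <= 1 ->
    strict_cvg (@memb R B @ F) (memb b) -> strict_cvg (p @ F) (p b).

Definition mstrict (R : realType) (B C : cstarAlgType R)
    (p : multiplier B -> multiplier C) : Prop :=
  forall (F : set_system (multiplier B)) (m : multiplier B), Filter F ->
    F [set n | mnorm_le n 1] -> mnorm_le m 1 ->
    strict_cvg F m -> strict_cvg (p @ F) (p m).

Definition mext (R : realType) (B C : cstarAlgType R) (p : B -> multiplier C) :
    multiplier B -> multiplier C :=
  xget (fun=> 0)
    [set q | [/\ star_hom q, mstrict q & forall b, q (memb b) = p b]].

Definition nondegenerate (R : realType) (B C : cstarAlgType R)
    (p : B -> multiplier C) : Prop :=
  cspan [set ml (p b) c | b in setT & c in setT] = setT.

(* The inner product is linear in the second variable. *)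
HB.mixin Record CompleteNormed_isHilbert (R : realType) V
    of CompleteNormedModule R[i] V := {
  inner : V -> V -> R[i] ;
  inner_linear : forall x, scalar (inner x) ;
  inner_conj : forall x y, inner y x = (inner x y)^* ;
  inner_norm : forall x : V, inner x x = `|x| ^+ 2
}.

#[short(type="hilbertType")]
HB.structure Definition Hilbert (R : realType) :=
  {V of CompleteNormedModule R[i] V & CompleteNormed_isHilbert R V}.

Notation "⟨ x , y ⟩" := (inner x y) : cstar_scope.

(* [L], with the map [h], is the Hilbert space tensor product of [H] and [K] *)
Definition hilbert_tensor (R : realType) (H K L : hilbertType R)
    (h : H -> K -> L) : Prop :=
  [/\ forall x, linear (h x),
      forall y, linear (h^~ y),
      forall x x' y y', ⟨h x y, h x' y'⟩ = ⟨x, x'⟩ * ⟨y, y'⟩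
    & cspan [set h x y | x in setT & y in setT] = setT].

Definition unitary (R : realType) (H : hilbertType R) (W : H -> H) : Prop :=
  [/\ linear W, forall x y, ⟨W x, W y⟩ = ⟨x, y⟩ & set_surj setT setT W].

Definition hadj (R : realType) (H : hilbertType R) (W : H -> H) : H -> H :=
  xget (id : H -> H) [set V | forall x y, ⟨V x, y⟩ = ⟨x, W y⟩].

(* [f (x) g] as a bounded operator on [H (x) K] *)
Definition op_tensor (R : realType) (H K L : hilbertType R) (h : H -> K -> L)
    (f : H -> H) (g : K -> K) : L -> L :=
  xget (id : L -> L) [set F | bounded_linear F /\ forall x y, F (h x y) = h (f x) (g y)].

Definition rep (R : realType) (A : cstarAlgType R) (H : hilbertType R)
    (p : A -> H -> H) : Prop :=
  [/\ forall a, bounded_linear (p a),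
      forall x, linear (p^~ x),
      forall a b x, p (a ⋅ b) x = p a (p b x)
    & forall a x y, ⟨p a^⋆ x, y⟩ = ⟨x, p a y⟩].

Definition faithful_rep (R : realType) (A : cstarAlgType R) (H : hilbertType R)
    (p : A -> H -> H) : Prop :=
  rep p /\ injective p.

(* [T] is identified with the closed linear span of the operators
   [p b (x) q a] on a Hilbert space tensor product, for some faithful
   representations [p] of [B] and [q] of [A]. *)
Definition min_tensor (R : realType) (B A T : cstarAlgType R)
    (t : B -> A -> T) : Prop :=
  exists (H K L : hilbertType R) (h : H -> K -> L)
         (p : B -> H -> H) (q : A -> K -> K) (s : T -> L -> L),
    [/\ hilbert_tensor h, faithful_rep p, faithful_rep q, faithful_rep s
      & (forall b a x y, s (t b a) (h x y) = h (p b x) (q a y)) /\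
        cspan [set t b a | b in setT & a in setT] = setT].

(* the multiplier [m (x) n] of [B (x) A], for [m] in [M(B)] and [n] in [M(A)] *)
Definition mtens (R : realType) (B A T : cstarAlgType R) (t : B -> A -> T)
    (m : multiplier B) (n : multiplier A) : multiplier T :=
  xget 0 [set k | forall b a, ml k (t b a) = t (ml m b) (ml n a)].

(* [f (x) g : B (x) A -> M(B' (x) A')] *)
Definition tens_mhom (R : realType) (B A T B' A' T' : cstarAlgType R)
    (t : B -> A -> T) (t' : B' -> A' -> T')
    (f : B -> multiplier B') (g : A -> multiplier A') : T -> multiplier T' :=
  xget (fun=> 0)
    [set k | star_hom k /\ forall b a, k (t b a) = mtens t' (f b) (g a)].

(* [f (x) id : B (x) A -> B' (x) A] *)
Definition tens_hom (R : realType) (B A T B' T' : cstarAlgType R)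
    (t : B -> A -> T) (t' : B' -> A -> T') (f : B -> B') : T -> T' :=
  xget (fun=> 0) [set k | star_hom k /\ forall b a, k (t b a) = t' (f b) a].

(* [id (x) w : B (x) A -> B] *)
Definition slice (R : realType) (B A T : cstarAlgType R) (t : B -> A -> T)
    (w : A -> R[i]) : T -> B :=
  xget (fun=> 0)
    [set s | bounded_linear s /\ forall b a, s (t b a) = w a *: b].

(* [id (x) w : M(B (x) A) -> M(B)] *)
Definition mslice (R : realType) (B A T : cstarAlgType R) (t : B -> A -> T)
    (w : A -> R[i]) : multiplier T -> multiplier B :=
  xget (fun=> 0)
    [set s | [/\ linear s, mstrict s
                & forall x, s (memb x) = memb (slice t w x)]].

(* [D (x) A] is the closed span of elementary tensors in [B (x) A]. *)
Definition slice_map_property (R : realType) (A : cstarAlgType R) : Prop :=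
  forall (B T : cstarAlgType R) (t : B -> A -> T), min_tensor t ->
  forall D : set B, sub_cstar D ->
  forall x : T, (forall w, bounded_functional w -> D (slice t w x)) ->
    cspan [set t d a | d in D & a in setT] x.

(* [T3 = (C (x) A1) (x) A2 = C (x) (A1 (x) A2)], with canonical maps [l], [r] *)
Definition min_tensor3 (R : realType) (C A1 A2 T12 T23 T3 : cstarAlgType R)
    (t12 : C -> A1 -> T12) (t23 : A1 -> A2 -> T23)
    (l : T12 -> A2 -> T3) (r : C -> T23 -> T3) : Prop :=
  [/\ min_tensor l, min_tensor r
    & forall c a a', l (t12 c a) a' = r c (t23 a a')].

Record cstarBialg (R : realType) := CstarBialg {
  bA :> cstarAlgType R ;
  bAA : cstarAlgType R ;
  bAAA : cstarAlgType R ;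
  bt : bA -> bA -> bAA ;
  bl : bAA -> bA -> bAAA ;
  br : bA -> bAA -> bAAA ;
  bt_min : min_tensor bt ;
  blr_min : min_tensor3 bt bt bl br ;
  Delta : bA -> multiplier bAA ;
  Delta_hom : star_hom Delta ;
  Delta_nondeg : nondegenerate Delta ;
  Delta_coassoc : forall a,
    mext (tens_mhom bt bl Delta (@memb R bA)) (Delta a) =
    mext (tens_mhom bt br (@memb R bA) Delta) (Delta a)
}.

(* [W_23 W_12 = W_12 W_13 W_23] on [H3 = H (x) H (x) H]; the maps [l], [r], [m]
   insert a vector in the third, first and second leg, respectively. *)
Definition multiplicative (R : realType) (H L : hilbertType R)
    (h : H -> H -> L) (W : L -> L) : Prop :=
  exists (H3 : hilbertType R) (l : L -> H -> H3) (r m : H -> L -> H3),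
    [/\ hilbert_tensor l, hilbert_tensor r, hilbert_tensor m
      & forall x y z, r x (h y z) = l (h x y) z /\ m y (h x z) = l (h x y) z] /\
    exists W12 W13 W23 : H3 -> H3,
      [/\ bounded_linear W12 /\ (forall v z, W12 (l v z) = l (W v) z),
          bounded_linear W13 /\ (forall y v, W13 (m y v) = m y (W v)),
          bounded_linear W23 /\ (forall x v, W23 (r x v) = r x (W v))
        & forall v, W23 (W12 v) = W12 (W13 (W23 v))].

(* [Hb], with the map [bar], is the conjugate Hilbert space of [H] *)
Definition conjugate_hilbert (R : realType) (H Hb : hilbertType R)
    (bar : H -> Hb) : Prop :=
  [/\ bijective bar,
      forall (z : R[i]) x y, bar (z *: x + y) = z^* *: bar x + bar y
    & forall x y, ⟨bar x, bar y⟩ = ⟨y, x⟩].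

(* Injective positive self-adjoint (unbounded) operators, given by their graph:
   [Q (x, y)] means that [x] is in the domain and is mapped to [y].  Density of
   the domain makes the right-hand side of the equivalence the graph of the
   adjoint; a graph satisfying it is automatically a linear subspace, and the
   graph of a function. *)
Definition inj_pos_selfadj (R : realType) (H : hilbertType R)
    (Q : set (H * H)) : Prop :=
  [/\ closure [set q.1 | q in Q] = setT,
      forall x y, Q (x, y) <-> (forall u v, Q (u, v) -> ⟨u, y⟩ = ⟨v, x⟩),
      forall x y, Q (x, y) -> 0 <= ⟨x, y⟩
    & forall x, Q (x, 0) -> x = 0].

(* the closure of the algebraic tensor product of two unbounded operators *)
Definition graph_tensor (R : realType) (H K L : hilbertType R) (h : H -> K -> L)
    (P : set (H * H)) (Q : set (K * K)) : set (L * L) :=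
  cspan [set (h p.1 q.1, h p.2 q.2) | p in P & q in Q].

Definition modular_with (R : realType) (H L : hilbertType R) (h : H -> H -> L)
    (W : L -> L) (Qh Q : set (H * H)) : Prop :=
  [/\ inj_pos_selfadj Qh, inj_pos_selfadj Q,
      [set (W g.1, W g.2) | g in graph_tensor h Qh Q] = graph_tensor h Qh Q
    & exists (Hb Lb : hilbertType R) (bar : H -> Hb) (hb : Hb -> H -> Lb)
             (Wt : Lb -> Lb),
        [/\ conjugate_hilbert bar, hilbert_tensor hb, unitary Wt
          & forall x z u Qu y Qiy, Q (u, Qu) -> Q (Qiy, y) ->
              ⟨h x u, W (h z y)⟩ = ⟨hb (bar z) Qu, Wt (hb (bar x) Qiy)⟩]].

Definition modular (R : realType) (H L : hilbertType R) (h : H -> H -> L)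
    (W : L -> L) : Prop := exists Qh Q, modular_with h W Qh Q.

Definition manageable (R : realType) (H L : hilbertType R) (h : H -> H -> L)
    (W : L -> L) : Prop := exists Q, modular_with h W Q Q.

Definition square_summable (R : realType) (H : hilbertType R) (x : nat -> H) :
    Prop :=
  exists M : R[i], forall n, \sum_(k < n) `|x k| ^+ 2 <= M.

(* The operators [(w (x) id) W], where [w] runs through the predual of [B(H)],
   i.e. through the functionals [T |-> \sum_k <x_k, T y_k>] with [x] and [y]
   square summable. *)
Definition left_slices (R : realType) (H L : hilbertType R) (h : H -> H -> L)
    (W : L -> L) : set (H -> H) :=
  [set a | bounded_linear a /\ exists x y : nat -> H,
     [/\ square_summable x, square_summable y
       & forall u v,
         (\sum_(k < n) ⟨h (x k) u, W (h (y k) v)⟩ : R[i]^o) @[n --> \oo]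
           --> (⟨u, a v⟩ : R[i]^o)]].

(* The last clause says that [Delta a = W (a (x) 1) W^*] as multipliers of
   [A (x) A], the latter being represented on [L = H (x) H] by [p2]. *)
Definition cstar_quantum_group (R : realType) (A : cstarBialg R) : Prop :=
  exists (H L : hilbertType R) (h : H -> H -> L) (W : L -> L) (p : A -> H -> H)
         (p2 : bAA A -> L -> L),
    [/\ hilbert_tensor h, unitary W, multiplicative h W
      & modular h W \/ manageable h W] /\
    [/\ faithful_rep p, range p = op_cspan (left_slices h W),
        rep p2 /\ (forall a b x y, p2 (bt a b) (h x y) = h (p a x) (p b y))
      & forall a t v, p2 (ml (Delta a) t) v =
                      W (op_tensor h (p a) id (hadj W (p2 t v)))].

Record tensorA (R : realType) (A : cstarBialg R) (C : cstarAlgType R) :=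
  TensorA {
    tA : cstarAlgType R ;
    tAA : cstarAlgType R ;
    tt : C -> A -> tA ;
    tl : tA -> A -> tAA ;
    tr : C -> bAA A -> tAA ;
    tt_min : min_tensor tt ;
    tlr_min : min_tensor3 tt (@bt R A) tl tr
  }.

Section Coactions.
Variables (R : realType) (A : cstarBialg R) (C : cstarAlgType R).
Variables (T : tensorA A C) (d : C -> multiplier (tA T)).

Definition one_tens (a : A) : multiplier (tA T) :=
  mtens (@tt _ _ _ T) (mone C) (memb a).

Definition tens_one (m : multiplier (tA T)) : multiplier (tAA T) :=
  mtens (@tl _ _ _ T) m (mone A).

Definition one_one_tens (a : A) : multiplier (tAA T) :=
  mtens (@tl _ _ _ T) (mone (tA T)) (memb a).

(* [d (x) id_A] on [C (x) A]; it extends to [M(C (x) A)] when [d] is strict. *)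
Definition coact_id : tA T -> multiplier (tAA T) :=
  tens_mhom (@tt _ _ _ T) (@tl _ _ _ T) d (@memb R A).

Definition id_Delta : multiplier (tA T) -> multiplier (tAA T) :=
  mext (tens_mhom (@tt _ _ _ T) (@tr _ _ _ T) (@memb R C) (@Delta R A)).

Definition coaction_range : Prop :=
  forall c a, exists x : tA T, d c ⋅ one_tens a = memb x.

Definition partial_coaction : Prop :=
  [/\ star_hom d, strict d, coaction_range
    & forall c, mext coact_id (d c) = tens_one (mext d (mone C)) ⋅ id_Delta (d c)].

(* The equation [d c ⋅ one_tens a = memb x] says that [x] is the element
   [d(c)(1 (x) a)] of [C (x) A]. *)
Definition coaction : Prop :=
  [/\ star_hom d, injective d, coaction_range
    & forall c a x, d c ⋅ one_tens a = memb x ->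
        coact_id x = id_Delta (d c) ⋅ one_one_tens a].

(* [w |> c], as an element of [M(C)]; it lies in [C] for partial coactions and
   coactions, because of [coaction_range]. *)
Definition act (w : A -> R[i]) (c : C) : multiplier C :=
  mslice (@tt _ _ _ T) w (d c).

Definition weakly_continuous : Prop :=
  mcspan [set act w c | w in @bounded_functional R A & c in setT] =
  range (@memb R C).

(* [M(C (x) A) (x) A] is the closed span of elementary tensors in
   [M(C (x) A (x) A)]. *)
Definition regular : Prop :=
  forall c a,
    mcspan [set mtens (@tl _ _ _ T) m (memb b)
             | m in setT & b in setT]
           (id_Delta (d c) ⋅ one_one_tens a).

End Coactions.

Record dilation (R : realType) (A : cstarBialg R) (C : cstarAlgType R)
    (T : tensorA A C) (d : C -> multiplier (tA T)) := Dilation {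
  dB : cstarAlgType R ;
  dT : tensorA A dB ;
  dd : dB -> multiplier (tA dT) ;
  dd_coaction : coaction dd ;
  di : C -> dB ;
  di_hom : star_hom di ;
  di_inj : injective di ;
  di_equiv : forall c c' (a : A),
    ml (dd (di c)) (tt dT (di c') a) =
    tens_hom (@tt _ _ _ T) (@tt _ _ _ dT) di (ml (d c) (tt T c' a))
}.

Section Dilations.
Variables (R : realType) (A : cstarBialg R) (C : cstarAlgType R).
Variables (T : tensorA A C) (d : C -> multiplier (tA T)).
Implicit Types D E : dilation d.

Definition minimal_dilation D : Prop :=
  cstar_generated
    (range (@di _ _ _ _ _ D) `|`
     [set b | exists w c, bounded_functional w /\
                          memb b = act (@dd _ _ _ _ _ D) w (di D c)]) = setT.

Definition dilation_morphism D E (phi : dB D -> dB E) : Prop :=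
  [/\ star_hom phi,
      forall c, phi (di D c) = di E c
    & forall b a x, dd b ⋅ one_tens (dT D) a = memb x ->
        dd (phi b) ⋅ one_tens (dT E) a =
        memb (tens_hom (@tt _ _ _ (dT D)) (@tt _ _ _ (dT E)) phi x)].

Definition dilation_isomorphic D E : Prop :=
  exists (phi : dB D -> dB E) (psi : dB E -> dB D),
    [/\ dilation_morphism phi, dilation_morphism psi,
        cancel phi psi & cancel psi phi].

End Dilations.

(* Main.v *)
(* Existence.  Represent [C] on [K0], let the multiplicative unitary [W] act on [H (x) H], and put
   [beta(X) = W_23 (X (x) 1) W_23^*] for operators [X] on [K0 (x) H].  The partial coaction is
   implemented by [delta : C -> B(K0 (x) H)], and regularity says that [beta(delta c)(1 (x) a)]
   belongs to [B(K0 (x) H) (x) A].  The dilation is the C*-algebra [B] generated by [delta(C)] and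
   the slices of these elements, with coaction [beta]: the slice map property places
   [beta(delta c)(1 (x) a)] in [B (x) A], and then the pentagon equation and the nondegeneracy of
   [Delta] show that [beta] maps all of [B] into the multipliers of [B (x) A].

   Uniqueness.  For a minimal dilation, [dd b] leaves [iota(C) (x) A] invariant and so restricts to
   a multiplier [Phi b] of [C (x) A].  This [Phi] intertwines [dd] with [beta] and extends [d], so its
   values on the generators of [B] do not depend on the dilation, and everything follows once [Phi]
   is injective.  If [Phi b = 0], then [dd(b)_12 W_23^* dd(iota c)_12 = 0].  The slices
   [(id (x) w) W] of a modular [W] have a selfadjoint closed span, so [W_23^*] can be replaced by
   [W_23]; this gives [(b (x) 1) dd(iota c) = 0], hence [b iota(C) = 0] by weak continuity, and
   finally [b B = 0]. *)
From HB Require Import structures.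
From mathcomp Require Import all_boot all_order all_algebra.
From mathcomp Require Import boolp classical_sets functions reals topology prodnormedzmodule normedtype sequences complex.
From mathcomp Require Import ring lra.
Require Import Defs.

Set Implicit Arguments.
Unset Strict Implicit.
Unset Printing Implicit Defensive.

Import Order.TTheory GRing.Theory Num.Theory numFieldNormedType.Exports.

Local Open Scope classical_set_scope.
Local Open Scope ring_scope.
Local Open Scope cstar_scope.

(** * Equations in abelian groups *)

(** Functional calculus, the Gelfand-Naimark theorem and Cohen factorization are replaced by
    elementary substitutes. Square roots come from an iteration that works without a unit. The
    algebras in question are legs or values of minimal tensor products, hence represented on Hilbert
    spaces. A functional [w] is only approximated by [w(. u)], so slices are handled up to norm
    closure. The recurring obstacle is the boundedness of maps given on generators. Iterating
    Cauchy-Schwarz overcomes it: a crude bound with a constant depending on the vector, valid for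
    all powers of an operator, already yields the sharp norm. For a modular unitary, two families of
    operators, each indexed by a total family of vectors, turn out to be values of one bounded map;
    totality of either family gives one of the two inclusions between [X] and the span of [X^⋆ X].
    In the existence proof, the generators are two-sided slices because these are defined on all
    multipliers and form a set stable under adjoints. *)

Inductive zexp := ZV of nat | ZA of zexp & zexp | ZN of zexp | Z0.

Fixpoint zcoef (i : nat) (e : zexp) : int :=
  match e with
  | ZV j => (i == j)%:Z
  | ZA a b => zcoef i a + zcoef i b
  | ZN a => - zcoef i a
  | Z0 => 0
  end.

Fixpoint zbound (n : nat) (e : zexp) : bool :=
  match e with
  | ZV j => (j < n)%N
  | ZA a b => zbound n a && zbound n b
  | ZN a => zbound n a
  | Z0 => true
  end.

Fixpoint zeval (V : zmodType) (s : seq V) (e : zexp) : V :=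
  match e with
  | ZV j => nth 0 s j
  | ZA a b => zeval s a + zeval s b
  | ZN a => - zeval s a
  | Z0 => 0
  end.

Lemma zevalE (V : zmodType) (s : seq V) e : zbound (size s) e ->
  zeval s e = \sum_(i < size s) nth 0 s i *~ zcoef i e.
Proof.
elim: e => [j|a iha b ihb|a iha|] /=.
- move=> h; rewrite (bigD1 (Ordinal h)) //= eqxx mulr1z big1 ?addr0 // => i ij.
  suff -> : (i : nat) == j = false by rewrite mulr0z.
  by apply: contraNF ij => /eqP ij; apply/eqP/val_inj.
- case/andP=> /iha -> /ihb ->; rewrite -big_split; apply: eq_bigr => i _.
  by rewrite /= mulrzDr.
- by move=> /iha ->; rewrite -sumrN; apply: eq_bigr => i _; rewrite mulrNz.
- by rewrite big1 // => i _; rewrite mulr0z.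
Qed.

(** Both sides are determined by their integer coefficients, so an identity in an abelian group
    becomes a boolean computation; this is the reflection step of [zmod]. *)
Lemma zeval_eq (V : zmodType) (s : seq V) e e' :
  [&& zbound (size s) e, zbound (size s) e' &
      all (fun i => zcoef i e == zcoef i e') (iota 0 (size s))] ->
  zeval s e = zeval s e'.
Proof.
case/and3P=> h h' /allP hc; rewrite !zevalE //; apply: eq_bigr => i _.
by congr (_ *~ _); apply/eqP/hc; rewrite mem_iota /=.
Qed.

(** Atoms are compared syntactically first and by unification otherwise, so that convertible terms
    seen through different structure instances count as one. *)
Ltac zadd e l := match l with
  | context [@cons _ e _] => l
  | context [@cons _ ?y _] => let _ := match goal with _ => unify e y end in l
  | _ => constr:(cons e l) end.
Ltac zvars e l := lazymatch e with
  | @Algebra.add _ ?a ?b => let l := zvars a l in zvars b l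
  | @Algebra.opp _ ?a => zvars a l
  | @Algebra.zero _ => l
  | _ => zadd e l
  end.
Ltac zidx e l := match l with
  | @cons _ e ?t => constr:(O)
  | @cons _ ?y ?t => let _ := match goal with _ => unify e y end in constr:(O)
  | @cons _ _ ?t => let i := zidx e t in constr:(S i)
  end.
Ltac zreify e l := lazymatch e with
  | @Algebra.add _ ?a ?b => let a := zreify a l in let b := zreify b l in constr:(ZA a b)
  | @Algebra.opp _ ?a => let a := zreify a l in constr:(ZN a)
  | @Algebra.zero _ => constr:(Z0)
  | _ => let i := zidx e l in constr:(ZV i)
  end.
Ltac zmod := lazymatch goal with |- @eq ?V ?a ?b =>
  let l := zvars a (@nil V) in let l := zvars b l in
  let ea := zreify a l in let eb := zreify b l in
  refine (@zeval_eq _ l ea eb _); vm_compute; reflexivity end.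

(** * Norms, closed subspaces and bounded linear maps *)

(** Norms take values in [R[i]]; passing to this real number makes estimates accessible to [lra] and
    [nra]. *)
Definition Nm (R : realType) (V : normedZmodType R[i]) (x : V) : R :=
  complex.Re `|x|.

Section Scalars.
Variable R : realType.
Implicit Types (z w : R[i]) (r s : R).

Lemma cjD z w : (z + w)^* = z^* + w^*. Proof. exact: rmorphD. Qed.
Lemma cjM z w : (z * w)^* = z^* * w^*. Proof. exact: rmorphM. Qed.
Lemma cjN z : (- z)^* = - z^*. Proof. exact: rmorphN. Qed.
Lemma cj0 : (0 : R[i])^* = 0. Proof. exact: rmorph0. Qed.
Lemma cj1 : (1 : R[i])^* = 1. Proof. exact: rmorph1. Qed.
Lemma cjK z : z^*^* = z. Proof. exact: conjCK. Qed.
Lemma cj_real r : (r%:C%C : R[i])^* = r%:C%C. Proof. exact: conjc_real. Qed.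
Lemma cj_sum (I : Type) (t : seq I) (F : I -> R[i]) :
  (\sum_(i <- t) F i)^* = \sum_(i <- t) (F i)^*.
Proof. exact: rmorph_sum. Qed.
Lemma ReD z w : complex.Re (z + w) = complex.Re z + complex.Re w. Proof. by case: z; case: w. Qed.
Lemma ReN z : complex.Re (- z) = - complex.Re z. Proof. by case: z. Qed.
Lemma rcD r s : (r + s)%:C%C = r%:C%C + s%:C%C :> R[i]. Proof. exact: rmorphD. Qed.
Lemma rcM r s : (r * s)%:C%C = r%:C%C * s%:C%C :> R[i]. Proof. exact: rmorphM. Qed.
Lemma rcB r s : (r - s)%:C%C = r%:C%C - s%:C%C :> R[i]. Proof. exact: rmorphB. Qed.
Lemma rcX r n : (r ^+ n)%:C%C = r%:C%C ^+ n :> R[i]. Proof. exact: rmorphXn. Qed.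

End Scalars.

Section Nm.
Variable R : realType.
Implicit Types V : normedModType R[i].

Lemma NmE (V : normedZmodType R[i]) (x : V) : `|x| = (Nm x)%:C%C.
Proof.
rewrite /Nm; have : 0 <= `|x| := normr_ge0 x.
by case: (`|x|) => a b; rewrite lecE /= => /andP[/eqP -> _].
Qed.

Lemma leNm (V W : normedZmodType R[i]) (x : V) (y : W) :
  (`|x| <= `|y|) = (Nm x <= Nm y).
Proof. by rewrite !NmE lecR. Qed.

Lemma Nm_ge0 (V : normedZmodType R[i]) (x : V) : 0 <= Nm x.
Proof. by have := normr_ge0 x; rewrite NmE ler0c. Qed.

Lemma NmD (V : normedZmodType R[i]) (x y : V) : Nm (x + y) <= Nm x + Nm y.
Proof. by have := ler_normD x y; rewrite !NmE -rcD lecR. Qed.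

Lemma NmN (V : normedZmodType R[i]) (x : V) : Nm (- x) = Nm x.
Proof. by rewrite /Nm normrN. Qed.

Lemma NmC (V : normedZmodType R[i]) (x y : V) : Nm (x - y) = Nm (y - x).
Proof. by rewrite /Nm distrC. Qed.

Lemma Nm0 (V : normedZmodType R[i]) : Nm (0 : V) = 0.
Proof. by rewrite /Nm normr0. Qed.

Lemma Nm_eq0 (V : normedZmodType R[i]) (x : V) : Nm x = 0 -> x = 0.
Proof. by move=> h; apply/eqP; rewrite -normr_eq0 NmE h. Qed.

Lemma Nm_gt0 (V : normedZmodType R[i]) (x : V) : x != 0 -> 0 < Nm x.
Proof.
move=> x0; rewrite lt_neqAle Nm_ge0 andbT eq_sym.
by apply: contra_neq x0 => /Nm_eq0.
Qed.

Lemma NmT (V : normedZmodType R[i]) (x y z : V) :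
  Nm (x - z) <= Nm (x - y) + Nm (y - z).
Proof.
have -> : x - z = (x - y) + (y - z) by rewrite addrA subrK.
exact: NmD.
Qed.

Lemma NmZ V (z : R[i]) (x : V) : Nm (z *: x) = Nm z * Nm x.
Proof. by rewrite /Nm normrZ !NmE -rmorphM. Qed.

Lemma NmM (z w : R[i]) : Nm (z * w) = Nm z * Nm w.
Proof. by rewrite /Nm normrM !NmE -rmorphM. Qed.

Lemma Nm_real (r : R) : Nm (r%:C%C) = `|r|.
Proof. by rewrite /Nm normc_def /= expr0n /= addr0 sqrtr_sqr. Qed.

Lemma NmZr V (r : R) (x : V) : Nm (r%:C%C *: x) = `|r| * Nm x.
Proof. by rewrite NmZ Nm_real. Qed.

Lemma Nm_conj (z : R[i]) : Nm (z^* : R[i]) = Nm z.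
Proof. by rewrite /Nm norm_conjC. Qed.

Lemma Nm1 : Nm (1 : R[i]) = 1.
Proof. by rewrite /Nm normr1. Qed.

Lemma Nm_le (V : normedZmodType R[i]) (x : V) (e : R) :
  (`|x| <= e%:C%C) = (Nm x <= e).
Proof. by rewrite NmE lecR. Qed.

Lemma Nm_lt (V : normedZmodType R[i]) (x : V) (e : R) :
  (`|x| < e%:C%C) = (Nm x < e).
Proof. by rewrite NmE ltcR. Qed.

Lemma posC (e : R[i]) : 0 < e -> exists2 r : R, 0 < r & e = r%:C%C.
Proof.
case: e => a b; rewrite ltcE /= => /andP[/eqP b0 a0].
by exists a => //; rewrite b0.
Qed.

Lemma Nm_small (V : normedZmodType R[i]) (x : V) :
  (forall e : R, 0 < e -> Nm x <= e) -> x = 0.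
Proof.
move=> h; apply: Nm_eq0; apply/eqP; rewrite eq_le Nm_ge0 andbT.
by apply/ler_addgt0Pl => e /h; rewrite addr0.
Qed.

Lemma Nm_eps (V : normedZmodType R[i]) (x : V) (r : R) :
  (forall e : R, 0 < e -> Nm x <= r + e) -> Nm x <= r.
Proof. by move=> h; apply/ler_addgt0Pr => e /h. Qed.

Lemma Nm_smallM (V : normedZmodType R[i]) (x : V) (K : R) :
  (forall e : R, 0 < e -> Nm x <= K * e) -> x = 0.
Proof.
move=> h; apply: Nm_small => e e0.
have K0 : 0 < `|K| + 1 by have := normr_ge0 K; lra.
apply: (le_trans (h (e / (`|K| + 1)) _)); first by rewrite divr_gt0.
rewrite mulrCA -[leRHS]mulr1 ler_pM2l // ler_pdivrMr // mul1r.
by have := ler_norm K; lra.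
Qed.

Definition clos V (S : set V) : set V :=
  [set v | forall e : R, 0 < e -> exists2 y, S y & Nm (v - y) <= e].

Lemma closureE V (S : set V) : closure S = clos S.
Proof.
apply/seteqP; split=> v /=.
  move=> h e e0; have := h (ball v e%:C%C).
  case; first by apply: nbhsx_ballx; rewrite ltcR.
  move=> y [Sy]; rewrite -ball_normE /= => ve.
  by exists y => //; move: ve; rewrite Nm_lt => /ltW.
move=> h U /nbhs_ballP [e /= /posC[r r0 ->]] bU.
have [|y Sy vy] := h (r / 2); first by rewrite divr_gt0.
exists y; split => //; apply: bU; rewrite -ball_normE /= Nm_lt.
by apply: (le_lt_trans vy); lra.
Qed.

Lemma subclos V (S : set V) : S `<=` clos S.
Proof. by move=> v Sv e e0; exists v => //; rewrite subrr Nm0 ltW. Qed.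

Lemma clos_clos V (S : set V) : clos (clos S) `<=` clos S.
Proof.
move=> v h e e0; have e2 : 0 < e / 2 by rewrite divr_gt0.
have [y hy vy] := h _ e2; have [x Sx yx] := hy _ e2.
by exists x => //; have := NmT v y x; lra.
Qed.

Lemma clos_mono V (S S' : set V) : S `<=` S' -> clos S `<=` clos S'.
Proof. by move=> h v cv e /cv[y /h]; exists y. Qed.

Lemma closed_clos V (S : set V) : closed S <-> clos S `<=` S.
Proof. by rewrite closure_id closureE; split=> [<-//|h]; apply/seteqP; split=> //; exact: subclos. Qed.

Lemma lspan_lin V (X : set V) (z : R[i]) x y :
  lspan X x -> lspan X y -> lspan X (z *: x + y).
Proof.
move=> [n [a [u [Xu ->]]]] [m [b [v [Xv ->]]]].
exists (n + m)%N, (fun i => match fintype.split (i : 'I_(n + m)) with inl j => z * a j | inr j => b j end),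
  (fun i => match fintype.split (i : 'I_(n + m)) with inl j => u j | inr j => v j end); split.
  by move=> i; case: splitP.
rewrite big_split_ord /= scaler_sumr; congr (_ + _); apply: eq_bigr => i _.
  by rewrite (unsplitK (inl i)) scalerA.
by rewrite (unsplitK (inr i)).
Qed.

Lemma lspan0 V (X : set V) : lspan X 0.
Proof.
exists 0%N, (fun=> 0), (fun=> 0); split; first by case.
by rewrite big_ord0.
Qed.

Lemma sub_lspan V (X : set V) : X `<=` lspan X.
Proof.
move=> x Xx; exists 1%N, (fun=> 1), (fun=> x); split => //.
by rewrite big_ord1 scale1r.
Qed.

Definition lsub (V : lmodType R[i]) (P : set V) : Prop :=
  P 0 /\ forall (z : R[i]) x y, P x -> P y -> P (z *: x + y).

Lemma lsubD (V : lmodType R[i]) (P : set V) : lsub P -> forall x y, P x -> P y -> P (x + y).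
Proof. by move=> [_ h] x y Px Py; rewrite -[x]scale1r; exact: h. Qed.

Lemma lsubZ (V : lmodType R[i]) (P : set V) : lsub P -> forall z x, P x -> P (z *: x).
Proof. by move=> [h0 h] z x Px; rewrite -[_ *: _]addr0; exact: h. Qed.

Lemma lsub_sum (V : lmodType R[i]) (P : set V) (I : Type) (r : seq I) (F : I -> V) :
  lsub P -> (forall i, P (F i)) -> P (\sum_(i <- r) F i).
Proof.
move=> h PF; elim: r => [|i r ih]; first by rewrite big_nil; exact: h.1.
by rewrite big_cons; apply: lsubD.
Qed.

Lemma lspan_min (V : lmodType R[i]) (X P : set V) : lsub P -> X `<=` P -> lspan X `<=` P.
Proof.
move=> hP XP v [n [z [x [Xx ->]]]]; apply: lsub_sum => // i.
by apply: lsubZ => //; exact/XP.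
Qed.

Lemma lspan_lsub V (X : set V) : lsub (lspan X).
Proof. by split; [exact: lspan0 | move=> *; exact: lspan_lin]. Qed.

Definition csub V (P : set V) : Prop := lsub P /\ clos P `<=` P.

Lemma clos_lsub V (P : set V) : lsub P -> csub (clos P).
Proof.
move=> hP; split; last exact: clos_clos.
split; first exact: (subclos hP.1).
move=> z x y cx cy e e0.
have K0 : 0 < Nm z + 1 by have := Nm_ge0 z; lra.
have [|x' Px' xx'] := cx (e / 2 / (Nm z + 1)); first by rewrite !divr_gt0.
have [|y' Py' yy'] := cy (e / 2); first by rewrite divr_gt0.
exists (z *: x' + y'); first exact: hP.2.
have -> : z *: x + y - (z *: x' + y') = z *: (x - x') + (y - y').
  by rewrite scalerBr opprD addrACA.
apply: (le_trans (NmD _ _)); rewrite NmZ.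
have : Nm z * Nm (x - x') <= e / 2.
  apply: (@le_trans _ _ ((Nm z + 1) * Nm (x - x'))).
    by rewrite ler_wpM2r ?Nm_ge0 //; lra.
  by rewrite mulrC -ler_pdivlMr.
by move=> ?; lra.
Qed.

Lemma cspanE V (X : set V) : cspan X = clos (lspan X).
Proof. by rewrite /cspan closureE. Qed.

Lemma cspan_csub V (X : set V) : csub (cspan X).
Proof. by rewrite cspanE; apply: clos_lsub; exact: lspan_lsub. Qed.

Lemma sub_cspan V (X : set V) : X `<=` cspan X.
Proof. by rewrite cspanE => x /sub_lspan /subclos. Qed.

Lemma cspan_min V (X P : set V) : csub P -> X `<=` P -> cspan X `<=` P.
Proof.
move=> [hP cP] XP; rewrite cspanE => v cv; apply: cP.
by apply: clos_mono cv; exact: lspan_min.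
Qed.

(** The density principle used throughout: a property that cuts out a closed subspace need only be
    checked on a total set. *)
Lemma cspan_all V (X P : set V) : cspan X = setT -> csub P -> X `<=` P ->
  forall v, P v.
Proof. by move=> h hP XP v; apply: (cspan_min hP XP); rewrite h. Qed.

Definition blin (V W : normedModType R[i]) (f : V -> W) : Prop :=
  linear f /\ exists M : R, forall v, Nm (f v) <= M * Nm v.

Lemma bounded_linearE (V W : normedModType R[i]) (f : V -> W) :
  bounded_linear f <-> blin f.
Proof.
split=> -[lf [M hM]]; split=> //; last first.
  by exists M%:C%C => v; rewrite NmE [`|v|]NmE -rmorphM lecR.
exists (complex.Re M) => v; have := hM v; rewrite NmE [`|v|]NmE.
case: M {hM} => a b; rewrite /GRing.mul /= lecE /= => /andP[_].
by rewrite mulr0 subr0.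
Qed.

Lemma linD (V W : lmodType R[i]) (f : V -> W) : linear f -> {morph f : x y / x + y}.
Proof. by move=> lf x y; have := lf 1 x y; rewrite !scale1r. Qed.
Lemma lin0 (V W : lmodType R[i]) (f : V -> W) : linear f -> f 0 = 0.
Proof. by move=> lf; apply: (@addrI _ (f 0)); rewrite -(linD lf) !addr0. Qed.
Lemma linZ (V W : lmodType R[i]) (f : V -> W) : linear f -> forall z x, f (z *: x) = z *: f x.
Proof. by move=> lf z x; have := lf z x 0; rewrite !addr0 (lin0 lf) addr0. Qed.
Lemma linN (V W : lmodType R[i]) (f : V -> W) : linear f -> {morph f : x / - x}.
Proof. by move=> lf x; rewrite -scaleN1r (linZ lf) scaleN1r. Qed.
Lemma linB (V W : lmodType R[i]) (f : V -> W) : linear f -> {morph f : x y / x - y}.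
Proof. by move=> lf x y; rewrite (linD lf) (linN lf). Qed.
Lemma lin_sum (V W : lmodType R[i]) (f : V -> W) (I : Type) (r : seq I) (F : I -> V) : linear f ->
  f (\sum_(i <- r) F i) = \sum_(i <- r) f (F i).
Proof.
move=> lf; elim: r => [|i r ih]; first by rewrite !big_nil lin0.
by rewrite !big_cons (linD lf) ih.
Qed.

Lemma blin_bound (V W : normedModType R[i]) (f : V -> W) : blin f ->
  exists2 M : R, 0 < M & forall v, Nm (f v) <= M * Nm v.
Proof.
move=> [_ [M h]]; exists (`|M| + 1); first by have := normr_ge0 M; lra.
move=> v; apply: (le_trans (h v)); rewrite ler_wpM2r ?Nm_ge0 //.
by have := ler_norm M; lra.
Qed.

Lemma blin_comp (U V W : normedModType R[i]) (f : V -> W) (g : U -> V) :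
  blin f -> blin g -> blin (f \o g).
Proof.
move=> bf bg; have [M M0 hM] := blin_bound bf; have [N N0 hN] := blin_bound bg.
split; first by move=> z x y /=; rewrite bg.1 bf.1.
exists (M * N) => v /=; apply: (le_trans (hM _)).
by rewrite -mulrA ler_pM2l.
Qed.

Lemma blin_id V : blin (@id V).
Proof. by split=> //; exists 1 => v; rewrite mul1r. Qed.

Lemma blin_lin (V W : normedModType R[i]) (f g : V -> W) (z : R[i]) : blin f -> blin g ->
  blin (fun v => z *: f v + g v).
Proof.
move=> bf bg; have [M M0 hM] := blin_bound bf; have [N N0 hN] := blin_bound bg.
split.
  move=> a x y /=; rewrite bf.1 bg.1 !scalerDr !scalerA [z * a]mulrC addrACA.
  by rewrite -!scalerA.
exists (Nm z * M + N) => v; apply: (le_trans (NmD _ _)).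
by rewrite NmZ mulrDl lerD // -mulrA ler_wpM2l ?Nm_ge0.
Qed.

Lemma blin0 (V W : normedModType R[i]) : blin (fun _ : V => 0 : W).
Proof. by split=> [z x y|]; [rewrite scaler0 addr0|exists 0 => v; rewrite Nm0 mul0r]. Qed.

Lemma blin_clos (V W : normedModType R[i]) (f : V -> W) (P : set W) v :
  blin f -> clos [set v | P (f v)] v -> clos P (f v).
Proof.
move=> bf cv e e0; have [M M0 hM] := blin_bound bf.
have [|y Py vy] := cv (e / M); first by rewrite divr_gt0.
exists (f y) => //; rewrite -(linB bf.1); apply: (le_trans (hM _)).
by rewrite mulrC -ler_pdivlMr.
Qed.

Lemma csub_pre (V W : normedModType R[i]) (f : V -> W) (P : set W) :
  blin f -> csub P -> csub [set v | P (f v)].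
Proof.
move=> bf [[P0 Pl] Pc]; split; last by move=> v /(blin_clos bf) /Pc.
split=> /=; first by rewrite (lin0 bf.1).
by move=> z x y Px Py; rewrite bf.1; exact: Pl.
Qed.

Lemma csub0 V : csub [set v : V | v = 0].
Proof.
split; first by split=> // z x y /= -> ->; rewrite scaler0 addr0.
by move=> v h; apply: Nm_small => e /h[y /= ->]; rewrite subr0.
Qed.

Lemma csub_eq (V W : normedModType R[i]) (f g : V -> W) : blin f -> blin g ->
  csub [set v | f v = g v].
Proof.
move=> bf bg; have := csub_pre (blin_lin (-1) bg bf) (csub0 W).
congr csub; apply/seteqP; split=> v /=; rewrite scaleN1r addrC.
  by move/subr0_eq.
by move->; rewrite subrr.
Qed.

Lemma csubI V (P Q : set V) : csub P -> csub Q -> csub (P `&` Q).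
Proof.
move=> hP hQ; split.
  by split; [split; [exact: hP.1.1|exact: hQ.1.1]|move=> z x y [? ?] [? ?]; split; [exact: hP.1.2|exact: hQ.1.2]].
by move=> v cv; split; [apply: hP.2|apply: hQ.2]; apply: clos_mono cv => u [].
Qed.

Lemma csub_all V (I : Type) (P : I -> set V) : (forall i, csub (P i)) ->
  csub [set v | forall i, P i v].
Proof.
move=> hP; split; first split=> /=.
- by move=> i; exact: (hP i).1.1.
- by move=> z x y Px Py i; apply: (hP i).1.2; [exact: Px|exact: Py].
by move=> v cv i; apply: (hP i).2; apply: clos_mono cv => u; exact.
Qed.

Lemma blin_ext (V W : normedModType R[i]) (X : set V) (f g : V -> W) : blin f -> blin g ->
  cspan X = setT -> (forall x, X x -> f x = g x) -> f =1 g.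
Proof. by move=> bf bg tX fg; apply: (cspan_all tX (csub_eq bf bg)). Qed.

Lemma Nm_sum (V : normedZmodType R[i]) (I : Type) (r : seq I) (F : I -> V) :
  Nm (\sum_(i <- r) F i) <= \sum_(i <- r) Nm (F i).
Proof.
elim: r => [|i r ih]; first by rewrite !big_nil Nm0.
by rewrite !big_cons; apply: (le_trans (NmD _ _)); rewrite lerD2l.
Qed.

Lemma cspan2 (U V W : normedModType R[i]) (t : U -> V -> W) (X : set U) (Y : set V) (P : set W) :
  (forall u, blin (t u)) -> (forall v, blin (t^~ v)) -> csub P ->
  (forall x y, X x -> Y y -> P (t x y)) ->
  forall x y, cspan X x -> cspan Y y -> P (t x y).
Proof.
move=> bl br hP h x y cx cy.
apply: (cspan_min (csub_pre (br y) hP) _ cx) => x' Xx' /=.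
by apply: (cspan_min (csub_pre (bl x') hP) _ cy) => y' Yy' /=; exact: h.
Qed.

End Nm.

(** * Completeness by means of sequences *)

Definition seq_cauchy (R : realType) (V : normedModType R[i]) (u : nat -> V) :=
  forall e : R, 0 < e -> exists N : nat, forall m n, (N <= m)%N -> (N <= n)%N -> Nm (u m - u n) <= e.
Definition seq_limit (R : realType) (V : normedModType R[i]) (u : nat -> V) (l : V) :=
  forall e : R, 0 < e -> exists N : nat, forall n, (N <= n)%N -> Nm (u n - l) <= e.

Section Completeness.
Variable R : realType.

Lemma seq_complete (V : completeNormedModType R[i]) (u : nat -> V) :
  seq_cauchy u -> exists l, seq_limit u l.
Proof.
move=> cu.
have cF : cauchy (u @ \oo).
  apply: cauchy_exP => e /posC[r r0 ->].
  have [|N hN] := cu (r / 2); first by rewrite divr_gt0.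
  exists (u N), N => // n /= Nn; rewrite -ball_normE /= Nm_lt.
  by apply: (le_lt_trans (hN _ _ (leqnn N) Nn)); lra.
have /cvg_ex[l ul] : cvg (u @ \oo) by exact: cauchy_cvg.
exists l => e e0.
have : nbhs l (ball l e%:C%C) by apply: nbhsx_ballx; rewrite ltcR.
move=> /ul [N _ hN]; exists N => n /hN /=.
by rewrite -ball_normE /= Nm_lt NmC => /ltW.
Qed.

Definition ivn (n : nat) : R := n.+1%:R^-1.

Lemma ivn_gt0 n : 0 < ivn n.
Proof. by rewrite /ivn invr_gt0 ltr0n. Qed.

Lemma invn_small (e : R) : 0 < e -> exists N : nat, forall n, (N <= n)%N -> ivn n <= e.
Proof.
move=> e0; exists (Num.truncn e^-1) => n hn.
rewrite /ivn -[leRHS]invrK lef_pV2 ?posrE ?invr_gt0 ?ltr0n //.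
apply: ltW; apply: (lt_le_trans (truncnS_gt _)).
by rewrite ler_nat ltnS.
Qed.

(** Balls of radius [ivn n] belonging to [F] have centres that form a Cauchy sequence, and its limit
    is the limit of [F]. *)
Lemma complete_of_seq (V : normedModType R[i]) :
  (forall u : nat -> V, seq_cauchy u -> exists l, seq_limit u l) ->
  forall F : set_system V, ProperFilter F -> cauchy F -> cvg F.
Proof.
move=> hV F PF cF.
have h n : exists x : V, F (ball x (ivn n)%:C%C).
  have /cauchy_exP : cauchy_ex F by apply/cauchyP.
  move=> /cauchyP; apply.
  by rewrite ltcR ivn_gt0.
have [u hu] := choice h.
have close m n : Nm (u m - u n) <= ivn m + ivn n.
  have [x [xm xn]] := filter_ex (filterI (hu m) (hu n)).
  move: xm xn; rewrite -!ball_normE /= !Nm_lt => xm xn.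
  by have := NmT (u m) x (u n); rewrite [Nm (x - _)]NmC => ?; lra.
have [e e0|l hl] := hV u.
  have [|N hN] := @invn_small (e / 2); first by rewrite divr_gt0.
  exists N => m n /hN ? /hN ?; have := close m n; lra.
apply/cvg_ex; exists l => U /nbhs_ballP[e /= /posC[r r0 ->]] bU.
have [|N hN] := hl (r / 3); first by rewrite divr_gt0.
have [|N' hN'] := @invn_small (r / 3); first by rewrite divr_gt0.
have hm := hN _ (leq_maxl N N'); have hm' := hN' _ (leq_maxr N N').
apply: filterS (hu (maxn N N')) => x; rewrite -ball_normE /= Nm_lt => hx.
apply: bU; rewrite -ball_normE /= Nm_lt.
by have := NmT l (u (maxn N N')) x; rewrite (NmC l (u _)) => ?; lra.
Qed.

End Completeness.

(** * Extension of maps from total families *)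

Definition comb (R : realType) (X : Type) (V : lmodType R[i]) (j : X -> V)
  (s : seq (R[i] * X)) : V := \sum_(p <- s) p.1 *: j p.2.

Section Lift.
Variable R : realType.
Implicit Types X : Type.

Definition cneg X (z : R[i]) (s : seq (R[i] * X)) := [seq (z * p.1, p.2) | p <- s].

Lemma comb_cat X (V : lmodType R[i]) (j : X -> V) s s' : comb j (s ++ s') = comb j s + comb j s'.
Proof. by rewrite /comb big_cat. Qed.

Lemma comb_scale X (V : lmodType R[i]) (j : X -> V) z s : comb j (cneg z s) = z *: comb j s.
Proof. by rewrite /comb big_map scaler_sumr; apply: eq_bigr => p _; rewrite scalerA. Qed.

Lemma comb_lin X (V W : lmodType R[i]) (j : X -> V) (f : V -> W) s : linear f ->
  f (comb j s) = comb (f \o j) s.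
Proof.
by move=> lf; rewrite /comb lin_sum //; apply: eq_bigr => p _; rewrite linZ.
Qed.

Lemma lspan_comb X (V : normedModType R[i]) (j : X -> V) v :
  lspan (range j) v <-> exists s, v = comb j s.
Proof.
split.
  move: v; apply: lspan_min; last first.
    by move=> _ [x _ <-]; exists [:: (1, x)]; rewrite /comb big_seq1 scale1r.
  split; first by exists [::]; rewrite /comb big_nil.
  move=> z _ _ [s ->] [s' ->]; exists (cneg z s ++ s').
  by rewrite comb_cat comb_scale.
move=> [s ->]; apply: lsub_sum; first exact: lspan_lsub.
by move=> p; apply: lsubZ; [exact: lspan_lsub|apply: sub_lspan; exists p.2].
Qed.

Definition total X (V : normedModType R[i]) (j : X -> V) :=
  forall v (e : R), 0 < e -> exists s, Nm (v - comb j s) <= e.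

Lemma totalE X (V : normedModType R[i]) (j : X -> V) : total j <-> cspan (range j) = setT.
Proof.
rewrite cspanE; split=> [h|h v e e0].
  apply/seteqP; split=> // v _ e /(h v)[s hs]; exists (comb j s) => //.
  by apply/lspan_comb; exists s.
have : clos (lspan (range j)) v by rewrite h.
by move=> /(_ _ e0)[y /lspan_comb[s ->] hs]; exists s.
Qed.

Lemma total_ind X (V : normedModType R[i]) (j : X -> V) (P : set V) :
  total j -> csub P -> (forall x, P (j x)) -> forall v, P v.
Proof.
by move=> /totalE tj hP h; apply: (cspan_all tj hP) => _ [x _ <-].
Qed.

Lemma total_eq X (V W : normedModType R[i]) (j : X -> V) (f g : V -> W) :
  total j -> blin f -> blin g -> (forall x, f (j x) = g (j x)) -> f =1 g.
Proof. by move=> tj bf bg h; apply: (total_ind tj (csub_eq bf bg)). Qed.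

(** [f] is the closure of the graph [comb j s ↦ comb F s], evaluated at [P u]. The bound makes this
    relation single-valued, so linear relations among the [j x] require no separate check. The map
    [P] allows for a family that is total only near the range of [P]. *)
Lemma lift_on X (U : lmodType R[i]) (V : normedModType R[i]) (W : completeNormedModType R[i])
    (P : U -> V) (j : X -> V) (F : X -> W) (M : R) :
  linear P -> (forall u (e : R), 0 < e -> exists s, Nm (P u - comb j s) <= e) ->
  (forall s, Nm (comb F s) <= M * Nm (comb j s)) ->
  exists f : U -> W, [/\ linear f, forall u, Nm (f u) <= M * Nm (P u)
    & forall u x, P u = j x -> f u = F x].
Proof.
move=> lP tj hM.
have [M' M'0 hM'] : exists2 M' : R, 0 < M' & forall s, Nm (comb F s) <= M' * Nm (comb j s).
  exists (`|M| + 1); first by have := normr_ge0 M; lra.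
  move=> s; apply: (le_trans (hM s)); rewrite ler_wpM2r ?Nm_ge0 //.
  by have := ler_norm M; lra.
pose rel v w := forall e : R, 0 < e -> exists s, Nm (v - comb j s) <= e /\ Nm (w - comb F s) <= e.
have rel_lin z v w v' w' : rel v w -> rel v' w' -> rel (z *: v + v') (z *: w + w').
  move=> h h' e e0.
  have K0 : 0 < Nm z + 1 by have := Nm_ge0 z; lra.
  have [|s [h1 h2]] := h (e / 2 / (Nm z + 1)); first by rewrite !divr_gt0.
  have [|s' [h1' h2']] := h' (e / 2); first by rewrite divr_gt0.
  have key (E : normedModType R[i]) (a b a' b' : E) :
      Nm (a - b) <= e / 2 / (Nm z + 1) -> Nm (a' - b') <= e / 2 ->
      Nm (z *: a + a' - (z *: b + b')) <= e.
    move=> hab hab'.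
    have -> : z *: a + a' - (z *: b + b') = z *: (a - b) + (a' - b').
      by rewrite scalerBr opprD addrACA.
    apply: (le_trans (NmD _ _)); rewrite NmZ.
    have : Nm z * Nm (a - b) <= e / 2.
      apply: (@le_trans _ _ ((Nm z + 1) * Nm (a - b))).
        by rewrite ler_wpM2r ?Nm_ge0 //; lra.
      by rewrite mulrC -ler_pdivlMr.
    by move=> ?; lra.
  by exists (cneg z s ++ s'); rewrite !comb_cat !comb_scale; split; apply: key.
have rel_bd v w : rel v w -> Nm w <= M * Nm v.
  move=> h; apply: Nm_eps => e e0.
  have K0 : 0 < `|M| + 1 by have := normr_ge0 M; lra.
  have [|s [h1 h2]] := h (e / 2 / (`|M| + 1)); first by rewrite !divr_gt0.
  set d := e / 2 / (`|M| + 1) in h1 h2.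
  have dd : (`|M| + 1) * d = e / 2 by rewrite /d; field; rewrite gt_eqF.
  have d0 : 0 < d by rewrite /d !divr_gt0.
  have a1 : Nm w <= Nm (w - comb F s) + Nm (comb F s).
    by rewrite -{1}[w](subrK (comb F s)) NmD.
  have a2 : M * Nm (comb j s) <= M * Nm v + `|M| * d.
    have a3 : `|Nm (comb j s) - Nm v| <= d.
      rewrite ler_norml; apply/andP; split.
        have := NmD (v - comb j s) (comb j s); rewrite subrK; lra.
      by have := NmD (comb j s - v) v; rewrite subrK NmC; lra.
    rewrite -lerBlDl -mulrBr; apply: (le_trans (ler_norm _)); rewrite normrM.
    by rewrite ler_wpM2l.
  by have := hM s; nra.
have rel_tot u : exists w, rel (P u) w.
  set v := P u.
  have hs (n : nat) : exists s, Nm (v - comb j s) <= ivn R n.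
    by apply: tj; rewrite ivn_gt0.
  have [s hs'] := choice hs.
  have [|w hw] := @seq_complete R W (fun n => comb F (s n)).
    move=> e e0; have [|N hN] := @invn_small R (e / 2 / M'); first by rewrite !divr_gt0.
    exists N => m n /hN hm /hN hn.
    have -> : comb F (s m) - comb F (s n) = comb F (s m ++ cneg (-1) (s n)).
      by rewrite comb_cat comb_scale scaleN1r.
    apply: (le_trans (hM' _)); rewrite comb_cat comb_scale scaleN1r.
    rewrite mulrC -ler_pdivlMr //.
    have := NmT (comb j (s m)) v (comb j (s n)); rewrite [Nm (_ - v)]NmC.
    have := hs' m; have := hs' n.
    have -> : e / M' = e / 2 / M' + e / 2 / M' by field; rewrite gt_eqF.
    by move=> *; lra.
  exists w => e e0; have [N hN] := @invn_small R e e0; have [N' hN'] := hw e e0.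
  exists (s (maxn N N')); split.
    by apply: (le_trans (hs' _)); apply: hN; exact: leq_maxl.
  by rewrite NmC; apply: hN'; exact: leq_maxr.
have [f hf] := choice rel_tot.
have uniq v w w' : rel v w -> rel v w' -> w = w'.
  move=> h h'; have := rel_bd _ _ (rel_lin (-1) _ _ _ _ h' h).
  rewrite !scaleN1r !(addrC (- _)) subrr Nm0 mulr0 => hh.
  by apply/subr0_eq/Nm_eq0/eqP; rewrite eq_le hh Nm_ge0.
exists f; split.
- by move=> z v v'; apply: (uniq _ _ _ (hf _)); rewrite lP; apply: rel_lin.
- by move=> v; exact/rel_bd.
- move=> u x ux; apply: (uniq (P u)) => // e e0; exists [:: (1, x)].
  by rewrite ux /comb !big_seq1 !scale1r !subrr !Nm0 ltW.
Qed.

Lemma lift_ex X (V : normedModType R[i]) (W : completeNormedModType R[i])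
    (j : X -> V) (F : X -> W) (M : R) :
  total j -> (forall s, Nm (comb F s) <= M * Nm (comb j s)) ->
  exists f : V -> W, [/\ linear f, forall v, Nm (f v) <= M * Nm v & forall x, f (j x) = F x].
Proof.
move=> tj hM; have [//|f [fl fb fE]] := @lift_on X V V W id j F M _ tj hM.
by exists f; split=> // x; exact: fE.
Qed.

End Lift.

(** * Inner products and adjointable operators *)

Section Inner.
Variables (R : realType) (H : hilbertType R).
Implicit Types x y z : H.

Lemma innerDr x y z : ⟨x, y + z⟩ = ⟨x, y⟩ + ⟨x, z⟩.
Proof. by have := inner_linear x 1 y z; rewrite scale1r mul1r. Qed.
Lemma inner0r x : ⟨x, 0⟩ = 0.
Proof. by apply: (@addrI _ ⟨x, 0⟩); rewrite -innerDr !addr0. Qed.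
Lemma innerZr (a : R[i]) x y : ⟨x, a *: y⟩ = a * ⟨x, y⟩.
Proof. by have := inner_linear x a y 0; rewrite inner0r !addr0. Qed.
Lemma innerNr x y : ⟨x, - y⟩ = - ⟨x, y⟩.
Proof. by rewrite -scaleN1r innerZr mulN1r. Qed.
Lemma innerBr x y z : ⟨x, y - z⟩ = ⟨x, y⟩ - ⟨x, z⟩.
Proof. by rewrite innerDr innerNr. Qed.
Lemma innerC x y : ⟨y, x⟩ = (⟨x, y⟩)^*.
Proof. exact: inner_conj. Qed.
Lemma innerDl x y z : ⟨x + y, z⟩ = ⟨x, z⟩ + ⟨y, z⟩.
Proof. by rewrite innerC innerDr cjD -!innerC. Qed.
Lemma innerZl (a : R[i]) x y : ⟨a *: x, y⟩ = a^* * ⟨x, y⟩.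
Proof. by rewrite innerC innerZr cjM -innerC. Qed.
Lemma inner0l x : ⟨0, x⟩ = 0.
Proof. by rewrite innerC inner0r cj0. Qed.
Lemma innerNl x y : ⟨- x, y⟩ = - ⟨x, y⟩.
Proof. by rewrite innerC innerNr cjN -innerC. Qed.
Lemma innerBl x y z : ⟨x - y, z⟩ = ⟨x, z⟩ - ⟨y, z⟩.
Proof. by rewrite innerDl innerNl. Qed.
Lemma inner_sumr (I : Type) (r : seq I) (F : I -> H) x :
  ⟨x, \sum_(i <- r) F i⟩ = \sum_(i <- r) ⟨x, F i⟩.
Proof.
by elim: r => [|i r ih]; rewrite ?big_nil ?inner0r // !big_cons innerDr ih.
Qed.
Lemma inner_suml (I : Type) (r : seq I) (F : I -> H) x :
  ⟨\sum_(i <- r) F i, x⟩ = \sum_(i <- r) ⟨F i, x⟩.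
Proof.
by elim: r => [|i r ih]; rewrite ?big_nil ?inner0l // !big_cons innerDl ih.
Qed.

Lemma inner_Nm x : ⟨x, x⟩ = (Nm x ^+ 2)%:C%C.
Proof. by rewrite inner_norm NmE rmorphXn. Qed.

Lemma NmRe x : Nm x ^+ 2 = complex.Re ⟨x, x⟩.
Proof. by rewrite inner_Nm. Qed.

Lemma mul_conjC_Nm (c : R[i]) : c * c^* = (Nm c ^+ 2)%:C%C.
Proof. by rewrite -normCK NmE rmorphXn. Qed.

Lemma inner_eq0 x : ⟨x, x⟩ = 0 -> x = 0.
Proof.
rewrite inner_Nm => /(congr1 (@complex.Re R)) /= /eqP; rewrite expf_eq0 /= => /eqP.
exact: Nm_eq0.
Qed.

Lemma CauchySchwarz x y : Nm (⟨x, y⟩ : R[i]) <= Nm x * Nm y.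
Proof.
have [->|y0] := eqVneq y 0; first by rewrite inner0r !Nm0 mulr0.
have n0 : 0 < Nm y ^+ 2 by rewrite exprn_gt0 // Nm_gt0.
set n := Nm y ^+ 2 in n0; set c := ⟨y, x⟩.
have -> : Nm (⟨x, y⟩ : R[i]) = Nm c by rewrite innerC Nm_conj.
have e : ⟨n%:C%C *: x - c *: y, n%:C%C *: x - c *: y⟩ =
   (n * (n * Nm x ^+ 2 - Nm c ^+ 2))%:C%C.
  rewrite !(innerDl, innerDr, innerZl, innerZr, innerNl, innerNr) inner_Nm.
  rewrite [⟨x, y⟩]innerC -/c inner_Nm -/n.
  rewrite cj_real rcM rcB rcM -mul_conjC_Nm; ring.
have : 0 <= n * (n * Nm x ^+ 2 - Nm c ^+ 2).
  by rewrite -lecR -e inner_norm exprn_ge0.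
rewrite pmulr_rge0 // subr_ge0 => h.
rewrite -(@ler_pXn2r _ 2) ?nnegrE ?mulr_ge0 ?Nm_ge0 //.
by rewrite exprMn mulrC.
Qed.

Lemma inner_ext x y : (forall z, ⟨z, x⟩ = ⟨z, y⟩) -> x = y.
Proof.
by move=> h; apply/subr0_eq/inner_eq0; rewrite innerBr h subrr.
Qed.

End Inner.

Lemma total_inner (R : realType) (X : Type) (H : hilbertType R) (j : X -> H) (x y : H) :
  total j -> (forall i, ⟨j i, x⟩ = ⟨j i, y⟩) -> x = y.
Proof.
move=> tj h; apply/subr0_eq; set d := x - y.
have jd i : ⟨j i, d⟩ = 0 by rewrite /d innerBr h subrr.
apply: (@Nm_smallM _ _ d 1) => e e0; have [s hs] := tj d e e0.
have : ⟨d, d⟩ = ⟨d - comb j s, d⟩.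
  rewrite [RHS]innerBl; suff -> : ⟨comb j s, d⟩ = 0 by rewrite subr0.
  by rewrite /comb inner_suml big1 // => p _; rewrite innerZl jd mulr0.
move/(congr1 (fun c : R[i] => Nm c)).
rewrite inner_Nm Nm_real ger0_norm ?exprn_ge0 ?Nm_ge0 // => h2.
have := CauchySchwarz (d - comb j s) d; rewrite -h2 mul1r => h3.
have [->|d0] := eqVneq d 0; first by rewrite Nm0 ltW.
have d1 := Nm_gt0 d0; rewrite expr2 ler_pM2r // in h3.
exact: le_trans h3 hs.
Qed.

(* Sesquilinear pairings with the C*-identity.  Adjointable operators with
   respect to such a pairing form a unital C*-algebra; the two examples used are
   the inner product of a Hilbert space and [x^* y] on a C*-algebra. *)
Record pairing (R : realType) (X : completeNormedModType R[i]) := Pairing {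
  pZ : normedModType R[i] ;
  pr : X -> X -> pZ ;
  pcj : pZ -> pZ ;
  pr_lin : forall x, linear (pr x) ;
  pr_antilin : forall (z : R[i]) x y w, pr (z *: x + y) w = z^* *: pr x w + pr y w ;
  pr_cj : forall x y, pr y x = pcj (pr x y) ;
  pr_sq : forall x, Nm (pr x x) = Nm x ^+ 2 ;
  pr_le : forall x y, Nm (pr x y) <= Nm x * Nm y }.

Record aop (R : realType) (X : completeNormedModType R[i]) (P : pairing X) := Aop {
  af : X -> X ;
  ag : X -> X ;
  aP : forall x y, pr P (af x) y = pr P x (ag y) ;
  ab : exists M : R, forall x, Nm (af x) <= M * Nm x }.

Section Aop.
Variables (R : realType) (X : completeNormedModType R[i]) (P : pairing X).
Local Notation M := (aop P).
Implicit Types a b c : M.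

HB.instance Definition _ := gen_eqMixin M.
HB.instance Definition _ := gen_choiceMixin M.

Lemma prB x y z : pr P x (y - z) = pr P x y - pr P x z.
Proof. exact: (linB (@pr_lin _ _ P x)). Qed.

Lemma pr_inj x y : (forall z, pr P z x = pr P z y) -> x = y.
Proof.
move=> h; apply/subr0_eq/Nm_eq0; have := pr_sq P (x - y).
by rewrite prB h subrr Nm0 => /esym/eqP; rewrite expf_eq0 => /eqP.
Qed.

Lemma aP' a x y : pr P (ag a x) y = pr P x (af a y).
Proof. by rewrite pr_cj -aP -pr_cj. Qed.

Lemma aop_ext a b : af a =1 af b -> a = b.
Proof.
move=> h; have h' : ag a =1 ag b.
  by move=> x; apply: pr_inj => z; rewrite -!aP h.
case: a b h h' => [f g p q] [f' g' p' q'] /= /funext e /funext e'; subst.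
by congr Aop; exact: Prop_irrelevance.
Qed.

Lemma af_lin a : linear (af a).
Proof.
move=> z x y; apply: pr_inj => w.
by rewrite -aP' pr_lin !aP' -pr_lin.
Qed.

(** [Nm (g x) ^+ 2] is the norm of the pairing of [f (g x)] with [x], and one factor [Nm (g x)]
    cancels. *)
Lemma ag_bound (f g : X -> X) (K : R) : (forall x y, pr P (f x) y = pr P x (g y)) ->
  (forall x, Nm (f x) <= K * Nm x) -> forall x, Nm (g x) <= K * Nm x.
Proof.
move=> fg hK x; have [->|g0] := eqVneq (g x) 0.
  by rewrite Nm0; apply: le_trans (hK x); exact: Nm_ge0.
have g1 := Nm_gt0 g0; rewrite -(ler_pM2l g1).
rewrite -expr2 -(pr_sq P) -fg; apply: (le_trans (pr_le P _ _)).
apply: (le_trans (ler_wpM2r (Nm_ge0 _) (hK _))).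
by rewrite -mulrA mulrCA.
Qed.

Fact a0P x y : pr P 0 y = pr P x 0.
Proof.
rewrite (lin0 (@pr_lin _ _ P x)) pr_cj (lin0 (@pr_lin _ _ P y)).
by rewrite -(lin0 (@pr_lin _ _ P 0)) -pr_cj.
Qed.
Fact a0b : exists K : R, forall x : X, Nm (0 : X) <= K * Nm x.
Proof. by exists 0 => x; rewrite Nm0 mul0r. Qed.
Definition azero : M := Aop a0P a0b.

Fact alinP (z : R[i]) a b x y :
  pr P (z *: af a x + af b x) y = pr P x (z^* *: ag a y + ag b y).
Proof. by rewrite pr_antilin pr_lin !aP. Qed.
Fact alinb (z : R[i]) a b : exists K : R, forall x, Nm (z *: af a x + af b x) <= K * Nm x.
Proof.
have [K hK] := ab a; have [K' hK'] := ab b; exists (Nm z * K + K') => x.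
apply: (le_trans (NmD _ _)); rewrite NmZ mulrDl lerD // -mulrA.
by rewrite ler_wpM2l ?Nm_ge0.
Qed.
Definition alin z a b : M := Aop (alinP z a b) (alinb z a b).

Definition aadd a b := alin 1 a b.
Definition aopp a := alin (-1) a azero.
Definition ascale z a := alin z a azero.

Lemma aaddA : associative aadd.
Proof. by move=> a b c; apply: aop_ext => x /=; rewrite !scale1r addrA. Qed.
Lemma aaddC : commutative aadd.
Proof. by move=> a b; apply: aop_ext => x /=; rewrite !scale1r addrC. Qed.
Lemma aadd0 : left_id azero aadd.
Proof. by move=> a; apply: aop_ext => x /=; rewrite scaler0 add0r. Qed.
Lemma aaddN : left_inverse azero aopp aadd.
Proof. by move=> a; apply: aop_ext => x /=; rewrite scale1r scaleN1r addr0 addNr. Qed.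
HB.instance Definition _ := GRing.isZmodule.Build M aaddA aaddC aadd0 aaddN.

Lemma af_add a b x : af (a + b) x = af a x + af b x.
Proof. by rewrite /= scale1r. Qed.

Lemma ascaleA z z' a : ascale z (ascale z' a) = ascale (z * z') a.
Proof. by apply: aop_ext => x /=; rewrite !addr0 scalerA. Qed.
Lemma ascale1 : left_id 1 ascale.
Proof. by move=> a; apply: aop_ext => x /=; rewrite addr0 scale1r. Qed.
Lemma ascaleDr : right_distributive ascale +%R.
Proof. by move=> z a b; apply: aop_ext => x; rewrite af_add /= !addr0 scale1r scalerDr. Qed.
Lemma ascaleDl a : {morph ascale^~ a : z z' / z + z'}.
Proof. by move=> z z'; apply: aop_ext => x; rewrite af_add /= !addr0 scalerDl. Qed.
HB.instance Definition _ :=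
  GRing.Zmodule_isLmodule.Build R[i] M ascaleA ascale1 ascaleDr ascaleDl.

Lemma af_scale z a x : af (z *: a) x = z *: af a x.
Proof. by rewrite /= addr0. Qed.
Lemma af_opp a x : af (- a) x = - af a x.
Proof. by rewrite /= addr0 scaleN1r. Qed.
Lemma af_zero x : af (0 : M) x = 0.
Proof. by []. Qed.

Definition onorm a : R := sup [set Nm (af a x) | x in [set x | Nm x <= 1]].

Lemma onorm_has a : has_sup [set Nm (af a x) | x in [set x | Nm x <= 1]].
Proof.
split; first by exists (Nm (af a 0)), 0 => //=; rewrite Nm0.
have [K hK] := ab a; exists `|K| => _ [x /= x1 <-].
apply: (le_trans (hK x)); apply: (le_trans (ler_wpM2r (Nm_ge0 _) (ler_norm K))).
by rewrite -[leRHS]mulr1 ler_wpM2l.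
Qed.

Lemma onorm_ub a x : Nm (af a x) <= onorm a * Nm x.
Proof.
have [->|x0] := eqVneq x 0; first by rewrite (lin0 (af_lin a)) !Nm0 mulr0.
have x1 := Nm_gt0 x0; rewrite -ler_pdivrMr // mulrC.
have -> : (Nm x)^-1 * Nm (af a x) = Nm (af a ((Nm x)^-1%:C%C *: x)).
  by rewrite (linZ (af_lin a)) NmZr ger0_norm ?invr_ge0 ?Nm_ge0.
apply: ub_le_sup; first exact: (onorm_has a).2.
exists ((Nm x)^-1%:C%C *: x) => //=.
by rewrite NmZr ger0_norm ?invr_ge0 ?Nm_ge0 // mulVf // gt_eqF.
Qed.

Lemma onorm_le a (K : R) : 0 <= K -> (forall x, Nm (af a x) <= K * Nm x) -> onorm a <= K.
Proof.
move=> K0 hK; apply: ge_sup; first exact: (onorm_has a).1.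
move=> _ [x /= x1 <-]; apply: (le_trans (hK x)).
by rewrite -[leRHS]mulr1 ler_wpM2l.
Qed.

Lemma onorm_ge0 a : 0 <= onorm a.
Proof.
apply: le_trans (ub_le_sup (onorm_has a).2 _); last by exists 0 => //=; rewrite Nm0.
exact: Nm_ge0.
Qed.

Definition anorm a : R[i] := (onorm a)%:C%C.

Lemma anormD a b : anorm (a + b) <= anorm a + anorm b.
Proof.
rewrite /anorm -rmorphD lecR; apply: onorm_le; first by rewrite addr_ge0 ?onorm_ge0.
move=> x; rewrite af_add mulrDl; apply: (le_trans (NmD _ _)).
by rewrite lerD ?onorm_ub.
Qed.

Lemma anormZ (z : R[i]) a : anorm (z *: a) = `|z| * anorm a.
Proof.
have le (y : R[i]) b : onorm (y *: b) <= Nm y * onorm b.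
  apply: onorm_le; first by rewrite mulr_ge0 ?Nm_ge0 ?onorm_ge0.
  by move=> x; rewrite af_scale NmZ -mulrA ler_wpM2l ?Nm_ge0 ?onorm_ub.
rewrite /anorm NmE -rmorphM; congr (_%:C%C); apply/eqP; rewrite eq_le le /=.
have [->|z0] := eqVneq z 0; first by rewrite Nm0 mul0r onorm_ge0.
rewrite mulrC -ler_pdivlMr ?Nm_gt0 // mulrC.
have := le z^-1 (z *: a); rewrite scalerA mulVf // scale1r.
suff -> : Nm z^-1 = (Nm z)^-1 by [].
apply: (@mulfI _ (Nm z)); first by rewrite gt_eqF ?Nm_gt0.
by rewrite -NmM divff // Nm1 divff // gt_eqF ?Nm_gt0.
Qed.

Lemma anorm0_eq0 a : anorm a = 0 -> a = 0.
Proof.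
move=> /(congr1 (@complex.Re R)) /= h; apply: aop_ext => x; apply: Nm_eq0.
by apply/eqP; rewrite eq_le Nm_ge0 andbT; have := onorm_ub a x; rewrite h mul0r.
Qed.

HB.instance Definition _ := Lmodule_isNormed.Build R[i] M anormD anormZ anorm0_eq0.

Lemma aop_le a x : Nm (af a x) <= Nm a * Nm x.
Proof. exact: onorm_ub. Qed.

Lemma aop_lub a (K : R) : 0 <= K -> (forall x, Nm (af a x) <= K * Nm x) -> Nm a <= K.
Proof. exact: onorm_le. Qed.

Fact acompP a b x y : pr P (af a (af b x)) y = pr P x (ag b (ag a y)).
Proof. by rewrite !aP. Qed.
Fact acompb a b : exists K : R, forall x, Nm (af a (af b x)) <= K * Nm x.
Proof.
exists (Nm a * Nm b) => x; apply: (le_trans (aop_le _ _)).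
by rewrite -mulrA ler_wpM2l ?Nm_ge0 ?aop_le.
Qed.
Definition acomp a b : M := Aop (acompP a b) (acompb a b).

Fact astarb a : exists K : R, forall x, Nm (ag a x) <= K * Nm x.
Proof. by exists (Nm a) => x; apply: (ag_bound (@aP _ _ _ a)) => y; exact: aop_le. Qed.
Definition astar a : M := Aop (aP' a) (astarb a).

Fact aidb : exists K : R, forall x : X, Nm (id x) <= K * Nm x.
Proof. by exists 1 => x; rewrite mul1r. Qed.
Definition aone : M := @Aop _ _ P id id (fun x y => erefl) aidb.

Lemma acompA : associative acomp.
Proof. by move=> a b c; apply: aop_ext. Qed.
Lemma acomp_linl b : linear (acomp^~ b).
Proof. by move=> z a a'; apply: aop_ext => x; rewrite /= !addr0 !scale1r. Qed.
Lemma acomp_linr a : linear (acomp a).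
Proof.
move=> z b b'; apply: aop_ext => x; rewrite /= !addr0 !scale1r.
by rewrite (linD (af_lin a)) (linZ (af_lin a)).
Qed.
Lemma astarK : involutive astar.
Proof. by move=> a; apply: aop_ext. Qed.
Lemma astar_antilin (z : R[i]) a b : astar (z *: a + b) = z^* *: astar a + astar b.
Proof. by apply: aop_ext => x; rewrite /= !addr0 !scale1r rmorph1 scale1r. Qed.
Lemma astarM a b : astar (acomp a b) = acomp (astar b) (astar a).
Proof. by apply: aop_ext. Qed.
HB.instance Definition _ := Lmodule_isStarAlg.Build R M
  acompA acomp_linl acomp_linr astarK astar_antilin astarM.

Lemma aop_complete (u : nat -> M) : seq_cauchy u -> exists l, seq_limit u l.
Proof.
move=> cu.
have cp x : exists l, seq_limit (fun n => af (u n) x) l.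
  apply: seq_complete => e e0.
  have K0 : 0 < Nm x + 1 by have := Nm_ge0 x; lra.
  have [|N hN] := cu (e / (Nm x + 1)); first by rewrite divr_gt0.
  exists N => m n hm hn; have := hN m n hm hn; rewrite ler_pdivlMr // => h.
  have -> : af (u m) x - af (u n) x = af (u m - u n) x by rewrite af_add af_opp.
  apply: (le_trans (aop_le _ _)); apply: le_trans h.
  by rewrite ler_wpM2l ?Nm_ge0 //; lra.
have cq x : exists l, seq_limit (fun n => ag (u n) x) l.
  apply: seq_complete => e e0.
  have K0 : 0 < Nm x + 1 by have := Nm_ge0 x; lra.
  have [|N hN] := cu (e / (Nm x + 1)); first by rewrite divr_gt0.
  exists N => m n hm hn; have := hN m n hm hn; rewrite ler_pdivlMr // => h.
  have -> : ag (u m) x - ag (u n) x = af (astar (u m - u n)) x.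
    by rewrite /= cj1 cjN cj1 !scale1r scaleN1r addr0.
  apply: (@le_trans _ _ (Nm (u m - u n) * Nm x)).
    by apply: (ag_bound (@aP _ _ _ _)) => y; exact: aop_le.
  by apply: le_trans h; rewrite ler_wpM2l ?Nm_ge0 //; lra.
have [f hf] := choice cp; have [g hg] := choice cq.
(* The limits exist pointwise only; passing to the limit in one index of the Cauchy condition
   restores uniformity. *)
have unif e : 0 < e -> exists N, forall n, (N <= n)%N -> forall x, Nm (af (u n) x - f x) <= e * Nm x.
  move=> e0; have [N hN] := cu e e0; exists N => n hn x; apply: Nm_eps => d d0.
  have [N' hN'] := hf x d d0.
  have h1 := hN' _ (leq_maxr N N'); have h2 := hN _ _ hn (leq_maxl N N').
  have := aop_le (u n - u (maxn N N')) x; rewrite af_add af_opp => h3.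
  have := NmT (af (u n) x) (af (u (maxn N N')) x) (f x).
  have := ler_wpM2r (Nm_ge0 x) h2; lra.
have fgP x y : pr P (f x) y = pr P x (g y).
  apply/subr0_eq; apply: (@Nm_smallM _ _ _ (Nm y + Nm x)) => e e0.
  have [N hN] := hf x e e0; have [N' hN'] := hg y e e0.
  have h1 := hN _ (leq_maxl N N'); have h2 := hN' _ (leq_maxr N N').
  set n := maxn N N' in h1 h2.
  have -> : pr P (f x) y - pr P x (g y) =
     pr P x (ag (u n) y - g y) - pr P (af (u n) x - f x) y.
    rewrite prB -aP; have -> : pr P (af (u n) x - f x) y = pr P (af (u n) x) y - pr P (f x) y.
      rewrite addrC -scaleN1r pr_antilin rmorphN1 scaleN1r addrC //.
    by rewrite opprB [RHS]addrC addrA subrK.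
  apply: (le_trans (NmD _ _)); rewrite NmN mulrDl [leRHS]addrC lerD //.
    by apply: (le_trans (pr_le P _ _)); rewrite ler_wpM2l ?Nm_ge0.
  by apply: (le_trans (pr_le P _ _)); rewrite mulrC ler_wpM2l ?Nm_ge0.
have fb : exists K : R, forall x, Nm (f x) <= K * Nm x.
  have [N hN] := unif 1 ltr01; exists (Nm (u N) + 1) => x.
  have := hN N (leqnn N) x; have := aop_le (u N) x.
  by have := NmT (f x) (af (u N) x) 0; rewrite !subr0 NmC mulrDl mul1r; lra.
exists (Aop fgP fb) => e e0; have [N hN] := unif e e0; exists N => n hn.
by apply: aop_lub; [exact: ltW | move=> x; rewrite af_add af_opp; exact: hN].
Qed.
HB.instance Definition _ := Uniform_isComplete.Build M (complete_of_seq aop_complete).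

Lemma aop_star_le a : Nm (a^⋆) <= Nm a.
Proof.
apply: aop_lub; first exact: Nm_ge0.
by move=> x; apply: (ag_bound (@aP _ _ _ a)) => y; exact: aop_le.
Qed.

Lemma anorm_mul a b : `|a ⋅ b| <= `|a| * `|b|.
Proof.
rewrite !NmE -rmorphM lecR; apply: aop_lub; first by rewrite mulr_ge0 ?Nm_ge0.
move=> x; rewrite -mulrA; apply: (le_trans (aop_le a (af b x))).
by rewrite ler_wpM2l ?Nm_ge0 ?aop_le.
Qed.

Lemma anorm_cstar a : `|a^⋆ ⋅ a| = `|a| ^+ 2.
Proof.
apply/eqP; rewrite eq_le; apply/andP; split.
  apply: (le_trans (anorm_mul _ _)); rewrite expr2 ler_wpM2r //.
  by rewrite leNm aop_star_le.
rewrite !NmE -rmorphXn lecR.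
have h : Nm a <= Num.sqrt (Nm (a^⋆ ⋅ a)).
  apply: aop_lub; first exact: sqrtr_ge0.
  move=> x; rewrite -(@ler_pXn2r _ 2) ?nnegrE ?mulr_ge0 ?Nm_ge0 ?sqrtr_ge0 //.
  rewrite exprMn sqr_sqrtr ?Nm_ge0 // -(pr_sq P) aP.
  apply: (le_trans (pr_le P _ _)).
  rewrite mulrC expr2 mulrA ler_wpM2r ?Nm_ge0 //.
  exact: (aop_le (a^⋆ ⋅ a) x).
rewrite -(sqr_sqrtr (Nm_ge0 (a^⋆ ⋅ a))).
by rewrite ler_pXn2r ?nnegrE ?Nm_ge0 ?sqrtr_ge0.
Qed.
HB.instance Definition _ := StarAlg_isCstar.Build R M anorm_mul anorm_cstar.

End Aop.

Section Operators.
Variables (R : realType).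

Fact inner_antilin (H : hilbertType R) (z : R[i]) (x y w : H) :
  ⟨z *: x + y, w⟩ = z^* *: (⟨x, w⟩ : R[i]^o) + ⟨y, w⟩.
Proof. by rewrite innerDl innerZl. Qed.
Fact inner_sq (H : hilbertType R) (x : H) : Nm (⟨x, x⟩ : R[i]^o) = Nm x ^+ 2.
Proof. by rewrite inner_Nm Nm_real ger0_norm // exprn_ge0 ?Nm_ge0. Qed.
Definition hpairing (H : hilbertType R) : pairing H :=
  @Pairing R H R[i]^o (@inner R H) (fun z : R[i]^o => (z : R[i])^*)
    (@inner_linear R H) (@inner_antilin H) (@innerC R H) (@inner_sq H) (@CauchySchwarz R H).

Definition Bop (H : hilbertType R) : cstarAlgType R := aop (hpairing H).

Lemma cstar_Nm (B : cstarAlgType R) (x : B) : Nm (x^⋆ ⋅ x) = Nm x ^+ 2.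
Proof. by rewrite /Nm norm_cstar NmE -rmorphXn. Qed.
Lemma smul_Nm (B : cstarAlgType R) (x y : B) : Nm (x ⋅ y) <= Nm x * Nm y.
Proof. by rewrite -lecR rcM -!NmE norm_smul. Qed.
Lemma sstar_Nm (B : cstarAlgType R) (x : B) : Nm x^⋆ = Nm x.
Proof.
have le (y : B) : Nm y <= Nm y^⋆.
  have [->|y0] := eqVneq y 0; first by rewrite Nm0 Nm_ge0.
  by rewrite -(ler_pM2r (Nm_gt0 y0)) -expr2 -cstar_Nm smul_Nm.
by apply/eqP; rewrite eq_le le andbT; have := le x^⋆; rewrite sstarK.
Qed.

Fact bpair_lin (B : cstarAlgType R) (x : B) : linear (fun y => x^⋆ ⋅ y).
Proof. exact: smul_linearr. Qed.
Fact bpair_antilin (B : cstarAlgType R) (z : R[i]) (x y w : B) :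
  (z *: x + y)^⋆ ⋅ w = z^* *: (x^⋆ ⋅ w) + y^⋆ ⋅ w.
Proof. by rewrite sstar_antilinear smulDl smulZl. Qed.
Fact bpair_cj (B : cstarAlgType R) (x y : B) : y^⋆ ⋅ x = (x^⋆ ⋅ y)^⋆.
Proof. by rewrite sstarM sstarK. Qed.
Fact bpair_le (B : cstarAlgType R) (x y : B) : Nm (x^⋆ ⋅ y) <= Nm x * Nm y.
Proof. by rewrite -(sstar_Nm x) smul_Nm. Qed.
Definition bpairing (B : cstarAlgType R) : pairing B :=
  Pairing (@bpair_lin B) (@bpair_antilin B) (@bpair_cj B) (@cstar_Nm B) (@bpair_le B).

(** The adjointable operators of [B] as a Hilbert module over itself, that is, its multiplier
    algebra; it supplies a unit to a possibly nonunital [B]. *)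
Definition Lop (B : cstarAlgType R) : cstarAlgType R := aop (bpairing B).

End Operators.

(** * Subalgebras and homomorphisms of C*-algebras *)

Record subc (R : realType) (B : cstarAlgType R) (D : set B) (hD : sub_cstar D) :=
  Subc { sv : B ; svP : D sv }.

Section SubCstar.
Variables (R : realType) (B : cstarAlgType R) (D : set B) (hD : sub_cstar D).
Local Notation S := (subc hD).
Implicit Types x y : S.

HB.instance Definition _ := gen_eqMixin S.
HB.instance Definition _ := gen_choiceMixin S.

Lemma sv_inj : injective (@sv R B D hD).
Proof. by case=> x p [y q] /= e; subst; congr Subc; exact: Prop_irrelevance. Qed.

Let D0 : D 0. Proof. by case: hD. Qed.
Let Dlin (z : R[i]) u v : D u -> D v -> D (z *: u + v). Proof. by case: hD => _ _ h _ _; exact: h. Qed.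
Let Dmul u v : D u -> D v -> D (u ⋅ v). Proof. by case: hD => _ _ _ h _; exact: h. Qed.
Let Dstar u : D u -> D u^⋆. Proof. by case: hD => _ _ _ _; exact. Qed.
Let DD u v : D u -> D v -> D (u + v). Proof. by move=> Du; rewrite -[u]scale1r; exact: Dlin. Qed.
Let DZ z u : D u -> D (z *: u). Proof. by move=> Du; rewrite -[_ *: _]addr0; exact: Dlin. Qed.
Let DN u : D u -> D (- u). Proof. by move=> Du; rewrite -scaleN1r; exact: DZ. Qed.

Definition szero : S := Subc hD D0.
Definition sadd x y : S := Subc hD (DD (svP x) (svP y)).
Definition sopp x : S := Subc hD (DN (svP x)).
Definition sscale z x : S := Subc hD (DZ z (svP x)).
Definition sprod x y : S := Subc hD (Dmul (svP x) (svP y)).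
Definition sinv x : S := Subc hD (Dstar (svP x)).

Lemma saddA : associative sadd.
Proof. by move=> x y w; apply: sv_inj; rewrite /= addrA. Qed.
Lemma saddC : commutative sadd.
Proof. by move=> x y; apply: sv_inj; rewrite /= addrC. Qed.
Lemma sadd0 : left_id szero sadd.
Proof. by move=> x; apply: sv_inj; rewrite /= add0r. Qed.
Lemma saddN : left_inverse szero sopp sadd.
Proof. by move=> x; apply: sv_inj; rewrite /= addNr. Qed.
HB.instance Definition _ := GRing.isZmodule.Build S saddA saddC sadd0 saddN.

Lemma sscaleA z z' x : sscale z (sscale z' x) = sscale (z * z') x.
Proof. by apply: sv_inj; rewrite /= scalerA. Qed.
Lemma sscale1 : left_id 1 sscale.
Proof. by move=> x; apply: sv_inj; rewrite /= scale1r. Qed.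
Lemma sscaleDr : right_distributive sscale +%R.
Proof. by move=> z x y; apply: sv_inj; rewrite /= scalerDr. Qed.
Lemma sscaleDl x : {morph sscale^~ x : z z' / z + z'}.
Proof. by move=> z z'; apply: sv_inj; rewrite /= scalerDl. Qed.
HB.instance Definition _ :=
  GRing.Zmodule_isLmodule.Build R[i] S sscaleA sscale1 sscaleDr sscaleDl.

Lemma snormD x y : `|sv (x + y)| <= `|sv x| + `|sv y|.
Proof. exact: ler_normD. Qed.
Lemma snormZ (z : R[i]) x : `|sv (z *: x)| = `|z| * `|sv x|.
Proof. exact: normrZ. Qed.
Lemma snorm0 x : `|sv x| = 0 -> x = 0.
Proof. by move=> h; apply: sv_inj; apply/eqP; rewrite -normr_eq0 h. Qed.
HB.instance Definition _ := Lmodule_isNormed.Build R[i] S snormD snormZ snorm0.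

Lemma Nm_sv x : Nm x = Nm (sv x). Proof. by []. Qed.

Lemma subc_complete (u : nat -> S) : seq_cauchy u -> exists l, seq_limit u l.
Proof.
move=> cu; have [l hl] := @seq_complete R B (fun n => sv (u n)) cu.
have Dl : D l.
  have : closed D by case: hD.
  move/closed_clos; apply => e e0; have [N hN] := hl e e0.
  by exists (sv (u N)); [exact: svP|rewrite NmC; exact: hN].
by exists (Subc hD Dl).
Qed.
HB.instance Definition _ := Uniform_isComplete.Build S (complete_of_seq subc_complete).

Lemma sprodA : associative sprod.
Proof. by move=> x y z; apply: sv_inj; rewrite /= smulA. Qed.
Lemma sprod_linl y : linear (sprod^~ y).
Proof. by move=> z x x'; apply: sv_inj; rewrite /= smulDl smulZl. Qed.
Lemma sprod_linr x : linear (sprod x).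
Proof. by move=> z y y'; apply: sv_inj; rewrite /= smulDr smulZr. Qed.
Lemma sinvK : involutive sinv.
Proof. by move=> x; apply: sv_inj; rewrite /= sstarK. Qed.
Lemma sinv_antilin (z : R[i]) x y : sinv (z *: x + y) = z^* *: sinv x + sinv y.
Proof. by apply: sv_inj; rewrite /= sstar_antilinear. Qed.
Lemma sinvM x y : sinv (sprod x y) = sprod (sinv y) (sinv x).
Proof. by apply: sv_inj; rewrite /= sstarM. Qed.
HB.instance Definition _ := Lmodule_isStarAlg.Build R S
  sprodA sprod_linl sprod_linr sinvK sinv_antilin sinvM.

Lemma snorm_mul x y : `|x ⋅ y| <= `|x| * `|y|.
Proof. exact: norm_smul. Qed.
Lemma snorm_cstar x : `|x^⋆ ⋅ x| = `|x| ^+ 2.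
Proof. exact: norm_cstar. Qed.
HB.instance Definition _ := StarAlg_isCstar.Build R S snorm_mul snorm_cstar.

Lemma sv_hom : star_hom (@sv R B D hD). Proof. by []. Qed.

End SubCstar.

Section StarHom.
Variables (R : realType) (X Y : starAlgType R) (f : X -> Y).
Hypothesis hf : star_hom f.
Lemma sh_lin : linear f. Proof. by case: hf. Qed.
Lemma shM x y : f (x ⋅ y) = f x ⋅ f y. Proof. by case: hf. Qed.
Lemma shS x : f x^⋆ = (f x)^⋆. Proof. by case: hf. Qed.
Lemma shD x y : f (x + y) = f x + f y. Proof. exact: (linD sh_lin). Qed.
Lemma shB x y : f (x - y) = f x - f y. Proof. exact: (linB sh_lin). Qed.
Lemma shZ z x : f (z *: x) = z *: f x. Proof. exact: (linZ sh_lin). Qed.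
Lemma sh0 : f 0 = 0. Proof. exact: (lin0 sh_lin). Qed.
End StarHom.

Lemma sh_comp (R : realType) (X Y Z : starAlgType R) (f : Y -> Z) (g : X -> Y) :
  star_hom f -> star_hom g -> star_hom (f \o g).
Proof.
move=> hf hg; split=> [z x y|x y|x] /=.
- by rewrite (sh_lin hg) (sh_lin hf).
- by rewrite (shM hg) (shM hf).
- by rewrite (shS hg) (shS hf).
Qed.

Lemma blin_smull (R : realType) (B : cstarAlgType R) (x : B) : blin (smul x).
Proof. by split; [exact: smul_linearr|exists (Nm x) => y; exact: smul_Nm]. Qed.

Lemma blin_smulr (R : realType) (B : cstarAlgType R) (y : B) : blin (smul^~ y).
Proof. by split; [exact: smul_linearl|exists (Nm y) => x; rewrite mulrC; exact: smul_Nm]. Qed.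

(** * Square roots by iteration *)

Section SquareRoot.
Variables (R : realType) (U : cstarAlgType R).
Implicit Types x y z : U.

Local Notation half := ((2^-1 : R)%:C%C : R[i]).

(** The map [y ↦ (x + y ⋅ y) / 2] has the fixed point [1 - (1 - x)^{1/2}]; started at [0], it never
    leaves the possibly nonunital algebra generated by [x]. *)
Fixpoint sqrt_iter (x : U) n : U :=
  if n is n'.+1 then half *: (x + sqrt_iter x n' ⋅ sqrt_iter x n') else 0.
(** The same iteration for the scalar [1]: an increasing majorant bounded by [1]. *)
Fixpoint sqrt_scal n : R := if n is n'.+1 then 2^-1 * (1 + sqrt_scal n' ^+ 2) else 0.

Lemma sqrt_scal_bd n : 0 <= sqrt_scal n <= 1.
Proof. by elim: n => [|n /andP[h1 h2]] /=; [lra|apply/andP; split; nra]. Qed.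

Lemma sqrt_scal_cauchy (e : R) : 0 < e -> exists N, forall n, (N <= n)%N -> sqrt_scal n - sqrt_scal N <= e.
Proof.
move=> e0; have hs : has_sup (range sqrt_scal).
  split; first by exists (sqrt_scal 0), 0%N.
  by exists 1 => _ [n _ <-]; case/andP: (sqrt_scal_bd n).
have [_ [N _ <-] hN] := sup_adherent e0 hs.
exists N => n _; have : sqrt_scal n <= sup (range sqrt_scal) by apply: ub_le_sup; [exact: hs.2|exists n].
lra.
Qed.

Lemma half2 x : half *: (x + x) = x.
Proof.
rewrite -{1 2}[x]scale1r -scalerDl scalerA.
have -> : half * (1 + 1) = 1.
  have -> : (1 + 1 : R[i]) = (2 : R)%:C%C by rewrite -[1]/((1:R)%:C%C) -rcD; congr (_%:C%C); ring.
  by rewrite -rcM mulVf ?pnatr_eq0.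
by rewrite scale1r.
Qed.

Variable x : U.
Hypotheses (xs : x^⋆ = x) (x1 : Nm x <= 1).

Lemma sqrt_iter_comm n z : x ⋅ z = z ⋅ x -> sqrt_iter x n ⋅ z = z ⋅ sqrt_iter x n.
Proof.
move=> xz; elim: n => [|n ih] /=; first by rewrite smul0l smul0r.
by rewrite smulZl smulZr smulDl smulDr xz -smulA ih !smulA ih.
Qed.

Lemma sqrt_iter_sa n : (sqrt_iter x n)^⋆ = sqrt_iter x n.
Proof. by elim: n => [|n ih] /=; rewrite ?sstar0 // sstarZ sstarD sstarM xs ih cj_real. Qed.

Lemma sqrt_iter_bd n : Nm (sqrt_iter x n) <= sqrt_scal n.
Proof.
elim: n => [|n ih] /=; first by rewrite Nm0.
rewrite NmZr ger0_norm ?invr_ge0 //; apply: ler_wpM2l; first by rewrite invr_ge0.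
apply: (le_trans (NmD _ _)); apply: lerD => //; apply: (le_trans (smul_Nm _ _)).
by rewrite expr2 ler_pM ?Nm_ge0.
Qed.

(** The iterates commute, so successive squares differ by [(y - w) ⋅ (y + w)]; the scalar iteration
    obeys the same recursion with equality. *)
Lemma sqrt_iter_step n : Nm (sqrt_iter x n.+1 - sqrt_iter x n) <= sqrt_scal n.+1 - sqrt_scal n.
Proof.
elim: n => [|n ih].
  rewrite /= !subr0 smul0l addr0 NmZr ger0_norm ?invr_ge0 // expr0n addr0.
  by apply: ler_wpM2l => //; rewrite invr_ge0.
have cm : sqrt_iter x n.+1 ⋅ sqrt_iter x n = sqrt_iter x n ⋅ sqrt_iter x n.+1.
  by apply: sqrt_iter_comm; rewrite sqrt_iter_comm.
set y := sqrt_iter x n.+1 in ih cm *; set w := sqrt_iter x n in ih cm *.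
have -> : sqrt_iter x n.+2 - y = half *: ((y - w) ⋅ (y + w)).
  have yE : y = half *: (x + w ⋅ w) by [].
  have -> : sqrt_iter x n.+2 = half *: (x + y ⋅ y) by [].
  rewrite {2}yE -scalerBr; congr (_ *: _).
  rewrite smulDr !smulDl !smulNl opprD addrACA subrr add0r cm.
  by rewrite addrA subrK.
rewrite NmZr ger0_norm ?invr_ge0 //.
have yb := sqrt_iter_bd n.+1; have wb := sqrt_iter_bd n.
rewrite -/y in yb; rewrite -/w in wb.
have -> : sqrt_scal n.+2 - sqrt_scal n.+1 =
   2^-1 * ((sqrt_scal n.+1 - sqrt_scal n) * (sqrt_scal n.+1 + sqrt_scal n)).
  have -> : sqrt_scal n.+2 = 2^-1 * (1 + sqrt_scal n.+1 ^+ 2) by [].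
  have {2}-> : sqrt_scal n.+1 = 2^-1 * (1 + sqrt_scal n ^+ 2) by [].
  ring.
apply: ler_wpM2l; first by rewrite invr_ge0.
apply: (le_trans (smul_Nm _ _)); apply: ler_pM; rewrite ?Nm_ge0 //.
by apply: (le_trans (NmD _ _)); rewrite lerD.
Qed.

Lemma sqrt_iter_diff n k : Nm (sqrt_iter x (n + k) - sqrt_iter x n) <= sqrt_scal (n + k) - sqrt_scal n.
Proof.
elim: k => [|k ih]; first by rewrite addn0 !subrr Nm0.
rewrite addnS; have := NmT (sqrt_iter x (n + k).+1) (sqrt_iter x (n + k)) (sqrt_iter x n).
by have := sqrt_iter_step (n + k); lra.
Qed.

(** The equation [y + y - y ⋅ y = x] is [(1 - y)^2 = 1 - x] written without a unit. *)
Lemma sqrt_ex : exists y, [/\ y^⋆ = y, Nm y <= 1, y + y - y ⋅ y = x &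
  forall z, x ⋅ z = z ⋅ x -> y ⋅ z = z ⋅ y].
Proof.
have [|y hy] := @seq_complete R U (sqrt_iter x).
  move=> e e0; have [|N hN] := @sqrt_scal_cauchy (e / 2); first by rewrite divr_gt0.
  exists N => m n hm hn.
  have := sqrt_iter_diff N (m - N); have := sqrt_iter_diff N (n - N).
  rewrite !subnKC //; have := hN m hm; have := hN n hn.
  have := NmT (sqrt_iter x m) (sqrt_iter x N) (sqrt_iter x n).
  by rewrite [Nm (sqrt_iter x N - sqrt_iter x n)]NmC; lra.
have y1 : Nm y <= 1.
  apply: Nm_eps => e e0; have [N hN] := hy e e0; have := hN N (leqnn N).
  have := sqrt_iter_bd N; have /andP[_ ?] := sqrt_scal_bd N.
  by have := NmD (y - sqrt_iter x N) (sqrt_iter x N); rewrite subrK NmC; lra.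
exists y; split => //.
- apply/subr0_eq; apply: (@Nm_smallM _ _ _ 2) => e e0; have [N hN] := hy e e0.
  have := hN N (leqnn N) => h.
  have : Nm (y^⋆ - sqrt_iter x N) <= e by rewrite -sqrt_iter_sa -(sstar_Nm (_ - _)) sstarD -scaleN1r sstarZ cjN cj1 !sstarK scaleN1r NmC.
  by have := NmT y^⋆ (sqrt_iter x N) y; lra.
- have e2 : y = half *: (x + y ⋅ y).
    apply/subr0_eq; apply: (@Nm_smallM _ _ _ 2) => e e0; have [N hN] := hy e e0.
    have h1 := hN N (leqnn N); have h2 := hN N.+1 (leqnSn N).
    have h3 : Nm (sqrt_iter x N.+1 - half *: (x + y ⋅ y)) <= e.
      rewrite /= -scalerBr opprD addrACA subrr add0r NmZr ger0_norm ?invr_ge0 //.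
      set w := sqrt_iter x N in h1 *.
      have -> : w ⋅ w - y ⋅ y = (w - y) ⋅ w + y ⋅ (w - y).
        by rewrite smulDl smulDr smulNl smulNr addrA subrK.
      have w1 : Nm w <= 1.
        by apply: (le_trans (sqrt_iter_bd N)); case/andP: (sqrt_scal_bd N).
      have := NmD ((w - y) ⋅ w) (y ⋅ (w - y)).
      have := smul_Nm (w - y) w; have := smul_Nm y (w - y).
      have := Nm_ge0 w; have := Nm_ge0 y; have := Nm_ge0 (w - y); nra.
    by have := NmT y (sqrt_iter x N.+1) (half *: (x + y ⋅ y)); rewrite (NmC y (sqrt_iter _ _)); lra.
  have -> : y + y = x + y ⋅ y; last by rewrite addrK.
  by rewrite {1 2}e2 -scalerDr half2.
- move=> z xz; apply/subr0_eq; apply: (@Nm_smallM _ _ _ (2 * Nm z)) => e e0.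
  have [N hN] := hy e e0; have h1 := hN N (leqnn N); set w := sqrt_iter x N in h1.
  have -> : y ⋅ z - z ⋅ y = (y - w) ⋅ z - z ⋅ (y - w).
    have wz : w ⋅ z = z ⋅ w by exact: sqrt_iter_comm.
    by rewrite smulDl smulDr smulNl smulNr wz; zmod.
  have := NmD ((y - w) ⋅ z) (- (z ⋅ (y - w))); rewrite NmN.
  have := smul_Nm (y - w) z; have := smul_Nm z (y - w); rewrite [Nm (y - w)]NmC.
  have := Nm_ge0 z; nra.
Qed.

End SquareRoot.

Section UnitTrick.
Variables (R : realType) (X : completeNormedModType R[i]) (P : pairing X).
Local Notation U := (aop P).
Local Notation e1 := (aone P : U).
Implicit Types a b w k : U.

Lemma amul1 a : a ⋅ e1 = a. Proof. exact: aop_ext. Qed.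
Lemma a1mul a : e1 ⋅ a = a. Proof. exact: aop_ext. Qed.
Lemma a1star : e1^⋆ = e1. Proof. exact: aop_ext. Qed.
Lemma Nm_aone : Nm e1 <= 1.
Proof. by apply: aop_lub => // x; rewrite mul1r. Qed.

Lemma sq_sub1 (y : U) : (e1 - y) ⋅ (e1 - y) = e1 - (y + y - y ⋅ y).
Proof. by rewrite smulDr !smulDl !smulNr !smulNl !amul1 !a1mul; zmod. Qed.

Lemma sub1_star (y : U) : y^⋆ = y -> (e1 - y)^⋆ = e1 - y.
Proof. by move=> ys; rewrite sstarD -scaleN1r sstarZ cjN cj1 ys a1star scaleN1r. Qed.

Lemma sub1_comm (y z : U) : y ⋅ z = z ⋅ y -> (e1 - y) ⋅ z = z ⋅ (e1 - y).
Proof. by move=> yz; rewrite smulDr smulDl smulNr smulNl amul1 a1mul yz. Qed.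

Local Notation ii := ('i%C : R[i]).

Lemma Nm_i : Nm ii = 1.
Proof. by rewrite /Nm normc_def /= expr0n expr1n add0r sqrtr1. Qed.

(* [w + i k] is [r] times a unitary, and [w], [k] are its real and imaginary parts *)
Lemma Nm_unitary_parts w k (r : R) : 0 <= r -> w^⋆ = w -> k^⋆ = k -> w ⋅ k = k ⋅ w ->
  w ⋅ w + k ⋅ k = (r ^+ 2)%:C%C *: e1 -> Nm w <= r /\ Nm k <= r.
Proof.
move=> r0 ws ks wk e.
pose u := w + ii *: k.
have us : u^⋆ = w - ii *: k.
  rewrite /u sstarD sstarZ ws ks; congr (_ + _); rewrite -scaleNr; congr (_ *: _).
  by apply/eqP; rewrite eq_complex /= oppr0 !eqxx.
have uu : u^⋆ ⋅ u = (r ^+ 2)%:C%C *: e1.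
  rewrite us /u smulDr !smulDl !smulNl !smulZl !smulZr scalerA wk -e.
  have -> : ii * ii = -1 by rewrite -expr2 sqr_i.
  by rewrite scaleN1r opprK addrA subrK.
have u1 : Nm u <= r.
  rewrite -(@ler_pXn2r _ 2) ?nnegrE ?Nm_ge0 // -cstar_Nm uu NmZr ger0_norm ?exprn_ge0 //.
  by rewrite -[leRHS]mulr1 ler_wpM2l ?exprn_ge0 // Nm_aone.
have u2 : Nm u^⋆ <= r by rewrite sstar_Nm.
have h0 : 0 <= (2^-1 : R) by rewrite invr_ge0.
split.
  have -> : w = (2^-1 : R)%:C%C *: (u + u^⋆).
    by rewrite us /u addrACA subrr addr0 half2.
  by rewrite NmZr ger0_norm //; have := NmD u u^⋆; lra.
have -> : k = (- ii) *: ((2^-1 : R)%:C%C *: (u - u^⋆)).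
  have -> : u - u^⋆ = ii *: k + ii *: k by rewrite us /u; zmod.
  by rewrite half2 scalerA mulNr -expr2 sqr_i opprK scale1r.
by rewrite NmZ NmN Nm_i mul1r NmZr ger0_norm //; have := NmD u (- u^⋆); rewrite NmN; lra.
Qed.

(** If [e1 - y] is a square root of [e1 - g ⋅ g], then [g + i (e1 - y)] is unitary, so its imaginary
    part is a contraction. *)
Lemma Nm_subr1 (g : U) : g^⋆ = g -> Nm g <= 1 -> Nm (e1 - g ⋅ g) <= 1.
Proof.
move=> gs g1.
have ggs : (g ⋅ g)^⋆ = g ⋅ g by rewrite sstarM gs.
have gg1 : Nm (g ⋅ g) <= 1 by apply: (le_trans (smul_Nm _ _)); rewrite mulr_ile1 ?Nm_ge0.
have [y [ys y1 ye yc]] := sqrt_ex ggs gg1.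
have es := sub1_star ys.
have ee : (e1 - y) ⋅ (e1 - y) = e1 - g ⋅ g by rewrite sq_sub1 ye.
have gy : g ⋅ (e1 - y) = (e1 - y) ⋅ g by rewrite sub1_comm // yc // smulA.
have [|_ h] := Nm_unitary_parts ler01 gs es gy.
  by rewrite ee addrC subrK expr1n scale1r.
by rewrite -ee; apply: (le_trans (smul_Nm _ _)); rewrite mulr_ile1 ?Nm_ge0.
Qed.

(** The condition [Nm (e1 - a) <= 1] stands for positivity: it makes the iteration for [e1 - a]
    converge, and the root inherits it. *)
Lemma sqrt_pos (a : U) : a^⋆ = a -> Nm (e1 - a) <= 1 ->
  exists c : U, [/\ c^⋆ = c, c ⋅ c = a, Nm (e1 - c) <= 1 & forall z, a ⋅ z = z ⋅ a -> c ⋅ z = z ⋅ c].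
Proof.
move=> as_ a1.
have [y [ys y1 ye yc]] := sqrt_ex (sub1_star as_) a1.
exists (e1 - y); split; first exact: sub1_star.
- by rewrite sq_sub1 ye; zmod.
- by have -> : e1 - (e1 - y) = y by zmod.
- by move=> z az; apply/sub1_comm/yc/sub1_comm.
Qed.

End UnitTrick.

(** * Contractivity and isometry of homomorphisms *)

Section Contractive.
Variables (R : realType) (B : cstarAlgType R) (X : completeNormedModType R[i]) (P : pairing X).
Variable f : B -> aop P.
Hypothesis hf : star_hom f.

(** For [y = 1 - (1 - b^2)^{1/2}], the elements [f b] and [1 - f y] are the real and imaginary part
    of a unitary. Since [y] lies in [B] itself, the argument works in the absence of a unit of
    [B]. *)
Lemma sh_contr_sa (b : B) : b^⋆ = b -> Nm b <= 1 -> Nm (f b) <= 1.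
Proof.
move=> bs b1.
have bbs : (b ⋅ b)^⋆ = b ⋅ b by rewrite sstarM bs.
have bb1 : Nm (b ⋅ b) <= 1 by apply: (le_trans (smul_Nm _ _)); rewrite mulr_ile1 ?Nm_ge0.
have [y [ys y1 ye yc]] := sqrt_ex bbs bb1.
have fs : (f b)^⋆ = f b by rewrite -(shS hf) bs.
have es : (aone P - f y)^⋆ = (aone P : aop P) - f y by apply: sub1_star; rewrite -(shS hf) ys.
have gy : f b ⋅ ((aone P : aop P) - f y) = ((aone P : aop P) - f y) ⋅ f b.
  by apply/esym/sub1_comm; rewrite -!(shM hf) yc ?smulA.
have [|? _ //] := Nm_unitary_parts ler01 fs es gy.
rewrite expr1n scale1r -(shM hf) -ye (shB hf) (shD hf) (shM hf) sq_sub1; zmod.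
Qed.

Lemma sh_contr (b : B) : Nm (f b) <= Nm b.
Proof.
have sa (c : B) : c^⋆ = c -> Nm (f c) <= Nm c.
  move=> cs; have [->|c0] := eqVneq c 0; first by rewrite (sh0 hf) !Nm0.
  have c1 := Nm_gt0 c0; rewrite -[leRHS]mulr1 -ler_pdivrMl //.
  have -> : (Nm c)^-1 * Nm (f c) = Nm (f ((Nm c)^-1%:C%C *: c)).
    by rewrite (shZ hf) NmZr ger0_norm ?invr_ge0 ?Nm_ge0.
  apply: sh_contr_sa; first by rewrite sstarZ cj_real cs.
  by rewrite NmZr ger0_norm ?invr_ge0 ?Nm_ge0 // mulVf // gt_eqF.
rewrite -(@ler_pXn2r _ 2) ?nnegrE ?Nm_ge0 // -!cstar_Nm -(shS hf) -(shM hf).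
by apply: sa; rewrite sstarM sstarK.
Qed.

Lemma sh_blin : blin f.
Proof. by split; [exact: (sh_lin hf)|exists 1 => b; rewrite mul1r; exact: sh_contr]. Qed.

End Contractive.

Section LeftMult.
Variables (R : realType) (B : cstarAlgType R).

Fact lmulP (b x y : B) : (b ⋅ x)^⋆ ⋅ y = x^⋆ ⋅ (b^⋆ ⋅ y).
Proof. by rewrite sstarM smulA. Qed.
Fact lmulb (b : B) : exists K : R, forall x, Nm (b ⋅ x) <= K * Nm x.
Proof. by exists (Nm b) => x; exact: smul_Nm. Qed.
Definition lmul (b : B) : Lop B := @Aop _ _ (bpairing B) _ _ (lmulP b) (lmulb b).

Lemma lmul_hom : star_hom lmul.
Proof.
split=> [z x y|x y|x]; apply: aop_ext => w /=.
- by rewrite addr0 scale1r smulDl smulZl.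
- by rewrite smulA.
- by [].
Qed.

Lemma Nm_lmul (b : B) : Nm (lmul b) = Nm b.
Proof.
apply/eqP; rewrite eq_le; apply/andP; split.
  by apply: aop_lub => [|x]; [exact: Nm_ge0|exact: smul_Nm].
have [->|b0] := eqVneq b 0; first by rewrite Nm0 Nm_ge0.
rewrite -(ler_pM2r (Nm_gt0 b0)) -expr2 -{1}(sstar_Nm b) -cstar_Nm sstarK.
by rewrite -[X in _ * X](sstar_Nm b); exact: (aop_le (lmul b) b^⋆).
Qed.

End LeftMult.

Section Isometry.
Variables (R : realType) (B : cstarAlgType R) (H : hilbertType R) (f : B -> Bop H).
Hypotheses (hf : star_hom f) (fi : injective f).
Local Notation e1 := (aone (bpairing B) : Lop B).

Lemma rep_sq (b c : B) (x : H) : ⟨af (f b) x, af (f c) x⟩ = ⟨x, af (f (b^⋆ ⋅ c)) x⟩.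
Proof. by rewrite (shM hf) (shS hf); exact: (@aP _ _ (hpairing H) (f b)). Qed.

(* With [g = h^2 - r^2], [a = |g|] and [D = a + g], the operator [f D] would be the
   positive part of [f h^2 - r^2 <= 0]; injectivity of [f] thus forces [D = 0],
   that is, [r^2 - h^2 = a] is the square of a selfadjoint element. *)
Lemma iso_sa_scaled (h : B) (r : R) : h^⋆ = h -> 0 <= r -> Nm (f h) <= r ->
  Nm h ^+ 2 + r ^+ 2 <= 1 -> Nm h <= r.
Proof.
move=> hs r0 fr hr.
pose k : Lop B := lmul h.
have ks : k^⋆ = k by rewrite /k -(shS (lmul_hom B)) hs.
have kN : Nm k = Nm h := Nm_lmul h.
have [g gE] : exists g : Lop B, g = k ⋅ k - (r ^+ 2)%:C%C *: e1 by exists (k ⋅ k - (r ^+ 2)%:C%C *: e1).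
have gs : g^⋆ = g.
  by rewrite gE sstarD sstarM ks -scaleNr sstarZ cjN cj_real a1star scaleNr.
have g1 : Nm g <= 1.
  rewrite gE; apply: (le_trans (NmD _ _)); rewrite NmN NmZr ger0_norm ?exprn_ge0 //.
  apply: le_trans hr; rewrite lerD //; first by rewrite expr2 -kN smul_Nm.
  by rewrite -[leRHS]mulr1 ler_wpM2l ?exprn_ge0 // Nm_aone.
have xs : (e1 - g ⋅ g)^⋆ = e1 - g ⋅ g by apply: sub1_star; rewrite sstarM gs.
have [y [ys y1 ye yc]] := sqrt_ex xs (Nm_subr1 gs g1).
(* The absolute value of [g]: as [y] was built from [e1 - g ⋅ g], the square of [e1 - y] is
   [g ⋅ g]. *)
have [a [as_ aa ac a1]] : exists a : Lop B, [/\ a^⋆ = a, a ⋅ a = g ⋅ g,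
    forall z, g ⋅ z = z ⋅ g -> a ⋅ z = z ⋅ a & Nm (e1 - a) <= 1].
  exists (e1 - y); split.
  - exact: sub1_star.
  - by rewrite sq_sub1 ye; zmod.
  - by move=> z gz; apply/sub1_comm/yc/sub1_comm; rewrite -smulA gz !smulA gz.
  - by have -> : e1 - (e1 - y) = y by zmod.
have [c [cs cc c1 ccm]] := sqrt_pos as_ a1.
have ga : a ⋅ g = g ⋅ a by apply: ac.
have [D DE] : exists D, D = a + g by exists (a + g).
have Ds : D^⋆ = D by rewrite DE sstarD as_ gs.
have Dag : (a - g) ⋅ D = 0.
  by rewrite DE smulDr !smulDl !smulNl aa ga; zmod.
(* [c] and [D] belong to [Lop B], where [f] is undefined, so they are tested on an element [b]. On
   the range of [D] the operators [a] and [g] agree; this turns [c^2] into [h^2 - r^2], whose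
   quadratic form under [f] is nonpositive. *)
have Dz (b : B) : af c (af D b) = 0.
  set b1 := af D b; apply: fi; rewrite (sh0 hf); apply: aop_ext => x; apply: Nm_eq0.
  have e1 : af a b1 = af g b1.
    have : af ((a - g) ⋅ D) b = 0 by rewrite Dag.
    by rewrite /= !scale1r !addr0 scaleN1r => /subr0_eq.
  have ea : af a b1 = af c (af c b1) by rewrite -cc.
  have eg : af g b1 = h ⋅ (h ⋅ b1) - (r ^+ 2)%:C%C *: b1.
    by rewrite gE /= !addr0 scaleN1r scale1r.
  have e2 : ⟨af (f (af c b1)) x, af (f (af c b1)) x⟩ =
    ⟨af (f (h ⋅ b1)) x, af (f (h ⋅ b1)) x⟩ - (r ^+ 2)%:C%C * ⟨af (f b1) x, af (f b1) x⟩.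
    rewrite !rep_sq.
    have -> : (af c b1)^⋆ ⋅ af c b1 = b1^⋆ ⋅ (h ⋅ (h ⋅ b1)) - (r ^+ 2)%:C%C *: (b1^⋆ ⋅ b1).
      have -> : (af c b1)^⋆ ⋅ af c b1 = b1^⋆ ⋅ (af (c^⋆) (af c b1)) by exact: (@aP _ _ (bpairing B) c).
      by rewrite cs -ea e1 eg smulDr smulNr smulZr.
    have -> : (h ⋅ b1)^⋆ ⋅ (h ⋅ b1) = b1^⋆ ⋅ (h ⋅ (h ⋅ b1)) by rewrite sstarM hs !smulA.
    rewrite (shB hf) (shZ hf) af_add af_opp af_scale innerBr innerZr //.
  have := congr1 (@complex.Re R) e2; rewrite !inner_Nm -rcM -rcB /= => e3.
  have h1 : Nm (af (f (h ⋅ b1)) x) <= r * Nm (af (f b1) x).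
    rewrite (shM hf); apply: (le_trans (aop_le (f h) _)).
    by rewrite ler_wpM2r ?Nm_ge0.
  have h2 : Nm (af (f (af c b1)) x) ^+ 2 <= 0.
    by have := Nm_ge0 (af (f (h ⋅ b1)) x); have := Nm_ge0 (af (f b1) x); nra.
  have := Nm_ge0 (af (f (af c b1)) x); nra.
have cD : c ⋅ D = 0 by apply: aop_ext => b; exact: Dz.
have aD : a ⋅ D = 0 by rewrite -cc -smulA cD smul0r.
have gD : g ⋅ D = 0.
  by have := Dag; rewrite smulDl aD smulNl add0r => /eqP; rewrite oppr_eq0 => /eqP.
have D0 : D = 0 by apply: cstar_eq0; rewrite Ds {1}DE smulDl aD gD addr0.
have kc : k ⋅ c = c ⋅ k.
  apply/esym/ccm/ac; rewrite gE smulDl smulDr smulNl smulNr smulZl smulZr amul1 a1mul.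
  by rewrite smulA.
(* Now [a = - g], hence [k ⋅ k + c ⋅ c] is [r^2], and [k] is the real part of [r] times a
   unitary. *)
have [|h1 _] := Nm_unitary_parts r0 ks cs kc; last by rewrite -kN.
have : a = - g by apply/eqP; rewrite -addr_eq0 -DE D0.
by rewrite cc => ->; rewrite gE; zmod.
Qed.

Lemma rep_iso (b : B) : Nm (f b) = Nm b.
Proof.
apply/eqP; rewrite eq_le sh_contr //=.
have sa (h : B) : h^⋆ = h -> Nm h <= Nm (f h).
  (* The factor [l] enforces the normalization [Nm h ^+ 2 + r ^+ 2 <= 1] of [iso_sa_scaled]. *)
  move=> hs; set l := (Nm h + Nm (f h) + 1)^-1.
  have l0 : 0 < Nm h + Nm (f h) + 1 by have := Nm_ge0 h; have := Nm_ge0 (f h); lra.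
  have l1 : 0 < l by rewrite invr_gt0.
  have lE : l * (Nm h + Nm (f h) + 1) = 1 by rewrite mulVf // gt_eqF.
  have lN (V : normedModType R[i]) (v : V) : Nm (l%:C%C *: v) = l * Nm v.
    by rewrite NmZr ger0_norm // ltW.
  rewrite -(ler_pM2l l1) -lN; apply: iso_sa_scaled.
  - by rewrite sstarZ hs cj_real.
  - by rewrite mulr_ge0 ?Nm_ge0 ?ltW.
  - by rewrite (shZ hf) lN.
  - rewrite lN; have := Nm_ge0 h; have := Nm_ge0 (f h).
    set p := Nm h in lE *; set q := Nm (f h) in lE *; move=> q0 p0.
    have p1 : 0 <= l * p by nra.
    have q1 : 0 <= l * q by nra.
    by nra.
rewrite -(@ler_pXn2r _ 2) ?nnegrE ?Nm_ge0 // -!cstar_Nm -(shS hf) -(shM hf).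
by apply: sa; rewrite sstarM sstarK.
Qed.

End Isometry.

(** Stands in for the Gelfand-Naimark theorem: legs and values of minimal tensor products come with
    a faithful representation by definition. *)
Definition represented (R : realType) (B : cstarAlgType R) : Prop :=
  exists (H : hilbertType R) (f : B -> Bop H), star_hom f /\ injective f.

Lemma sh_contr_rep (R : realType) (B C : cstarAlgType R) (f : B -> C) :
  represented C -> star_hom f -> forall b, Nm (f b) <= Nm b.
Proof.
move=> [H [p [hp pi]]] hf b; rewrite -(rep_iso hp pi).
exact: (sh_contr (sh_comp hp hf)).
Qed.

Lemma sh_blin_rep (R : realType) (B C : cstarAlgType R) (f : B -> C) :
  represented C -> star_hom f -> blin f.
Proof.
by move=> rC hf; split; [exact: (sh_lin hf)|exists 1 => b; rewrite mul1r; exact: sh_contr_rep].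
Qed.

(** * Numerical range and powers of a positive contraction *)

Section NumericalRange.
Variables (R : realType) (H : hilbertType R).
Implicit Types (T : Bop H) (x y : H).

Definition qf T x : R := complex.Re ⟨x, af T x⟩.

Lemma sa_inner T : T^⋆ = T -> forall x y, ⟨af T x, y⟩ = ⟨x, af T y⟩.
Proof. by move=> Ts x y; rewrite -{2}Ts; exact: (@aP _ _ (hpairing H) T). Qed.

(** Polarization with [y = T x]: [4 * Nm y ^+ 2] equals [qf T (x + y) - qf T (x - y)], which the
    parallelogram law bounds by [2 * Nm x ^+ 2 + 2 * Nm y ^+ 2]. *)
Lemma numerical_range_le T : T^⋆ = T -> (forall x, `|qf T x| <= Nm x ^+ 2) -> Nm T <= 1.
Proof.
move=> Ts hT; apply: aop_lub => // x; rewrite mul1r.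
have plg (u v : H) : Nm (u + v) ^+ 2 + Nm (u - v) ^+ 2 = 2 * Nm u ^+ 2 + 2 * Nm v ^+ 2.
  rewrite !NmRe !(innerDl, innerDr, innerNl, innerNr) !(ReD, ReN); ring.
set y := af T x.
have h1 := hT (x + y); have h2 := hT (x - y); have h3 := plg x y.
have h4 : qf T (x + y) - qf T (x - y) = 4 * Nm y ^+ 2.
  rewrite /qf !(linD (af_lin T)) (linN (af_lin T)) -/y.
  have e : ⟨x, af T y⟩ = ⟨y, y⟩ by rewrite -(sa_inner Ts).
  rewrite !(innerDl, innerDr, innerNl, innerNr) !(ReD, ReN) e inner_Nm /=.
  by ring.
have := ler_norm (qf T (x + y)); have := ler_norm (- qf T (x - y)); rewrite normrN.
move=> h5 h6; rewrite -(@ler_pXn2r _ 2) ?nnegrE ?Nm_ge0 //; lra.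
Qed.

Variable T : Bop H.
Hypotheses (Ts : T^⋆ = T) (T0 : forall x, 0 <= qf T x) (T1 : forall x, qf T x <= Nm x ^+ 2).

Local Notation pw k x := (iter k (af T) x).

Lemma pw_add j k x : pw (j + k) x = pw j (pw k x). Proof. by rewrite iterD. Qed.

Lemma pw_inner k x y : ⟨pw k x, y⟩ = ⟨x, pw k y⟩.
Proof. by elim: k x y => // k ih x y; rewrite iterS (sa_inner Ts) ih -iterSr. Qed.

Lemma pw_lin k : linear (fun x => pw k x).
Proof. by move=> z x y; elim: k => //= k ->; rewrite af_lin. Qed.

Definition pq k x : R := complex.Re ⟨x, pw k x⟩.

Lemma pq_shift i j x : pq (i + j + j) x = pq i (pw j x).
Proof. by rewrite /pq addnC pw_add -pw_inner pw_add. Qed.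

Lemma pq_ge0 k x : 0 <= pq k x.
Proof.
rewrite -(odd_double_half k) -addnn addnA pq_shift; case: (odd k); first exact: T0.
by rewrite /pq inner_Nm /= exprn_ge0 ?Nm_ge0.
Qed.

Lemma pq_dec k x : pq k.+1 x <= pq k x.
Proof.
(* Add [T0] at [y - T y] and [T1] at [T y]; the terms [⟨T y, T (T y)⟩] cancel. *)
have key y : Nm (af T y) ^+ 2 <= qf T y.
  have h1 := T1 (af T y); have h2 := T0 (y - af T y).
  move: h1 h2; rewrite /qf (linB (af_lin T)) !(innerDl, innerDr, innerNl, innerNr) !(ReD, ReN).
  by rewrite -[⟨y, af T (af T y)⟩](sa_inner Ts) inner_Nm /=; lra.
rewrite -(odd_double_half k) -addnn addnA -!addSn !pq_shift /pq.
case: (odd k) => /=; last by rewrite inner_Nm; exact: T1.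
by rewrite -(sa_inner Ts) inner_Nm /= key.
Qed.

Definition pd k x : R := pq k x - pq k.+1 x.

Lemma pd_dec k x : pd k.+1 x <= pd k x.
Proof.
have := pq_ge0 k (x - af T x); rewrite /pd /pq.
rewrite (linB (pw_lin k)) !(innerDl, innerDr, innerNl, innerNr) !(ReD, ReN).
by rewrite !(sa_inner Ts) -iterSr -!iterS; lra.
Qed.

(** The numbers [pd k x = ⟨x, T^k (1 - T) x⟩] decrease in [k] and telescope, so the last of [n + 1]
    of them is at most their average. This replaces the spectral estimate of [t^n (1 - t)]. *)
Lemma pd_small n x : n.+1%:R * pd n x <= Nm x ^+ 2.
Proof.
have h m : m.+1%:R * pd m x <= pq 0 x - pq m.+1 x.
  elim: m => [|m ih]; first by rewrite mul1r.
  have h1 := pd_dec m x; have : m.+1%:R * pd m.+1 x <= m.+1%:R * pd m x by rewrite ler_wpM2l.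
  rewrite -[m.+2%:R]natr1 mulrDl mul1r [X in _ -> _ + X <= _]/pd.
  by move=> h2; lra.
apply: (le_trans (h n)); rewrite {1}/pq /= inner_Nm /=.
by have := pq_ge0 n.+1 x; lra.
Qed.

Lemma pw_bound n x : 0 <= Nm x ^+ 2 - pq n x <= Nm x ^+ 2.
Proof.
have h0 := pq_ge0 n x; suff : pq n x <= Nm x ^+ 2 by move=> ?; apply/andP; split; lra.
elim: n {h0} => [|n ih]; first by rewrite /pq /= inner_Nm.
by apply: (le_trans (pq_dec n x)).
Qed.

End NumericalRange.

(** * Approximate units *)

Section ApproximateUnit.
Variables (R : realType) (B : cstarAlgType R).
Hypothesis rB : represented B.

(** [1 - (1 - h)^n], written without a unit. *)
Fixpoint unit_iter (h : B) n : B :=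
  if n is n'.+1 then unit_iter h n' + h - h ⋅ unit_iter h n' else 0.

(** Let [h] be proportional to the sum of the [x ⋅ x^⋆], [T = 1 - h] and [u = 1 - T^n]. The squared
    norm of [x^⋆ (u - 1) z] is at most [N ⟨z, T^{2n} (1 - T) z⟩], which [pd_small] makes small
    uniformly on the unit ball. *)
Lemma approx_unit (s : seq B) (e : R) : 0 < e -> exists u : B,
  [/\ u^⋆ = u, Nm u <= 1 &
      forall x, x \in s -> Nm (u ⋅ x - x) <= e /\ Nm (x ⋅ u - x) <= e].
Proof.
move=> e0; have [H [f [hf fi]]] := rB.
(* Adjoining the adjoints yields the left and the right estimate at once. *)
pose s' := s ++ [seq x^⋆ | x <- s].
have NN : 0 <= \sum_(x <- s') Nm x ^+ 2 by apply: sumr_ge0 => x _; rewrite exprn_ge0 ?Nm_ge0.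
pose N : R := 1 + \sum_(x <- s') Nm x ^+ 2.
have N0 : 0 < N by rewrite /N; lra.
pose h : B := (N^-1)%:C%C *: \sum_(x <- s') x ⋅ x^⋆.
have starsum (I : Type) (r : seq I) (F : I -> B) : (\sum_(i <- r) F i)^⋆ = \sum_(i <- r) (F i)^⋆.
  elim: r => [|i r ih]; first by rewrite !big_nil sstar0.
  by rewrite !big_cons sstarD ih.
have hs : h^⋆ = h.
  rewrite sstarZ cj_real starsum; congr (_ *: _); apply: eq_bigr => x _.
  by rewrite sstarM sstarK.
pose F : Bop H := f h.
have Fs : F^⋆ = F by rewrite /F -(shS hf) hs.
have qF x : qf F x = N^-1 * \sum_(y <- s') Nm (af (f y^⋆) x) ^+ 2.
  rewrite /qf /F (shZ hf) (lin_sum _ _ (sh_lin hf)) af_scale innerZr.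
  have -> : ⟨x, af (\sum_(i <- s') f (i ⋅ i^⋆)) x⟩ = (\sum_(y <- s') Nm (af (f y^⋆) x) ^+ 2)%:C%C.
    elim: (s') => [|y r ih]; first by rewrite !big_nil inner0r.
    rewrite !big_cons af_add innerDr ih rcD; congr (_ + _).
    by rewrite -inner_Nm (rep_sq hf) sstarK.
  by rewrite -rcM.
pose T : Bop H := (aone (hpairing H) : Bop H) - F.
have Ts : T^⋆ = T by exact: sub1_star.
have qT x : qf T x = Nm x ^+ 2 - qf F x.
  by rewrite /qf /T af_add af_opp innerBr ReD ReN inner_Nm.
have qF0 x : 0 <= qf F x.
  rewrite qF mulr_ge0 ?invr_ge0 ?(ltW N0) //; apply: sumr_ge0 => y _.
  by rewrite exprn_ge0 ?Nm_ge0.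
have qF1 x : qf F x <= Nm x ^+ 2.
  rewrite qF ler_pdivrMl //; apply: (@le_trans _ _ (\sum_(y <- s') Nm y ^+ 2 * Nm x ^+ 2)).
    apply: ler_sum => y _; rewrite -exprMn ler_pXn2r ?nnegrE ?mulr_ge0 ?Nm_ge0 //.
    apply: (le_trans (aop_le (f y^⋆) x)); rewrite ler_wpM2r ?Nm_ge0 //.
    by rewrite -[leRHS]sstar_Nm; exact: sh_contr.
  by rewrite -mulr_suml ler_wpM2r ?exprn_ge0 ?Nm_ge0 // /N; lra.
have T0 x : 0 <= qf T x by rewrite qT subr_ge0.
have T1 x : qf T x <= Nm x ^+ 2 by rewrite qT; have := qF0 x; lra.
pose pw k x := iter k (af T) x.
have fu n x : af (f (unit_iter h n)) x = x - pw n x.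
  elim: n => [|n ih]; first by rewrite (sh0 hf) /pw /= subrr.
  have -> : pw n.+1 x = pw n x - af F (pw n x) by rewrite /pw iterS /T af_add af_opp.
  have -> : unit_iter h n.+1 = unit_iter h n + h - h ⋅ unit_iter h n by [].
  rewrite (shB hf) (shD hf) (shM hf) !(af_add, af_opp).
  have -> : af (f h ⋅ f (unit_iter h n)) x = af F (af (f (unit_iter h n)) x) by [].
  by rewrite ih (linB (af_lin F)) -/F; zmod.
(* Chosen so that [N / (2 n + 1) <= e ^+ 2]. *)
pose n := Num.truncn (N / e ^+ 2).
have nE : N <= e ^+ 2 * (n + n).+1%:R.
  rewrite -ler_pdivrMl ?exprn_gt0 // mulrC; apply: ltW; apply: (lt_le_trans (truncnS_gt _)).
  by rewrite ler_nat ltnS leq_addr.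
pose u := unit_iter h n.
have us : u^⋆ = u.
  apply: fi; rewrite (shS hf); apply: aop_ext => x; apply: inner_ext => z.
  rewrite -(@aP _ _ (hpairing H) (f u) z x : ⟨_, _⟩ = ⟨_, _⟩) !fu.
  by rewrite innerBl innerBr (pw_inner Ts).
have key x : x \in s' -> Nm (x^⋆ ⋅ u - x^⋆) <= e.
  move=> xs; rewrite -(rep_iso hf fi); apply: aop_lub => [|z]; first exact: ltW.
  rewrite (shB hf) (shM hf) af_add af_opp.
  have -> : af (f x^⋆ ⋅ f u) z = af (f x^⋆) (af (f u) z) by [].
  rewrite fu (linB (af_lin (f x^⋆))) addrAC subrr add0r NmN.
  rewrite -(@ler_pXn2r _ 2) ?nnegrE ?mulr_ge0 ?Nm_ge0 ?(ltW e0) // exprMn.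
  have h1 : Nm (af (f x^⋆) (pw n z)) ^+ 2 <= N * qf F (pw n z).
    rewrite qF mulrA divff ?gt_eqF // mul1r.
    rewrite (perm_big _ (perm_to_rem xs)) big_cons lerDl.
    by apply: sumr_ge0 => y _; rewrite exprn_ge0 ?Nm_ge0.
  have h2 : qf F (pw n z) = pd T (n + n) z.
    have -> : qf F (pw n z) = Nm (pw n z) ^+ 2 - qf T (pw n z) by rewrite qT; lra.
    rewrite /pd; have -> : pq T (n + n).+1 z = qf T (pw n z).
      by rewrite -[(n + n).+1]/((1 + n) + n)%N (pq_shift Ts).
    rewrite -[X in pq T X]/(0 + n + n)%N (pq_shift Ts).
    by rewrite /pq /= inner_Nm.
  apply: (le_trans h1); rewrite h2.
  have h3 := pd_small Ts T0 (n + n) z.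
  have p0 : 0 <= pd T (n + n) z by rewrite -h2.
  apply: (@le_trans _ _ (e ^+ 2 * ((n + n).+1%:R * pd T (n + n) z))).
    by rewrite mulrA ler_wpM2r.
  by rewrite ler_wpM2l ?exprn_ge0 ?(ltW e0).
exists u; split => //.
- rewrite -(rep_iso hf fi); apply: numerical_range_le; first by rewrite -(shS hf) us.
  move=> x; have := pw_bound Ts T0 T1 n x; rewrite /qf fu innerBr ReD ReN inner_Nm /=.
  rewrite -/(pq T n x) => /andP[h1 h2]; by rewrite ger0_norm.
- move=> x xs; split.
    rewrite -sstar_Nm sstarD sstarM us -scaleN1r sstarZ cjN cj1 scaleN1r.
    by apply: key; rewrite mem_cat xs.
  rewrite -[x]sstarK; apply: key.
  by rewrite mem_cat map_f ?orbT.
Qed.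

Lemma approx_unit1 (x : B) (e : R) : 0 < e -> exists u : B,
  [/\ u^⋆ = u, Nm u <= 1, Nm (u ⋅ x - x) <= e & Nm (x ⋅ u - x) <= e].
Proof.
move=> e0; have [u [us u1 h]] := approx_unit [:: x] e0.
by exists u; have [] := h x (mem_head _ _); split.
Qed.

Lemma cspan_mulr (x : B) : cspan [set y ⋅ z | y in setT & z in setT] x.
Proof.
rewrite cspanE => e e0; have [u [_ _ _ h]] := approx_unit1 x e0.
by exists (x ⋅ u); [apply: sub_lspan; exists x => //; exists u|rewrite NmC].
Qed.

End ApproximateUnit.

(** * Approximate factorization of functionals *)

Lemma bounded_functionalE (R : realType) (B : normedModType R[i]) (w : B -> R[i]) :
  bounded_functional w <-> blin (w : B -> R[i]^o).
Proof. exact: (@bounded_linearE R B R[i]^o w). Qed.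

Lemma phase_ex (R : realType) (a b : R[i]) (t : R) : 0 <= t ->
  exists2 c : R[i], Nm c <= t & Nm (a + c * b) = Nm a + t * Nm b.
Proof.
move=> t0.
have [->|a0] := eqVneq a 0.
  have -> : Nm (0 : R[i]) = 0 by exact: Nm0.
  by exists t%:C%C; rewrite ?add0r ?NmM Nm_real ger0_norm.
have [->|b0] := eqVneq b 0.
  have n0 : Nm (0 : R[i]) = 0 by exact: Nm0.
  by exists 0; rewrite n0 // !mulr0 !addr0.
have a1 := Nm_gt0 a0; have b1 := Nm_gt0 b0.
exists ((t / (Nm a * Nm b))%:C%C * (a * b^*)).
  have ab0 : 0 <= t / (Nm a * Nm b) by rewrite divr_ge0 ?mulr_ge0 ?Nm_ge0.
  rewrite !NmM Nm_real (ger0_norm ab0) Nm_conj.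
  by rewrite divfK // mulf_neq0 ?gt_eqF.
have -> : a + (t / (Nm a * Nm b))%:C%C * (a * b^*) * b = (1 + t * Nm b / Nm a)%:C%C * a.
  have -> : (t / (Nm a * Nm b))%:C%C * (a * b^*) * b = (t / (Nm a * Nm b))%:C%C * (b * b^*) * a by ring.
  rewrite mul_conjC_Nm -rcM rcD mulrDl mul1r; congr (_ + _%:C%C * _).
  by field; rewrite !gt_eqF.
rewrite NmM Nm_real ger0_norm; last by rewrite addr_ge0 // divr_ge0 ?mulr_ge0 // ltW.
by field; rewrite gt_eqF.
Qed.

(** [p] and [r] are the absolute values of the functional at a near-maximizer and at the
    perturbation, and [X] is the norm of the combined vector. In the square of [p + t r <= N X] the
    terms of order zero nearly cancel since [p] is close to [N]; dividing by [t] bounds [r] by terms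
    of order [d], [q] and [t]. *)
Lemma functional_factor_arith (R : realType) (N K q t d p r X : R) :
  0 < d -> 0 < N -> 0 < q -> 0 < 1 + K -> 0 < t -> 0 <= r -> 0 <= X -> t * (16 * (N + 1)) = d ->
  (1 + K) * q <= t * d / 8 -> (N + 1) * q <= d / 8 -> (1 + K) * q <= N / 2 ->
  N - (1 + K) * q <= p -> p + t * r <= N * X -> X ^+ 2 <= 1 + 2 * t * q + 4 * t ^+ 2 -> r <= d.
Proof.
move=> d0 Np q0 K1 t0 r0 X0 tE q1 q2 q3 wy2 h1 vN.
have N1 : 0 < N + 1 by lra.
have p2 : N / 2 <= p by lra.
have h2 : (p + t * r) ^+ 2 <= N ^+ 2 * (1 + 2 * t * q + 4 * t ^+ 2).
  apply: (@le_trans _ _ ((N * X) ^+ 2)).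
    have pr0 : 0 <= p + t * r by rewrite addr_ge0 ?mulr_ge0 ?(ltW t0) //; lra.
    by rewrite ler_pXn2r // nnegrE mulr_ge0 // ltW.
  by rewrite exprMn ler_wpM2l ?exprn_ge0 // ltW.
have h3 : 2 * p * t * r <= N ^+ 2 - p ^+ 2 + N ^+ 2 * (2 * t * q + 4 * t ^+ 2).
  have : 0 <= (t * r) ^+ 2 by rewrite exprn_ge0 // mulr_ge0 // ltW.
  move: h2; rewrite sqrrD; lra.
have h4 : N ^+ 2 - p ^+ 2 <= 2 * N * ((1 + K) * q).
  have k0 : 0 <= N - (1 + K) * q by lra.
  have : (N - (1 + K) * q) ^+ 2 <= p ^+ 2 by rewrite ler_pXn2r ?nnegrE //; lra.
  have : 0 <= ((1 + K) * q) ^+ 2 by rewrite exprn_ge0 // mulr_ge0 ?ltW.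
  rewrite sqrrB; lra.
have h5 : N * (t * r) <= N * (2 * (t * d / 8) + N * (2 * t * q + 4 * t ^+ 2)).
  have tr0 : 0 <= t * r by rewrite mulr_ge0 // ltW.
  have : N * (t * r) <= 2 * p * (t * r) by rewrite ler_wpM2r //; lra.
  have : N * ((1 + K) * q) <= N * (t * d / 8) by rewrite ler_pM2l.
  nra.
rewrite ler_pM2l // in h5.
have h6 : t * r <= t * (d / 4 + 2 * N * q + 4 * N * t) by nra.
rewrite ler_pM2l // in h6.
have h7 : 16 * N * t <= d by nra.
have h8 : N * q <= d / 8.
  by apply: le_trans q2; rewrite ler_pM2r //; lra.
by lra.
Qed.

(* If [w] almost attains its norm at [y0 = x f] and [f] is almost fixed by [u],
   then [w] is small on [y (1 - u)]: otherwise [y0 + c y (1 - u)], whose square norm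
   is about [1 + O(t^2)] for [|c| = t], would exceed the norm of [w]. *)
Lemma functional_factor (R : realType) (B : cstarAlgType R) (w : B -> R[i]) (d : R) :
  represented B -> bounded_functional w -> 0 < d ->
  exists u : B, Nm u <= 1 /\ forall y, Nm (w y - w (y ⋅ u)) <= d * Nm y.
Proof.
move=> rB /bounded_functionalE bw d0; have [K K0 hK] := blin_bound bw.
have wB a b : w a - w b = w (a - b) := esym (linB bw.1 a b).
have wD a b : w (a + b) = w a + w b := linD bw.1 a b.
have wZ c a : w (c *: a) = c * w a := linZ bw.1 c a.
pose W := [set Nm (w a) | a in [set a | Nm a <= 1]].
have hsW : has_sup W.
  split; first by exists (Nm (w 0)), 0 => //=; rewrite Nm0.
  exists K => _ [a /= a1 <-]; apply: (le_trans (hK a)).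
  by rewrite -[leRHS]mulr1 ler_pM2l.
pose N := sup W.
have Nub a : Nm (w a) <= N * Nm a.
  have [->|a0] := eqVneq a 0; first by rewrite (lin0 bw.1) !Nm0 mulr0.
  have a1 := Nm_gt0 a0; rewrite -ler_pdivrMr // mulrC.
  have -> : (Nm a)^-1 * Nm (w a) = Nm (w ((Nm a)^-1%:C%C *: a)).
    by rewrite wZ NmM Nm_real ger0_norm ?invr_ge0 ?Nm_ge0.
  apply: ub_le_sup; first exact: hsW.2.
  exists ((Nm a)^-1%:C%C *: a) => //=.
  by rewrite NmZr ger0_norm ?invr_ge0 ?Nm_ge0 // mulVf // gt_eqF.
have N0 : 0 <= N by have := ub_le_sup hsW.2 (_ : W 0); apply; exists 0; rewrite /= ?Nm0 // (lin0 bw.1) Nm0.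
(* [t] makes the second-order term [4 t^2] negligible against [t d]; [q] is then chosen small
   compared with [t d]. *)
pose t := d / (16 * (N + 1)).
have t0 : 0 < t by rewrite divr_gt0 // mulr_gt0 //; lra.
have tE : t * (16 * (N + 1)) = d by rewrite /t divfK // gt_eqF // mulr_gt0 //; lra.
pose q := Num.min (Num.min (t * d / (8 * (1 + K))) (d / (8 * (N + 1)))) (N / (2 * (1 + K))).
(* The zero functional is treated apart because the estimate cancels a factor [N]. *)
have [Nz|Np] : N = 0 \/ 0 < N by move: N0; rewrite le_eqVlt => /orP[/eqP <-|]; [left|right].
  exists 0; rewrite Nm0; split=> // y.
  by have := Nub (y - y ⋅ 0); rewrite -wB Nz mul0r => h; apply: (le_trans h); rewrite mulr_ge0 ?Nm_ge0 ?ltW.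
have K1 : 0 < 1 + K by lra.
have N1 : 0 < N + 1 by lra.
have td0 : 0 < t * d by rewrite mulr_gt0.
have q0 : 0 < q.
  by rewrite !lt_min; apply/andP; split; [apply/andP; split|]; rewrite divr_gt0 // mulr_gt0.
have q1 : (1 + K) * q <= t * d / 8.
  have : q <= t * d / (8 * (1 + K)) by rewrite /q !ge_min lexx.
  by rewrite ler_pdivlMr ?mulr_gt0 //; lra.
have q2 : (N + 1) * q <= d / 8.
  have : q <= d / (8 * (N + 1)) by rewrite /q !ge_min lexx orbT.
  by rewrite ler_pdivlMr ?mulr_gt0 //; lra.
have q3 : (1 + K) * q <= N / 2.
  have : q <= N / (2 * (1 + K)) by rewrite /q !ge_min lexx !orbT.
  by rewrite ler_pdivlMr ?mulr_gt0 //; lra.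
have [_ [x x1 <-] hx] := sup_adherent q0 hsW; rewrite -/N in hx.
have [v [_ v1 _ xv]] := approx_unit1 rB x q0.
have [u [us u1 _ vu]] := approx_unit1 rB v q0.
exists u; split => // y.
have [->|y0] := eqVneq y 0; first by rewrite smul0l (lin0 bw.1) subrr !Nm0 mulr0.
suff main y' : Nm y' <= 1 -> Nm (w y' - w (y' ⋅ u)) <= d.
  have yp := Nm_gt0 y0; rewrite -ler_pdivrMr // mulrC.
  have := main ((Nm y)^-1%:C%C *: y); rewrite NmZr ger0_norm ?invr_ge0 ?Nm_ge0 //.
  rewrite mulVf ?gt_eqF // smulZl wB -scalerBr wZ wB.
  by rewrite NmM Nm_real ger0_norm ?invr_ge0 ?Nm_ge0 //; apply.
move=> y1; set z := y' - y' ⋅ u; rewrite wB -/z.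
set y2 := x ⋅ v.
have y2N : Nm y2 <= 1 by apply: (le_trans (smul_Nm _ _)); rewrite mulr_ile1 ?Nm_ge0.
have wy2 : N - (1 + K) * q <= Nm (w y2).
  have h1 := NmT (w x) (w y2) 0; rewrite !subr0 in h1.
  have h2 : Nm (w x - w y2) <= K * q.
    rewrite wB; apply: (le_trans (hK _)); rewrite NmC.
    by rewrite ler_pM2l.
  by move: hx h1 h2; lra.
have [c cN cE] := phase_ex (w y2) (w z) (ltW t0).
have zN : Nm z <= 2.
  apply: (le_trans (NmD _ _)); rewrite NmN; have := smul_Nm y' u.
  by have := Nm_ge0 y'; have := Nm_ge0 u; nra.
(* Orthogonality up to [q]: [z] is [y' (1 - u)], and [y2] ends with [v], which [u] almost fixes. *)
have cross : Nm (y2 ⋅ z^⋆) <= q.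
  have -> : y2 ⋅ z^⋆ = x ⋅ ((v - v ⋅ u) ⋅ y'^⋆).
    rewrite /y2 /z sstarD -scaleN1r sstarZ cjN cj1 scaleN1r sstarM us.
    by rewrite smulDr smulNr smulDl smulNl smulDr smulNr !smulA.
  apply: (le_trans (smul_Nm _ _)); have h1 := smul_Nm (v - v ⋅ u) y'^⋆.
  rewrite sstar_Nm NmC in h1; have xx : Nm x <= 1 by [].
  have := Nm_ge0 x; have := Nm_ge0 y'; have := Nm_ge0 (v ⋅ u - v).
  have := Nm_ge0 ((v - v ⋅ u) ⋅ y'^⋆); nra.
have vN : Nm (y2 + c *: z) ^+ 2 <= 1 + 2 * t * q + 4 * t ^+ 2.
  rewrite -sstar_Nm -cstar_Nm sstarK sstarD sstarZ smulDl !smulDr !smulZl !smulZr.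
  have h1 : Nm (y2 ⋅ y2^⋆) <= 1.
    by apply: (le_trans (smul_Nm _ _)); rewrite sstar_Nm mulr_ile1 ?Nm_ge0.
  have h2 : Nm (c^* *: (y2 ⋅ z^⋆)) <= t * q.
    by rewrite NmZ Nm_conj ler_pM ?Nm_ge0.
  have h3 : Nm (c *: (z ⋅ y2^⋆)) <= t * q.
    rewrite NmZ -[Nm (z ⋅ _)]sstar_Nm sstarM sstarK.
    by rewrite ler_pM ?Nm_ge0.
  have h4 : Nm (c *: (c^* *: (z ⋅ z^⋆))) <= 4 * t ^+ 2.
    rewrite !NmZ Nm_conj mulrA; have h5 := smul_Nm z z^⋆; rewrite sstar_Nm in h5.
    have h6 : Nm c * Nm c <= t ^+ 2 by rewrite expr2 ler_pM ?Nm_ge0.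
    have h7 : Nm (z ⋅ z^⋆) <= 4 by have := Nm_ge0 z; nra.
    by rewrite mulrC ler_pM ?Nm_ge0 // mulr_ge0 ?Nm_ge0.
  apply: (le_trans (NmD _ _)); have := NmD (y2 ⋅ y2^⋆) (c^* *: (y2 ⋅ z^⋆)).
  have := NmD (c *: (z ⋅ y2^⋆)) (c *: (c^* *: (z ⋅ z^⋆))); lra.
have := Nub (y2 + c *: z).
have -> : w (y2 + c *: z) = w y2 + c * w z by rewrite wD wZ.
rewrite cE => h1.
exact: (functional_factor_arith d0 Np q0 K1 t0 (Nm_ge0 _) (Nm_ge0 _) tE q1 q2 q3 wy2 h1 vN).
Qed.

(** * Hilbert spaces of positive kernels *)

Section ComplexComplete.
Variable R : realType.

Lemma real_complete (u : nat -> R) :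
  (forall e : R, 0 < e -> exists N, forall m n, (N <= m)%N -> (N <= n)%N -> `|u m - u n| <= e) ->
  exists l, forall e : R, 0 < e -> exists N, forall n, (N <= n)%N -> `|u n - l| <= e.
Proof.
move=> cu.
have cF : cauchy (u @ \oo).
  apply: cauchy_exP => e e0.
  have [|N hN] := cu (e / 2); first by rewrite divr_gt0.
  exists (u N), N => // n /= Nn; rewrite -ball_normE /=.
  by apply: (le_lt_trans (hN _ _ (leqnn N) Nn)); rewrite gtr_pMr // invf_lt1 // ltr1n.
have /cvg_ex[l ul] : cvg (u @ \oo) by exact: cauchy_cvg.
exists l => e e0; have /ul [N _ hN] : nbhs l (ball l e) by exact: nbhsx_ballx.
by exists N => n /hN /=; rewrite -ball_normE /= distrC => /ltW.
Qed.

Lemma Nm_ReIm (z : R[i]) : `|complex.Re z| <= Nm z /\ `|complex.Im z| <= Nm z.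
Proof.
case: z => a b /=; rewrite /Nm normc_def /=; split.
  by rewrite -(sqrtr_sqr a) ler_wsqrtr // lerDl sqr_ge0.
by rewrite -(sqrtr_sqr b) ler_wsqrtr // lerDr sqr_ge0.
Qed.

Lemma Nm_le_ReIm (z : R[i]) : Nm z <= `|complex.Re z| + `|complex.Im z|.
Proof.
rewrite -(@ler_pXn2r _ 2) ?nnegrE ?addr_ge0 ?Nm_ge0 //.
case: z => a b /=; rewrite {1}/Nm normc_def /= sqr_sqrtr ?addr_ge0 ?sqr_ge0 //.
rewrite sqrrD !real_normK ?num_real // lerD2r lerDl.
by rewrite mulrn_wge0 // mulr_ge0.
Qed.

Lemma complex_complete (u : nat -> R[i]^o) : seq_cauchy u -> exists l, seq_limit u l.
Proof.
move=> cu.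
have ReB (z w : R[i]) : complex.Re (z - w) = complex.Re z - complex.Re w by rewrite ReD ReN.
have ImB (z w : R[i]) : complex.Im (z - w) = complex.Im z - complex.Im w by case: z w => ? ? [].
have [a ha] : exists a, forall e : R, 0 < e -> exists N, forall n, (N <= n)%N ->
    `|complex.Re (u n) - a| <= e.
  apply: real_complete => e e0; have [N hN] := cu e e0; exists N => m n hm hn.
  by rewrite -ReB; apply: le_trans (hN m n hm hn); exact: (Nm_ReIm _).1.
have [b hb] : exists a, forall e : R, 0 < e -> exists N, forall n, (N <= n)%N ->
    `|complex.Im (u n) - a| <= e.
  apply: real_complete => e e0; have [N hN] := cu e e0; exists N => m n hm hn.
  by rewrite -ImB; apply: le_trans (hN m n hm hn); exact: (Nm_ReIm _).2.
exists (a +i* b)%C => e e0.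
have [|N hN] := ha (e / 2); first by rewrite divr_gt0.
have [|N' hN'] := hb (e / 2); first by rewrite divr_gt0.
exists (maxn N N') => n; rewrite geq_max => /andP[/hN h1 /hN' h2].
apply: (le_trans (Nm_le_ReIm _)); rewrite ReB ImB /=.
by have := lerD h1 h2; rewrite -splitr.
Qed.

Definition cplx := R[i]^o.
HB.instance Definition _ := NormedModule.on cplx.
HB.instance Definition _ := Uniform_isComplete.Build cplx (complete_of_seq complex_complete).

End ComplexComplete.

(* The Hilbert space of a positive semidefinite kernel, realised by functions: the
   closed span of the functions [k _ x] with respect to the norm dual to the
   seminorm [kq] of formal linear combinations. *)
Section Kernel.
Variables (R : realType) (X : Type) (k : X -> X -> R[i]).
Implicit Types (s t : seq (R[i] * X)) (f g : X -> R[i]).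

Definition kev s f : R[i] := \sum_(p <- s) p.1^* * f p.2.
Definition kfun t (x : X) : R[i] := \sum_(p <- t) p.1 * k x p.2.
Definition kform s t : R[i] := kev s (kfun t).

Hypothesis k_herm : forall x y, k y x = (k x y)^*.
Hypothesis k_pos : forall s, 0 <= kform s s.

Lemma kev_lin s (z : R[i]) f g : kev s (fun x => z * f x + g x) = z * kev s f + kev s g.
Proof.
rewrite /kev mulr_sumr -big_split; apply: eq_bigr => p _ /=; ring.
Qed.
Lemma kev_scale s (z : R[i]) f : kev (cneg z s) f = z^* * kev s f.
Proof. by rewrite /kev big_map mulr_sumr; apply: eq_bigr => p _ /=; rewrite cjM mulrA. Qed.
Lemma kfun_cat s t x : kfun (s ++ t) x = kfun s x + kfun t x.
Proof. by rewrite /kfun big_cat. Qed.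
Lemma kfun_scale s (z : R[i]) x : kfun (cneg z s) x = z * kfun s x.
Proof. by rewrite /kfun big_map mulr_sumr; apply: eq_bigr => p _ /=; rewrite mulrA. Qed.
Lemma kform_linr s (z : R[i]) t t' : kform s (cneg z t ++ t') = z * kform s t + kform s t'.
Proof.
rewrite /kform -kev_lin; congr kev; apply/funext => x.
by rewrite kfun_cat kfun_scale.
Qed.
Lemma kform_herm s t : kform t s = (kform s t)^*.
Proof.
rewrite /kform /kev /kfun cj_sum.
under eq_bigr do rewrite mulr_sumr.
under [RHS]eq_bigr do rewrite cjM cjK cj_sum mulr_sumr.
rewrite exchange_big; apply: eq_bigr => p _; apply: eq_bigr => q _ /=.
by rewrite cjM -k_herm mulrCA.
Qed.
Lemma kform_linl s (z : R[i]) t t' : kform (cneg z t ++ t') s = z^* * kform t s + kform t' s.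
Proof. by rewrite kform_herm kform_linr cjD cjM -!kform_herm. Qed.

Lemma kform_nil s : kform s [::] = 0.
Proof. by rewrite /kform /kev big1 // => p _; rewrite /kfun big_nil mulr0. Qed.

Definition kq s : R := Num.sqrt (complex.Re (kform s s)).

Lemma kform_sq s : kform s s = (kq s ^+ 2)%:C%C.
Proof.
have := k_pos s; rewrite /kq; case: (kform s s) => a b; rewrite lecE /= => /andP[/eqP -> a0].
by rewrite sqr_sqrtr.
Qed.
Lemma kq_ge0 s : 0 <= kq s. Proof. exact: sqrtr_ge0. Qed.

Lemma kq_CS s t : Nm (kform s t) <= kq s * kq t.
Proof.
rewrite -(@ler_pXn2r _ 2) ?nnegrE ?mulr_ge0 ?Nm_ge0 ?kq_ge0 // exprMn.
set a := kq s ^+ 2; set n := kq t ^+ 2; set c := kform t s.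
have -> : Nm (kform s t) = Nm c by rewrite kform_herm Nm_conj.
have n0 : 0 <= n by rewrite exprn_ge0 ?kq_ge0.
have a0 : 0 <= a by rewrite exprn_ge0 ?kq_ge0.
(* The discriminant argument with [n + e] in place of [n], because the seminorm of [t] may
   vanish. *)
have main e : 0 < e -> Nm c ^+ 2 <= (n + e) * a.
  move=> e0; have ne0 : 0 < n + e by lra.
  pose r := cneg (- c) t ++ cneg (n + e)%:C%C s.
  have : kform r r = ((n + e) ^+ 2 * a - (n + 2 * e) * Nm c ^+ 2)%:C%C.
    have scl (z : R[i]) u v : kform u (cneg z v) = z * kform u v.
      by have := kform_linr u z v [::]; rewrite cats0 kform_nil addr0.
    have scr (z : R[i]) u v : kform (cneg z u) v = z^* * kform u v.
      by rewrite kform_herm scl cjM -kform_herm.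
    rewrite /r kform_linl !kform_linr !scl !scr !cj_real !cjN (kform_herm t s) -/c !kform_sq -/a -/n.
    rewrite rcB (rcM _ (Nm c ^+ 2)) -mul_conjC_Nm (rcM ((n + e) ^+ 2)) rcX (rcD n (2 * e)) (rcM 2) (rcD n e).
    have -> : (2 : R)%:C%C = 2 :> R[i] by exact: rmorph_nat.
    ring.
  move/(congr1 (@complex.Re R)) => /= h.
  have h1 : 0 <= (n + e) ^+ 2 * a - (n + 2 * e) * Nm c ^+ 2.
    by have := k_pos r; rewrite lecE => /andP[_]; rewrite h.
  have h2 : (n + e) * Nm c ^+ 2 <= (n + e) * ((n + e) * a).
    have : 0 <= e * Nm c ^+ 2 by rewrite mulr_ge0 ?exprn_ge0 ?Nm_ge0 ?ltW.
    by lra.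
  by rewrite ler_pM2l in h2.
rewrite mulrC; apply/ler_addgt0Pr => e e0.
have a1 : 0 < a + 1 by lra.
have := main (e / (a + 1)) (divr_gt0 e0 a1).
have : e / (a + 1) * a <= e by rewrite mulrAC ler_pdivrMr // ler_pM2l //; lra.
by rewrite mulrDl; lra.
Qed.

Lemma kq_scale (z : R[i]) s : kq (cneg z s) = Nm z * kq s.
Proof.
apply/eqP; rewrite -(@eqrXn2 _ 2) ?kq_ge0 ?mulr_ge0 ?Nm_ge0 ?kq_ge0 // exprMn; apply/eqP.
suff : (kq (cneg z s) ^+ 2)%:C%C = (Nm z ^+ 2 * kq s ^+ 2)%:C%C by move/(congr1 (@complex.Re R)).
rewrite rcM -mul_conjC_Nm -!kform_sq.
have h u v : kform u (cneg z v) = z * kform u v.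
  by have := kform_linr u z v [::]; rewrite cats0 kform_nil addr0.
by rewrite h kform_herm h cjM -kform_herm mulrA.
Qed.

Definition kclosed f := forall e : R, 0 < e -> exists t, forall s, Nm (kev s f - kform s t) <= e * kq s.

Record kspace := Kspace { kv : X -> R[i] ; kvP : kclosed kv }.
Implicit Types v w : kspace.

HB.instance Definition _ := gen_eqMixin kspace.
HB.instance Definition _ := gen_choiceMixin kspace.

Lemma kv_inj v w : kv v =1 kv w -> v = w.
Proof.
by case: v w => f p [g q] /= /funext e; subst; congr Kspace; exact: Prop_irrelevance.
Qed.

Fact kclosed_lin (z : R[i]) f g : kclosed f -> kclosed g -> kclosed (fun x => z * f x + g x).
Proof.
move=> hf hg e e0.
have K0 : 0 < Nm z + 1 by have := Nm_ge0 z; lra.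
have [|t ht] := hf (e / 2 / (Nm z + 1)); first by rewrite !divr_gt0.
have [|t' ht'] := hg (e / 2); first by rewrite divr_gt0.
exists (cneg z t ++ t') => s; rewrite kev_lin kform_linr opprD addrACA -mulrBr.
apply: (le_trans (NmD _ _)); rewrite NmM.
have : Nm z * Nm (kev s f - kform s t) <= e / 2 * kq s.
  apply: (@le_trans _ _ ((Nm z + 1) * (e / 2 / (Nm z + 1) * kq s))).
    by rewrite ler_pM ?Nm_ge0 //; lra.
  by rewrite mulrA [_ * (_ / _)]mulrC divfK // gt_eqF.
by have := ht' s; lra.
Qed.
Fact kclosed0 : kclosed (fun=> 0).
Proof.
move=> e e0; exists [::] => s; rewrite /kform /kev !big1 ?subrr.
- by rewrite Nm0 mulr_ge0 ?kq_ge0 ?ltW.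
- by move=> p _; rewrite /kfun big_nil mulr0.
- by move=> p _; rewrite mulr0.
Qed.

Definition klin (z : R[i]) v w := Kspace (kclosed_lin z (kvP v) (kvP w)).
Definition kzero := Kspace kclosed0.
Definition kadd v w := klin 1 v w.
Definition kopp v := klin (-1) v kzero.
Definition kscale z v := klin z v kzero.
Lemma kaddA : associative kadd.
Proof. by move=> u v w; apply: kv_inj => x /=; rewrite !mul1r addrA. Qed.
Lemma kaddC : commutative kadd.
Proof. by move=> u v; apply: kv_inj => x /=; rewrite !mul1r addrC. Qed.
Lemma kadd0 : left_id kzero kadd.
Proof. by move=> u; apply: kv_inj => x /=; rewrite mulr0 add0r. Qed.
Lemma kaddN : left_inverse kzero kopp kadd.
Proof. by move=> u; apply: kv_inj => x /=; rewrite mul1r mulN1r addr0 addNr. Qed.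
HB.instance Definition _ := GRing.isZmodule.Build kspace kaddA kaddC kadd0 kaddN.
Lemma kv_add v w x : kv (v + w) x = kv v x + kv w x. Proof. by rewrite /= mul1r. Qed.
Lemma kscaleA z z' v : kscale z (kscale z' v) = kscale (z * z') v.
Proof. by apply: kv_inj => x /=; rewrite !addr0 mulrA. Qed.
Lemma kscale1 : left_id 1 kscale.
Proof. by move=> v; apply: kv_inj => x /=; rewrite addr0 mul1r. Qed.
Lemma kscaleDr : right_distributive kscale +%R.
Proof. by move=> z v w; apply: kv_inj => x; rewrite kv_add /= !addr0 mul1r mulrDr. Qed.
Lemma kscaleDl v : {morph kscale^~ v : z z' / z + z'}.
Proof. by move=> z z'; apply: kv_inj => x; rewrite kv_add /= !addr0 mulrDl. Qed.
HB.instance Definition _ :=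
  GRing.Zmodule_isLmodule.Build R[i] kspace kscaleA kscale1 kscaleDr kscaleDl.
Lemma kv_scale z v x : kv (z *: v) x = z * kv v x. Proof. by rewrite /= addr0. Qed.
Lemma kev_add s v w : kev s (kv (v + w)) = kev s (kv v) + kev s (kv w).
Proof. by rewrite /= kev_lin mul1r. Qed.
Lemma kev_zero s : kev s (fun=> 0) = 0.
Proof. by rewrite /kev big1 // => p _; rewrite mulr0. Qed.
Lemma kev_scaler s z v : kev s (kv (z *: v)) = z * kev s (kv v).
Proof. by rewrite /= kev_lin kev_zero addr0. Qed.
Lemma kev_opp s v : kev s (kv (- v)) = - kev s (kv v).
Proof. by rewrite /= kev_lin kev_zero addr0 mulN1r. Qed.

Definition knset v := [set Nm (kev s (kv v)) | s in [set s | kq s <= 1]].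
Definition knorm v : R := sup (knset v).

Lemma kev_bd v : exists C : R, 0 <= C /\ forall s, Nm (kev s (kv v)) <= C * kq s.
Proof.
have [t ht] := kvP v ltr01; exists (1 + kq t); split; first by rewrite addr_ge0 ?kq_ge0.
move=> s; have := NmD (kev s (kv v) - kform s t) (kform s t); rewrite subrK.
by have := ht s; have := kq_CS s t; rewrite mulrDl; lra.
Qed.

Lemma knset_has v : has_sup (knset v).
Proof.
have q0 : kq [::] <= 1.
  by rewrite /kq /kform /kev big_nil /= sqrtr0.
split; first by exists (Nm (kev [::] (kv v))), [::].
have [C [C0 hC]] := kev_bd v; exists C => _ [s /= s1 <-]; apply: (le_trans (hC s)).
by rewrite -[leRHS]mulr1 ler_wpM2l.
Qed.

Lemma knorm_ub v s : Nm (kev s (kv v)) <= knorm v * kq s.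
Proof.
have [C [C0 hC]] := kev_bd v.
have := kq_ge0 s; rewrite le_eqVlt => /orP[/eqP e|s0].
  by rewrite -e mulr0; apply: (le_trans (hC s)); rewrite -e mulr0.
rewrite -ler_pdivrMr // mulrC.
have -> : (kq s)^-1 * Nm (kev s (kv v)) = Nm (kev (cneg (kq s)^-1%:C%C s) (kv v)).
  by rewrite kev_scale NmM Nm_conj Nm_real ger0_norm ?invr_ge0 ?kq_ge0.
apply: ub_le_sup; first exact: (knset_has v).2.
exists (cneg (kq s)^-1%:C%C s) => //=.
by rewrite kq_scale Nm_real ger0_norm ?invr_ge0 ?kq_ge0 // mulVf // gt_eqF.
Qed.

Lemma knorm_le v (C : R) : 0 <= C -> (forall s, Nm (kev s (kv v)) <= C * kq s) -> knorm v <= C.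
Proof.
move=> C0 hC; apply: ge_sup; first exact: (knset_has v).1.
move=> _ [s /= s1 <-]; apply: (le_trans (hC s)).
by rewrite -[leRHS]mulr1 ler_wpM2l.
Qed.

Lemma knorm_ge0 v : 0 <= knorm v.
Proof.
have q0 : kq [::] <= 1 by rewrite /kq /kform /kev big_nil /= sqrtr0.
apply: le_trans (ub_le_sup (knset_has v).2 _); last by exists [::].
exact: Nm_ge0.
Qed.

Definition knormC v : R[i] := (knorm v)%:C%C.

Lemma knormD v w : knormC (v + w) <= knormC v + knormC w.
Proof.
rewrite /knormC -rcD lecR; apply: knorm_le; first by rewrite addr_ge0 ?knorm_ge0.
move=> s; rewrite kev_add mulrDl; apply: (le_trans (NmD _ _)).
by rewrite lerD ?knorm_ub.
Qed.
Lemma knormZ (z : R[i]) v : knormC (z *: v) = `|z| * knormC v.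
Proof.
have le (y : R[i]) w : knorm (y *: w) <= Nm y * knorm w.
  apply: knorm_le; first by rewrite mulr_ge0 ?Nm_ge0 ?knorm_ge0.
  by move=> s; rewrite kev_scaler NmM -mulrA ler_wpM2l ?Nm_ge0 ?knorm_ub.
rewrite /knormC NmE -rcM; congr (_%:C%C); apply/eqP; rewrite eq_le le /=.
have [->|z0] := eqVneq z 0; first by rewrite (Nm0 R[i]) mul0r knorm_ge0.
rewrite mulrC -ler_pdivlMr ?Nm_gt0 // mulrC.
have := le z^-1 (z *: v); rewrite scalerA mulVf // scale1r.
suff -> : Nm z^-1 = (Nm z)^-1 by [].
apply: (@mulfI _ (Nm z)); first by rewrite gt_eqF ?Nm_gt0.
by rewrite -NmM divff // Nm1 divff // gt_eqF ?Nm_gt0.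
Qed.

Definition kpt (x : X) : seq (R[i] * X) := [:: (1, x)].
Lemma kev_pt x f : kev (kpt x) f = f x.
Proof. by rewrite /kev big_seq1 /= cj1 mul1r. Qed.

Lemma knorm0_eq0 v : knormC v = 0 -> v = 0.
Proof.
move=> /(congr1 (@complex.Re R)) /= h; apply: kv_inj => x; apply: Nm_eq0.
by apply/eqP; rewrite eq_le Nm_ge0 andbT; have := knorm_ub v (kpt x); rewrite h mul0r kev_pt.
Qed.
HB.instance Definition _ := Lmodule_isNormed.Build R[i] kspace knormD knormZ knorm0_eq0.

Lemma kspace_ub v s : Nm (kev s (kv v)) <= Nm v * kq s.
Proof. exact: knorm_ub. Qed.

Lemma kspace_complete (u : nat -> kspace) : seq_cauchy u -> exists l, seq_limit u l.
Proof.
move=> cu.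
have evB s m n : kev s (kv (u m)) - kev s (kv (u n)) = kev s (kv (u m - u n)).
  by rewrite kev_add kev_opp.
have cp x : exists l : R[i]^o, seq_limit (fun n => kv (u n) x : R[i]^o) l.
  apply: complex_complete => e e0.
  have K0 : 0 < kq (kpt x) + 1 by have := kq_ge0 (kpt x); lra.
  have [|N hN] := cu (e / (kq (kpt x) + 1)); first by rewrite divr_gt0.
  exists N => m n hm hn; have := hN m n hm hn; rewrite ler_pdivlMr // => h.
  rewrite -!kev_pt evB; apply: (le_trans (kspace_ub _ _)); apply: le_trans h.
  by rewrite ler_wpM2l ?Nm_ge0 //; lra.
have [f hf] := choice cp.
have lim s (d : R) : 0 < d -> exists N, forall n, (N <= n)%N -> Nm (kev s (kv (u n)) - kev s f) <= d.
  elim: s d => [|p s ih] d d0.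
    by exists 0%N => n _; rewrite /kev !big_nil subrr (Nm0 R[i]) ltW.
  have K0 : 0 < Nm p.1 + 1 by have := Nm_ge0 p.1; lra.
  have [|N hN] := ih (d / 2); first by rewrite divr_gt0.
  have [|N' hN'] := hf p.2 (d / 2 / (Nm p.1 + 1)); first by rewrite !divr_gt0.
  exists (maxn N N') => n; rewrite geq_max => /andP[/hN h1 /hN' h2].
  rewrite /kev !big_cons -!/(kev s _) opprD addrACA -mulrBr.
  apply: (le_trans (NmD _ _)); rewrite NmM Nm_conj.
  have : Nm p.1 * Nm (kv (u n) p.2 - f p.2) <= d / 2.
    apply: (@le_trans _ _ ((Nm p.1 + 1) * (d / 2 / (Nm p.1 + 1)))).
      by rewrite ler_pM ?Nm_ge0 //; lra.
    by rewrite [_ * (_ / _)]mulrC divfK // gt_eqF.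
  by lra.
have unif e : 0 < e -> exists N, forall n, (N <= n)%N -> forall s, Nm (kev s (kv (u n)) - kev s f) <= e * kq s.
  move=> e0; have [N hN] := cu e e0; exists N => n hn s; apply: Nm_eps => d d0.
  have [N' hN'] := lim s d d0.
  have h1 := hN' _ (leq_maxr N N'); have h2 := hN _ _ hn (leq_maxl N N').
  have := NmT (kev s (kv (u n))) (kev s (kv (u (maxn N N')))) (kev s f); rewrite evB.
  have := kspace_ub (u n - u (maxn N N')) s.
  have := ler_wpM2r (kq_ge0 s) h2; lra.
have fP : kclosed f.
  move=> e e0; have [|N hN] := unif (e / 2); first by rewrite divr_gt0.
  have [|t ht] := kvP (u N) (_ : 0 < e / 2); first by rewrite divr_gt0.
  exists t => s; have := hN N (leqnn N) s; have := ht s.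
  by have := NmT (kev s f) (kev s (kv (u N))) (kform s t); rewrite (NmC (kev s f) (kev s (kv (u N)))); lra.
exists (Kspace fP) => e e0; have [N hN] := unif e e0; exists N => n hn.
apply: knorm_le; first exact: ltW.
by move=> s; rewrite kev_add kev_opp; exact: hN.
Qed.
HB.instance Definition _ := Uniform_isComplete.Build kspace (complete_of_seq kspace_complete).

Fact kclosed_fun t : kclosed (kfun t).
Proof.
by move=> e e0; exists t => s; rewrite subrr (Nm0 R[i]) mulr_ge0 ?kq_ge0 ?ltW.
Qed.
Definition kemb (x : X) : kspace := Kspace (kclosed_fun (kpt x)).

Lemma kv_comb t x : kv (comb kemb t) x = kfun t x.
Proof.
elim: t => [|p t ih]; first by rewrite /comb /kfun !big_nil.
rewrite /comb big_cons kv_add kv_scale -/(comb kemb t) ih /kfun big_cons /=.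
by rewrite /kfun big_seq1 mul1r.
Qed.

Lemma kev_comb s t : kev s (kv (comb kemb t)) = kform s t.
Proof. by congr kev; apply/funext => x; exact: kv_comb. Qed.

Lemma Nm_kcomb t : Nm (comb kemb t) = kq t.
Proof.
apply/eqP; rewrite eq_le; apply/andP; split.
  by apply: knorm_le; [exact: kq_ge0|move=> s; rewrite kev_comb mulrC; exact: kq_CS].
have := kspace_ub (comb kemb t) t; rewrite kev_comb kform_sq Nm_real ger0_norm ?exprn_ge0 ?kq_ge0 //.
have [->|t0] := eqVneq (kq t) 0; first by rewrite Nm_ge0.
by rewrite expr2 ler_pM2r // lt0r t0 kq_ge0.
Qed.

Lemma kemb_total : total kemb.
Proof.
move=> v e e0; have [t ht] := kvP v e0; exists t.
by apply: knorm_le; [exact: ltW|move=> s; rewrite kev_add kev_opp kev_comb; exact: ht].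
Qed.

Lemma kinner_ex v : exists f : kspace -> R[i]^o, [/\ linear f,
  forall w, Nm (f w) <= Nm v * Nm w & forall x, f (kemb x) = (kv v x)^*].
Proof.
apply: (@lift_ex _ _ _ (cplx R) kemb (fun x => (kv v x)^*) _ kemb_total) => s; rewrite Nm_kcomb.
have -> : comb (fun x : X => (kv v x)^* : R[i]^o) s = (kev s (kv v))^*.
  by rewrite /comb /kev cj_sum; apply: eq_bigr => p _; rewrite cjM cjK.
by rewrite Nm_conj; exact: kspace_ub.
Qed.
Definition kinner v : kspace -> R[i]^o := projT1 (cid (kinner_ex v)).
Lemma kinner_lin v : scalar (kinner v).
Proof. by rewrite /kinner; case: cid => f []. Qed.
Lemma kinner_le v w : Nm (kinner v w) <= Nm v * Nm w.
Proof. by rewrite /kinner; case: cid => f []. Qed.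
Lemma kinner_emb v x : kinner v (kemb x) = (kv v x)^*.
Proof. by rewrite /kinner; case: cid => f []. Qed.
Lemma kinner_comb v t : kinner v (comb kemb t) = (kev t (kv v))^*.
Proof.
rewrite (comb_lin _ _ (kinner_lin v : linear (kinner v))) /comb /kev cj_sum.
by apply: eq_bigr => p _; rewrite /= kinner_emb cjM cjK.
Qed.
Lemma kinner_blin v : blin (kinner v).
Proof. by split; [exact: kinner_lin|exists (Nm v) => w; exact: kinner_le]. Qed.

Lemma kinner_antilin (z : R[i]) v v' w : kinner (z *: v + v') w = z^* * kinner v w + kinner v' w.
Proof.
apply: (total_eq (f := kinner _) (g := fun w => z^* *: kinner v w + kinner v' w) kemb_total).
- exact: kinner_blin.
- by apply: blin_lin; exact: kinner_blin.
- move=> x; rewrite !kinner_emb -[RHS]/(z^* * (kv v x)^* + (kv v' x)^*) -cjM -cjD.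
  congr (_^*); rewrite kv_add; congr (_ + _).
  exact: kv_scale.
Qed.

Lemma kinner_blinl w : blin (fun v => (kinner v w)^* : R[i]^o).
Proof.
split; first by move=> z v v' /=; rewrite kinner_antilin cjD cjM cjK.
by exists (Nm w) => v; rewrite Nm_conj mulrC; exact: kinner_le.
Qed.

Lemma kinner_conj v w : kinner w v = (kinner v w)^*.
Proof.
move: v; apply: (total_eq (f := kinner w) (g := fun v => (kinner v w)^* : R[i]^o) kemb_total).
- exact: kinner_blin.
- exact: kinner_blinl.
move=> x; rewrite kinner_emb; congr (_^*); move: w.
apply: (total_eq (f := fun w => kv w x : R[i]^o) (g := kinner (kemb x)) kemb_total).
- split; first by move=> z v w; rewrite kv_add; congr (_ + _); exact: kv_scale.
  exists (kq (kpt x)) => v; rewrite mulrC; have := kspace_ub v (kpt x).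
  by rewrite kev_pt.
- exact: kinner_blin.
- by move=> y; rewrite kinner_emb /= /kfun !big_seq1 /= !mul1r; exact: k_herm.
Qed.

Lemma kinner_sq v : kinner v v = (Nm v ^+ 2)%:C%C.
Proof.
apply/subr0_eq; apply: (@Nm_smallM _ _ _ (4 * Nm v + 2)) => e e0.
(* The cap at [1] keeps the norm of the approximant below [Nm v + 1]. *)
have d0 : 0 < Num.min e 1 by rewrite lt_min e0 ltr01.
have [s hs] := kemb_total v d0.
have [se s1] : Nm (v - comb kemb s) <= e /\ Nm (v - comb kemb s) <= 1.
  by move: hs; rewrite le_min => /andP.
set u := comb kemb s in se s1.
have uu : kinner u u = (Nm u ^+ 2)%:C%C.
  by rewrite kinner_comb kev_comb kform_sq cj_real Nm_kcomb.
have -> : kinner v v - (Nm v ^+ 2)%:C%C = kinner v (v - u) + (kinner u (v - u))^*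
    + (Nm u ^+ 2 - Nm v ^+ 2)%:C%C.
  rewrite rcB -uu !(linB (kinner_lin _ : linear (kinner _))) cjD cjN -!kinner_conj.
  by zmod.
have h1 := le_trans (kinner_le v (v - u)) (ler_wpM2l (Nm_ge0 v) se).
have h2 := le_trans (kinner_le u (v - u)) (ler_wpM2l (Nm_ge0 u) se).
have h3 : `|Nm u ^+ 2 - Nm v ^+ 2| <= (Nm u + Nm v) * e.
  rewrite subr_sqr normrM mulrC ger0_norm ?addr_ge0 ?Nm_ge0 //.
  rewrite ler_wpM2l ?addr_ge0 ?Nm_ge0 //; apply: le_trans se.
  rewrite ler_norml; have := NmD (v - u) u; have := NmD (u - v) v.
  by rewrite !subrK (NmC u v); lra.
have h4 : Nm u <= Nm v + 1 by have := NmD (u - v) v; rewrite subrK NmC; lra.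
apply: (le_trans (NmD _ _)); have := NmD (kinner v (v - u)) (kinner u (v - u))^*.
rewrite Nm_conj Nm_real; have := Nm_ge0 u; have := Nm_ge0 v; nra.
Qed.

Fact kinner_norm v : kinner v v = `|v| ^+ 2.
Proof. by rewrite kinner_sq NmE rcX. Qed.

HB.instance Definition _ := CompleteNormed_isHilbert.Build R kspace kinner_lin kinner_conj kinner_norm.

(** Tensor products of Hilbert spaces and essential subspaces of representations are both obtained
    from this by prescribing the inner products of generators. *)
Theorem kernel_hilbert : exists (V : hilbertType R) (j : X -> V),
  total j /\ forall x y, ⟨j x, j y⟩ = k x y.
Proof.
exists (kspace : hilbertType R), kemb; split; first exact: kemb_total.
move=> x y; rewrite -[LHS]/(kinner (kemb x) (kemb y)) kinner_emb /= /kfun big_seq1 mul1r /=.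
by rewrite -k_herm.
Qed.

End Kernel.

(** * Sharp norm bounds from the growth of powers *)

Section PowerBound.
Variable R : realType.

(* Log-convexity: the ratios [v m.+1 / v m] increase. *)
Lemma logconvex_bound (v : nat -> R) (C M : R) : 0 < M -> (forall m, 0 <= v m) ->
  (forall m, v m.+1 ^+ 2 <= v m * v m.+2) -> (forall m, v m <= C * M ^+ m) -> v 1%N <= M * v 0%N.
Proof.
move=> M0 v0 vv vC; rewrite leNgt; apply/negP => h.
have v00 : 0 < v 0%N.
  rewrite lt_neqAle v0 andbT; apply/eqP => e; move: h; rewrite -e mulr0 => h1.
  have h2 : 0 < v 1%N ^+ 2 by rewrite exprn_gt0.
  by have := lt_le_trans h2 (vv 0%N); rewrite -e mul0r ltxx.
pose q := v 1%N / v 0%N.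
have qE : v 1%N = q * v 0%N by rewrite divfK // gt_eqF.
have qM : M < q by rewrite ltr_pdivlMr.
have q0 : 0 < q by lra.
have st m : 0 < v m /\ q * v m <= v m.+1.
  elim: m => [|m [vm ih]]; first by rewrite -qE.
  have vm1 : 0 < v m.+1 by apply: lt_le_trans ih; rewrite mulr_gt0.
  split=> //; rewrite -(ler_pM2l vm) mulrCA; apply: le_trans (vv m).
  by rewrite expr2 mulrA ler_pM2r.
have gr m : (1 + m%:R * (q / M - 1)) * v 0%N * M ^+ m <= v m.
  have : (q / M) ^+ m * v 0%N * M ^+ m <= v m.
    elim: m => [|m ih]; first by rewrite !expr0 !mul1r mulr1.
    apply: le_trans (st m).2; rewrite 2!exprS.
    have -> : q / M * (q / M) ^+ m * v 0%N * (M * M ^+ m) = q * ((q / M) ^+ m * v 0%N * M ^+ m).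
      by field; rewrite gt_eqF.
    by rewrite ler_pM2l.
  apply: le_trans; rewrite ler_pM2r ?exprn_gt0 // ler_pM2r //.
  elim: m => [|m ih]; first by rewrite mul0r addr0.
  have d0 : 0 <= q / M - 1 by rewrite subr_ge0 ler_pdivlMr // mul1r ltW.
  have : (1 + m%:R * (q / M - 1)) * (1 + (q / M - 1)) <= (q / M) ^+ m * (q / M).
    have -> : 1 + (q / M - 1) = q / M by ring.
    by apply: ler_wpM2r => //; rewrite divr_ge0 // ltW.
  rewrite -exprSr; apply: le_trans; rewrite -[m.+1]addn1 natrD.
  set D := _ - 1 in d0 *; have : 0 <= m%:R * D * D by rewrite !mulr_ge0.
  lra.
have d0 : 0 < q / M - 1 by rewrite subr_gt0 ltr_pdivlMr // mul1r.
have K0 : 0 < (q / M - 1) * v 0%N by rewrite mulr_gt0.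
pose m := (Num.truncn (C / ((q / M - 1) * v 0%N))).+1.
have : C / ((q / M - 1) * v 0%N) < m%:R.
  have [c0|c0] := leP 0 (C / ((q / M - 1) * v 0%N)).
    by rewrite /m; have := truncn_itv c0 => /andP[].
  exact: lt_le_trans c0 _.
rewrite ltr_pdivrMr // => hm.
have := le_trans (gr m) (vC m); rewrite ler_pM2r ?exprn_gt0 // mulrDl mul1r -mulrA; lra.
Qed.

(* [T] is only required to be formally selfadjoint on the sequence of iterates. *)
Lemma power_bound (H : hilbertType R) (u : nat -> H) (C M : R) : 0 < M ->
  (forall m n, ⟨u m.+1, u n⟩ = ⟨u m, u n.+1⟩) -> (forall m, Nm (u m) <= C * M ^+ m) ->
  Nm (u 1%N) <= M * Nm (u 0%N).
Proof.
move=> M0 su uC; apply: (logconvex_bound M0 (fun m => Nm_ge0 (u m)) _ uC) => m.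
have -> : Nm (u m.+1) ^+ 2 = Nm (⟨u m, u m.+2⟩ : R[i]).
  by rewrite -su inner_Nm Nm_real ger0_norm ?exprn_ge0 ?Nm_ge0.
exact: CauchySchwarz.
Qed.

End PowerBound.

Section Act.
Variables (R : realType) (X : Type) (V : hilbertType R) (j : X -> V).
Hypothesis jt : total j.

Lemma comb_inner s t : ⟨comb j s, comb j t⟩ = \sum_(p <- s) \sum_(q <- t) p.1^* * q.1 * ⟨j p.2, j q.2⟩.
Proof.
rewrite /comb inner_suml; apply: eq_bigr => p _; rewrite inner_sumr; apply: eq_bigr => q _.
by rewrite innerZl innerZr mulrA.
Qed.

(** A map given only on generators, with formal adjoint [g], is bounded by [M] as soon as each orbit
    of [g \o f] grows at most like [M^{2m}]: the constants, which depend on the vector, disappear in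
    [power_bound]. *)
Lemma act_bound (f g : X -> X) (M : R) : 0 < M ->
  (forall x y, ⟨j (g x), j y⟩ = ⟨j x, j (f y)⟩) ->
  (forall x, exists C : R, forall m, Nm (j (iter m (g \o f) x)) <= C * (M ^+ 2) ^+ m) ->
  forall s, Nm (comb (j \o f) s) <= M * Nm (comb j s).
Proof.
move=> M0 adj gr s; pose mp (f : X -> X) := map (fun p : R[i] * X => (p.1, f p.2)).
have mpE (k : X -> X) t : comb (j \o k) t = comb j (mp k t) by rewrite /comb big_map.
have adjc a b : ⟨comb j (mp g a), comb j b⟩ = ⟨comb j a, comb j (mp f b)⟩.
  rewrite !comb_inner big_map; apply: eq_bigr => p _; rewrite big_map.
  by apply: eq_bigr => q _; rewrite /= adj.
have adjc' a b : ⟨comb j (mp f a), comb j b⟩ = ⟨comb j a, comb j (mp g b)⟩.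
  by rewrite innerC -adjc -innerC.
pose u m := comb j (iter m (mp (g \o f)) s).
have mpc t : mp (g \o f) t = mp g (mp f t) by rewrite /mp -map_comp.
have [C hC] : exists C : R, forall m, Nm (u m) <= C * (M ^+ 2) ^+ m.
  have -> : u = fun m => comb (fun x => j (iter m (g \o f) x)) s.
    apply/funext => m; rewrite /u (mpE (iter m (g \o f))); congr comb.
    elim: m => [|m ih]; first by rewrite /mp /=; elim: (s) => //= -[a b] r <-.
    by rewrite /= ih /mp -map_comp.
  elim: (s) => [|p t [C hC]].
    by exists 0 => m; rewrite /comb big_nil Nm0 mul0r.
  have [D hD] := gr p.2; exists (Nm p.1 * D + C) => m.
  rewrite /comb big_cons; apply: (le_trans (NmD _ _)); rewrite mulrDl lerD //; last exact: hC.
  by rewrite NmZ -mulrA ler_wpM2l ?Nm_ge0.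
have h : Nm (u 1%N) <= M ^+ 2 * Nm (u 0%N).
  apply: power_bound hC; first by rewrite exprn_gt0.
  by move=> m n; rewrite /u /= !mpc adjc adjc'.
rewrite mpE -(@ler_pXn2r _ 2) ?nnegrE ?mulr_ge0 ?Nm_ge0 ?(ltW M0) // exprMn.
have -> : Nm (comb j (mp f s)) ^+ 2 = Nm (⟨u 0%N, u 1%N⟩ : R[i]).
  by rewrite /u /= mpc -adjc' inner_Nm Nm_real ger0_norm ?exprn_ge0 ?Nm_ge0.
apply: (le_trans (CauchySchwarz _ _)); 
have -> : M ^+ 2 * Nm (comb j s) ^+ 2 = Nm (u 0%N) * (M ^+ 2 * Nm (u 0%N)) by rewrite /u /=; ring.
by rewrite ler_wpM2l ?Nm_ge0.
Qed.

Lemma act_op (f g : X -> X) (M : R) : 0 < M ->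
  (forall x y, ⟨j (g x), j y⟩ = ⟨j x, j (f y)⟩) ->
  (forall x, exists C : R, forall m, Nm (j (iter m (g \o f) x)) <= C * (M ^+ 2) ^+ m) ->
  (forall x, exists C : R, forall m, Nm (j (iter m (f \o g) x)) <= C * (M ^+ 2) ^+ m) ->
  exists F : Bop V, [/\ Nm F <= M, forall x, af F (j x) = j (f x) & forall x, ag F (j x) = j (g x)].
Proof.
move=> M0 adj h1 h2.
have adj' x y : ⟨j (f x), j y⟩ = ⟨j x, j (g y)⟩ by rewrite innerC -adj -innerC.
have [F [Fl Fb Fj]] := lift_ex jt (act_bound M0 adj h1).
have [G [Gl Gb Gj]] := lift_ex jt (act_bound M0 adj' h2).
have FG x y : ⟨G x, y⟩ = ⟨x, F y⟩.
  move: y; apply: (total_eq (f := fun y => ⟨G x, y⟩ : R[i]^o) (g := fun y => ⟨x, F y⟩ : R[i]^o) jt).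
  - split; first by move=> z v w; rewrite innerDr innerZr.
    by exists (Nm (G x)) => v; exact: CauchySchwarz.
  - split; first by move=> z v w; rewrite Fl innerDr innerZr.
    exists (Nm x * M) => v; apply: (le_trans (CauchySchwarz _ _)).
    by rewrite -mulrA ler_wpM2l ?Nm_ge0.
  move=> y; rewrite /= Fj innerC [RHS]innerC; congr (_^*); move: x.
  apply: (total_eq (f := fun x => ⟨j y, G x⟩ : R[i]^o) (g := fun x => ⟨j (f y), x⟩ : R[i]^o) jt).
  - split; first by move=> z v w; rewrite Gl innerDr innerZr.
    exists (Nm (j y) * M) => v; apply: (le_trans (CauchySchwarz _ _)).
    by rewrite -mulrA ler_wpM2l ?Nm_ge0.
  - split; first by move=> z v w; rewrite innerDr innerZr.
    by exists (Nm (j (f y))) => v; exact: CauchySchwarz.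
  by move=> x /=; rewrite Gj adj'.
have FG' x y : ⟨F x, y⟩ = ⟨x, G y⟩ by rewrite innerC -FG -innerC.
exists (@Aop _ _ (hpairing V) F G FG' (ex_intro _ M Fb)); split=> //.
by apply: aop_lub => //; exact: ltW.
Qed.

End Act.

(** * Tensor products of Hilbert spaces *)

Section SchurProduct.
Variables (R : realType) (H K : hilbertType R).

(** Induction on the number of vectors: removing from the second components their projection onto
    [y0] leaves a sum without its first vector, and the removed part is a nonnegative multiple of
    the squared norm of a single vector. *)
Lemma schur_pos (s : seq (H * K)) :
  0 <= \sum_(p <- s) \sum_(q <- s) ⟨p.1, q.1⟩ * ⟨p.2, q.2⟩ :> R[i].
Proof.
elim: {s}(size s) {-2}s (leqnn (size s)) => [|n ih] [|[x0 y0] s] //= ns; try by rewrite big_nil.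
pose n0 : R[i] := ⟨y0, y0⟩; pose a (y : K) := ⟨y0, y⟩.
(* The convention [0^-1 = 0] makes [pj] the identity if [y0 = 0]. *)
pose pj (y : K) := y - (n0^-1 * a y) *: y0.
have n0c : n0^* = n0 by rewrite -innerC.
have nic : (n0^-1)^* = n0^-1 by rewrite -[in RHS]n0c; exact: fmorphV.
have nn : n0^-1 * n0^-1 * n0 = n0^-1.
  by have [->|h] := eqVneq n0 0; rewrite ?invr0 ?mulr0 // -mulrA mulVf ?mulr1.
have pjE y y' : ⟨y, y'⟩ = ⟨pj y, pj y'⟩ + n0^-1 * ((a y)^* * a y').
  rewrite /pj innerBl !innerBr !innerZl !innerZr cjM nic -/n0 -/(a y') [⟨y, y0⟩]innerC -/(a y).
  have -> : n0^-1 * (a y)^* * (n0^-1 * a y' * n0) = n0^-1 * n0^-1 * n0 * ((a y)^* * a y') by ring.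
  by rewrite nn; ring.
have p0 : pj y0 = 0.
  rewrite /pj /a -/n0; have [h|h] := eqVneq n0 0; last by rewrite mulVf // scale1r subrr.
  by rewrite (inner_eq0 (h : ⟨y0, y0⟩ = 0)) scaler0 subr0.
set t := (x0, y0) :: s.
have -> : \sum_(p <- t) \sum_(q <- t) ⟨p.1, q.1⟩ * ⟨p.2, q.2⟩ =
    \sum_(p <- t) \sum_(q <- t) ⟨p.1, q.1⟩ * ⟨pj p.2, pj q.2⟩ +
    n0^-1 * ⟨\sum_(p <- t) a p.2 *: p.1, \sum_(p <- t) a p.2 *: p.1⟩.
  rewrite inner_suml mulr_sumr -big_split; apply: eq_bigr => p _ /=.
  rewrite inner_sumr mulr_sumr -big_split; apply: eq_bigr => q _ /=.
  by rewrite {1}pjE innerZl innerZr; ring.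
have nge : 0 <= n0^-1 by rewrite invr_ge0 /n0 inner_norm exprn_ge0.
apply: addr_ge0; last by rewrite mulr_ge0 // inner_norm exprn_ge0.
have := ih [seq (p.1, pj p.2) | p <- s]; rewrite size_map => /(_ ns).
congr (_ <= _); rewrite big_map /t [RHS]big_cons [X in _ = X + _]big1 ?add0r; last first.
  by move=> q _; rewrite /= p0 inner0l mulr0.
by apply: eq_bigr => p _; rewrite big_map big_cons /= p0 inner0r mulr0 add0r.
Qed.

Lemma hilbert_tensor_ex : exists (L : hilbertType R) (h : H -> K -> L), hilbert_tensor h.
Proof.
pose k (p q : H * K) : R[i] := ⟨p.1, q.1⟩ * ⟨p.2, q.2⟩.
have kh p q : k q p = (k p q)^* by rewrite /k cjM -!innerC.
have kp s : 0 <= kform k s s.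
  have := schur_pos [seq (p.1 *: p.2.1, p.2.2) | p <- s]; congr (_ <= _).
  rewrite big_map /kform /kev; apply: eq_bigr => p _; rewrite big_map /kfun mulr_sumr.
  by apply: eq_bigr => q _ /=; rewrite innerZl innerZr /k; ring.
have [L [j [jt jk]]] := kernel_hilbert kh kp.
have jl (z : R[i]) x x' y y' v w : (forall q, k q (v, w) = z * k q (x, y) + k q (x', y')) ->
    j (v, w) = z *: j (x, y) + j (x', y').
  by move=> e; apply: (total_inner jt) => q; rewrite innerDr innerZr !jk e.
exists L, (fun x y => j (x, y)); split.
- move=> x z y y'; apply: jl => q; rewrite /k /= innerDr innerZr; ring.
- move=> y z x x'; apply: jl => q; rewrite /k /= innerDr innerZr; ring.
- by move=> x x' y y'; rewrite jk.
apply/seteqP; split=> // v _; have /totalE tj := jt.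
have : cspan (range j) v by rewrite tj.
apply: cspan_min; first exact: cspan_csub.
by move=> _ [[x y] _ <-]; apply: sub_cspan; exists x => //; exists y.
Qed.

End SchurProduct.

Section BopTools.
Variables (R : realType) (H : hilbertType R).
Implicit Types a b : Bop H.

Lemma Bop_adj a x y : ⟨af a x, y⟩ = ⟨x, af a^⋆ y⟩. Proof. exact: (aP a x y). Qed.
Lemma Bop_adj' a x y : ⟨af a^⋆ x, y⟩ = ⟨x, af a y⟩. Proof. exact: (aP' a x y). Qed.
Lemma afD a x y : af a (x + y) = af a x + af a y. Proof. exact: (linD (af_lin a)). Qed.
Lemma afZ a z x : af a (z *: x) = z *: af a x. Proof. exact: (linZ (af_lin a)). Qed.
Lemma af0 a : af a 0 = 0. Proof. exact: (lin0 (af_lin a)). Qed.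
Lemma af_comp a b x : af (a ⋅ b) x = af a (af b x). Proof. by []. Qed.
Lemma af_one x : af (aone (hpairing H)) x = x. Proof. by []. Qed.
Lemma af_blin a : blin (af a).
Proof. by split; [exact: af_lin|exists (Nm a) => x; exact: aop_le]. Qed.
Lemma af_blinl x : blin (fun a => af a x).
Proof.
split; first by move=> z a b; rewrite af_add af_scale.
by exists (Nm x) => a; rewrite mulrC; exact: aop_le.
Qed.
Lemma inner_blin (x : H) : blin (fun y : H => ⟨x, y⟩ : R[i]^o).
Proof.
split; first by move=> z v w; rewrite innerDr innerZr.
by exists (Nm x) => v; exact: CauchySchwarz.
Qed.
Lemma Bop_total X (j : X -> H) a b : total j -> (forall x, af a (j x) = af b (j x)) -> a = b.
Proof. by move=> tj h; apply: aop_ext; apply: (total_eq tj); [exact: af_blin|exact: af_blin|]. Qed.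
Lemma Bop_zero a : (forall x y, ⟨x, af a y⟩ = 0) -> a = 0.
Proof. by move=> h; apply: aop_ext => y; apply: inner_ext => x; rewrite h af_zero inner0r. Qed.
Lemma amul1' a : a ⋅ aone (hpairing H) = a. Proof. exact: aop_ext. Qed.
Lemma a1mul' a : aone (hpairing H) ⋅ a = a. Proof. exact: aop_ext. Qed.

Lemma Nm_iter a m x : Nm (iter m (fun x => af a^⋆ (af a x)) x) <= Nm x * (Nm a ^+ 2) ^+ m.
Proof.
elim: m => [|m ih]; first by rewrite expr0 mulr1.
rewrite iterS exprSr mulrA [_ * Nm a ^+ 2]mulrC expr2 -mulrA.
apply: (le_trans (aop_le _ _)); rewrite sstar_Nm ler_wpM2l ?Nm_ge0 //.
by apply: (le_trans (aop_le _ _)); rewrite ler_wpM2l ?Nm_ge0.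
Qed.

Lemma unitary_op (W : H -> H) : unitary W ->
  exists U : Bop H, [/\ af U = W, U^⋆ ⋅ U = aone (hpairing H) & U ⋅ U^⋆ = aone (hpairing H)].
Proof.
move=> [Wl Wi Ws].
have /choice[V hV] : forall y, exists x, W x = y by move=> y; have [x _ <-] := Ws y I; exists x.
have adj x y : ⟨W x, y⟩ = ⟨x, V y⟩ by rewrite -{1}[y]hV Wi.
have Wb : exists M : R, forall x, Nm (W x) <= M * Nm x.
  exists 1 => x; rewrite mul1r -(@ler_pXn2r _ 2) ?nnegrE ?Nm_ge0 //.
  by rewrite !NmRe Wi.
exists (@Aop _ _ (hpairing H) W V adj Wb); split => //; apply: aop_ext => x /=; last exact: hV.
by apply: inner_ext => z; rewrite -adj Wi.
Qed.

End BopTools.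

Lemma isom_ex (R : realType) (X : Type) (V W : hilbertType R) (j : X -> V) (F : X -> W) : total j ->
  (forall x y, ⟨F x, F y⟩ = ⟨j x, j y⟩) ->
  exists U : V -> W, [/\ linear U, forall x y, ⟨U x, U y⟩ = ⟨x, y⟩ & forall x, U (j x) = F x].
Proof.
move=> jt iso.
have nm s : Nm (comb F s) = Nm (comb j s).
  apply/eqP; rewrite -(@eqrXn2 _ 2) ?Nm_ge0 // !NmRe !comb_inner; apply/eqP; congr complex.Re.
  by apply: eq_bigr => p _; apply: eq_bigr => q _; rewrite iso.
have [U [Ul Ub Uj]] : exists U : V -> W, [/\ linear U, forall v, Nm (U v) <= 1 * Nm v & forall x, U (j x) = F x].
  by apply: lift_ex => // s; rewrite mul1r nm.
have bU : blin U by split=> //; exists 1.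
exists U; split=> // x y; move: y.
apply: (total_eq (f := fun y => ⟨U x, U y⟩ : R[i]^o) (g := fun y => ⟨x, y⟩ : R[i]^o) jt).
- exact: (blin_comp (inner_blin (U x)) bU).
- exact: inner_blin.
move=> i; rewrite innerC [RHS]innerC; congr (_^*); move: x.
apply: (total_eq (f := fun y => ⟨U (j i), U y⟩ : R[i]^o) (g := fun y => ⟨j i, y⟩ : R[i]^o) jt).
- exact: (blin_comp (inner_blin (U (j i))) bU).
- exact: inner_blin.
by move=> k; rewrite !Uj iso.
Qed.

Section HilbertTensor.
Variables (R : realType) (H K L : hilbertType R) (h : H -> K -> L).
Hypothesis hh : hilbert_tensor h.

Lemma htl y : linear (h^~ y). Proof. by case: hh. Qed.
Lemma htr x : linear (h x). Proof. by case: hh. Qed.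
Lemma ht_inner x x' y y' : ⟨h x y, h x' y'⟩ = ⟨x, x'⟩ * ⟨y, y'⟩. Proof. by case: hh. Qed.
Lemma ht_Nm x y : Nm (h x y) = Nm x * Nm y.
Proof.
apply/eqP; rewrite -(@eqrXn2 _ 2) ?mulr_ge0 ?Nm_ge0 // NmRe ht_inner !inner_Nm exprMn.
by rewrite -rcM.
Qed.
Lemma ht_blinl y : blin (h^~ y).
Proof. by split; [exact: htl|exists (Nm y) => x; rewrite ht_Nm mulrC]. Qed.
Lemma ht_blinr x : blin (h x).
Proof. by split; [exact: htr|exists (Nm x) => y; rewrite ht_Nm]. Qed.
Lemma ht_cspan : cspan [set h x y | x in setT & y in setT] = setT. Proof. by case: hh. Qed.
Lemma ht_flip : hilbert_tensor (fun y x => h x y).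
Proof.
split; [exact: htl|exact: htr| |].
  by move=> *; rewrite ht_inner mulrC.
rewrite -ht_cspan; congr cspan; apply/seteqP.
by split=> _ [x _ [y _ <-]]; exists y => //; exists x.
Qed.
Lemma ht_total : total (fun p => h p.1 p.2).
Proof.
apply/totalE; rewrite -ht_cspan; congr cspan; apply/seteqP.
by split=> [_ [[x y] _ <-]|_ [x _ [y _ <-]]]; [exists x => //; exists y|exists (x, y)].
Qed.
Lemma ht_total2 X Y (j : X -> H) (k : Y -> K) : total j -> total k ->
  total (fun p => h (j p.1) (k p.2)).
Proof.
move=> /totalE tj /totalE tk; apply/totalE/seteqP; split=> // v _.
apply: (cspan_all ht_cspan (cspan_csub _)) => _ [x _ [y _ <-]].
apply: (@cspan2 _ _ _ _ h (range j) (range k)).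
- exact: ht_blinr.
- exact: ht_blinl.
- exact: cspan_csub.
- by move=> _ _ [i _ <-] [i' _ <-]; apply: sub_cspan; exists (i, i').
- by rewrite tj.
- by rewrite tk.
Qed.

(** On elementary tensors the iterates split into those of [f^⋆ f] and [g^⋆ g], so their growth is
    plain, and [act_op] carries the bound to all sums. A positive [M] is kept because [Nm f * Nm g]
    may be zero. *)
Lemma otens_exM (f : Bop H) (g : Bop K) (M : R) : 0 < M -> Nm f * Nm g <= M ->
  exists F : Bop L, [/\ Nm F <= M, forall x y, af F (h x y) = h (af f x) (af g y)
    & forall x y, ag F (h x y) = h (ag f x) (ag g y)].
Proof.
move=> M0 fgM.
have gr (f' : Bop H) (g' : Bop K) : Nm f' = Nm f -> Nm g' = Nm g -> forall p : H * K, exists C : R,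
    forall m, Nm (let q := iter m (fun p : H * K => (af f'^⋆ (af f' p.1), af g'^⋆ (af g' p.2))) p in
     h q.1 q.2) <= C * (M ^+ 2) ^+ m.
  move=> ef eg p; exists (Nm p.1 * Nm p.2) => m.
  have -> : iter m (fun p : H * K => (af f'^⋆ (af f' p.1), af g'^⋆ (af g' p.2))) p =
    (iter m (fun x => af f'^⋆ (af f' x)) p.1, iter m (fun x => af g'^⋆ (af g' x)) p.2).
    by elim: m => [|m /= ->] //; case: (p).
  rewrite /= ht_Nm; apply: (le_trans (ler_pM (Nm_ge0 _) (Nm_ge0 _) (Nm_iter _ _ _) (Nm_iter _ _ _))).
  rewrite mulrACA -exprMn -exprMn ef eg ler_wpM2l ?mulr_ge0 ?Nm_ge0 //.
  have h0 : 0 <= Nm f * Nm g by rewrite mulr_ge0 ?Nm_ge0.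
  by apply: lerXn2r; rewrite ?nnegrE ?exprn_ge0 ?(ltW M0) // lerXn2r ?nnegrE ?(ltW M0).
have [F [FM Ff Fg]] := @act_op R (H * K)%type L (fun p => h p.1 p.2) ht_total
  (fun p => (af f p.1, af g p.2)) (fun p => (ag f p.1, ag g p.2)) M M0
  (fun p q => ltac:(by rewrite /= !ht_inner !Bop_adj'))
  (gr f g erefl erefl) (gr f^⋆ g^⋆ (sstar_Nm _) (sstar_Nm _)).
by exists F; split=> // x y; [exact: (Ff (x, y))|exact: (Fg (x, y))].
Qed.

Lemma otens_ex (f : Bop H) (g : Bop K) : exists F : Bop L,
  (forall x y, af F (h x y) = h (af f x) (af g y)) /\
  (forall x y, ag F (h x y) = h (ag f x) (ag g y)).
Proof.
have [||F [_ F1 F2]] := @otens_exM f g (Nm f * Nm g + 1); last by exists F.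
  by rewrite ltr_pwDr ?mulr_ge0 ?Nm_ge0.
by rewrite lerDl.
Qed.
Definition otens f g : Bop L := projT1 (cid (otens_ex f g)).
Lemma otensE f g x y : af (otens f g) (h x y) = h (af f x) (af g y).
Proof. by rewrite /otens; case: cid => F []. Qed.
Lemma otens_uniq (F : Bop L) f g : (forall x y, af F (h x y) = h (af f x) (af g y)) -> F = otens f g.
Proof. by move=> e; apply: (Bop_total ht_total) => -[x y]; rewrite otensE e. Qed.
Lemma otens_star f g : (otens f g)^⋆ = otens f^⋆ g^⋆.
Proof.
apply: otens_uniq => x y; rewrite -[LHS]/(ag (otens f g) (h x y)).
by rewrite /otens; case: cid => F [].
Qed.
Lemma otensM f g f' g' : otens f g ⋅ otens f' g' = otens (f ⋅ f') (g ⋅ g').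
Proof. by apply: otens_uniq => x y; rewrite af_comp !otensE. Qed.
Lemma otens1 : otens (aone (hpairing H)) (aone (hpairing K)) = aone (hpairing L).
Proof. by apply/esym/otens_uniq. Qed.
Lemma Nm_otens f g : Nm (otens f g) <= Nm f * Nm g.
Proof.
apply: Nm_eps => e e0; have M0 : 0 < Nm f * Nm g + e by rewrite ltr_pwDr ?mulr_ge0 ?Nm_ge0.
have [|F [FM FE _]] := otens_exM M0 (_ : Nm f * Nm g <= _); first by rewrite lerDl ltW.
by rewrite -(otens_uniq FE).
Qed.
Lemma otens_linl g : linear (otens^~ g).
Proof.
move=> z f f'; apply/esym/otens_uniq => x y.
by rewrite af_add af_scale !otensE af_add af_scale (htl (af g y)).
Qed.
Lemma otens_linr f : linear (otens f).
Proof.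
move=> z g g'; apply/esym/otens_uniq => x y.
by rewrite af_add af_scale !otensE af_add af_scale (htr (af f x)).
Qed.
Lemma otens_blinl g : blin (otens^~ g).
Proof. by split; [exact: otens_linl|exists (Nm g) => f; rewrite mulrC; exact: Nm_otens]. Qed.
Lemma otens_blinr f : blin (otens f).
Proof. by split; [exact: otens_linr|exists (Nm f) => g; exact: Nm_otens]. Qed.

Lemma ctr_ex (y : K) : exists F : L -> H, [/\ blin F, forall x v, ⟨x, F v⟩ = ⟨h x y, v⟩,
  forall v, Nm (F v) <= Nm y * Nm v & forall x y', F (h x y') = ⟨y, y'⟩ *: x].
Proof.
have bd s : Nm (comb (fun p : H * K => ⟨y, p.2⟩ *: p.1) s) <= Nm y * Nm (comb (fun p => h p.1 p.2) s).
  set v := comb _ s; set w := comb _ s.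
  have e x : ⟨x, v⟩ = ⟨h x y, w⟩.
    rewrite /v /w /comb !inner_sumr; apply: eq_bigr => p _.
    by rewrite !innerZr ht_inner; ring.
  have [->|v0] := eqVneq v 0; first by rewrite Nm0 mulr_ge0 ?Nm_ge0.
  rewrite -(ler_pM2l (Nm_gt0 v0)); have := CauchySchwarz (h v y) w.
  by rewrite -e inner_Nm Nm_real ger0_norm ?exprn_ge0 ?Nm_ge0 // expr2 ht_Nm mulrA.
have [F [Fl Fb FE]] := lift_ex ht_total bd.
have bF : blin F by split=> //; exists (Nm y).
exists F; split=> // [x|x y']; last exact: (FE (x, y')).
apply: (total_eq (f := fun v => ⟨x, F v⟩ : R[i]^o) (g := fun v => ⟨h x y, v⟩ : R[i]^o) ht_total).
- exact: (blin_comp (inner_blin x) bF).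
- exact: inner_blin.
- by move=> p; rewrite FE innerZr ht_inner mulrC.
Qed.
(** The adjoint of [x ↦ h x y], that is, contraction of the second leg against [y]. *)
Definition ctr y : L -> H := projT1 (cid (ctr_ex y)).
Lemma ctr_blin y : blin (ctr y). Proof. by rewrite /ctr; case: cid => F []. Qed.
Lemma ctrE y x v : ⟨x, ctr y v⟩ = ⟨h x y, v⟩. Proof. by rewrite /ctr; case: cid => F []. Qed.
Lemma Nm_ctr y v : Nm (ctr y v) <= Nm y * Nm v. Proof. by rewrite /ctr; case: cid => F []. Qed.
Lemma ctr_h y x y' : ctr y (h x y') = ⟨y, y'⟩ *: x. Proof. by rewrite /ctr; case: cid => F []. Qed.

Lemma ht_op_tensor (f : Bop H) (g : Bop K) : op_tensor h (af f) (af g) = af (otens f g).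
Proof.
rewrite /op_tensor; case: xgetP => [F _ [/bounded_linearE bF FE]|/(_ (af (otens f g)))]; last first.
  by case; split; [apply/bounded_linearE; exact: af_blin|exact: otensE].
apply/funext; apply: (total_eq ht_total) => //; first exact: af_blin.
by move=> p; rewrite FE otensE.
Qed.
Lemma hadj_op (U : Bop H) : hadj (af U) = af U^⋆.
Proof.
rewrite /hadj; case: xgetP => [V _ VE|/(_ (af U^⋆))]; last by case=> x y; exact: Bop_adj'.
apply/funext => x; apply: inner_ext => z; rewrite innerC VE -innerC.
exact: Bop_adj.
Qed.

End HilbertTensor.

Section Associativity.
Variables (R : realType) (K H K2 L K3 : hilbertType R).
Variables (h2 : K -> H -> K2) (h : H -> H -> L) (h3 : K -> L -> K3).
Hypotheses (hh2 : hilbert_tensor h2) (hh : hilbert_tensor h) (hh3 : hilbert_tensor h3).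

(** Realizes the second bracketing on the same space [K3], so that operators adapted to
    [(K (x) H) (x) H] and to [K (x) (H (x) H)] can be multiplied without an identification. *)
Lemma ht_assoc : exists hr : K2 -> H -> K3,
  hilbert_tensor hr /\ forall x y z, hr (h2 x y) z = h3 x (h y z).
Proof.
have [L' [h' hh']] := hilbert_tensor_ex K2 H.
have idt (V : hilbertType R) : total (@id V).
  by apply/totalE/seteqP; split=> // v _; apply: sub_cspan; exists v.
have [U [Ul Ui Uh]] := isom_ex (F := fun p : K * H * H => h3 p.1.1 (h p.1.2 p.2))
  (ht_total2 hh' (ht_total hh2) (idt H))
  (fun p q => ltac:(by rewrite !(ht_inner hh3) !(ht_inner hh) !(ht_inner hh') !(ht_inner hh2) mulrA)).
exists (fun v z => U (h' v z)); split; last by move=> x y z; rewrite -(Uh (x, y, z)).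
split.
- by move=> v a z z'; rewrite (htr hh') Ul.
- by move=> z a v v'; rewrite (htl hh') Ul.
- by move=> *; rewrite Ui (ht_inner hh').
apply/seteqP; split=> // v _.
apply: (total_ind (ht_total2 hh3 (idt K) (ht_total hh)) (cspan_csub _)) => -[x [y z]].
apply: sub_cspan; exists (h2 x y) => //; exists z => //.
exact: (Uh (x, y, z)).
Qed.

End Associativity.

Section Flip.
Variables (R : realType) (K H K2 K3 : hilbertType R).
Variables (h2 : K -> H -> K2) (h3 : K2 -> H -> K3).
Hypotheses (hh2 : hilbert_tensor h2) (hh3 : hilbert_tensor h3).

Lemma triple_total : total (fun p : K * H * H => h3 (h2 p.1.1 p.1.2) p.2).
Proof.
have idt : total (@id H).
  by apply/totalE/seteqP; split=> // v _; apply: sub_cspan; exists v.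
exact: (ht_total2 hh3 (ht_total hh2) idt).
Qed.

(** Conjugation by [F] moves an operator on the first two legs to the first and third; this is how
    leg numbers such as 13 are expressed. *)
Lemma flip_ex : exists F : Bop K3, [/\ F^⋆ = F, F ⋅ F = aone (hpairing K3)
  & forall x y z, af F (h3 (h2 x y) z) = h3 (h2 x z) y].
Proof.
pose fl (p : K * H * H) := (p.1.1, p.2, p.1.2).
have gr (p : K * H * H) : exists C : R, forall m, Nm (let q := iter m (fl \o fl) p in h3 (h2 q.1.1 q.1.2) q.2)
    <= C * ((1 : R) ^+ 2) ^+ m.
  exists (Nm (h3 (h2 p.1.1 p.1.2) p.2)) => m; rewrite !expr1n mulr1.
  suff -> : iter m (fl \o fl) p = p by [].
  by elim: m => //= m ->; case: (p) => -[].
have [F [_ F1 F2]] := act_op triple_total (f := fl) (g := fl) ltr01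
  (fun p q => ltac:(by rewrite !(ht_inner hh3) !(ht_inner hh2) /=; ring)) gr gr.
exists F; split.
- by apply: (Bop_total triple_total) => p; rewrite [LHS]F2 F1.
- by apply: (Bop_total triple_total) => p; rewrite af_comp F1 (F1 (fl p)); case: p => -[].
- by move=> x y z; exact: (F1 (x, y, z)).
Qed.

End Flip.

(** * Minimal tensor products *)

Lemma rep_hom (R : realType) (A : cstarAlgType R) (H : hilbertType R) (p : A -> H -> H) : rep p ->
  exists f : A -> Bop H, star_hom f /\ forall a, af (f a) = p a.
Proof.
move=> [pb pl pm ps].
have pa a x y : ⟨p a x, y⟩ = ⟨x, p a^⋆ y⟩ by rewrite -{1}[a]sstarK ps.
have bd a : exists M : R, forall x, Nm (p a x) <= M * Nm x.
  by have /bounded_linearE[] := pb a.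
exists (fun a => @Aop _ _ (hpairing H) (p a) (p a^⋆) (pa a) (bd a)); split=> //; split.
- by move=> z a b; apply: aop_ext => x; rewrite af_add af_scale /= (pl x).
- by move=> a b; apply: aop_ext => x /=; rewrite pm.
- by move=> a; apply: aop_ext => x /=.
Qed.

Lemma hom_rep (R : realType) (A : cstarAlgType R) (H : hilbertType R) (f : A -> Bop H) :
  star_hom f -> rep (fun a => af (f a)).
Proof.
move=> hf; split=> [a|x z a b|a b x|a x y].
- by apply/bounded_linearE; exact: af_blin.
- by rewrite (sh_lin hf) af_add af_scale.
- by rewrite (shM hf).
- by rewrite (shS hf) Bop_adj'.
Qed.

Lemma faithful_hom (R : realType) (A : cstarAlgType R) (H : hilbertType R) (p : A -> H -> H) :
  faithful_rep p -> exists f : A -> Bop H, [/\ star_hom f, injective f & forall a, af (f a) = p a].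
Proof.
move=> [rp pi]; have [f [hf fE]] := rep_hom rp; exists f; split=> // a b e.
by apply: pi; rewrite -!fE e.
Qed.

Lemma hom_faithful (R : realType) (A : cstarAlgType R) (H : hilbertType R) (f : A -> Bop H) :
  star_hom f -> injective f -> faithful_rep (fun a => af (f a)).
Proof. by move=> hf fi; split; [exact: hom_rep|move=> a b e; apply: fi; apply: aop_ext => x; rewrite e]. Qed.

Lemma aop_lub_total (R : realType) (X : Type) (H : hilbertType R) (j : X -> H) (F : Bop H) (K : R) :
  total j -> 0 <= K -> (forall s, Nm (af F (comb j s)) <= K * Nm (comb j s)) -> Nm F <= K.
Proof.
move=> tj K0 h; apply: aop_lub => // v; apply: Nm_eps => e e0.
have D0 : 0 < Nm F + K + 1 by have := Nm_ge0 F; lra.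
have [s hs] := tj v (e / (Nm F + K + 1)) (divr_gt0 e0 D0).
rewrite ler_pdivlMr // in hs.
have h1 := NmD (af F (v - comb j s)) (af F (comb j s)).
rewrite -(linD (af_lin F)) subrK in h1.
have h2 := aop_le F (v - comb j s); have h3 := h s.
have := NmD (comb j s - v) v; rewrite subrK NmC => h4.
have := ler_wpM2l K0 h4; have := Nm_ge0 (v - comb j s); lra.
Qed.

Lemma af_sum (R : realType) (H : hilbertType R) (I : Type) (r : seq I) (F : I -> Bop H) x :
  af (\sum_(i <- r) F i) x = \sum_(i <- r) af (F i) x.
Proof. by elim: r => [|i r ih]; rewrite ?big_nil ?af_zero // !big_cons af_add ih. Qed.

Lemma af_comb (R : realType) (H : hilbertType R) (X : Type) (r : seq (R[i] * X)) (F : X -> Bop H) x :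
  af (comb F r) x = comb (fun i => af (F i) x) r.
Proof. by rewrite /comb af_sum; apply: eq_bigr => p _; rewrite af_scale. Qed.

(** * Independence of the minimal norm from the representations *)

Section SpatialNorm.
Variables (R : realType) (B A : cstarAlgType R).
Implicit Types z y : seq (B * A).

Definition zop (H K L : hilbertType R) (h : H -> K -> L) (hh : hilbert_tensor h)
  (f : B -> Bop H) (g : A -> Bop K) z : Bop L := \sum_(p <- z) otens hh (f p.1) (g p.2).
Definition zmul z y := [seq (p.1 ⋅ q.1, p.2 ⋅ q.2) | p <- z, q <- y].
Definition zstar z := [seq (p.1^⋆, p.2^⋆) | p <- z].

Lemma zopM (H K L : hilbertType R) (h : H -> K -> L) (hh : hilbert_tensor h)
  (f : B -> Bop H) (g : A -> Bop K) z y : star_hom f -> star_hom g ->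
  zop hh f g (zmul z y) = zop hh f g z ⋅ zop hh f g y.
Proof.
move=> hf hg; rewrite /zop /zmul big_allpairs_dep /=.
rewrite (lin_sum _ _ (smul_linearl _)); apply: eq_bigr => p _.
rewrite (lin_sum _ _ (smul_linearr _)); apply: eq_bigr => q _.
by rewrite otensM (shM hf) (shM hg).
Qed.

Lemma sstar_sum (I : Type) (V : starAlgType R) (s : seq I) (F : I -> V) :
  (\sum_(i <- s) F i)^⋆ = \sum_(i <- s) (F i)^⋆.
Proof. by elim: s => [|i s ih]; rewrite ?big_nil ?sstar0 // !big_cons sstarD ih. Qed.

Lemma zopS (H K L : hilbertType R) (h : H -> K -> L) (hh : hilbert_tensor h)
  (f : B -> Bop H) (g : A -> Bop K) z : star_hom f -> star_hom g ->
  zop hh f g (zstar z) = (zop hh f g z)^⋆.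
Proof.
move=> hf hg; rewrite /zop sstar_sum big_map; apply: eq_bigr => p _.
by rewrite otens_star (shS hf) (shS hg).
Qed.

Lemma zop_flip (H K L : hilbertType R) (h : H -> K -> L) (hh : hilbert_tensor h)
  (f : B -> Bop H) (g : A -> Bop K) z :
  zop hh f g z = \sum_(p <- z) otens (ht_flip hh) (g p.2) (f p.1).
Proof. by apply: eq_bigr => p _; apply/esym/otens_uniq => x y; rewrite otensE. Qed.

Section Leg.
Variables (H H' K L L' : hilbertType R) (h : H -> K -> L) (h' : H' -> K -> L').
Hypotheses (hh : hilbert_tensor h) (hh' : hilbert_tensor h').
Variables (f : B -> Bop H) (f' : B -> Bop H') (g : A -> Bop K).
Hypotheses (hf : star_hom f) (fi : injective f) (hf' : star_hom f') (hg : star_hom g).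

(** The [B]-valued inner product of [z e] with itself. No representation of [B] enters it, so norm
    estimates can pass from [f] to [f']. *)
Let zbeta z (e : K) : B := \sum_(p <- z) \sum_(q <- z)
  ⟨af (g p.2) e, af (g q.2) e⟩ *: (p.1^⋆ ⋅ q.1).

Let zbetaE (H1 L1 : hilbertType R) (h1 : H1 -> K -> L1) (hh1 : hilbert_tensor h1) (f1 : B -> Bop H1) z (e : K) (x y : H1) :
  star_hom f1 ->
  ⟨y, af (f1 (zbeta z e)) x⟩ = ⟨af (zop hh1 f1 g z) (h1 y e), af (zop hh1 f1 g z) (h1 x e)⟩.
Proof.
move=> hf1; have zE v : af (zop hh1 f1 g z) (h1 v e) = \sum_(p <- z) h1 (af (f1 p.1) v) (af (g p.2) e).
  rewrite /zop af_sum.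
  by apply: eq_bigr => p _; rewrite otensE.
rewrite !zE inner_suml /zbeta (lin_sum _ _ (sh_lin hf1)).
rewrite af_sum inner_sumr.
apply: eq_bigr => p _; rewrite (lin_sum _ _ (sh_lin hf1)).
rewrite af_sum !inner_sumr.
apply: eq_bigr => q _; rewrite (shZ hf1) af_scale innerZr (ht_inner hh1).
by rewrite mulrC (shM hf1) (shS hf1) af_comp -Bop_adj.
Qed.

(** [f] is isometric, so the estimate of [f (zbeta z e)] in terms of [zop hh f g z] bounds
    [zbeta z e] itself, and [f'] is contractive. *)
Lemma zop_elementary z x e :
  Nm (af (zop hh' f' g z) (h' x e)) <= Nm (zop hh f g z) * (Nm x * Nm e).
Proof.
set N := Nm (zop hh f g z); have N0 : 0 <= N * Nm e by rewrite mulr_ge0 ?Nm_ge0.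
have nb : Nm (zbeta z e) <= (N * Nm e) ^+ 2.
  rewrite -(rep_iso hf fi); apply: aop_lub; first by rewrite exprn_ge0.
  move=> v; set w := af _ v; have [->|w0] := eqVneq w 0.
    by rewrite Nm0 mulr_ge0 ?exprn_ge0 ?Nm_ge0.
  rewrite -(ler_pM2l (Nm_gt0 w0)).
  have : Nm (⟨w, w⟩ : R[i]) <= N * (Nm w * Nm e) * (N * (Nm v * Nm e)).
    rewrite {2}/w (zbetaE hh) //; apply: (le_trans (CauchySchwarz _ _)).
    by rewrite ler_pM ?Nm_ge0 // -(ht_Nm hh) aop_le.
  rewrite inner_Nm Nm_real ger0_norm ?exprn_ge0 ?Nm_ge0 // expr2.
  by move=> h1; apply: (le_trans h1); rewrite le_eqVlt; apply/orP; left; apply/eqP; ring.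
rewrite -(@ler_pXn2r _ 2) ?nnegrE ?mulr_ge0 ?Nm_ge0 //.
have -> : Nm (af (zop hh' f' g z) (h' x e)) ^+ 2 = Nm (⟨x, af (f' (zbeta z e)) x⟩ : R[i]).
  by rewrite (zbetaE hh') // inner_Nm Nm_real ger0_norm ?exprn_ge0 ?Nm_ge0.
apply: (le_trans (CauchySchwarz _ _)).
have h1 := le_trans (aop_le (f' (zbeta z e)) x) (ler_wpM2r (Nm_ge0 x) (le_trans (sh_contr hf' _) nb)).
apply: (le_trans (ler_wpM2l (Nm_ge0 x) h1)); rewrite le_eqVlt; apply/orP; left; apply/eqP; ring.
Qed.

(** For a fixed finite sum [v], the estimate on elementary vectors gives a constant [C] valid for
    all [z]. Applied to the powers of [z^⋆ z] and combined with [power_bound], it yields the bound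
    without the constant. *)
Lemma zop_leg z : Nm (zop hh' f' g z) <= Nm (zop hh f g z).
Proof.
apply: Nm_eps => e e0; set M := Nm (zop hh f g z) + e.
have M0 : 0 < M by rewrite ltr_pwDr ?Nm_ge0.
apply: (aop_lub_total (ht_total hh')); first exact: ltW.
move=> s; set v := comb _ s.
pose y := zmul (zstar z) z.
have yE' : zop hh' f' g y = (zop hh' f' g z)^⋆ ⋅ zop hh' f' g z by rewrite zopM // zopS.
have yE : Nm (zop hh f g y) <= M ^+ 2.
  rewrite zopM // zopS // cstar_Nm; apply: lerXn2r; rewrite ?nnegrE ?Nm_ge0 ?(ltW M0) //.
  by rewrite lerDl ltW.
have [C C0 hC] : exists2 C : R, 0 <= C & forall w, Nm (af (zop hh' f' g w) v) <= C * Nm (zop hh f g w).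
  rewrite /v; elim: (s) => [|p t [C C0 hC]].
    by exists 0 => // w; rewrite /comb big_nil af0 Nm0 mul0r.
  exists (Nm p.1 * (Nm p.2.1 * Nm p.2.2) + C); first by rewrite addr_ge0 ?mulr_ge0 ?Nm_ge0.
  move=> w; rewrite /comb big_cons afD afZ mulrDl.
  apply: (le_trans (NmD _ _)); rewrite lerD ?hC // NmZ -mulrA ler_wpM2l ?Nm_ge0 // mulrC.
  exact: zop_elementary.
pose u m := iter m (af (zop hh' f' g y)) v.
have uS m : u m.+1 = af (zop hh' f' g (iter m (zmul y) y)) v.
  elim: m => [|m ih] //; rewrite /u iterS -/(u m.+1) ih iterS zopM //.
have uN m : Nm (zop hh f g (iter m (zmul y) y)) <= (M ^+ 2) ^+ m.+1.
  elim: m => [|m ih]; first by rewrite expr1.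
  rewrite iterS zopM // exprS; apply: (le_trans (smul_Nm _ _)).
  by rewrite ler_pM ?Nm_ge0.
have uC m : Nm (u m) <= (C + Nm v) * (M ^+ 2) ^+ m.
  case: m => [|m]; first by rewrite /u /= expr0 mulr1; lra.
  rewrite uS; apply: (le_trans (hC _)); rewrite ler_pM ?Nm_ge0 //.
  by have := Nm_ge0 v; lra.
have h1 : Nm (u 1%N) <= M ^+ 2 * Nm (u 0%N).
  apply: power_bound uC; first by rewrite exprn_gt0.
  by move=> m n; rewrite /u /= yE' !af_comp !Bop_adj' Bop_adj.
rewrite -(@ler_pXn2r _ 2) ?nnegrE ?mulr_ge0 ?Nm_ge0 ?(ltW M0) // exprMn.
have -> : Nm (af (zop hh' f' g z) v) ^+ 2 = Nm (⟨v, u 1%N⟩ : R[i]).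
  by rewrite /u /= yE' af_comp -Bop_adj inner_Nm Nm_real ger0_norm ?exprn_ge0 ?Nm_ge0.
apply: (le_trans (CauchySchwarz _ _)).
have -> : M ^+ 2 * Nm v ^+ 2 = Nm v * (M ^+ 2 * Nm v) by ring.
by rewrite ler_wpM2l ?Nm_ge0.
Qed.

End Leg.

End SpatialNorm.

Lemma zop_swap (R : realType) (B A : cstarAlgType R) (H K L : hilbertType R) (h : H -> K -> L)
  (hh : hilbert_tensor h) (f : B -> Bop H) (g : A -> Bop K) z :
  zop hh f g z = zop (ht_flip hh) g f [seq (p.2, p.1) | p <- z].
Proof. by rewrite zop_flip /zop big_map. Qed.

(** One leg is exchanged at a time, the second through the flip. For two pairs of faithful
    representations this gives equality of norms. *)
Theorem zop_le (R : realType) (B A : cstarAlgType R) (H K L H' K' L' : hilbertType R)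
  (h : H -> K -> L) (h' : H' -> K' -> L') (hh : hilbert_tensor h) (hh' : hilbert_tensor h')
  (f : B -> Bop H) (g : A -> Bop K) (f' : B -> Bop H') (g' : A -> Bop K') z :
  star_hom f -> injective f -> star_hom g -> injective g -> star_hom f' -> star_hom g' ->
  Nm (zop hh' f' g' z) <= Nm (zop hh f g z).
Proof.
move=> hf fi hg gi hf' hg'; have [L1 [h1 hh1]] := hilbert_tensor_ex H K'.
apply: (le_trans (zop_leg hh1 hh' hf fi hf' hg' z)); 
rewrite (zop_swap hh1) (zop_swap hh).
exact: (zop_leg (ht_flip hh) (ht_flip hh1) hg gi hg' hf).
Qed.

Section MinTensor.
Variables (R : realType) (B A T : cstarAlgType R) (t : B -> A -> T).
Hypothesis mt : min_tensor t.

Lemma min_tensorE : exists (H K L : hilbertType R) (h : H -> K -> L) (hh : hilbert_tensor h)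
    (f : B -> Bop H) (g : A -> Bop K) (s : T -> Bop L),
  [/\ star_hom f /\ injective f, star_hom g /\ injective g, star_hom s /\ injective s &
    forall b a, s (t b a) = otens hh (f b) (g a)].
Proof.
move: mt => [H [K [L [h [p [q [s [hh fp fq fs [st _]]]]]]]]].
have [f [hf fi fE]] := faithful_hom fp; have [g [hg gi gE]] := faithful_hom fq.
have [S [hS Si SE]] := faithful_hom fs.
exists H, K, L, h, hh, f, g, S; split=> // b a; apply: otens_uniq => x y.
by rewrite SE fE gE.
Qed.

Lemma mt_cspan : cspan [set t b a | b in setT & a in setT] = setT.
Proof. by move: mt => [H [K [L [h [p [q [s [_ _ _ _ [_ ->]]]]]]]]]. Qed.

Lemma mt_total : total (fun p : B * A => t p.1 p.2).
Proof.
apply/totalE; rewrite -mt_cspan; congr cspan; apply/seteqP.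
by split=> [_ [[x y] _ <-]|_ [x _ [y _ <-]]]; [exists x => //; exists y|exists (x, y)].
Qed.

Lemma mt_repl : represented B.
Proof. by have [H [K [L [h [hh [f [g [s [[? ?] _ _ _]]]]]]]]] := min_tensorE; exists H, f. Qed.
Lemma mt_repr : represented A.
Proof. by have [H [K [L [h [hh [f [g [s [_ [? ?] _ _]]]]]]]]] := min_tensorE; exists K, g. Qed.
Lemma mt_rep : represented T.
Proof. by have [H [K [L [h [hh [f [g [s [_ _ [? ?] _]]]]]]]]] := min_tensorE; exists L, s. Qed.

Lemma mt_mul b a b' a' : t b a ⋅ t b' a' = t (b ⋅ b') (a ⋅ a').
Proof.
have [H [K [L [h [hh [f [g [s [[hf _] [hg _] [hs si] st]]]]]]]]] := min_tensorE.
by apply: si; rewrite (shM hs) !st otensM (shM hf) (shM hg).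
Qed.
Lemma mt_star b a : (t b a)^⋆ = t b^⋆ a^⋆.
Proof.
have [H [K [L [h [hh [f [g [s [[hf _] [hg _] [hs si] st]]]]]]]]] := min_tensorE.
by apply: si; rewrite (shS hs) !st otens_star (shS hf) (shS hg).
Qed.
Lemma mt_linl a : linear (t^~ a).
Proof.
have [H [K [L [h [hh [f [g [s [[hf _] [hg _] [hs si] st]]]]]]]]] := min_tensorE.
by move=> z b b'; apply: si; rewrite (sh_lin hs) !st (sh_lin hf) (otens_linl hh (g a)).
Qed.
Lemma mt_linr b : linear (t b).
Proof.
have [H [K [L [h [hh [f [g [s [[hf _] [hg _] [hs si] st]]]]]]]]] := min_tensorE.
by move=> z a a'; apply: si; rewrite (sh_lin hs) !st (sh_lin hg) (otens_linr hh (f b)).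
Qed.
Lemma mt_Nm b a : Nm (t b a) <= Nm b * Nm a.
Proof.
have [H [K [L [h [hh [f [g [s [[hf fi] [hg gi] [hs si] st]]]]]]]]] := min_tensorE.
by rewrite -(rep_iso hs si) -(rep_iso hf fi) -(rep_iso hg gi) st Nm_otens.
Qed.
Lemma mt_blinl a : blin (t^~ a).
Proof. by split; [exact: mt_linl|exists (Nm a) => b; rewrite mulrC; exact: mt_Nm]. Qed.
Lemma mt_blinr b : blin (t b).
Proof. by split; [exact: mt_linr|exists (Nm b) => a; exact: mt_Nm]. Qed.

Lemma mt_comb (V : lmodType R[i]) (k : B -> A -> V) (s : seq (R[i] * (B * A))) :
  (forall a, linear (k^~ a)) ->
  comb (fun p => k p.1 p.2) s = \sum_(p <- [seq (p.1 *: p.2.1, p.2.2) | p <- s]) k p.1 p.2.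
Proof. by move=> kl; rewrite big_map; apply: eq_bigr => p _ /=; rewrite (linZ (kl _)). Qed.

Section Spatial.
Variables (H K L : hilbertType R) (h : H -> K -> L) (hh : hilbert_tensor h).
Variables (f : B -> Bop H) (g : A -> Bop K).
Hypotheses (hf : star_hom f) (hg : star_hom g).

Lemma otens_hom_lin a : linear (fun b => otens hh (f b) (g a)).
Proof. by move=> z b b'; rewrite (sh_lin hf) (otens_linl hh). Qed.

Lemma spatial_ex : exists S : T -> Bop L, star_hom S /\ forall b a, S (t b a) = otens hh (f b) (g a).
Proof.
have [H0 [K0 [L0 [h0 [hh0 [f0 [g0 [s [[hf0 f0i] [hg0 g0i] [hs si] st]]]]]]]]] := min_tensorE.
have bd r : Nm (comb (fun p => otens hh (f p.1) (g p.2)) r) <= 1 * Nm (comb (fun p => t p.1 p.2) r).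
  rewrite mul1r -(rep_iso hs si) (comb_lin _ _ (sh_lin hs)).
  have -> : s \o (fun p => t p.1 p.2) = fun p => otens hh0 (f0 p.1) (g0 p.2).
    by apply/funext => p /=; rewrite st.
  rewrite (mt_comb (k := fun b a => otens hh (f b) (g a)) _ otens_hom_lin).
  rewrite (mt_comb (k := fun b a => otens hh0 (f0 b) (g0 a))); last first.
    by move=> a z b b'; rewrite (sh_lin hf0) (otens_linl hh0).
  exact: (zop_le hh0 hh).
have [S [Sl Sb SE]] := lift_ex mt_total bd.
have bS : blin S by split=> //; exists 1.
have SE' b a : S (t b a) = otens hh (f b) (g a) by exact: (SE (b, a)).
exists S; split=> //; split=> //.
- move=> x y; move: x; apply: (blin_ext (X := [set t b a | b in setT & a in setT])) mt_cspan _.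
  + exact: (blin_comp bS (blin_smulr y)).
  + exact: (blin_comp (blin_smulr (S y)) bS).
  move=> _ [b _ [a _ <-]]; move: y.
  apply: (blin_ext (X := [set t b a | b in setT & a in setT])) mt_cspan _.
  + exact: (blin_comp bS (blin_smull _)).
  + exact: (blin_comp (blin_smull _) bS).
  by move=> _ [b' _ [a' _ <-]]; rewrite mt_mul !SE' otensM (shM hf) (shM hg).
- suff h1 x : (S x^⋆)^⋆ = S x by move=> x; rewrite -[LHS]sstarK h1.
  have bS' : blin (fun x => (S x^⋆)^⋆).
    split; first by move=> z u v; rewrite sstar_antilinear Sl sstar_antilinear cjK.
    by exists 1 => u; rewrite sstar_Nm -(sstar_Nm u).
  move: x; apply: (blin_ext (X := [set t b a | b in setT & a in setT])) bS' bS mt_cspan _.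
  move=> _ [b _ [a _ <-]]; rewrite mt_star !SE' otens_star (shS hf) (shS hg) !sstarK //.
Qed.

Lemma spatial_iso (S : T -> Bop L) : injective f -> injective g -> star_hom S ->
  (forall b a, S (t b a) = otens hh (f b) (g a)) -> injective S.
Proof.
move=> fi gi hS SE.
have [H0 [K0 [L0 [h0 [hh0 [f0 [g0 [s [[hf0 f0i] [hg0 g0i] [hs si] st]]]]]]]]] := min_tensorE.
have bd r : Nm (comb (fun p => t p.1 p.2) r) <= 1 * Nm (comb (fun p => otens hh (f p.1) (g p.2)) r).
  rewrite mul1r -(rep_iso hs si) (comb_lin _ _ (sh_lin hs)).
  have -> : s \o (fun p => t p.1 p.2) = fun p => otens hh0 (f0 p.1) (g0 p.2).
    by apply/funext => p /=; rewrite st.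
  rewrite (mt_comb (k := fun b a => otens hh (f b) (g a)) _ otens_hom_lin).
  rewrite (mt_comb (k := fun b a => otens hh0 (f0 b) (g0 a))); last first.
    by move=> a z b b'; rewrite (sh_lin hf0) (otens_linl hh0).
  exact: (zop_le hh hh0).
have Sc x : Nm x <= Nm (S x).
  apply: Nm_eps => e e0; have e2 : 0 < e / 2 by rewrite divr_gt0.
  have [r hr] := mt_total x e2.
  have h1 := NmD (x - comb (fun p => t p.1 p.2) r) (comb (fun p => t p.1 p.2) r).
  rewrite subrK in h1; have h2 := bd r; rewrite mul1r in h2.
  have h3 : Nm (comb (fun p => otens hh (f p.1) (g p.2)) r) <= Nm (S x) + e / 2.
    have -> : comb (fun p => otens hh (f p.1) (g p.2)) r = S (comb (fun p => t p.1 p.2) r).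
      by rewrite (comb_lin _ _ (sh_lin hS)); congr comb; apply/funext => p /=; rewrite SE.
    set y := comb _ r in hr *; have := NmD (S x) (S (y - x)); rewrite -(shD hS) addrC subrK.
    by have := sh_contr hS (y - x); rewrite (NmC y x); lra.
  lra.
move=> x y e; apply/subr0_eq/Nm_eq0/eqP; rewrite eq_le Nm_ge0 andbT.
by rewrite (le_trans (Sc _)) // (shB hS) e subrr Nm0.
Qed.

End Spatial.

Section Slices.
Variables (w : A -> R[i]).
Hypothesis bw : bounded_functional w.

(** In a faithful representation, [⟨x, f0 Y y⟩] is [w] evaluated at the slice of [X] in the other
    leg by [x] and [y], and the norm of that slice is at most [Nm x * Nm y * Nm X]. *)
Lemma slice_ex (M : R) : 0 <= M -> (forall a, Nm (w a) <= M * Nm a) -> exists s : T -> B,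
  [/\ linear s, forall x, Nm (s x) <= M * Nm x & forall b a, s (t b a) = w a *: b].
Proof.
move=> M0 wM; have wl : linear (w : A -> R[i]^o) by have /bounded_functionalE[] := bw.
have [H0 [K0 [L0 [h0 [hh0 [f0 [g0 [s [[hf0 f0i] [hg0 g0i] [hs si] st]]]]]]]]] := min_tensorE.
have bd r : Nm (comb (fun p => w p.2 *: p.1) r) <= M * Nm (comb (fun p : B * A => t p.1 p.2) r).
  rewrite -(rep_iso hs si) (comb_lin _ _ (sh_lin hs)).
  set X := comb (s \o _) r; set Y := comb _ r.
  have h1 x y : Nm (⟨x, af (f0 Y) y⟩ : R[i]) <= M * (Nm x * Nm y * Nm X).
    have -> : ⟨x, af (f0 Y) y⟩ = w (comb (fun p : B * A => ⟨x, af (f0 p.1) y⟩ *: p.2) r).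
      rewrite (comb_lin _ _ wl) /Y (comb_lin _ _ (sh_lin hf0)).
      rewrite af_comb.
      rewrite (comb_lin _ _ (inner_blin x).1).
      congr comb; apply/funext => p /=; rewrite (shZ hf0) af_scale innerZr (linZ wl) mulrC //.
    set Z := comb _ r; apply: (le_trans (wM _)).
    rewrite ler_wpM2l // -(rep_iso hg0 g0i); apply: aop_lub; first by rewrite !mulr_ge0 ?Nm_ge0.
    move=> v; have -> : af (g0 Z) v = ctr (ht_flip hh0) x (af X (h0 y v)).
      rewrite /X af_comb.
      rewrite (comb_lin _ _ (ctr_blin (ht_flip hh0) x).1) /Z (comb_lin _ _ (sh_lin hg0)).
      rewrite af_comb.
      congr comb; apply/funext => p /=; rewrite st otensE (ctr_h (ht_flip hh0)) (shZ hg0) af_scale //.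
    apply: (le_trans (Nm_ctr _ _ _)); rewrite -mulrA -mulrA ler_wpM2l ?Nm_ge0 //.
    by have := aop_le X (h0 y v); rewrite (ht_Nm hh0) mulrCA.
  rewrite -(rep_iso hf0 f0i); apply: aop_lub; first by rewrite mulr_ge0 ?Nm_ge0.
  move=> v; set u := af _ v.
  have [->|u0] := eqVneq u 0; first by rewrite Nm0 !mulr_ge0 ?Nm_ge0.
  rewrite -(ler_pM2l (Nm_gt0 u0)); have := h1 u v; rewrite -/u inner_Nm Nm_real ger0_norm ?exprn_ge0 ?Nm_ge0 //.
  by rewrite expr2; have -> : M * (Nm u * Nm v * Nm X) = Nm u * (M * Nm X * Nm v) by ring.
have [S [Sl Sb SE]] := lift_ex mt_total bd.
by exists S; split=> // b a; exact: (SE (b, a)).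
Qed.

End Slices.

Lemma slice_spec (w : A -> R[i]) : bounded_functional w ->
  blin (slice t w) /\ forall b a, slice t w (t b a) = w a *: b.
Proof.
move=> bw; have /bounded_functionalE/blin_bound[M /ltW M0 wM] := bw.
have [s [sl sM sE]] := slice_ex bw M0 wM.
rewrite /slice; case: xgetP => [S _ [/bounded_linearE ? ?] //|/(_ s) []].
by split=> //; apply/bounded_linearE; split=> //; exists M.
Qed.

Lemma slice_blin w : bounded_functional w -> blin (slice t w).
Proof. by case/slice_spec. Qed.
Lemma sliceE w b a : bounded_functional w -> slice t w (t b a) = w a *: b.
Proof. by case/slice_spec. Qed.

Lemma mt_ext (V : normedModType R[i]) (f g : T -> V) : blin f -> blin g ->
  (forall b a, f (t b a) = g (t b a)) -> f =1 g.
Proof. by move=> bf bg e; apply: (total_eq mt_total) => // -[b a]. Qed.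

Lemma slice_uniq w (s : T -> B) : bounded_functional w -> blin s ->
  (forall b a, s (t b a) = w a *: b) -> s =1 slice t w.
Proof.
move=> bw bs sE; apply: mt_ext => //; first exact: slice_blin.
by move=> b a; rewrite sE sliceE.
Qed.

Lemma slice_Nm w (M : R) : bounded_functional w -> 0 <= M -> (forall a, Nm (w a) <= M * Nm a) ->
  forall x, Nm (slice t w x) <= M * Nm x.
Proof.
move=> bw M0 wM x; have [s [sl sM sE]] := slice_ex bw M0 wM.
by rewrite -(slice_uniq bw _ sE) //; split=> //; exists M.
Qed.

End MinTensor.

Section ClosedSpans.
Variable R : realType.

Lemma iso_range (V : completeNormedModType R[i]) (W : normedModType R[i]) (f : V -> W) :
  linear f -> (forall v, Nm (f v) = Nm v) -> csub (range f).
Proof.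
move=> fl fN; split; first split.
- by exists 0 => //; rewrite lin0.
- by move=> z _ _ [x _ <-] [y _ <-]; exists (z *: x + y) => //; rewrite fl.
move=> w h; have /choice[u hu] : forall n, exists v, Nm (w - f v) <= ivn R n.
  by move=> n; have [|_ [v _ <-] hv] := h (ivn R n); [exact: ivn_gt0|exists v].
have [|v hv] := @seq_complete R V u.
  move=> e e0; have e2 : 0 < e / 2 by rewrite divr_gt0.
  have [N hN] := invn_small e2; exists N => m n /hN hm /hN hn; rewrite -fN (linB fl).
  by have := NmT (f (u m)) w (f (u n)); rewrite (NmC _ w); have := hu m; have := hu n; lra.
exists v => //; apply/subr0_eq; apply: Nm_small => e e0.
have e2 : 0 < e / 2 by rewrite divr_gt0.
have [N hN] := invn_small e2; have [N' hN'] := hv _ e2.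
set n := maxn N N'; have h1 := hN n (leq_maxl _ _); have h2 := hN' n (leq_maxr _ _).
have := NmT (f v) (f (u n)) w; rewrite -(linB fl) fN (NmC v (u n)) (NmC (f (u n)) w).
by have := hu n; lra.
Qed.

Lemma cspan_mono (V : normedModType R[i]) (X Y : set V) : X `<=` Y -> cspan X `<=` cspan Y.
Proof.
by move=> XY; apply: cspan_min; [exact: cspan_csub|move=> x /XY; exact: sub_cspan].
Qed.

Lemma cspan_image (V W : normedModType R[i]) (f : V -> W) (X : set V) x :
  blin f -> cspan X x -> cspan (f @` X) (f x).
Proof.
move=> bf; apply: (cspan_min (csub_pre bf (cspan_csub _))) => y Xy.
by apply: sub_cspan; exists y.
Qed.

Lemma cspan_iso (V W : normedModType R[i]) (f : V -> W) (X : set V) x :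
  linear f -> (forall v, Nm (f v) = Nm v) -> cspan (f @` X) (f x) -> cspan X x.
Proof.
move=> fl fN; rewrite !cspanE => h e /h[y hy].
have [v hv <-] : exists2 v, lspan X v & f v = y.
  apply: (lspan_min (P := [set y | exists2 v, lspan X v & f v = y])) hy.
    split; first by exists 0; [exact: lspan0|rewrite lin0].
    by move=> z _ _ [v hv <-] [w hw <-]; exists (z *: v + w); [exact: lspan_lin|rewrite fl].
  by move=> _ [v Xv <-]; exists v => //; exact: sub_lspan.
by rewrite -(linB fl) fN => ?; exists v.
Qed.

Lemma csub_star (B : cstarAlgType R) (P : set B) : csub P -> csub [set x | P x^⋆].
Proof.
move=> [[P0 Pl] Pc]; split; first by split=> [|z x y /= hx hy]; rewrite /= ?sstar0 // sstar_antilinear; exact: Pl.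
move=> x h /=; apply: Pc => e /h[y Py xy]; exists y^⋆ => //.
have -> : x^⋆ - y^⋆ = (x - y)^⋆ by rewrite sstarD -[- y]scaleN1r sstarZ cjN cj1 scaleN1r.
by rewrite sstar_Nm.
Qed.

Lemma sub_cstarE (B : cstarAlgType R) (D : set B) : sub_cstar D <->
  [/\ csub D, forall x y, D x -> D y -> D (x ⋅ y) & forall x, D x -> D x^⋆].
Proof.
split=> [[/closed_clos cD D0 Dl Dm Ds]|[[[D0 Dl] cD] Dm Ds]]; first by split.
by split=> //; exact/closed_clos.
Qed.

Lemma sub_cstar_cspan (B : cstarAlgType R) (X : set B) :
  (forall x y, X x -> X y -> X (x ⋅ y)) -> (forall x, X x -> X x^⋆) -> sub_cstar (cspan X).
Proof.
move=> Xm Xs; apply/sub_cstarE; split; first exact: cspan_csub.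
  move=> x y; apply: (@cspan2 _ _ _ _ (@smul R B) X X).
  - exact: blin_smull.
  - exact: blin_smulr.
  - exact: cspan_csub.
  - by move=> u v Xu Xv; apply: sub_cspan; exact: Xm.
apply: (cspan_min (csub_star (cspan_csub _))) => x Xx /=.
by apply: sub_cspan; exact: Xs.
Qed.

Lemma cstar_generated_sub (B : cstarAlgType R) (X : set B) : sub_cstar (cstar_generated X).
Proof.
apply/sub_cstarE; split.
- split; first split.
  + by move=> D [/sub_cstarE[[[]]]].
  + move=> z x y hx hy D hD; have /sub_cstarE[[[_ Dl] _] _ _] := hD.1.
    by apply: Dl; [exact: hx|exact: hy].
  + move=> x h D hD; have /sub_cstarE[[_ Dc] _ _] := hD.1.
    by apply: Dc => e /h[y hy xy]; exists y => //; exact: hy.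
- move=> x y hx hy D hD; have /sub_cstarE[_ Dm _] := hD.1.
  by apply: Dm; [exact: hx|exact: hy].
- move=> x hx D hD; have /sub_cstarE[_ _ Ds] := hD.1.
  by apply: Ds; exact: hx.
Qed.
Lemma sub_cstar_generated (B : cstarAlgType R) (X : set B) : X `<=` cstar_generated X.
Proof. by move=> x Xx D [_]; exact. Qed.
Lemma cstar_generated_min (B : cstarAlgType R) (X D : set B) : sub_cstar D -> X `<=` D ->
  cstar_generated X `<=` D.
Proof. by move=> hD XD x; apply. Qed.

Lemma hom_factor (X Y Z : starAlgType R) (S : X -> Z) (s : Y -> Z) : star_hom S -> star_hom s ->
  injective s -> (forall x, exists y, s y = S x) ->
  exists k : X -> Y, star_hom k /\ forall x, s (k x) = S x.
Proof.
move=> hS hs si /choice[k kE]; exists k; split=> //; split.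
- by move=> z x y; apply: si; rewrite kE (sh_lin hS) (sh_lin hs) !kE.
- by move=> x y; apply: si; rewrite kE (shM hS) (shM hs) !kE.
- by move=> x; apply: si; rewrite kE (shS hS) (shS hs) kE.
Qed.

End ClosedSpans.

Section TensorHom.
Variable R : realType.

Lemma min_tensor_intro (B A T : cstarAlgType R) (t : B -> A -> T) (H K L : hilbertType R)
  (h : H -> K -> L) (hh : hilbert_tensor h) (f : B -> Bop H) (g : A -> Bop K) (S : T -> Bop L) :
  star_hom f -> injective f -> star_hom g -> injective g -> star_hom S -> injective S ->
  (forall b a, S (t b a) = otens hh (f b) (g a)) ->
  cspan [set t b a | b in setT & a in setT] = setT -> min_tensor t.
Proof.
move=> hf fi hg gi hS Si SE tc.
exists H, K, L, h, (fun b => af (f b)), (fun a => af (g a)), (fun x => af (S x)).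
split; [exact: hh|exact: hom_faithful|exact: hom_faithful|exact: hom_faithful|split=> //].
by move=> b a x y; rewrite SE otensE.
Qed.

Lemma min_tensor_ex (B A : cstarAlgType R) (H K L : hilbertType R)
  (h : H -> K -> L) (hh : hilbert_tensor h) (f : B -> Bop H) (g : A -> Bop K) :
  star_hom f -> injective f -> star_hom g -> injective g ->
  exists (T : cstarAlgType R) (t : B -> A -> T) (S : T -> Bop L),
  [/\ min_tensor t, star_hom S, injective S & forall b a, S (t b a) = otens hh (f b) (g a)].
Proof.
move=> hf fi hg gi; pose X := [set otens hh (f b) (g a) | b in setT & a in setT].
have hX : sub_cstar (cspan X).
  apply: sub_cstar_cspan.
    move=> _ _ [b _ [a _ <-]] [b' _ [a' _ <-]]; rewrite otensM -(shM hf) -(shM hg).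
    by exists (b ⋅ b') => //; exists (a ⋅ a').
  by move=> _ [b _ [a _ <-]]; rewrite otens_star -(shS hf) -(shS hg); exists b^⋆ => //; exists a^⋆.
have tX b a : cspan X (otens hh (f b) (g a)) by apply: sub_cspan; exists b => //; exists a.
pose t b a := Subc hX (tX b a).
have hS : star_hom (@sv R _ _ hX) by exact: sv_hom.
exists (subc hX), t, (@sv R _ _ hX); split=> //; last exact: sv_inj.
apply: (min_tensor_intro (hh := hh) hf fi hg gi hS (@sv_inj _ _ _ _)) => //.
apply/seteqP; split=> // x _; apply: (cspan_iso (sh_lin hS)); first by move=> v; rewrite Nm_sv.
have := svP x; apply: cspan_mono => _ [b _ [a _ <-]].
by exists (t b a) => //; exists b => //; exists a.
Qed.

Lemma tens_hom_ex (B A T B' T' : cstarAlgType R) (t : B -> A -> T) (t' : B' -> A -> T') (f : B -> B') :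
  min_tensor t -> min_tensor t' -> star_hom f ->
  exists k : T -> T', [/\ star_hom k, forall b a, k (t b a) = t' (f b) a & injective f -> injective k].
Proof.
move=> mt mt' hf.
have [H [K [L [h [hh [p [q [s [[hp pi] [hq qi] [hs si] st]]]]]]]]] := min_tensorE mt'.
have [S [hS SE]] := spatial_ex mt hh (sh_comp hp hf) hq.
have SE' b a : S (t b a) = s (t' (f b) a) by rewrite SE st.
have rg x : exists y, s y = S x.
  suff [y _ <-] : range s (S x) by exists y.
  apply: (cspan_all (mt_cspan mt) (csub_pre (sh_blin hS) (iso_range (sh_lin hs) (rep_iso hs si)))).
  by move=> _ [b _ [a _ <-]] /=; exists (t' (f b) a).
have [k [hk kE]] := hom_factor hS hs si rg.
exists k; split=> // [b a|fi]; first by apply: si; rewrite kE SE'.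
have Si : injective S by apply: (spatial_iso mt (sh_comp hp hf) hq _ qi hS SE); exact: inj_comp.
by move=> x y e; apply: Si; rewrite -!kE e.
Qed.

Lemma tens_hom_spec (B A T B' T' : cstarAlgType R) (t : B -> A -> T) (t' : B' -> A -> T') (f : B -> B') :
  min_tensor t -> min_tensor t' -> star_hom f ->
  star_hom (tens_hom t t' f) /\ forall b a, tens_hom t t' f (t b a) = t' (f b) a.
Proof.
move=> mt mt' hf; have [k [hk kE _]] := tens_hom_ex mt mt' hf.
by rewrite /tens_hom; case: xgetP => [k' _ [] //|/(_ k) []].
Qed.

Lemma tens_hom_uniq (B A T B' T' : cstarAlgType R) (t : B -> A -> T) (t' : B' -> A -> T')
  (f : B -> B') (k : T -> T') : min_tensor t -> min_tensor t' -> star_hom f -> star_hom k ->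
  (forall b a, k (t b a) = t' (f b) a) -> k =1 tens_hom t t' f.
Proof.
move=> mt mt' hf hk kE; have [hk' kE'] := tens_hom_spec mt mt' hf.
apply: (mt_ext mt); [exact: sh_blin_rep (mt_rep mt') hk|exact: sh_blin_rep (mt_rep mt') hk'|].
by move=> b a; rewrite kE kE'.
Qed.

Lemma tens_hom_inj (B A T B' T' : cstarAlgType R) (t : B -> A -> T) (t' : B' -> A -> T') (f : B -> B') :
  min_tensor t -> min_tensor t' -> star_hom f -> injective f -> injective (tens_hom t t' f).
Proof.
move=> mt mt' hf fi; have [k [hk kE /(_ fi) ki]] := tens_hom_ex mt mt' hf.
by move=> x y; rewrite -!(tens_hom_uniq mt mt' hf hk kE); exact: ki.
Qed.

End TensorHom.

(** * Spatial pictures of triple tensor products *)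

Section ThreeLegs.
Variables (R : realType) (K H K2 L K3 : hilbertType R).
Variables (h2 : K -> H -> K2) (h : H -> H -> L) (h3 : K -> L -> K3) (hr : K2 -> H -> K3).
Hypotheses (hh2 : hilbert_tensor h2) (hh : hilbert_tensor h) (hh3 : hilbert_tensor h3)
  (hhr : hilbert_tensor hr) (assoc : forall x y z, hr (h2 x y) z = h3 x (h y z)).

Lemma otens_assoc f g k : otens hhr (otens hh2 f g) k = otens hh3 f (otens hh g k).
Proof.
apply: (Bop_total (triple_total hh2 hhr)) => -[[x y] z].
by rewrite /= assoc !otensE -assoc !otensE assoc.
Qed.

Variables (A : cstarBialg R) (B : cstarAlgType R).
Variables (s : B -> Bop K) (p : A -> Bop H) (P2 : bAA A -> Bop L).
Hypotheses (hs : star_hom s) (si : injective s) (hp : star_hom p) (pi : injective p).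
Hypotheses (hP2 : star_hom P2) (P2E : forall a a', P2 (bt a a') = otens hh (p a) (p a')).

Lemma P2_inj : injective P2.
Proof. exact: (spatial_iso (@bt_min R A) hp hp pi pi hP2 P2E). Qed.

(** The last two clauses describe both bracketings of the triple product on one and the same space
    [K3]. *)
Definition tensorA_rep (T : tensorA A B) (S2 : tA T -> Bop K2) (S3 : tAA T -> Bop K3) : Prop :=
  [/\ star_hom S2 /\ injective S2, star_hom S3 /\ injective S3,
      forall b a, S2 (tt T b a) = otens hh2 (s b) (p a),
      forall x a, S3 (tl x a) = otens hhr (S2 x) (p a)
    & forall b y, S3 (tr T b y) = otens hh3 (s b) (P2 y)].

Lemma tensorA_rep_ex (T : tensorA A B) : exists S2 S3, tensorA_rep (T := T) S2 S3.
Proof.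
have [S2 [hS2 S2E]] := spatial_ex (@tt_min _ _ _ T) hh2 hs hp.
have S2i := spatial_iso (@tt_min _ _ _ T) hs hp si pi hS2 S2E.
have [ml mr e] := @tlr_min _ _ _ T.
have [S3 [hS3 S3E]] := spatial_ex ml hhr hS2 hp.
have S3i := spatial_iso ml hS2 hp S2i pi hS3 S3E.
exists S2, S3; split=> // b; apply: (mt_ext (@bt_min R A)).
- by apply: blin_comp; [exact: sh_blin hS3|exact: mt_blinr mr b].
- by apply: (blin_comp (otens_blinr hh3 (s b))); exact: sh_blin hP2.
by move=> a a'; rewrite -e S3E S2E P2E otens_assoc.
Qed.

Lemma tensorA_ex : exists (T : tensorA A B) S2 S3, tensorA_rep (T := T) S2 S3.
Proof.
have [T2 [t2 [S2 [mt2 hS2 S2i S2E]]]] := min_tensor_ex hh2 hs si hp pi.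
have [T3 [l [S3 [ml hS3 S3i S3E]]]] := min_tensor_ex hhr hS2 S2i hp pi.
(* The second bracketing is found inside the algebra built from the first. *)
have rg b y : exists x, S3 x = otens hh3 (s b) (P2 y).
  suff [x _ <-] : range S3 (otens hh3 (s b) (P2 y)) by exists x.
  have bl : blin (fun y => otens hh3 (s b) (P2 y)).
    by apply: (blin_comp (otens_blinr hh3 (s b))); exact: sh_blin hP2.
  apply: (cspan_all (mt_cspan (@bt_min R A)) (csub_pre bl (iso_range (sh_lin hS3) (rep_iso hS3 S3i)))).
  by move=> _ [a _ [a' _ <-]] /=; exists (l (t2 b a) a') => //; rewrite S3E S2E P2E otens_assoc.
have /choice[r rE] : forall b, exists r, forall y, S3 (r y) = otens hh3 (s b) (P2 y).
  by move=> b; have [r hr'] := choice (rg b); exists r.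
have e c a a' : l (t2 c a) a' = r c (bt a a').
  by apply: S3i; rewrite rE S3E S2E P2E otens_assoc.
have mr : min_tensor r.
  apply: (min_tensor_intro (hh := hh3) hs si hP2 P2_inj hS3 S3i rE).
  apply/seteqP; split=> // x _.
  apply: (cspan_all (mt_cspan ml) (cspan_csub _)) => _ [y _ [a' _ <-]]; move: y.
  apply: (cspan_all (mt_cspan mt2) (csub_pre (mt_blinl ml a') (cspan_csub _))).
  by move=> _ [c _ [a _ <-]] /=; apply: sub_cspan; exists c => //; exists (bt a a').
have m3 : min_tensor3 t2 (@bt R A) l r by split.
exists (TensorA mt2 m3), S2, S3; split=> //.
Qed.

End ThreeLegs.

(** * Multiplier algebras *)

Section MultiplierBound.
Variables (R : realType) (A : cstarAlgType R).
Implicit Types m n : multiplier A.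

Lemma ml_inj m n : ml m =1 ml n -> m = n.
Proof.
move=> e; apply: multiplier_ext => // x; apply: cstar_injr => y.
by rewrite -!mlrP e.
Qed.

Let q (n : nat) : R := (3 ^+ n)^-1.
Let q0 (n : nat) : 0 < q n. Proof. by rewrite invr_gt0 exprn_gt0. Qed.
Let qS (n : nat) : q n.+1 = q n / 3. Proof. by rewrite /q exprS invfM mulrC. Qed.
Let qi (n : nat) : q n <= ivn R n.
Proof.
rewrite /q /ivn lef_pV2 ?posrE ?exprn_gt0 ?ltr0n //.
elim: n => [|n ih]; first by rewrite expr0.
rewrite exprS -[n.+2]addn1 natrD; have : 1 <= n.+1%:R :> R by rewrite ler1n.
lra.
Qed.

(* The gliding hump argument: a sequence of unit vectors on which [mr m] grows too fast would
   produce one element [l] with [ml m l] of infinite norm. *)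
Lemma mr_bound1 m : exists M : R, forall c, Nm c <= 1 -> Nm (mr m c) <= M.
Proof.
have [//|h] := pselect (exists M : R, forall c, Nm c <= 1 -> Nm (mr m c) <= M); exfalso.
have /choice[c cP] : forall n : nat, exists c, Nm c <= 1 /\ 2 * n.+1%:R * 3 ^+ n < Nm (mr m c).
  move=> n; have [//|h'] := pselect (exists c, Nm c <= 1 /\ 2 * n.+1%:R * 3 ^+ n < Nm (mr m c)).
  exfalso; apply: h; exists (2 * n.+1%:R * 3 ^+ n) => c c1; rewrite leNgt; apply/negP => h.
  by apply: h'; exists c.
pose k (n : nat) := mr m (c n).
have k0 (n : nat) : 0 < Nm (k n).
  by apply: le_lt_trans (cP n).2; rewrite !mulr_ge0 ?exprn_ge0.
(* One of [x + v] and [x - v] works, because [k n] maps their difference to a vector of norm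
   [2 * (q n * Nm (k n))]. *)
have /choice[g gP] : forall z : nat * A, exists x', Nm (x' - z.2) <= q z.1 /\
    q z.1 * Nm (k z.1) <= Nm (k z.1 ⋅ x').
  case=> n x /=; pose v := (q n / Nm (k n))%:C%C *: (k n)^⋆.
  have vN : Nm v = q n.
    rewrite NmZr sstar_Nm ger0_norm ?divr_ge0 ?Nm_ge0 ?(ltW (q0 n)) // divfK //.
    by rewrite gt_eqF.
  have kv : Nm (k n ⋅ v) = q n * Nm (k n).
    rewrite smulZr NmZr ger0_norm ?divr_ge0 ?Nm_ge0 ?(ltW (q0 n)) //.
    rewrite -{2}[k n]sstarK cstar_Nm sstar_Nm.
    by move: (Nm (k n)) (k0 n) => N N0; field; rewrite gt_eqF.
  have h2 : Nm (k n ⋅ v + k n ⋅ v) <= Nm (k n ⋅ (x + v)) + Nm (k n ⋅ (x - v)).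
    have -> : k n ⋅ v + k n ⋅ v = k n ⋅ (x + v) - k n ⋅ (x - v).
      by rewrite !smulDr smulNr; zmod.
    by apply: (le_trans (NmD _ _)); rewrite NmN.
  have h3 : Nm (k n ⋅ v + k n ⋅ v) = 2 * (q n * Nm (k n)).
    have -> : k n ⋅ v + k n ⋅ v = (2 : R)%:C%C *: (k n ⋅ v).
      have -> : (2 : R)%:C%C = 1 + 1 :> R[i] by rewrite -rcD.
      by rewrite scalerDl scale1r.
    by rewrite NmZr kv ger0_norm.
  have [h4|h4] := leP (q n * Nm (k n)) (Nm (k n ⋅ (x + v))).
    by exists (x + v); split=> //; rewrite addrC addKr vN.
  exists (x - v); split; last by lra.
  by rewrite addrC addKr NmN vN.
pose x := fix x (n : nat) : A := if n is n'.+1 then g (n', x n') else 0.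
(* All later corrections together move [x] by at most [q n / 2], half of what was gained at stage
   [n]. *)
have xd (n j : nat) : Nm (x (n.+1 + j)%N - x n.+1) <= (q n - q (n + j)%N) / 2.
  elim: j => [|j ih]; first by rewrite !addn0 !subrr Nm0 mul0r.
  have h1 := (gP ((n.+1 + j)%N, x (n.+1 + j)%N)).1; rewrite /= in h1.
  have := NmT (x (n.+1 + j.+1)%N) (x (n.+1 + j)%N) (x n.+1).
  rewrite addnS [x (n.+1 + j).+1]/= => h2; apply: (le_trans h2).
  rewrite addnS qS; rewrite addSn qS in h1; rewrite addSn; lra.
have [|l hl] := @seq_complete R A x.
  move=> e e0; have [N hN] := invn_small e0; exists N.+1 => i j hi hj.
  have := xd N (i - N.+1)%N; have := xd N (j - N.+1)%N; rewrite !subnKC //.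
  have := NmT (x i) (x N.+1) (x j); rewrite (NmC (x N.+1) (x j)).
  have := q0 (N + (i - N.+1))%N; have := q0 (N + (j - N.+1))%N.
  have := hN N (leqnn N); have := qi N; lra.
have ld (n : nat) : Nm (l - x n.+1) <= q n / 2.
  apply: Nm_eps => e e0; have [N hN] := hl e e0.
  have h1 := hN (n.+1 + N)%N (leq_addl _ _); have h2 := xd n N.
  have := NmT l (x (n.+1 + N)%N) (x n.+1); rewrite (NmC l (x (n.+1 + N)%N)).
  have := q0 (n + N)%N; lra.
have big (n : nat) : n.+1%:R <= Nm (ml m l).
  have h1 : Nm (k n ⋅ l) <= Nm (ml m l).
    rewrite /k -mlrP; apply: (le_trans (smul_Nm _ _)).
    by have := (cP n).1; have := Nm_ge0 (ml m l); have := Nm_ge0 (c n); nra.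
  have h2 := (gP (n, x n)).2; rewrite /= -[g _]/(x n.+1) in h2.
  have h3 : Nm (k n ⋅ (x n.+1 - l)) <= Nm (k n) * (q n / 2).
    apply: (le_trans (smul_Nm _ _)); rewrite ler_wpM2l ?Nm_ge0 // NmC.
    exact: ld.
  have h4 := NmD (k n ⋅ (x n.+1 - l)) (k n ⋅ l); rewrite -smulDr subrK in h4.
  have h5 : n.+1%:R <= q n * Nm (k n) / 2.
    have -> : n.+1%:R = q n * (2 * n.+1%:R * 3 ^+ n) / 2 :> R.
      by rewrite /q; field; rewrite expf_neq0 // pnatr_eq0.
    by rewrite ler_pM2r ?invr_gt0 // ler_pM2l //; exact: ltW (cP n).2.
  lra.
have /andP[_ h1] := truncn_itv (Nm_ge0 (ml m l)).
by have := big (Num.truncn (Nm (ml m l))); rewrite leNgt h1.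
Qed.

Lemma mr_bound m : exists2 M : R, 0 <= M & forall c, Nm (mr m c) <= M * Nm c.
Proof.
have [M hM] := mr_bound1 m.
have M0 : 0 <= M by apply: le_trans (Nm_ge0 _) (hM 0 _); rewrite Nm0.
exists M => // c; have [->|c0] := eqVneq c 0.
  by rewrite (lin0 (mr_linear m)) !Nm0 mulr0.
have cN := Nm_gt0 c0; have := hM ((Nm c)^-1%:C%C *: c).
rewrite (linZ (mr_linear m)) !NmZr ger0_norm ?invr_ge0 ?Nm_ge0 // mulVf ?gt_eqF // => /(_ (lexx _)).
by rewrite mulrC ler_pdivrMr.
Qed.

Lemma ml_bound m : exists2 M : R, 0 <= M & forall c, Nm (ml m c) <= M * Nm c.
Proof.
have [M M0 hM] := mr_bound m; exists M => // c.
have [->|h] := eqVneq (ml m c) 0; first by rewrite Nm0 mulr_ge0 ?Nm_ge0.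
rewrite -(ler_pM2l (Nm_gt0 h)) -expr2 -cstar_Nm mlrP; apply: (le_trans (smul_Nm _ _)).
have := hM (ml m c)^⋆; rewrite sstar_Nm => h1.
by apply: (le_trans (ler_wpM2r (Nm_ge0 c) h1)); rewrite mulrCA mulrA.
Qed.

Lemma ml_blin m : blin (ml m).
Proof. by split; [exact: ml_linear|have [M _ hM] := ml_bound m; exists M]. Qed.
Lemma mr_blin m : blin (mr m).
Proof. by split; [exact: mr_linear|have [M _ hM] := mr_bound m; exists M]. Qed.

Fact mlopP m x y : (ml m x)^⋆ ⋅ y = x^⋆ ⋅ ml (m^⋆) y.
Proof. by rewrite /= -[y in LHS]sstarK -sstarM mlrP sstarM. Qed.
Fact mlopb m : exists M : R, forall x, Nm (ml m x) <= M * Nm x.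
Proof. by have [M _ hM] := ml_bound m; exists M. Qed.
Definition mlop m : Lop A := @Aop _ _ (bpairing A) (ml m) (ml m^⋆) (mlopP m) (mlopb m).

Lemma mlop_hom : star_hom mlop.
Proof.
split=> [z m n|m n|m]; apply: aop_ext => x //.
by rewrite af_add af_scale.
Qed.

Fact mopP (a : Lop A) x y : x ⋅ af a y = (ag a x^⋆)^⋆ ⋅ y.
Proof. by have := aP' a x^⋆ y; rewrite /= sstarK => <-. Qed.
(* [Lop A] and [multiplier A] are the same algebra. *)
Definition mop (a : Lop A) : multiplier A := Multiplier (mopP a).
Lemma mlopK a : mlop (mop a) = a. Proof. exact: aop_ext. Qed.
Lemma mopK m : mop (mlop m) = m. Proof. exact: ml_inj. Qed.
Lemma mop_hom : star_hom mop.
Proof.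
have h := mlop_hom; split.
- by move=> z a b; rewrite -[z *: a + b]mlopK -[in RHS](mopK (z *: _ + _)) (sh_lin h) !mlopK.
- by move=> a b; rewrite -[a ⋅ b]mlopK -[in RHS](mopK (_ ⋅ _)) (shM h) !mlopK.
- by move=> a; rewrite -[a^⋆]mlopK -[in RHS](mopK (_ ^⋆)) (shS h) !mlopK.
Qed.

Lemma memb_hom : star_hom (@memb R A).
Proof.
split=> [z x y|x y|x]; apply: ml_inj => c /=.
- by rewrite smulDl smulZl.
- by rewrite smulA.
- by rewrite sstarM sstarK.
Qed.
Lemma memb_inj : injective (@memb R A).
Proof. by move=> a b e; apply: cstar_injr => c; have := congr1 (fun m => ml m c) e. Qed.

Lemma mstarE m x : ml (m^⋆) x = (mr m x^⋆)^⋆. Proof. by []. Qed.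
Lemma mM m n x : ml (m ⋅ n) x = ml m (ml n x). Proof. by []. Qed.

End MultiplierBound.

Lemma msh_contr (R : realType) (X Y : cstarAlgType R) (k : X -> multiplier Y) : star_hom k ->
  forall x y, Nm (ml (k x) y) <= Nm x * Nm y.
Proof.
move=> hk x y; apply: (le_trans (aop_le (mlop (k x)) y)).
by rewrite ler_wpM2r ?Nm_ge0 // (sh_contr (sh_comp (mlop_hom Y) hk)).
Qed.

Lemma msh_blinl (R : realType) (X Y : cstarAlgType R) (k : X -> multiplier Y) y : star_hom k ->
  blin (fun x => ml (k x) y).
Proof.
move=> hk; split; first by move=> z u v; rewrite (sh_lin hk).
by exists (Nm y) => x; rewrite mulrC; exact: msh_contr.
Qed.

(** [F] represents [m] through [s]: [m] is unique if [s] is injective, [F] is unique if [s] is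
    nondegenerate. Equations between multipliers are proved by exhibiting one operator that
    implements both sides. *)
Definition impl (R : realType) (T : cstarAlgType R) (L : hilbertType R) (s : T -> Bop L)
    (m : multiplier T) (F : Bop L) : Prop :=
  (forall x, s (ml m x) = F ⋅ s x) /\ (forall x, s (mr m x) = s x ⋅ F).

Definition nondeg (R : realType) (T : cstarAlgType R) (L : hilbertType R) (s : T -> Bop L) : Prop :=
  total (fun p : T * L => af (s p.1) p.2).

(* The norm of [sum c_i (m x_i) v_i] is controlled by inserting an approximate unit. *)
Lemma module_bound (R : realType) (T : cstarAlgType R) (V : normedModType R[i]) (sg : T -> V -> V)
    (m : multiplier T) (M : R) : represented T ->
  (forall x, linear (sg x)) -> (forall v, linear (sg^~ v)) ->
  (forall x y v, sg (x ⋅ y) v = sg x (sg y v)) -> (forall x v, Nm (sg x v) <= Nm x * Nm v) ->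
  0 <= M -> (forall x, Nm (ml m x) <= M * Nm x) ->
  forall r : seq (R[i] * (T * V)),
  Nm (comb (fun p : T * V => sg (ml m p.1) p.2) r) <= M * Nm (comb (fun p : T * V => sg p.1 p.2) r).
Proof.
move=> rT sr sl sM sN M0 hM r.
set w := comb (fun p => sg (ml m p.1) p.2) r; set v := comb (fun p => sg p.1 p.2) r.
apply: Nm_eps => e e0.
pose D := \sum_(p <- r) Nm p.1 * Nm p.2.2.
have D0 : 0 <= D by apply: sumr_ge0 => p _; rewrite mulr_ge0 ?Nm_ge0.
have K0 : 0 < M * D + 1 by have := mulr_ge0 M0 D0; lra.
have [u [us u1 hu]] := approx_unit rT [seq p.2.1 | p <- r] (divr_gt0 e0 K0).
have h1 : Nm (w - sg (ml m u) v) <= M * (e / (M * D + 1)) * D.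
  rewrite /w /v /comb (lin_sum _ _ (sr (ml m u))) -sumrB.
  apply: (le_trans (Nm_sum _ _)); rewrite mulr_sumr big_seq [leRHS]big_seq.
  apply: ler_sum => p pr; rewrite (linZ (sr _)) -scalerBr NmZ mulrCA ler_wpM2l ?Nm_ge0 //.
  have -> : sg (ml m p.2.1) p.2.2 - sg (ml m u) (sg p.2.1 p.2.2) = sg (ml m (p.2.1 - u ⋅ p.2.1)) p.2.2.
    by rewrite (linB (ml_linear m)) (linB (sl p.2.2)) ml_mul sM.
  apply: (le_trans (sN _ _)); rewrite ler_wpM2r ?Nm_ge0 //.
  apply: (le_trans (hM _)); rewrite ler_wpM2l // NmC.
  by have [] := hu p.2.1; first by apply/mapP; exists p.
have h2 : Nm (sg (ml m u) v) <= M * Nm v.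
  apply: (le_trans (sN _ _)); rewrite ler_wpM2r ?Nm_ge0 //.
  by apply: (le_trans (hM u)); rewrite -[leRHS]mulr1 ler_wpM2l.
have h3 : M * (e / (M * D + 1)) * D <= e.
  have -> : M * (e / (M * D + 1)) * D = (M * D) * e / (M * D + 1) by ring.
  by rewrite ler_pdivrMr // mulrC ler_pM2l //; lra.
have := NmD (w - sg (ml m u) v) (sg (ml m u) v); rewrite subrK; lra.
Qed.

Section Implements.
Variables (R : realType) (T : cstarAlgType R) (L : hilbertType R) (s : T -> Bop L).
Hypothesis hs : star_hom s.
Implicit Types (m n : multiplier T) (F G : Bop L).

Lemma impl_memb x : impl s (memb x) (s x).
Proof. by split=> y /=; rewrite (shM hs). Qed.
Lemma impl_lin z m n F G : impl s m F -> impl s n G -> impl s (z *: m + n) (z *: F + G).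
Proof.
move=> [h1 h2] [h3 h4]; split=> x /=.
  by rewrite (sh_lin hs) h1 h3 smulDl smulZl.
by rewrite (sh_lin hs) h2 h4 smulDr smulZr.
Qed.
Lemma implM m n F G : impl s m F -> impl s n G -> impl s (m ⋅ n) (F ⋅ G).
Proof.
by move=> [h1 h2] [h3 h4]; split=> x /=; rewrite ?h1 ?h3 ?h4 ?h2 smulA.
Qed.
Lemma implS m F : impl s m F -> impl s (m^⋆) F^⋆.
Proof.
by move=> [h1 h2]; split=> x /=; rewrite (shS hs) ?h1 ?h2 sstarM (shS hs) sstarK.
Qed.
Lemma impl_one : impl s (mone T) (aone (hpairing L)).
Proof. by split=> x /=; rewrite ?a1mul' ?amul1'. Qed.

Hypothesis si : injective s.

Lemma impl_uniq m n F : impl s m F -> impl s n F -> m = n.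
Proof. by move=> [h1 _] [h2 _]; apply: ml_inj => x; apply: si; rewrite h1 h2. Qed.

Lemma impl_op F : (forall x, range s (F ⋅ s x)) -> (forall x, range s (s x ⋅ F)) ->
  exists m, impl s m F.
Proof.
move=> h1 h2.
have /choice[l lE] : forall x, exists y, s y = F ⋅ s x by move=> x; have [y _ <-] := h1 x; exists y.
have /choice[r rE] : forall x, exists y, s y = s x ⋅ F by move=> x; have [y _ <-] := h2 x; exists y.
have P x y : x ⋅ l y = r x ⋅ y by apply: si; rewrite !(shM hs) lE rE smulA.
by exists (Multiplier P).
Qed.

Lemma impl_hom (X : starAlgType R) (S : X -> Bop L) : star_hom S -> (forall x, exists m, impl s m (S x)) ->
  exists k : X -> multiplier T, star_hom k /\ forall x, impl s (k x) (S x).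
Proof.
move=> hS /choice[k kE]; exists k; split=> //; split.
- move=> z x y; apply: (impl_uniq (F := z *: S x + S y)); last exact: impl_lin.
  by rewrite -(sh_lin hS).
- by move=> x y; apply: (impl_uniq (F := S x ⋅ S y)); [rewrite -(shM hS)|exact: implM].
- by move=> x; apply: (impl_uniq (F := (S x)^⋆)); [rewrite -(shS hS)|exact: implS].
Qed.

Hypothesis nd : nondeg s.

Lemma impl_uniqF m F G : impl s m F -> impl s m G -> F = G.
Proof.
move=> [h1 _] [h2 _]; apply: (Bop_total nd) => -[x v] /=.
by rewrite -af_comp -h1 h2.
Qed.

(** [F] sends [s(x) v] to [s(m x) v] on a total set of vectors; [module_bound] makes it bounded, and
    the same construction for [m^⋆] gives its adjoint. *)
Lemma impl_nd m : exists F, impl s m F.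
Proof.
have impl_bound n N : 0 <= N -> (forall x, Nm (ml n x) <= N * Nm x) -> forall r : seq (R[i] * (T * L)),
    Nm (comb (fun p : T * L => af (s (ml n p.1)) p.2) r) <= N * Nm (comb (fun p : T * L => af (s p.1) p.2) r).
  apply: (@module_bound _ _ _ (fun x => af (s x))).
  - by exists L, s.
  - by move=> x; exact: af_lin.
  - by move=> v z x y; rewrite (sh_lin hs) af_add af_scale.
  - by move=> x y v; rewrite (shM hs).
  - by move=> x v; rewrite -(rep_iso hs si); exact: aop_le.
have [M M0 hM] := ml_bound m; have [N N0 hN] := ml_bound m^⋆.
have [F [Fl Fb FE]] := lift_ex nd (impl_bound m M M0 hM).
have [G [Gl Gb GE]] := lift_ex nd (impl_bound m^⋆ N N0 hN).
have bF : blin F by split=> //; exists M.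
have bG : blin G by split=> //; exists N.
have FG x y : ⟨F x, y⟩ = ⟨x, G y⟩.
  move: y; apply: (total_eq (f := fun y => ⟨F x, y⟩ : R[i]^o) (g := fun y => ⟨x, G y⟩ : R[i]^o) nd).
  - exact: inner_blin.
  - exact: (blin_comp (inner_blin x) bG).
  move=> p; rewrite innerC [RHS]innerC; congr (_^*); move: x.
  apply: (total_eq (f := fun x => ⟨af (s p.1) p.2, F x⟩ : R[i]^o)
    (g := fun x => ⟨G (af (s p.1) p.2), x⟩ : R[i]^o) nd).
  - exact: (blin_comp (inner_blin _) bF).
  - exact: inner_blin.
  move=> r; rewrite FE GE -!Bop_adj' -!(shS hs) -!af_comp -!(shM hs).
  by rewrite mlopP.
exists (@Aop _ _ (hpairing L) F G FG (ex_intro _ M Fb)); split=> x; apply: (Bop_total nd) => -[y v] /=.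
  by rewrite -[LHS]af_comp -(shM hs) -ml_mul -(FE (x ⋅ y, v)) (shM hs).
by rewrite (FE (y, v)) -!af_comp -!(shM hs) mlrP.
Qed.

Lemma bar_ex : exists sb : multiplier T -> Bop L, star_hom sb /\ forall m, impl s m (sb m).
Proof.
have /choice[sb sbE] := impl_nd; exists sb; split=> //; split.
- by move=> z m n; apply: impl_uniqF (sbE _) _; exact: impl_lin.
- by move=> m n; apply: impl_uniqF (sbE _) _; exact: implM.
- by move=> m; apply: impl_uniqF (sbE _) _; exact: implS.
Qed.

End Implements.

(** The Hilbert space of the kernel [⟨f b v, f b' v'⟩] is the essential subspace of [f].
    Faithfulness survives, since [c] acts by zero there only if [f (c ⋅ b) = 0] for all [b]. *)
Lemma nondeg_rep_ex (R : realType) (B : cstarAlgType R) : represented B ->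
  exists (H : hilbertType R) (p : B -> Bop H), [/\ star_hom p, injective p & nondeg p].
Proof.
move=> rB; have [H0 [f [hf fi]]] := rB.
pose k (q r : B * H0) : R[i] := ⟨af (f q.1) q.2, af (f r.1) r.2⟩.
have kh q r : k r q = (k q r)^* by rewrite /k -innerC.
have kp s : 0 <= kform k s s.
  have -> : kform k s s = ⟨comb (fun q => af (f q.1) q.2) s, comb (fun q => af (f q.1) q.2) s⟩.
    rewrite comb_inner; apply: eq_bigr => q _; rewrite mulr_sumr; apply: eq_bigr => r _.
    by rewrite mulrA.
  by rewrite inner_norm exprn_ge0.
have [V [j [jt jk]]] := kernel_hilbert kh kp.
have jl z b b' v : j (z *: b + b', v) = z *: j (b, v) + j (b', v).
  apply: (total_inner jt) => q; rewrite innerDr innerZr !jk /k /=.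
  by rewrite (sh_lin hf) af_add af_scale innerDr innerZr.
have jN q : Nm (j q) <= Nm q.1 * Nm q.2.
  suff -> : Nm (j q) = Nm (af (f q.1) q.2) by rewrite -(rep_iso hf fi); exact: aop_le.
  apply/eqP; rewrite -(@eqrXn2 _ 2) ?Nm_ge0 // !NmRe jk //.
have adj c (x y : B * H0) : ⟨j (c^⋆ ⋅ x.1, x.2), j y⟩ = ⟨j x, j (c ⋅ y.1, y.2)⟩.
  by rewrite !jk /k /= !(shM hf) (shS hf) !af_comp Bop_adj'.
have gr c (x : B * H0) : exists C : R, forall m,
    Nm (j (iter m ((fun q => (c^⋆ ⋅ q.1, q.2)) \o (fun q => (c ⋅ q.1, q.2))) x)) <= C * ((Nm c + 1) ^+ 2) ^+ m.
  exists (Nm x.1 * Nm x.2) => m.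
  have -> : iter m ((fun q : B * H0 => (c^⋆ ⋅ q.1, q.2)) \o (fun q => (c ⋅ q.1, q.2))) x =
      (iter m (fun b => c^⋆ ⋅ (c ⋅ b)) x.1, x.2).
    by elim: m => [|m /= ->] //; case: (x).
  apply: (le_trans (jN _)); rewrite /= mulrAC ler_wpM2r ?Nm_ge0 //.
  elim: m => [|m ih]; first by rewrite mulr1.
  rewrite iterS exprSr mulrA [leRHS]mulrC expr2 -mulrA; have := Nm_ge0 c => c0.
  have c1 : Nm c <= Nm c + 1 by lra.
  apply: (le_trans (smul_Nm _ _)); rewrite sstar_Nm; apply: ler_pM => //; rewrite ?Nm_ge0 //.
  by apply: (le_trans (smul_Nm _ _)); apply: ler_pM => //; rewrite ?Nm_ge0.
have /choice[p pE] : forall c, exists F : Bop V,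
    (forall q, af F (j q) = j (c ⋅ q.1, q.2)) /\ (forall q, ag F (j q) = j (c^⋆ ⋅ q.1, q.2)).
  move=> c; have c1 : 0 < Nm c + 1 by have := Nm_ge0 c; lra.
  have gr' := gr c^⋆; rewrite sstarK sstar_Nm in gr'.
  have [F [_ F1 F2]] := act_op jt c1 (adj c) (gr c) gr'.
  by exists F.
have hp : star_hom p.
  split=> [z c c'|c c'|c]; apply: (Bop_total jt) => q.
  - by rewrite af_add af_scale !(pE _).1 smulDl smulZl jl.
  - by rewrite af_comp !(pE _).1 /= smulA.
  - by rewrite (pE _).1 [RHS](pE _).2.
exists V, p; split=> //.
- move=> c c' e; apply: cstar_injr => b; apply: fi; apply: aop_ext => v; apply/subr0_eq/inner_eq0.
  have h : j (c ⋅ b, v) = j (c' ⋅ b, v).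
    by have := (pE c).1 (b, v); rewrite e (pE c').1 => /= ->.
  have kk b1 b2 : ⟨af (f b1) v, af (f b2) v⟩ = ⟨j (b1, v), j (b2, v)⟩ by rewrite jk.
  by rewrite innerBl !innerBr !kk h !subrr.
apply/totalE/seteqP; split=> // v _.
apply: (total_ind jt (cspan_csub _)) => -[b w]; apply: (cspan_csub _).2 => e e0.
have K0 : 0 < Nm w + 1 by have := Nm_ge0 w; lra.
have [u [_ _ h _]] := approx_unit1 rB b (divr_gt0 e0 K0).
exists (j (u ⋅ b, w)); first by apply: sub_cspan; exists (u, j (b, w)); rewrite //= (pE u).1.
have -> : j (b, w) - j (u ⋅ b, w) = j (b - u ⋅ b, w).
  by have := jl (-1) (u ⋅ b) b w; rewrite !scaleN1r (addrC (- (u ⋅ b))) (addrC (- j _)) => ->.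
apply: (le_trans (jN _)); rewrite /= NmC; rewrite ler_pdivlMr // in h.
apply: le_trans h; rewrite ler_wpM2l ?Nm_ge0 //; lra.
Qed.

(** * Tensor products of multipliers and of morphisms *)

Section MultiplierTensor.
Variables (R : realType) (B A T : cstarAlgType R) (t : B -> A -> T).
Hypothesis mt : min_tensor t.
Implicit Types (m : multiplier B) (n : multiplier A).

Lemma mtens_uniq k k' m n : (forall b a, ml k (t b a) = t (ml m b) (ml n a)) ->
  (forall b a, ml k' (t b a) = t (ml m b) (ml n a)) -> k = k'.
Proof.
move=> h h'; apply/ml_inj/(mt_ext mt); [exact: ml_blin|exact: ml_blin|].
by move=> b a; rewrite h h'.
Qed.

Lemma mtens_spec k m n : (forall b a, ml k (t b a) = t (ml m b) (ml n a)) -> mtens t m n = k.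
Proof.
move=> h; rewrite /mtens; case: xgetP => [k' _ h'|/(_ k) []//].
exact: mtens_uniq h' h.
Qed.

Section Impl.
Variables (H K L : hilbertType R) (h : H -> K -> L) (hh : hilbert_tensor h).
Variables (p : B -> Bop H) (q : A -> Bop K) (S : T -> Bop L).
Hypotheses (hp : star_hom p) (hq : star_hom q) (hS : star_hom S) (Si : injective S).
Hypothesis SE : forall b a, S (t b a) = otens hh (p b) (q a).

Lemma range_csub : csub (range S).
Proof. by apply: iso_range; [exact: sh_lin hS|exact: rep_iso]. Qed.

Lemma rangeP_mt (F : T -> Bop L) : blin F -> (forall b a, range S (F (t b a))) -> forall x, range S (F x).
Proof.
move=> bF h'; apply: (cspan_all (mt_cspan mt) (csub_pre bF range_csub)).
by move=> _ [b _ [a _ <-]]; exact: h'.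
Qed.

Lemma mtens_impl m n F G : impl p m F -> impl q n G -> impl S (mtens t m n) (otens hh F G).
Proof.
move=> [F1 F2] [G1 G2].
have [k [k1 k2]] : exists k, impl S k (otens hh F G).
  apply: (impl_op hS Si); apply: rangeP_mt.
  - by apply: (blin_comp (blin_smull _)); exact: sh_blin hS.
  - by move=> b a; rewrite SE otensM -F1 -G1 -SE; exists (t (ml m b) (ml n a)).
  - by apply: (blin_comp (blin_smulr _)); exact: sh_blin hS.
  - by move=> b a; rewrite SE otensM -F2 -G2 -SE; exists (t (mr m b) (mr n a)).
suff -> : mtens t m n = k by split.
by apply: mtens_spec => b a; apply: Si; rewrite k1 !SE otensM F1 G1.
Qed.

Lemma nondeg_otens : nondeg p -> nondeg q -> nondeg S.
Proof.
move=> np nq; apply/totalE/seteqP; split=> // v _.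
apply: (total_ind (ht_total2 hh np nq) (cspan_csub _)) => -[[b x] [a y]] /=.
by apply: sub_cspan; exists (t b a, h x y) => //=; rewrite SE otensE.
Qed.

End Impl.

Lemma nondeg_tensor_rep : exists (H K L : hilbertType R) (h : H -> K -> L) (hh : hilbert_tensor h)
    (p : B -> Bop H) (q : A -> Bop K) (S : T -> Bop L),
  [/\ [/\ star_hom p, injective p & nondeg p], [/\ star_hom q, injective q & nondeg q],
     [/\ star_hom S, injective S & nondeg S] & forall b a, S (t b a) = otens hh (p b) (q a)].
Proof.
have [H [p [hp pi np]]] := nondeg_rep_ex (mt_repl mt).
have [K [q [hq qi nq]]] := nondeg_rep_ex (mt_repr mt).
have [L [h hh]] := hilbert_tensor_ex H K.
have [S [hS SE]] := spatial_ex mt hh hp hq.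
have Si := spatial_iso mt hp hq pi qi hS SE.
exists H, K, L, h, hh, p, q, S; split=> //; split=> //.
exact: (nondeg_otens SE).
Qed.

(** In a nondegenerate representation the multiplier exists as the operator [F (x) G], with [F] and
    [G] implementing [m] and [n]. *)
Lemma mtens_lr m n b a : ml (mtens t m n) (t b a) = t (ml m b) (ml n a) /\
  mr (mtens t m n) (t b a) = t (mr m b) (mr n a).
Proof.
have [H [K [L [h [hh [p [q [S [[hp pi np] [hq qi nq] [hS Si nS] SE]]]]]]]]] := nondeg_tensor_rep.
have [F iF] := impl_nd hp pi np m; have [G iG] := impl_nd hq qi nq n.
have [k1 k2] := mtens_impl hS Si SE iF iG.
split; apply: Si; rewrite ?k1 ?k2 !SE otensM.
  by rewrite iF.1 iG.1.
by rewrite iF.2 iG.2.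
Qed.
Lemma mtensE m n b a : ml (mtens t m n) (t b a) = t (ml m b) (ml n a).
Proof. by have [] := mtens_lr m n b a. Qed.
Lemma mtensEr m n b a : mr (mtens t m n) (t b a) = t (mr m b) (mr n a).
Proof. by have [] := mtens_lr m n b a. Qed.

Lemma mtensM m n m' n' : mtens t m n ⋅ mtens t m' n' = mtens t (m ⋅ m') (n ⋅ n').
Proof. by apply/esym/mtens_spec => b a; rewrite mM !mtensE. Qed.
Lemma mtens_star m n : (mtens t m n)^⋆ = mtens t m^⋆ n^⋆.
Proof.
apply/esym/mtens_spec => b a.
by rewrite !mstarE (mt_star mt) mtensEr (mt_star mt).
Qed.
Lemma mtens_memb b a : mtens t (memb b) (memb a) = memb (t b a).
Proof. by apply: mtens_spec => b' a'; rewrite /= (mt_mul mt). Qed.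

End MultiplierTensor.

Section TensorMhom.
Variables (R : realType) (B A T B' A' T' : cstarAlgType R) (t : B -> A -> T) (t' : B' -> A' -> T').
Variables (f : B -> multiplier B') (g : A -> multiplier A').
Hypotheses (mt : min_tensor t) (mt' : min_tensor t') (hf : star_hom f) (hg : star_hom g).

Lemma tens_mhom_ex : exists k : T -> multiplier T',
  star_hom k /\ forall b a, k (t b a) = mtens t' (f b) (g a).
Proof.
have [H [K [L [h [hh [p [q [S' [[hp pi np] [hq qi nq] [hS' Si' nS'] SE']]]]]]]]] := nondeg_tensor_rep mt'.
have [pb [hpb pbE]] := bar_ex hp pi np; have [qb [hqb qbE]] := bar_ex hq qi nq.
have [S [hS SE]] := spatial_ex mt hh (sh_comp hpb hf) (sh_comp hqb hg).
have im b a : impl S' (mtens t' (f b) (g a)) (S (t b a)).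
  by rewrite SE; apply: (mtens_impl mt' hS' Si' SE').
have bS : blin S by exact: sh_blin hS.
have ix x : exists m, impl S' m (S x).
  apply: (impl_op hS' Si') => y.
    move: x; apply: (cspan_all (mt_cspan mt) (csub_pre (blin_comp (blin_smulr _) bS) (range_csub hS' Si'))).
    by move=> _ [b _ [a _ <-]] /=; rewrite -(im b a).1; exists (ml (mtens t' (f b) (g a)) y).
  move: x; apply: (cspan_all (mt_cspan mt) (csub_pre (blin_comp (blin_smull _) bS) (range_csub hS' Si'))).
  by move=> _ [b _ [a _ <-]] /=; rewrite -(im b a).2; exists (mr (mtens t' (f b) (g a)) y).
have [k [hk kE]] := impl_hom hS' Si' hS ix.
exists k; split=> // b a; exact: (impl_uniq Si' (kE _) (im b a)).
Qed.

Lemma tens_mhom_spec : star_hom (tens_mhom t t' f g) /\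
  forall b a, tens_mhom t t' f g (t b a) = mtens t' (f b) (g a).
Proof.
have [k [hk kE]] := tens_mhom_ex.
by rewrite /tens_mhom; case: xgetP => [k' _ [] //|/(_ k) []].
Qed.
Lemma tens_mhom_hom : star_hom (tens_mhom t t' f g). Proof. by have [] := tens_mhom_spec. Qed.
Lemma tens_mhomE b a : tens_mhom t t' f g (t b a) = mtens t' (f b) (g a).
Proof. by have [_] := tens_mhom_spec. Qed.

Lemma tens_mhom_impl (L : hilbertType R) (S' : T' -> Bop L) (S : T -> Bop L) :
  star_hom S' -> injective S' -> blin S ->
  (forall b a, impl S' (mtens t' (f b) (g a)) (S (t b a))) ->
  forall x, impl S' (tens_mhom t t' f g x) (S x).
Proof.
move=> hS' Si' bS im x; have hk := tens_mhom_hom; split=> y; move: x.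
  apply: (mt_ext mt (f := fun x => S' (ml (tens_mhom t t' f g x) y)) (g := fun x => S x ⋅ S' y)).
  - exact: (blin_comp (sh_blin hS') (msh_blinl y hk)).
  - exact: (blin_comp (blin_smulr _) bS).
  by move=> b a; rewrite tens_mhomE (im b a).1.
apply: (mt_ext mt (f := fun x => S' (mr (tens_mhom t t' f g x) y)) (g := fun x => S' y ⋅ S x)).
- apply: (blin_comp (sh_blin hS')); split.
    by move=> z u v; rewrite (sh_lin hk).
  exists (Nm y) => x; rewrite -[mr _ y]sstarK -[y in mr _ y]sstarK -mstarE -(shS hk) sstar_Nm.
  by rewrite mulrC; apply: (le_trans (msh_contr hk _ _)); rewrite !sstar_Nm.
- exact: (blin_comp (blin_smull _) bS).
by move=> b a; rewrite tens_mhomE (im b a).2.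
Qed.

End TensorMhom.

Lemma cvg_Nm (R : realType) (V : normedModType R[i]) (X : Type) (F : set_system X) (f : X -> V) (l : V) :
  Filter F -> f x @[x --> F] --> l <-> forall e : R, 0 < e -> F [set x | Nm (f x - l) <= e].
Proof.
move=> FF; split=> [/cvgrPdist_le h e e0|h].
  have /h : (0 : R[i]) < e%:C%C by rewrite ltcR.
  by apply: filterS => x /=; rewrite Nm_le NmC.
apply/cvgrPdist_le => e /posC[r r0 ->]; apply: filterS (h r r0) => x /=.
by rewrite Nm_le NmC.
Qed.

Lemma Nm_mlop (R : realType) (A : cstarAlgType R) (m : multiplier A) x : Nm (ml m x) <= Nm (mlop m) * Nm x.
Proof. exact: (aop_le (mlop m)). Qed.
Lemma mnorm_mlop (R : realType) (A : cstarAlgType R) (m : multiplier A) : mnorm_le m 1 -> Nm (mlop m) <= 1.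
Proof.
move=> h; apply: aop_lub => // x; have := h x.
by rewrite mul1r leNm mul1r.
Qed.
Lemma mlop_mnorm (R : realType) (A : cstarAlgType R) (m : multiplier A) : Nm (mlop m) <= 1 -> mnorm_le m 1.
Proof.
move=> h x; rewrite mul1r leNm; apply: (le_trans (Nm_mlop m x)).
by rewrite -[leRHS]mul1r ler_wpM2r ?Nm_ge0.
Qed.
Lemma Nm_mlop_star (R : realType) (A : cstarAlgType R) (m : multiplier A) : Nm (mlop m^⋆) = Nm (mlop m).
Proof. by rewrite (shS (mlop_hom A)) sstar_Nm. Qed.

Lemma af_blin_lop (R : realType) (A : cstarAlgType R) (a : Lop A) : blin (af a).
Proof. by split; [exact: af_lin|exists (Nm a) => x; exact: aop_le]. Qed.

(* Extension of a possibly degenerate [pi : B -> M(C)] to [M(B)]: [P] is the projection of [C]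
   onto the closed submodule generated by [pi(B) C]. *)
Section Extension.
Variables (R : realType) (B C : cstarAlgType R) (pi : B -> multiplier C) (P : C -> C).
Hypotheses (rB : represented B) (hpi : star_hom pi) (bP : blin P).
Let j (p : B * C) : C := ml (pi p.1) p.2.
Hypotheses (Pj : forall b c, P (ml (pi b) c) = ml (pi b) c)
  (PN : forall u, cspan (range j) (P u))
  (Psa : forall x y, (P x)^⋆ ⋅ y = x^⋆ ⋅ P y).

Lemma ext_on (f g : C -> C) : blin f -> blin g -> (forall b c, f (ml (pi b) c) = g (ml (pi b) c)) ->
  forall u, f (P u) = g (P u).
Proof.
move=> bf bg e u; apply: (cspan_min (csub_eq bf bg)) (@PN u).
by move=> _ [[b c] _ <-]; exact: e.
Qed.

(** The extension acts by [pi(b) c ↦ pi(a b) c] on the submodule; as the bound involves only [P u],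
    it vanishes on the kernel of [P]. *)
Lemma theta_ex (a : multiplier B) : exists f : C -> C, [/\ linear f,
  forall u, Nm (f u) <= Nm (mlop a) * Nm (P u) & forall b c, f (ml (pi b) c) = ml (pi (ml a b)) c].
Proof.
have dn u (e : R) : 0 < e -> exists s, Nm (P u - comb j s) <= e.
  move=> e0; have := @PN u; rewrite cspanE => /(_ e e0)[y /lspan_comb[s ->] h].
  by exists s.
have bd := @module_bound R B C (fun b => ml (pi b)) a (Nm (mlop a)) rB
  (fun b => ml_linear (pi b)) (fun v => (msh_blinl v hpi).1)
  (fun x y v => ltac:(by rewrite /= (shM hpi))) (msh_contr hpi) (Nm_ge0 _) (Nm_mlop a).
have [f [fl fb fE]] := lift_on bP.1 dn bd.
by exists f; split=> // b c; rewrite (fE _ (b, c)).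
Qed.
Definition theta a : C -> C := projT1 (cid (theta_ex a)).
Lemma theta_lin a : linear (theta a). Proof. by rewrite /theta; case: cid => f []. Qed.
Lemma theta_Nm a u : Nm (theta a u) <= Nm (mlop a) * Nm (P u).
Proof. by rewrite /theta; case: cid => f []. Qed.
Lemma thetaE a b c : theta a (ml (pi b) c) = ml (pi (ml a b)) c.
Proof. by rewrite /theta; case: cid => f []. Qed.
Lemma theta_blin a : blin (theta a).
Proof.
have [K K0 hK] := blin_bound bP; split; first exact: theta_lin.
exists (Nm (mlop a) * K) => u; apply: (le_trans (theta_Nm a u)).
by rewrite -mulrA ler_wpM2l ?Nm_ge0.
Qed.
Lemma P_idem u : P (P u) = P u.
Proof. by apply: (ext_on bP (blin_id _)) => b c; exact: Pj. Qed.
Lemma theta_P a u : theta a (P u) = theta a u.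
Proof.
apply/subr0_eq/Nm_eq0/eqP; rewrite -(linB (theta_lin a)) eq_le Nm_ge0 andbT.
by apply: (le_trans (theta_Nm _ _)); rewrite (linB bP.1) P_idem subrr Nm0 mulr0.
Qed.
Lemma P_theta a u : P (theta a u) = theta a u.
Proof.
rewrite -theta_P; apply: (ext_on (f := P \o theta a)); [|exact: theta_blin|].
  by apply: blin_comp; [exact: bP|exact: theta_blin].
by move=> b c /=; rewrite thetaE Pj.
Qed.

Lemma theta_adj a x y : (theta a x)^⋆ ⋅ y = x^⋆ ⋅ theta a^⋆ y.
Proof.
have h0 a' p b c : (theta a' (j p))^⋆ ⋅ ml (pi b) c = (j p)^⋆ ⋅ theta a'^⋆ (ml (pi b) c).
  rewrite /j !thetaE !mlopP -!mM -!(shS hpi) -!(shM hpi).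
  by rewrite mlopP.
have h1 a' p v : (theta a' (j p))^⋆ ⋅ P v = (j p)^⋆ ⋅ theta a'^⋆ (P v).
  apply: (ext_on (f := fun v => (theta a' (j p))^⋆ ⋅ v) (g := fun v => (j p)^⋆ ⋅ theta a'^⋆ v)).
  - exact: blin_smull.
  - exact: (blin_comp (blin_smull _) (theta_blin _)).
  - by move=> b c; exact: h0.
have h2 u v : (P v)^⋆ ⋅ theta a (P u) = (theta a^⋆ (P v))^⋆ ⋅ P u.
  apply: (ext_on (f := fun u => (P v)^⋆ ⋅ theta a u) (g := fun u => (theta a^⋆ (P v))^⋆ ⋅ u)).
  - exact: (blin_comp (blin_smull _) (theta_blin _)).
  - exact: blin_smull.
  move=> b c; apply: sstar_inj; rewrite !sstarM !sstarK.
  exact: (h1 a (b, c) v).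
apply: sstar_inj; rewrite !sstarM !sstarK -P_theta -Psa -[theta a x]theta_P h2.
by rewrite theta_P -Psa P_theta.
Qed.

Fact qext_b a : exists M : R, forall x, Nm (theta a x) <= M * Nm x.
Proof. exact: (theta_blin a).2. Qed.
Definition qext a : Lop C := @Aop _ _ (bpairing C) (theta a) (theta a^⋆) (theta_adj a) (qext_b a).

Lemma theta_ext (f : C -> C) a : blin f -> (forall u, f (P u) = f u) ->
  (forall b c, f (ml (pi b) c) = theta a (ml (pi b) c)) -> f =1 theta a.
Proof.
move=> bf fP e u; rewrite -fP -theta_P.
by apply: (ext_on bf (theta_blin a)).
Qed.

Lemma qext_hom : star_hom qext.
Proof.
split=> [z a b|a b|a]; apply: aop_ext => u //; apply/esym; move: u; apply: theta_ext.
- by apply: (af_blin_lop (z *: qext a + qext b)).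
- by move=> u; rewrite !af_add !af_scale /= !theta_P.
- by move=> b' c; rewrite af_add af_scale /= !thetaE /= (sh_lin hpi) /=.
- exact: (af_blin_lop (qext a ⋅ qext b)).
- by move=> u /=; rewrite theta_P.
- by move=> b' c /=; rewrite !thetaE.
Qed.

Lemma qext_memb b : mop (qext (memb b)) = pi b.
Proof.
apply: ml_inj => u /=; apply/esym; move: u; apply: theta_ext; first exact: ml_blin.
  move=> u; apply: cstar_injl => c; rewrite -[c]sstarK.
  have e v : c^⋆^⋆ ⋅ ml (pi b) v = (P (ml (pi b^⋆) c^⋆))^⋆ ⋅ v.
    by rewrite Pj (shS hpi) mlopP !sstarK.
  by rewrite !e -!Psa P_idem.
by move=> b' c; rewrite thetaE -mM -(shM hpi).
Qed.

(** On the unit ball the maps [theta n] are uniformly bounded, so the vectors at which they converge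
    form a closed subspace. It contains every [pi(b) c], and [theta] sees only [P u]. *)
Lemma qext_strict (F : set_system (multiplier B)) (m : multiplier B) : Filter F ->
  F [set n | mnorm_le n 1] -> mnorm_le m 1 ->
  (forall a, ml n a @[n --> F] --> ml m a) -> forall u, theta n u @[n --> F] --> theta m u.
Proof.
move=> FF F1 /mnorm_mlop m1 Fm.
have [K K0 hK] := blin_bound bP.
have tN n v : Nm (mlop n) <= 1 -> Nm (theta n v) <= K * Nm v.
  move=> n1; apply: (le_trans (theta_Nm _ _)); apply: (le_trans _ (hK v)).
  by rewrite -[leRHS]mul1r ler_wpM2r ?Nm_ge0.
pose G := [set v : C | forall e : R, 0 < e -> F [set n | Nm (theta n v - theta m v) <= e]].
have cG : csub G.
  split; first split.
  - move=> e e0; apply: filterS F1 => n _ /=.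
    by rewrite !(lin0 (theta_lin _)) subrr Nm0 ltW.
  - move=> z v w hv hw e e0; have K1 : 0 < Nm z + 1 by have := Nm_ge0 z; lra.
    have e2 : 0 < e / 2 by rewrite divr_gt0.
    apply: filterS (filterI (hv _ (divr_gt0 e2 K1)) (hw _ e2)) => n [/= h1 h2].
    rewrite !theta_lin opprD addrACA -scalerBr; apply: (le_trans (NmD _ _)); rewrite NmZ.
    rewrite ler_pdivlMr // in h1.
    have := ler_wpM2r (Nm_ge0 (theta n v - theta m v)) (_ : Nm z <= Nm z + 1).
    by rewrite lerDl ler01 => /(_ isT); lra.
  - move=> v h e e0; have K1 : 0 < 4 * K by rewrite mulr_gt0.
    have [w hw vw] := h _ (divr_gt0 e0 K1).
    have e2 : 0 < e / 2 by rewrite divr_gt0.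
    apply: filterS (filterI F1 (hw _ e2)) => n [/= /mnorm_mlop n1 h2].
    have -> : theta n v - theta m v = theta n (v - w) - theta m (v - w) + (theta n w - theta m w).
      by rewrite !(linB (theta_lin _)); zmod.
    have h3 := tN n (v - w) n1; have h4 := tN m (v - w) m1.
    have h5 : K * Nm (v - w) <= e / 4.
      rewrite ler_pdivlMr // in vw; lra.
    apply: (le_trans (NmD _ _)); have := NmD (theta n (v - w)) (- theta m (v - w)); rewrite NmN; lra.
move=> u; apply/cvg_Nm => e e0.
have : G (P u).
  apply: (cspan_min cG) (@PN u) => _ [[b c] _ <-] d d0 /=.
  have K1 : 0 < Nm c + 1 by have := Nm_ge0 c; lra.
  have /cvg_Nm h := Fm b; apply: filterS (h _ (divr_gt0 d0 K1)) => n /= hn.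
  rewrite /j /= !thetaE -[X in Nm X]/(ml (pi (ml n b) - pi (ml m b)) c) -(shB hpi).
  apply: (le_trans (msh_contr hpi _ _)); rewrite ler_pdivlMr // in hn.
  by apply: le_trans hn; rewrite ler_wpM2l ?Nm_ge0 //; lra.
by move=> /(_ e e0); apply: filterS => n /=; rewrite !theta_P.
Qed.

Lemma mext_spec : [/\ star_hom (mext pi), mstrict (mext pi) & forall b, mext pi (memb b) = pi b].
Proof.
rewrite /mext; case: xgetP => [q' _ //|/(_ (fun a => mop (qext a))) []].
split; last exact: qext_memb.
  exact: (sh_comp (mop_hom C) qext_hom).
move=> F m FF F1 m1 Fm a; split.
  apply/cvg_Nm => e e0.
  have h : theta n a @[n --> F] --> theta m a.
    by apply: (qext_strict FF F1 m1) => a'; exact: (Fm a').1.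
  by move/cvg_Nm : h => /(_ e e0).
have sE n : mr (mop (qext n)) a = (theta n^⋆ a^⋆)^⋆ by [].
apply/cvg_Nm => e e0.
have FF' : Filter ((@sstar _ (multiplier B)) @ F) by exact: fmap_filter.
have h : theta n a^⋆ @[n --> (@sstar _ (multiplier B)) @ F] --> theta m^⋆ a^⋆.
  apply: (qext_strict FF').
  - change (F [set n | mnorm_le n^⋆ 1]); apply: filterS F1 => n /mnorm_mlop h /=.
    by apply: mlop_mnorm; rewrite Nm_mlop_star.
  - by apply: mlop_mnorm; rewrite Nm_mlop_star; exact: mnorm_mlop.
  move=> b; apply/cvg_Nm => d d0; have /cvg_Nm h := (Fm b^⋆).2.
  change (F [set n | Nm ((mr n b^⋆)^⋆ - (mr m b^⋆)^⋆) <= d]); apply: filterS (h d d0) => n /=.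
  have -> : (mr n b^⋆)^⋆ - (mr m b^⋆)^⋆ = (mr n b^⋆ - mr m b^⋆)^⋆.
    by rewrite sstarD -[- mr m _]scaleN1r sstarZ cjN cj1 scaleN1r.
  by rewrite sstar_Nm.
have {}h : F [set n | Nm (theta n^⋆ a^⋆ - theta m^⋆ a^⋆) <= e] by move/cvg_Nm : h => /(_ e e0).
change (F [set n | Nm ((theta n^⋆ a^⋆)^⋆ - (theta m^⋆ a^⋆)^⋆) <= e]); apply: filterS h => n /=.
have -> : (theta n^⋆ a^⋆)^⋆ - (theta m^⋆ a^⋆)^⋆ = (theta n^⋆ a^⋆ - theta m^⋆ a^⋆)^⋆.
  by rewrite sstarD -[- theta _ _]scaleN1r sstarZ cjN cj1 scaleN1r.
by rewrite sstar_Nm.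
Qed.

End Extension.

(** [a ⋅ memb b = memb (ml a b)], so multiplicativity forces the effect of the extension on the
    range of [pi]. *)
Lemma mextE (R : realType) (B C : cstarAlgType R) (pi : B -> multiplier C) :
  [/\ star_hom (mext pi), mstrict (mext pi) & forall b, mext pi (memb b) = pi b] ->
  forall a b, mext pi a ⋅ pi b = pi (ml a b).
Proof.
move=> [qh _ qE] a b; rewrite -!qE -(shM qh); congr (mext pi _).
by apply: ml_inj => x; rewrite mM /= ml_mul.
Qed.

Lemma mext_nondeg (R : realType) (B C : cstarAlgType R) (pi : B -> multiplier C) :
  represented B -> star_hom pi -> nondegenerate pi ->
  [/\ star_hom (mext pi), mstrict (mext pi) & forall b, mext pi (memb b) = pi b].
Proof.
move=> rB hpi nd; apply: (mext_spec (P := id)) => //; first exact: blin_id.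
move=> u; have : cspan [set ml (pi b) c | b in setT & c in setT] u by rewrite -/(nondegenerate pi) nd.
by apply: cspan_mono => _ [b _ [c _ <-]]; exists (b, c).
Qed.

(* Strictness on the unit ball, unfolded at [0]. *)
Definition near0 (R : realType) (B : cstarAlgType R) (s : seq B) (e : R) (x : B) : Prop :=
  Nm x <= 1 /\ forall b, b \in s -> Nm (x ⋅ b) <= e /\ Nm (b ⋅ x) <= e.

(** Strict continuity is applied to the filter of strict neighbourhoods of [0] in the unit ball,
    which turns convergence of filters into finitely many norm conditions. *)
Lemma strict_near0 (R : realType) (B C : cstarAlgType R) (d : B -> multiplier C) :
  star_hom d -> strict d -> forall y (e : R), 0 < e ->
  exists s r, 0 < r /\ forall x, near0 s r x -> Nm (ml (d x) y) <= e.
Proof.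
move=> hd sd y e e0.
pose F : set_system B := [set U | exists s (r : R), 0 < r /\ forall x, near0 s r x -> U x].
have FF : Filter F.
  split.
  - by exists [::], 1; split.
  - move=> U V [s [r [r0 h]]] [s' [r' [r0' h']]].
    exists (s ++ s'), (Num.min r r'); split; first by rewrite lt_min r0.
    move=> x [x1 hx]; split; [apply: h|apply: h']; split=> // b bs;
      have [] := hx b; rewrite ?mem_cat ?bs ?orbT //; rewrite !le_min => /andP[? ?] /andP[? ?] //.
  - by move=> U V UV [s [r [r0 h]]]; exists s, r; split=> // x /h /UV.
have c0 : strict_cvg (@memb R B @ F) (memb 0).
  move=> a; split; apply/cvg_Nm => r r0; exists [:: a], r; split=> // x [_ hx] /=.
    by rewrite smul0l subr0; have [] := hx a (mem_head _ _).
  by rewrite smul0r subr0; have [] := hx a (mem_head _ _).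
have FU : F [set x | `|x| <= 1].
  by exists [::], 1; split=> // x [x1 _] /=; rewrite -[1]/(1%:C%C) Nm_le.
have n0 : `|0 : B| <= 1 by rewrite normr0 ler01.
have [/cvg_Nm h _] := sd F 0 FF FU n0 c0 y.
have [s [r [r0 hs]]] := h e e0; exists s, r; split=> // x /hs /=.
by rewrite (sh0 hd) subr0.
Qed.

(** * Strict maps and partial coactions *)

(** The basic strict neighbourhoods of [1] in the selfadjoint part of the unit ball. *)
Definition nearU (R : realType) (B : cstarAlgType R) (s : seq B) (e : R) (u : B) : Prop :=
  [/\ u^⋆ = u, Nm u <= 1 & forall b, b \in s -> Nm (u ⋅ b - b) <= e /\ Nm (b ⋅ u - b) <= e].

Section NearUnit.
Variables (R : realType) (B : cstarAlgType R).
Implicit Types (s : seq B) (u : B).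

Lemma nearU_ex s (e : R) : represented B -> 0 < e -> exists u, nearU s e u.
Proof. by move=> rB e0; have [u [us u1 h]] := approx_unit rB s e0; exists u. Qed.

Lemma nearU_cap s s' (e e' : R) : 0 < e -> 0 < e' -> exists t (r : R), 0 < r /\
  forall u, nearU t r u -> nearU s e u /\ nearU s' e' u.
Proof.
move=> e0 e0'; exists (s ++ s'), (Num.min e e'); split; first by rewrite lt_min e0.
move=> u [us u1 h]; split; split=> // b bs; have [] := h b; rewrite ?mem_cat ?bs ?orbT //;
  by rewrite !le_min => /andP[? ?] /andP[? ?].
Qed.

End NearUnit.

Section StrictProjection.
Variables (R : realType) (B C : cstarAlgType R) (d : B -> multiplier C).
Hypotheses (rB : represented B) (hd : star_hom d) (sd : strict d).

(* [z] is the strict limit of [d u], along approximate units [u], applied to [y]. *)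
Definition slim (y z : C) : Prop := forall e : R, 0 < e ->
  exists s (r : R), 0 < r /\ forall u, nearU s r u -> Nm (ml (d u) y - z) <= e.

Lemma slim_cauchy y (e : R) : 0 < e -> exists s (r : R), 0 < r /\
  forall u v, nearU s r u -> nearU s r v -> Nm (ml (d u) y - ml (d v) y) <= e.
Proof.
move=> e0; have e2 : 0 < e / 2 by rewrite divr_gt0.
have [s [r [r0 h]]] := strict_near0 hd sd y e2.
exists s, r; split=> // u v [us u1 hu] [vs v1 hv].
(* Half the difference stays in the unit ball, the only place where strictness is assumed. *)
pose x := (2^-1 : R)%:C%C *: (u - v).
have Nh (z : B) (K : R) : Nm z <= 2 * K -> Nm ((2^-1 : R)%:C%C *: z) <= K.
  by rewrite NmZr ger0_norm ?invr_ge0 //; lra.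
have : near0 s r x.
  split; first by apply: Nh; apply: (le_trans (NmD _ _)); rewrite NmN; lra.
  move=> b /[dup] /hu[h1 h2] /hv[h3 h4]; rewrite smulZl smulZr; split; apply: Nh.
    have -> : (u - v) ⋅ b = (u ⋅ b - b) - (v ⋅ b - b) by rewrite smulDl smulNl; zmod.
    by apply: (le_trans (NmD _ _)); rewrite NmN; lra.
  have -> : b ⋅ (u - v) = (b ⋅ u - b) - (b ⋅ v - b) by rewrite smulDr smulNr; zmod.
  by apply: (le_trans (NmD _ _)); rewrite NmN; lra.
move/h; rewrite /x (shZ hd) (shB hd) -[ml _ y]/((2^-1 : R)%:C%C *: (ml (d u) y - ml (d v) y)).
by rewrite NmZr ger0_norm ?invr_ge0 //; lra.
Qed.

Lemma slim_ex y : exists z, slim y z.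
Proof.
have /choice[sr srP] : forall n : nat, exists sr : seq B * R, 0 < sr.2 /\
    forall u v, nearU sr.1 sr.2 u -> nearU sr.1 sr.2 v -> Nm (ml (d u) y - ml (d v) y) <= ivn R n.
  by move=> n; have [s [r [r0 h]]] := slim_cauchy y (ivn_gt0 R n); exists (s, r).
have cap (n : nat) : exists s (r : R), 0 < r /\ forall u, nearU s r u ->
    forall k, (k <= n)%N -> nearU (sr k).1 (sr k).2 u.
  elim: n => [|n [s [r [r0 h]]]].
    by exists (sr 0%N).1, (sr 0%N).2; split; [exact: (srP 0%N).1|move=> u hu k; rewrite leqn0 => /eqP->].
  have [t [r' [r0' h']]] := nearU_cap s (sr n.+1).1 r0 (srP n.+1).1.
  exists t, r'; split=> // u /h'[hu hu'] k; rewrite leq_eqVlt => /orP[/eqP->//|].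
  exact: h.
(* [u n] meets the conditions of all stages up to [n], which makes the resulting sequence Cauchy. *)
have /choice[u hu] : forall n : nat, exists u, forall k, (k <= n)%N -> nearU (sr k).1 (sr k).2 u.
  move=> n; have [s [r [r0 h]]] := cap n; have [u /h hu] := nearU_ex s rB r0.
  by exists u.
have [|z hz] := @seq_complete R C (fun n => ml (d (u n)) y).
  move=> e e0; have [N hN] := invn_small e0; exists N => m n hm hn.
  by apply: le_trans (hN N (leqnn N)); apply: (srP N).2; exact: hu.
exists z => e e0; have e2 : 0 < e / 2 by rewrite divr_gt0.
have [N hN] := invn_small e2; have [N' hN'] := hz _ e2.
exists (sr N).1, (sr N).2; split; first exact: (srP N).1.
move=> v hv; have h1 := hN' _ (leq_maxr N N').
have h2 := (srP N).2 v (u (maxn N N')) hv (hu _ _ (leq_maxl N N')).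
have := NmT (ml (d v) y) (ml (d (u (maxn N N'))) y) z; have := hN N (leqnn N); lra.
Qed.

Lemma slim_uniq y z z' : slim y z -> slim y z' -> z = z'.
Proof.
move=> h h'; apply/subr0_eq; apply: (@Nm_smallM _ _ _ 2) => e e0.
have [s [r [r0 hs]]] := h e e0; have [s' [r' [r0' hs']]] := h' e e0.
have [t [q [q0 ht]]] := nearU_cap s s' r0 r0'.
have [u /ht[/hs h1 /hs' h2]] := nearU_ex t rB q0.
by have := NmT z (ml (d u) y) z'; rewrite (NmC z (ml (d u) y)); lra.
Qed.

(** The value of [d] at [1], obtained as a strict limit before the extension of [d] to multipliers
    is available. *)
Definition sproj y : C := projT1 (cid (slim_ex y)).
Lemma sprojP y : slim y (sproj y). Proof. by rewrite /sproj; case: cid. Qed.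

Lemma sproj_blin : blin sproj.
Proof.
split.
  move=> z x y; apply: (slim_uniq (sprojP _)) => e e0.
  have K0 : 0 < Nm z + 1 by have := Nm_ge0 z; lra.
  have e2 : 0 < e / 2 by rewrite divr_gt0.
  have [s [r [r0 h]]] := sprojP x (divr_gt0 e2 K0).
  have [s' [r' [r0' h']]] := sprojP y e2.
  have [t [q [q0 ht]]] := nearU_cap s s' r0 r0'; exists t, q; split=> // u /ht[/h h1 /h' h2].
  rewrite ml_linear opprD addrACA -scalerBr; apply: (le_trans (NmD _ _)); rewrite NmZ.
  rewrite ler_pdivlMr // in h1; have := Nm_ge0 (ml (d u) x - sproj x); nra.
exists 1 => y; apply: Nm_eps => e e0; have [s [r [r0 h]]] := sprojP y e0.
have [u hu] := nearU_ex s rB r0; have h1 := h u hu; have [_ u1 _] := hu.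
have := NmD (sproj y - ml (d u) y) (ml (d u) y); rewrite subrK (NmC (sproj y)).
have := msh_contr hd u y; have := Nm_ge0 y; nra.
Qed.

Lemma sproj_im b c : sproj (ml (d b) c) = ml (d b) c.
Proof.
apply: (slim_uniq (sprojP _)) => e e0.
have K0 : 0 < Nm c + 1 by have := Nm_ge0 c; lra.
exists [:: b], (e / (Nm c + 1)); split; first by rewrite divr_gt0.
move=> u [_ _ hu]; have [h _] := hu b (mem_head _ _).
rewrite -mM -(shM hd) -[X in Nm X]/(ml (d (u ⋅ b) - d b) c) -(shB hd).
apply: (le_trans (msh_contr hd _ _)); rewrite ler_pdivlMr // in h.
by apply: le_trans h; rewrite ler_wpM2l ?Nm_ge0 //; lra.
Qed.

Lemma sproj_span u : cspan (range (fun p : B * C => ml (d p.1) p.2)) (sproj u).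
Proof.
apply: (cspan_csub _).2 => e e0; have [s [r [r0 h]]] := sprojP u e0.
have [v /h hv] := nearU_ex s rB r0; exists (ml (d v) u); last by rewrite NmC.
by apply: sub_cspan; exists (v, u).
Qed.

Lemma sproj_sa x y : (sproj x)^⋆ ⋅ y = x^⋆ ⋅ sproj y.
Proof.
apply/subr0_eq; apply: (@Nm_smallM _ _ _ (Nm y + Nm x)) => e e0.
have [s [r [r0 hs]]] := sprojP x e0; have [s' [r' [r0' hs']]] := sprojP y e0.
have [t [q [q0 ht]]] := nearU_cap s s' r0 r0'.
have [u hu] := nearU_ex t rB q0; have [/hs h1 /hs' h2] := ht u hu; have [us _ _] := hu.
have -> : (sproj x)^⋆ ⋅ y - x^⋆ ⋅ sproj y =
    (sproj x - ml (d u) x)^⋆ ⋅ y + x^⋆ ⋅ (ml (d u) y - sproj y).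
  rewrite -{2}us (shS hd) sstarD -[- ml _ _]scaleN1r sstarZ cjN cj1 scaleN1r smulDl smulNl.
  by rewrite smulDr smulNr mlopP; zmod.
apply: (le_trans (NmD _ _)); rewrite mulrDl.
have h3 := smul_Nm (sproj x - ml (d u) x)^⋆ y; rewrite sstar_Nm NmC in h3.
have h4 := smul_Nm x^⋆ (ml (d u) y - sproj y); rewrite sstar_Nm in h4.
have := Nm_ge0 x; have := Nm_ge0 y; nra.
Qed.

Lemma mext_strict : [/\ star_hom (mext d), mstrict (mext d) & forall b, mext d (memb b) = d b].
Proof. exact: (mext_spec rB hd sproj_blin sproj_im sproj_span sproj_sa). Qed.

Fact msprojP x y : x ⋅ sproj y = (sproj x^⋆)^⋆ ⋅ y.
Proof. by rewrite sproj_sa sstarK. Qed.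
Definition msproj : multiplier C := Multiplier msprojP.
Lemma msproj_star : msproj^⋆ = msproj.
Proof. by apply: ml_inj => x /=; rewrite sstarK sstarK. Qed.
Lemma msproj_im b : msproj ⋅ d b = d b.
Proof. by apply: ml_inj => x; exact: sproj_im. Qed.

End StrictProjection.

Section PartialCoaction.
Variables (R : realType) (A : cstarBialg R) (C : cstarAlgType R) (T : tensorA A C).
Let mtt := @tt_min _ _ _ T.
Let mtl : min_tensor (@tl _ _ _ T). Proof. by have [] := @tlr_min _ _ _ T. Qed.
Let mtr : min_tensor (@tr _ _ _ T). Proof. by have [] := @tlr_min _ _ _ T. Qed.

Definition idD : tA T -> multiplier (tAA T) :=
  tens_mhom (@tt _ _ _ T) (@tr _ _ _ T) (@memb R C) (@Delta R A).

Lemma idD_hom : star_hom idD.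
Proof. by apply: tens_mhom_hom => //; [exact: memb_hom|exact: Delta_hom]. Qed.
Lemma idDE c a : idD (tt T c a) = mtens (@tr _ _ _ T) (memb c) (Delta a).
Proof. by apply: tens_mhomE => //; [exact: memb_hom|exact: Delta_hom]. Qed.

Lemma idD_total : cspan [set ml (idD x) y | x in setT & y in setT] = setT.
Proof.
apply/seteqP; split=> // y _.
apply: (cspan_all (mt_cspan mtr) (cspan_csub _)) => _ [c _ [z _ <-]].
apply: (@cspan2 _ _ _ _ (@tr _ _ _ T) [set c1 ⋅ c2 | c1 in setT & c2 in setT]
  [set ml (Delta a) z | a in setT & z in setT]).
- exact: (mt_blinr mtr).
- exact: (mt_blinl mtr).
- exact: cspan_csub.
- move=> _ _ [c1 _ [c2 _ <-]] [a _ [z' _ <-]]; apply: sub_cspan.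
  by exists (tt T c1 a) => //; exists (tr T c2 z') => //; rewrite idDE (mtensE mtr).
- exact: (cspan_mulr (mt_repl mtt)).
- by rewrite -/(nondegenerate _) (@Delta_nondeg R A).
Qed.

Lemma id_Delta_spec : [/\ star_hom (@id_Delta R A C T), mstrict (@id_Delta R A C T)
  & forall x, id_Delta (memb x) = idD x].
Proof. by apply: (mext_nondeg (mt_rep mtt) idD_hom); exact: idD_total. Qed.
Lemma id_Delta_hom : star_hom (@id_Delta R A C T). Proof. by have [] := id_Delta_spec. Qed.
Lemma id_DeltaM m x : id_Delta m ⋅ idD x = idD (ml m x).
Proof. exact: (mextE id_Delta_spec). Qed.

Lemma id_Delta_ext (V : normedModType R[i]) (f g : tAA T -> V) : blin f -> blin g ->
  (forall x y, f (ml (idD x) y) = g (ml (idD x) y)) -> f =1 g.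
Proof.
move=> bf bg e; apply: (blin_ext bf bg idD_total) => _ [x _ [y _ <-]].
exact: e.
Qed.

Variable d : C -> multiplier (tA T).

Lemma coact_id_hom : star_hom d -> star_hom (coact_id d).
Proof. by move=> hd; apply: tens_mhom_hom => //; exact: memb_hom. Qed.
Lemma coact_idE c a : star_hom d -> coact_id d (tt T c a) = mtens (@tl _ _ _ T) (d c) (memb a).
Proof. by move=> hd; apply: tens_mhomE => //; exact: memb_hom. Qed.

(** The projection that belongs to [d (x) id] is the one of [d] tensored with the identity. *)
Lemma coact_id_spec : star_hom d -> strict d ->
  [/\ star_hom (mext (coact_id d)), mstrict (mext (coact_id d))
    & forall x, mext (coact_id d) (memb x) = coact_id d x].
Proof.
move=> hd sd; have rC := mt_repl mtt; have hk := coact_id_hom hd.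
pose Pm := mtens (@tl _ _ _ T) (msproj rC hd sd) (mone A).
have Pk x : Pm ⋅ coact_id d x = coact_id d x.
  apply: ml_inj => y; rewrite mM; move: x.
  apply: (mt_ext mtt (f := fun x => ml Pm (ml (coact_id d x) y)) (g := fun x => ml (coact_id d x) y)).
  - exact: (blin_comp (ml_blin Pm) (msh_blinl y hk)).
  - exact: msh_blinl.
  by move=> c a; rewrite -mM coact_idE // /Pm (mtensM mtl) msproj_im.
apply: (mext_spec (P := ml Pm) (mt_rep mtt) hk (ml_blin _)).
- by move=> x y; rewrite -mM Pk.
- move: (cspan_csub (range (fun p : tA T * tAA T => ml (coact_id d p.1) p.2))) => cS u.
  move: u; apply: (cspan_all (mt_cspan mtl) (csub_pre (ml_blin Pm) cS)) => _ [z _ [a' _ <-]] /=.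
  rewrite /Pm (mtensE mtl).
  apply: (@cspan2 _ _ _ _ (@tl _ _ _ T) (range (fun p : C * tA T => ml (d p.1) p.2))
    [set a1 ⋅ a2 | a1 in setT & a2 in setT]).
  + exact: (mt_blinr mtl).
  + exact: (mt_blinl mtl).
  + exact: cS.
  + move=> _ _ [[c z'] _ <-] [a1 _ [a2 _ <-]]; apply: sub_cspan.
    by exists (tt T c a1, tl z' a2) => //=; rewrite coact_idE // (mtensE mtl).
  + exact: sproj_span.
  + exact: (cspan_mulr (mt_repr mtt)).
- move=> x y; rewrite mlopP /Pm (mtens_star mtl) msproj_star.
  by have -> : (mone A)^⋆ = mone A by apply: ml_inj => a /=; rewrite sstarK.
Qed.

(* The projection [d(1)] disappears from the coaction identity once it acts on [d(C)]. *)
Lemma partial_coactE : partial_coaction d -> forall c c' a,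
  coact_id d (ml (d c) (tt T c' a)) = id_Delta (d c) ⋅ mtens (@tl _ _ _ T) (d c') (memb a).
Proof.
move=> [hd sd _ hco] c c' a.
have sp := coact_id_spec hd sd; have [qh _ qE] := sp.
have [eh _ eE] := mext_strict (mt_repl mtt) hd sd.
set P1 := tens_one (mext d (mone C)).
have P1s : P1^⋆ = P1.
  rewrite /P1 /tens_one (mtens_star mtl) -(shS eh).
  have o (X : cstarAlgType R) : (mone X)^⋆ = mone X by apply: ml_inj => x /=; rewrite sstarK.
  by rewrite !o.
have P1d : P1 ⋅ mtens (@tl _ _ _ T) (d c') (memb a) = mtens (@tl _ _ _ T) (d c') (memb a).
  rewrite /P1 /tens_one (mtensM mtl); congr mtens; last exact: ml_inj.
  by rewrite -!eE -(shM eh); congr (mext d _); exact: ml_inj.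
have cm : P1 ⋅ id_Delta (d c) = id_Delta (d c) ⋅ P1.
  rewrite -hco -[mext _ _]sstarK -(shS qh) -(shS hd) hco sstarM P1s -/P1.
  by rewrite -(shS id_Delta_hom) -(shS hd) sstarK.
by rewrite -(mextE sp) hco cm -smulA coact_idE // P1d.
Qed.

End PartialCoaction.

(** * Slices of multipliers *)

Section FunctionalTools.
Variables (R : realType) (A : cstarAlgType R).

Lemma bf_blin (w : A -> R[i]) : bounded_functional w -> blin (w : A -> R[i]^o).
Proof. by move/bounded_functionalE. Qed.

Lemma bf_comp (w : A -> R[i]) (f : A -> A) : bounded_functional w -> blin f ->
  bounded_functional (fun a => w (f a)).
Proof. by move=> /bf_blin bw bf; apply/bounded_functionalE; exact: (blin_comp bw bf). Qed.

Lemma bf_mulr (w : A -> R[i]) u : bounded_functional w -> bounded_functional (fun a => w (a ⋅ u)).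
Proof. by move=> bw; apply: bf_comp => //; exact: blin_smulr. Qed.
Lemma bf_mull (w : A -> R[i]) u : bounded_functional w -> bounded_functional (fun a => w (u ⋅ a)).
Proof. by move=> bw; apply: bf_comp => //; exact: blin_smull. Qed.

Lemma bf_conj (w : A -> R[i]) : bounded_functional w -> bounded_functional (fun a => (w a^⋆)^*).
Proof.
move=> /bf_blin[wl [M hM]]; apply/bounded_functionalE; split.
  by move=> z x y; rewrite sstar_antilinear wl cjD cjM cjK.
by exists M => x; rewrite Nm_conj -[Nm x]sstar_Nm.
Qed.
End FunctionalTools.

Section MultiplierSlices.
Variables (R : realType) (B A T : cstarAlgType R) (t : B -> A -> T).
Hypothesis mt : min_tensor t.
Local Notation sl := (slice t).
Local Notation one_t a := (mtens t (mone B) (memb a)).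
Local Notation t_one b := (mtens t (memb b) (mone A)).
Implicit Types (w : A -> R[i]) (m : multiplier T).

Lemma slice_mull w b x : bounded_functional w -> sl w (ml (t_one b) x) = b ⋅ sl w x.
Proof.
move=> bw; have bs := slice_blin mt bw; move: x.
apply: (mt_ext mt (f := fun x => sl w (ml (t_one b) x)) (g := fun x => b ⋅ sl w x)).
- exact: (blin_comp bs (ml_blin _)).
- exact: (blin_comp (blin_smull b) bs).
by move=> b' a; rewrite (mtensE mt) !(sliceE mt) // smulZr.
Qed.
Lemma slice_mulr w b x : bounded_functional w -> sl w (mr (t_one b) x) = sl w x ⋅ b.
Proof.
move=> bw; have bs := slice_blin mt bw; move: x.
apply: (mt_ext mt (f := fun x => sl w (mr (t_one b) x)) (g := fun x => sl w x ⋅ b)).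
- exact: (blin_comp bs (mr_blin _)).
- exact: (blin_comp (blin_smulr b) bs).
by move=> b' a; rewrite (mtensEr mt) !(sliceE mt) // smulZl.
Qed.
Lemma slice_onel w a x : bounded_functional w ->
  sl w (ml (one_t a) x) = sl (fun a' => w (a ⋅ a')) x.
Proof.
move=> bw; have bs := slice_blin mt bw; have bw' := bf_mull a bw; move: x.
apply: (mt_ext mt (f := fun x => sl w (ml (one_t a) x)) (g := sl (fun a' => w (a ⋅ a')))).
- exact: (blin_comp bs (ml_blin _)).
- exact: slice_blin.
by move=> b' a'; rewrite (mtensE mt) !(sliceE mt).
Qed.
Lemma slice_oner w a x : bounded_functional w ->
  sl w (mr (one_t a) x) = sl (fun a' => w (a' ⋅ a)) x.
Proof.
move=> bw; have bs := slice_blin mt bw; have bw' := bf_mulr a bw; move: x.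
apply: (mt_ext mt (f := fun x => sl w (mr (one_t a) x)) (g := sl (fun a' => w (a' ⋅ a)))).
- exact: (blin_comp bs (mr_blin _)).
- exact: slice_blin.
by move=> b' a'; rewrite (mtensEr mt) !(sliceE mt).
Qed.
Lemma one_tB a b : one_t a ⋅ t_one b = memb (t b a).
Proof. by rewrite (mtensM mt) -(mtens_memb mt); congr mtens; exact: ml_inj. Qed.
Lemma t_oneB a b : t_one b ⋅ one_t a = memb (t b a).
Proof. by rewrite (mtensM mt) -(mtens_memb mt); congr mtens; exact: ml_inj. Qed.
Lemma mr_range m a x b : m ⋅ one_t a = memb x -> mr (t_one b) x = ml m (t b a).
Proof.
move=> h; apply: (@memb_inj _ T).
have -> : memb (ml m (t b a)) = m ⋅ memb (t b a) by apply: ml_inj => y; rewrite mM /= ml_mul.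
have -> : memb (mr (t_one b) x) = memb x ⋅ t_one b by apply: ml_inj => y; rewrite mM /= mlrP.
by rewrite -h -smulA one_tB.
Qed.

Definition mslice_spec w (s : multiplier T -> multiplier B) : Prop :=
  [/\ linear s, mstrict s & forall x, s (memb x) = memb (slice t w x)].

(** [m ⋅ memb u] tends strictly to [m] along approximate units [u], and a strict slice respects this
    limit once [m] is scaled into the unit ball. *)
Lemma mslice_approx w s m b (e : R) : bounded_functional w -> mslice_spec w s -> 0 < e ->
  exists S (r : R), 0 < r /\ forall u, nearU S r u -> Nm (ml (s m) b - sl w (ml m u) ⋅ b) <= e.
Proof.
move=> bw [sl' ss sE] e0; have bs := slice_blin mt bw.
pose c : R := (Nm (mlop m) + 1)^-1; have K0 : 0 < Nm (mlop m) + 1 by have := Nm_ge0 (mlop m); lra.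
have c0 : 0 < c by rewrite invr_gt0.
pose m' := c%:C%C *: m.
have m'1 : Nm (mlop m') <= 1.
  rewrite (shZ (mlop_hom T)) NmZr gtr0_norm // /c mulrC ler_pdivrMr // mul1r; lra.
pose F : set_system (multiplier T) :=
  [set U | exists S (r : R), 0 < r /\ forall u, nearU S r u -> U (m' ⋅ memb u)].
have FF : Filter F.
  split; first by exists [::], 1; split.
    move=> U V [S [r [r0 h]]] [S' [r' [r0' h']]].
    have [S2 [r2 [r20 h2]]] := nearU_cap S S' r0 r0'.
    by exists S2, r2; split=> // u /h2[/h ? /h' ?].
  by move=> U V UV [S [r [r0 h]]]; exists S, r; split=> // u /h /UV.
have mm u : m' ⋅ memb u = memb (ml m' u) by apply: ml_inj => y; exact: ml_mul.
have F1 : F [set n | mnorm_le n 1].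
  exists [::], 1; split=> // u [_ u1 _] /=; apply: mlop_mnorm.
  rewrite (shM (mlop_hom T)); apply: (le_trans (smul_Nm _ _)); rewrite mulr_ile1 ?Nm_ge0 //.
  by apply: le_trans u1; exact: (sh_contr (sh_comp (mlop_hom T) (memb_hom T))).
have Fm : strict_cvg F m'.
  move=> a; split; apply/cvg_Nm => r r0.
    have L0 : 0 < Nm (mlop m') + 1 by have := Nm_ge0 (mlop m'); lra.
    exists [:: a], r; split=> // u [_ _ h] /=; have [h1 _] := h a (mem_head _ _).
    rewrite -(linB (ml_linear m')); apply: (le_trans (Nm_mlop _ _)).
    by have := Nm_ge0 (u ⋅ a - a); nra.
  exists [:: mr m' a], r; split=> // u [_ _ h] /=.
  by have [_] := h (mr m' a) (mem_head _ _).
have [/cvg_Nm h _] := ss F m' FF F1 (mlop_mnorm m'1) Fm b.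
have [S [r [r0 hS]]] := h _ (mulr_gt0 c0 e0); exists S, r; split=> // u /hS /=.
have -> : ml (s (m' ⋅ memb u)) b = c%:C%C *: (sl w (ml m u) ⋅ b).
  by rewrite mm sE /= (linZ bs.1) smulZl.
have -> : ml (s m') b = c%:C%C *: ml (s m) b by rewrite /m' (linZ sl').
by rewrite -scalerBr NmZr gtr0_norm // NmC ler_pM2l.
Qed.

(** Replacing [w] by [w (. u0)] puts [m ⋅ one_t u0], an element of [T], in the place of the
    multiplier [m]. *)
Lemma mslice_near w m (e : R) : bounded_functional w -> 0 < e ->
  (forall a, exists x, m ⋅ one_t a = memb x) ->
  exists w' a x, [/\ bounded_functional w', m ⋅ one_t a = memb x &
    forall b, Nm (ml (mslice t w m) b - sl w' x ⋅ b) <= e * Nm b].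
Proof.
move=> bw e0 hr; have rA := mt_repr mt.
(* In the branch where [xget] returns its default value [0], the zero functional is taken. *)
rewrite /mslice; case: xgetP => [s _ hs|_]; last first.
  have [x hx] := hr 0; exists (fun=> 0), 0, x.
  have b0 : bounded_functional (fun _ : A => 0 : R[i]).
    by apply/bounded_functionalE; exact: blin0.
  split=> // b; rewrite -(slice_uniq mt (s := fun=> 0) b0) //=; last first.
  - by move=> b' a; rewrite scale0r.
  - exact: blin0.
  by rewrite smul0l subrr Nm0 mulr_ge0 ?Nm_ge0 ?ltW.
have bs := slice_blin mt bw; set N := Nm (mlop m) + 1.
have N0 : 0 < N by rewrite /N; have := Nm_ge0 (mlop m); lra.
have d0 : 0 < e / N by rewrite divr_gt0.
have [u0 [u01 hu0]] := functional_factor rA bw d0.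
have [x hx] := hr u0; exists w, u0, x; split=> // b; apply: Nm_eps => g g0.
have [K K0 hK] := blin_bound bs.
have g2 : 0 < g / 2 by rewrite divr_gt0.
have [S [r [r0 h1]]] := mslice_approx m b bw hs g2.
have KN : 0 < K * N by rewrite mulr_gt0.
have r0' : 0 < g / 2 / (K * N) by rewrite divr_gt0.
have [S' [r' [r'0 h2]]] := nearU_cap S [:: t b u0] r0 r0'.
have [u /h2[/h1 {}h1 [_ u1 h3]]] := nearU_ex S' (mt_rep mt) r'0.
have {h3}[h3 _] := h3 _ (mem_head _ _).
have bw0 := bf_mulr u0 bw.
have e1 : sl (fun a => w (a ⋅ u0)) (ml m u) ⋅ b = sl w (ml m (u ⋅ t b u0)).
  rewrite -slice_mulr // -slice_oner // ml_mul; congr (sl w).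
  rewrite -[LHS]/(mr (t_one b ⋅ one_t u0) (ml m u)) t_oneB //.
have e2 : sl w x ⋅ b = sl w (ml m (t b u0)) by rewrite -slice_mulr // (mr_range _ hx).
have h4 : Nm (sl w (ml m u) ⋅ b - sl w (ml m (u ⋅ t b u0))) <= e * Nm b.
  rewrite -e1 -smulNl -smulDl.
  have bd : blin (fun a => w a - w (a ⋅ u0) : R[i]^o).
    have [wl _] := bf_blin bw; split; last by exists (e / N); exact: hu0.
    by move=> z a a'; rewrite smulDl smulZl !wl scalerBr opprD addrACA.
  have bfd : bounded_functional (fun a => w a - w (a ⋅ u0)) by apply/bounded_functionalE.
  have -> : sl w (ml m u) - sl (fun a => w (a ⋅ u0)) (ml m u) = sl (fun a => w a - w (a ⋅ u0)) (ml m u).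
    move: (ml m u); apply: (slice_uniq mt (s := fun y => sl w y - sl (fun a => w (a ⋅ u0)) y) bfd).
      have := blin_lin (-1) (slice_blin mt bw0) bs; congr blin; apply/funext => y.
      by rewrite scaleN1r addrC.
    by move=> b' a; rewrite !(sliceE mt) // scalerBl.
  apply: (le_trans (smul_Nm _ _)); rewrite ler_wpM2r ?Nm_ge0 //.
  apply: (le_trans (slice_Nm mt bfd (ltW d0) hu0 _)).
  rewrite mulrAC ler_pdivrMr // ler_pM2l //; apply: (le_trans (Nm_mlop _ _)).
  by rewrite /N; have := Nm_ge0 (mlop m); have := Nm_ge0 u; nra.
have h5 : Nm (sl w (ml m (u ⋅ t b u0)) - sl w (ml m (t b u0))) <= g / 2.
  rewrite -(linB bs.1) -(linB (ml_linear m)); apply: (le_trans (hK _)).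
  rewrite ler_pdivlMr // mulrC -mulrA in h3; apply: le_trans h3; rewrite ler_pM2l //.
  by apply: (le_trans (Nm_mlop _ _)); rewrite ler_wpM2r ?Nm_ge0 // /N; lra.
rewrite e2.
have := NmT (ml (s m) b) (sl w (ml m u) ⋅ b) (sl w (ml m (t b u0))).
have := NmT (sl w (ml m u) ⋅ b) (sl w (ml m (u ⋅ t b u0))) (sl w (ml m (t b u0))).
lra.
Qed.

Section TwoSided.
Variables (w : A -> R[i]) (a a' : A).
Hypothesis bw : bounded_functional w.
Let w2 x := w (a' ⋅ (x ⋅ a)).

Lemma bf_two : bounded_functional w2.
Proof. exact: (bf_mulr a (bf_mull a' bw)). Qed.

Let lE m b := sl w (ml (one_t a') (ml m (t b a))).
Let rE m b := sl w (mr (one_t a) (mr m (t b a'))).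
Let lrE m b b' : b ⋅ lE m b' = rE m b ⋅ b'.
Proof.
rewrite /lE /rE -slice_mull // -slice_mulr //; congr (sl w).
rewrite -[LHS]/(ml (t_one b ⋅ one_t a') (ml m (t b' a))).
rewrite -[RHS]/(mr (one_t a ⋅ t_one b') (mr m (t b a'))) one_tB t_oneB /=.
exact: mlrP.
Qed.
(** For the functional [w (a' . a)] the slice of any multiplier can be written down: on the left
    through [m (b (x) a)], on the right through [(b (x) a') m]. *)
Definition mslice2 m : multiplier B := Multiplier (lrE m).

Lemma mslice2_memb x : mslice2 (memb x) = memb (sl w2 x).
Proof.
apply: ml_inj => b /=; rewrite /lE; have bw2 := bf_two; move: x.
apply: (mt_ext mt (f := fun x => sl w (ml (one_t a') (x ⋅ t b a))) (g := fun x => sl w2 x ⋅ b)).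
- exact: (blin_comp (slice_blin mt bw) (blin_comp (ml_blin _) (blin_smulr _))).
- exact: (blin_comp (blin_smulr _) (slice_blin mt bw2)).
by move=> b1 a1; rewrite (mt_mul mt) (mtensE mt) !(sliceE mt) // smulZl.
Qed.

Lemma mslice2_spec : mslice_spec w2 mslice2.
Proof.
have bs := slice_blin mt bw; split; last exact: mslice2_memb.
  move=> z m n; apply: ml_inj => b /=; rewrite /lE /=.
  by rewrite (ml_linear (one_t a')) bs.1.
move=> F m FF _ _ Fm b; split; apply/cvg_Nm => e e0.
  have [K K0 hK] := blin_bound (blin_comp bs (ml_blin (one_t a'))).
  have [/cvg_Nm h _] := Fm (t b a); have {}h := h _ (divr_gt0 e0 K0).
  change (F [set n | Nm (lE n b - lE m b) <= e]); apply: filterS h => n /= hn; rewrite /lE -(linB bs.1) -(linB (ml_linear _)).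
  by apply: (le_trans (hK _)); rewrite mulrC -ler_pdivlMr.
have [K K0 hK] := blin_bound (blin_comp bs (mr_blin (one_t a))).
have [_ /cvg_Nm h] := Fm (t b a'); have {}h := h _ (divr_gt0 e0 K0).
change (F [set n | Nm (rE n b - rE m b) <= e]); apply: filterS h => n /= hn; rewrite /rE -(linB bs.1) -(linB (mr_linear _)).
by apply: (le_trans (hK _)); rewrite mulrC -ler_pdivlMr.
Qed.

(** By [mslice_approx] all strict slices agree at [m], and [mslice2] shows that one exists. *)
Lemma mslice_two m x : m ⋅ one_t a = memb x -> mslice t w2 m = memb (sl w (ml (one_t a') x)).
Proof.
move=> hx; have bs := slice_blin mt bw.
have main s : mslice_spec w2 s -> s m = memb (sl w (ml (one_t a') x)).
  move=> hs; apply: ml_inj => b; rewrite -[RHS]/(sl w (ml (one_t a') x) ⋅ b) -slice_mulr //.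
  have -> : mr (t_one b) (ml (one_t a') x) = ml (one_t a') (ml m (t b a)).
    rewrite -(mr_range b hx); apply: cstar_injl => y.
    by rewrite -mr_mul mlrP mr_mul -mlrP.
  have [K K0 hK] := blin_bound (blin_comp bs (blin_comp (ml_blin (one_t a')) (ml_blin m))).
  apply/subr0_eq; apply: (@Nm_smallM _ _ _ (1 + K)) => e e0.
  have [S [r [r0 h1]]] := mslice_approx m b bf_two hs e0.
  have [S' [r' [r'0 h2]]] := nearU_cap S [:: t b a] r0 e0.
  have [u /h2[/h1 {}h1 [_ u1 h3]]] := nearU_ex S' (mt_rep mt) r'0.
  have {h3}[h3 _] := h3 _ (mem_head _ _).
  have e1 : sl w2 (ml m u) ⋅ b = sl w (ml (one_t a') (ml m (u ⋅ t b a))).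
    by rewrite ml_mul; have := congr1 (fun k => ml k b) (mslice2_memb (ml m u)).
  have h4 : Nm (sl w (ml (one_t a') (ml m (u ⋅ t b a))) - sl w (ml (one_t a') (ml m (t b a)))) <= K * e.
    rewrite -!(linB bs.1) -!(linB (ml_linear _)); apply: (le_trans (hK _)).
    by rewrite ler_pM2l.
  rewrite e1 in h1; have := NmT (ml (s m) b) (sl w (ml (one_t a') (ml m (u ⋅ t b a))))
     (sl w (ml (one_t a') (ml m (t b a)))).
  by rewrite mulrDl mul1r; lra.
rewrite /mslice; case: xgetP => [s _ hs|/(_ mslice2)]; first exact: main.
by case; exact: mslice2_spec.
Qed.

End TwoSided.

End MultiplierSlices.

(** * Modular multiplicative unitaries *)

Section Projection.
Variables (R : realType) (H : hilbertType R).

Lemma parallelogram (x y : H) : Nm (x + y) ^+ 2 + Nm (x - y) ^+ 2 = 2 * (Nm x ^+ 2 + Nm y ^+ 2).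
Proof.
by rewrite !NmRe innerBl !innerBr innerDl !innerDr !ReD !ReN; lra.
Qed.

Lemma Nm_subproj (w x : H) (k : R) : k * Nm x ^+ 2 = 1 ->
  Nm (w - (k%:C%C * ⟨x, w⟩) *: x) ^+ 2 = Nm w ^+ 2 - k * Nm (⟨x, w⟩ : R[i]) ^+ 2.
Proof.
move=> kx; set c := ⟨x, w⟩.
rewrite NmRe; suff -> : ⟨w - (k%:C%C * c) *: x, w - (k%:C%C * c) *: x⟩ = (Nm w ^+ 2 - k * Nm c ^+ 2)%:C%C by [].
rewrite rcB (rcM k) -inner_Nm -mul_conjC_Nm innerBl !innerBr !innerZl !innerZr.
rewrite (inner_Nm x) -/c (innerC x w) -/c cjM cj_real.
have nn : k%:C%C * (Nm x ^+ 2)%:C%C = 1 :> R[i] by rewrite -rcM kx.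
have -> : k%:C%C * c^* * (k%:C%C * c * (Nm x ^+ 2)%:C%C) = k%:C%C * (Nm x ^+ 2)%:C%C * (k%:C%C * (c * c^*)) by ring.
by rewrite nn; ring.
Qed.

(** The parallelogram law provides a best approximation [p] of [v] in [P]; then [v - p] is
    orthogonal to [P], hence zero. *)
Lemma csub_orth (P : set H) : csub P -> (forall v, (forall x, P x -> ⟨x, v⟩ = 0) -> v = 0) ->
  forall v, P v.
Proof.
move=> cP hP v; pose S := [set Nm (v - y) | y in P].
have S0 : has_inf S.
  split; first by exists (Nm (v - 0)); exists 0 => //; exact: cP.1.1.
  by exists 0 => _ [y _ <-]; exact: Nm_ge0.
set d := inf S; have d0 : 0 <= d by apply: lb_le_inf => [|_ [y _ <-]]; [exact: S0.1|exact: Nm_ge0].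
have dle y : P y -> d <= Nm (v - y) by move=> Py; apply: ge_inf; [exact: S0.2|exists y].
have /choice[y hy] : forall n : nat, exists y, P y /\ Nm (v - y) <= d + ivn R n.
  move=> n; have [_ [y Py <-] hy] := inf_adherent (ivn_gt0 R n) S0.
  by exists y; split=> //; exact: ltW.
have half : forall x z : H, P x -> P z -> Nm (x - z) ^+ 2 <= 2 * (Nm (v - x) ^+ 2 + Nm (v - z) ^+ 2) - 4 * d ^+ 2.
  move=> x z Px Pz; have := parallelogram (v - x) (v - z).
  have -> : v - x - (v - z) = z - x by zmod.
  have -> : v - x + (v - z) = (2 : R)%:C%C *: (v - (2^-1 : R)%:C%C *: (x + z)).
    rewrite scalerBr scalerA -rcM mulfV ?pnatr_eq0 //.
    have -> : (1 : R)%:C%C = 1 :> R[i] by [].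
    rewrite scale1r.
    have -> : (2 : R)%:C%C = 1 + 1 :> R[i] by rewrite -rcD.
    by rewrite scalerDl scale1r; zmod.
  rewrite NmZr ger0_norm // exprMn (NmC z) => h.
  have := dle _ (lsubZ cP.1 (2^-1 : R)%:C%C (lsubD cP.1 Px Pz)).
  set q := Nm (v - _ *: _) in h * => dq.
  have := @lerXn2r R 2 d q; rewrite !nnegrE d0 Nm_ge0 => /(_ isT isT dq); lra.
have [|p hp] := @seq_complete R H y.
  move=> e e0; have K0 : 0 < 8 * d + 4 by lra.
  have e1 : 0 < e ^+ 2 / (8 * d + 4) by rewrite divr_gt0 ?exprn_gt0.
  have [N hN] := invn_small e1; exists N => m n hm hn.
  have i1 (k : nat) : ivn R k <= 1 by rewrite /ivn invf_le1 ?ler1n.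
  have sq k : Nm (v - y k) ^+ 2 <= d ^+ 2 + (2 * d + 1) * ivn R k.
    have h1 : Nm (v - y k) ^+ 2 <= (d + ivn R k) ^+ 2.
      by rewrite lerXn2r ?nnegrE ?Nm_ge0 ?addr_ge0 ?(ltW (ivn_gt0 _ _)) // (hy k).2.
    have := i1 k; have := ivn_gt0 R k; nra.
  rewrite -(@ler_pXn2r _ 2) ?nnegrE ?Nm_ge0 ?(ltW e0) //.
  apply: (le_trans (half _ _ (hy m).1 (hy n).1)); have := sq m; have := sq n.
  have := hN m hm; have := hN n hn; rewrite !ler_pdivlMr //; lra.
have Pp : P p.
  apply: cP.2 => e /hp[N hN]; exists (y N); first exact: (hy N).1.
  by rewrite NmC; exact: hN.
have pd : Nm (v - p) <= d.
  apply: Nm_eps => e e0; have e2 : 0 < e / 2 by rewrite divr_gt0.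
  have [N hN] := invn_small e2; have [N' hN'] := hp _ e2.
  have := NmT v (y (maxn N N')) p; have := hN _ (leq_maxl N N'); have := hN' _ (leq_maxr N N').
  by have := (hy (maxn N N')).2; lra.
suff -> : v = p by [].
apply/subr0_eq/hP => x Px; have [->|x0] := eqVneq x 0; first exact: inner0l.
set w := v - p in pd *; set c := ⟨x, w⟩; set n := Nm x ^+ 2.
have n0 : 0 < n by rewrite exprn_gt0 ?Nm_gt0.
have : d ^+ 2 <= Nm (w - (n^-1%:C%C * c) *: x) ^+ 2.
  rewrite lerXn2r ?nnegrE ?Nm_ge0 // /w -addrA -opprD; apply: dle.
  by apply: lsubD cP.1 _ _ Pp _; exact: lsubZ cP.1 _ _ Px.
have -> : Nm (w - (n^-1%:C%C * c) *: x) ^+ 2 = Nm w ^+ 2 - n^-1 * Nm c ^+ 2.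
  by rewrite Nm_subproj // mulVf // gt_eqF.
have : Nm w ^+ 2 <= d ^+ 2 by rewrite lerXn2r ?nnegrE ?Nm_ge0.
move=> h1 h2; apply: Nm_eq0; apply/eqP; rewrite -sqrf_eq0 eq_le exprn_ge0 ?Nm_ge0 // andbT.
have : n^-1 * Nm c ^+ 2 <= 0 by lra.
by rewrite pmulr_rle0 ?invr_gt0.
Qed.

Lemma selfadj_dom (Q : set (H * H)) : inj_pos_selfadj Q -> forall v (e : R), 0 < e ->
  exists x y, Q (x, y) /\ Nm (v - x) <= e.
Proof.
move=> [dQ _ _ _] v e e0; have : closure [set q.1 | q in Q] v by rewrite dQ.
by rewrite closureE => /(_ e e0)[_ [[x y] Qxy <-] h]; exists x, y.
Qed.
Lemma selfadj_lin (Q : set (H * H)) (z : R[i]) x y x' y' : inj_pos_selfadj Q ->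
  Q (x, y) -> Q (x', y') -> Q (z *: x + x', z *: y + y').
Proof.
move=> [_ sQ _ _] /sQ h /sQ h'; apply/sQ => u v Quv.
by rewrite !innerDr !innerZr (h _ _ Quv) (h' _ _ Quv).
Qed.
(** A vector orthogonal to the range lies in the kernel of the adjoint, which is [Q] itself, and [Q]
    is injective. *)
Lemma selfadj_ran (Q : set (H * H)) : inj_pos_selfadj Q -> forall v (e : R), 0 < e ->
  exists x y, Q (x, y) /\ Nm (v - y) <= e.
Proof.
move=> sQ v; have [_ Q2 _ Q4] := sQ.
suff : clos [set q.2 | q in Q] v.
  by move=> h e /h[_ [[x y] Qxy <-] ?]; exists x, y.
have lQ : lsub [set q.2 | q in Q].
  split; first by exists (0, 0) => //; apply/Q2 => u w _; rewrite !inner0r.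
  move=> z _ _ [[x y] Qxy <-] [[x' y'] Qxy' <-]; exists (z *: x + x', z *: y + y') => //.
  exact: selfadj_lin.
apply: (csub_orth (clos_lsub lQ)) => w hw; apply: Q4; apply/Q2 => x y Qxy.
by rewrite inner0r hw //; apply: subclos; exists (x, y).
Qed.
End Projection.

Section BetweenSpaces.
Variables (R : realType) (H H' K L L' : hilbertType R) (h : H -> K -> L) (h' : H' -> K -> L').
Hypotheses (hh : hilbert_tensor h) (hh' : hilbert_tensor h').

(** The form [⟨F v, F v⟩] belongs to [g \o f] tensored with the identity, an operator on the single
    space [L], to which [otens] applies. *)
Lemma tens_map_ex (f : H -> H') (g : H' -> H) : blin f -> blin g -> (forall x y, ⟨g x, y⟩ = ⟨x, f y⟩) ->
  exists F : L -> L', blin F /\ forall x y, F (h x y) = h' (f x) y.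
Proof.
move=> bf bg fg.
have gf x y : ⟨g (f x), y⟩ = ⟨x, g (f y)⟩ by rewrite fg innerC -fg -innerC.
have gg x y : ⟨f x, f y⟩ = ⟨x, g (f y)⟩ by rewrite [RHS]innerC fg -innerC.
have bgf : exists M : R, forall x, Nm (g (f x)) <= M * Nm x by exact: (blin_comp bg bf).2.
pose T : Bop H := @Aop _ _ (hpairing H) (g \o f) (g \o f) gf bgf.
pose N := Nm (otens hh T (aone (hpairing K))) + 1.
have N0 : 0 < N by rewrite /N; have := Nm_ge0 (otens hh T (aone (hpairing K))); lra.
have bd s : Nm (comb (fun p => h' (f p.1) p.2) s) <= Num.sqrt N * Nm (comb (fun p : H * K => h p.1 p.2) s).
  set v := comb _ s; set w := comb _ s.
  rewrite -(@ler_pXn2r _ 2) ?nnegrE ?mulr_ge0 ?sqrtr_ge0 ?Nm_ge0 // exprMn sqr_sqrtr ?(ltW N0) //.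
  have -> : Nm v ^+ 2 = Nm (⟨w, af (otens hh T (aone (hpairing K))) w⟩ : R[i]).
    suff <- : ⟨v, v⟩ = ⟨w, af (otens hh T (aone (hpairing K))) w⟩.
      by rewrite inner_Nm Nm_real ger0_norm ?exprn_ge0 ?Nm_ge0.
    rewrite /w (comb_lin _ _ (af_lin (otens hh T (aone (hpairing K))))) /comb !inner_suml; apply: eq_bigr => p _.
    rewrite !inner_sumr; apply: eq_bigr => q _; rewrite !innerZl !innerZr /= otensE.
    by rewrite (ht_inner hh) (ht_inner hh') gg.
  apply: (le_trans (CauchySchwarz _ _)); rewrite expr2 [leRHS]mulrCA.
  rewrite ler_wpM2l ?Nm_ge0 //; apply: (le_trans (aop_le _ _)).
  by rewrite ler_wpM2r ?Nm_ge0 // /N; lra.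
have [F [Fl Fb FE]] := lift_ex (ht_total hh) bd.
by exists F; split; [split=> //; exists (Num.sqrt N)|move=> x y; rewrite (FE (x, y))].
Qed.
End BetweenSpaces.

Section Legs.
Variables (R : realType) (H K L : hilbertType R) (h : H -> K -> L) (hh : hilbert_tensor h).
Variable U : Bop L.

(* [(id (x) w_{u,y})(U)] *)
Fact rsl_adj u y x z : ⟨ctr hh u (af U (h x y)), z⟩ = ⟨x, ctr hh y (af U^⋆ (h z u))⟩.
Proof. by rewrite ctrE innerC ctrE -innerC Bop_adj. Qed.
Fact rsl_b u y : exists M : R, forall x, Nm (ctr hh u (af U (h x y))) <= M * Nm x.
Proof. exact: (blin_comp (ctr_blin hh u) (blin_comp (af_blin U) (ht_blinl hh y))).2. Qed.
Definition rsl u y : Bop H := @Aop _ _ (hpairing H) _ _ (rsl_adj u y) (rsl_b u y).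

Lemma rslE u y x z : ⟨x, af (rsl u y) z⟩ = ⟨h x u, af U (h z y)⟩.
Proof. exact: ctrE. Qed.
Lemma Nm_rsl u y : Nm (rsl u y) <= Nm U * Nm u * Nm y.
Proof.
apply: aop_lub => [|x]; first by rewrite !mulr_ge0 ?Nm_ge0.
apply: (le_trans (Nm_ctr _ _ _)).
have -> : Nm U * Nm u * Nm y * Nm x = Nm u * (Nm U * (Nm x * Nm y)) by ring.
by rewrite ler_wpM2l ?Nm_ge0 // -(ht_Nm hh) aop_le.
Qed.
Lemma rsl_blinr u : blin (rsl u).
Proof.
split; last by exists (Nm U * Nm u) => y; exact: Nm_rsl.
move=> z y y'; apply: aop_ext => x; apply: inner_ext => v.
by rewrite af_add af_scale innerDr innerZr !rslE (htr hh) afD afZ innerDr innerZr.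
Qed.
Lemma rsl_antil (z : R[i]) u u' y : rsl (z *: u + u') y = z^* *: rsl u y + rsl u' y.
Proof.
apply: aop_ext => x; apply: inner_ext => v.
by rewrite af_add af_scale innerDr innerZr !rslE (htr hh) innerDl innerZl.
Qed.
Lemma rslBl u u' y : rsl (u - u') y = rsl u y - rsl u' y.
Proof. by have := rsl_antil (-1) u' u y; rewrite !scaleN1r cjN cj1 scaleN1r !(addrC (- _)). Qed.
Lemma rsl_csub P u y (D E : set K) : csub P ->
  (forall v (e : R), 0 < e -> exists2 x, D x & Nm (v - x) <= e) ->
  (forall v (e : R), 0 < e -> exists2 x, E x & Nm (v - x) <= e) ->
  (forall u' y', D u' -> E y' -> P (rsl u' y')) -> P (rsl u y).
Proof.
move=> cP dD dE hP.
have h1 u' : D u' -> P (rsl u' y).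
  move=> Du; have [K1 K0 hK] := blin_bound (rsl_blinr u').
  apply: cP.2 => e e0; have [y' Ey hy] := dE y _ (divr_gt0 e0 K0).
  exists (rsl u' y'); first exact: hP.
  rewrite -(linB (rsl_blinr u').1); apply: (le_trans (hK _)).
  by rewrite mulrC -ler_pdivlMr.
apply: cP.2 => e e0.
have K0 : 0 < Nm U * Nm y + 1 by have := mulr_ge0 (Nm_ge0 U) (Nm_ge0 y); lra.
have [u' Du hu] := dD u _ (divr_gt0 e0 K0); exists (rsl u' y); first exact: h1.
rewrite -rslBl; apply: (le_trans (Nm_rsl _ _)); rewrite mulrAC.
rewrite ler_pdivlMr // mulrC in hu; apply: le_trans hu.
by rewrite ler_wpM2r ?Nm_ge0 //; lra.
Qed.
End Legs.

Lemma Nm_pair (R : realType) (V W : normedModType R[i]) (v : (V * W)%type : normedModType R[i]) : Nm v.1 <= Nm v /\ Nm v.2 <= Nm v.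
Proof. by rewrite -!leNm ProdNormedZmodule.prod_normE !comparable_le_max ?real_comparable ?normr_real // !lexx orbT. Qed.

Lemma Nm_dual (R : realType) (X : Type) (H : hilbertType R) (j : X -> H) (v : H) (K : R) : total j -> 0 <= K ->
  (forall s, Nm (⟨v, comb j s⟩ : R[i]) <= K * Nm (comb j s)) -> Nm v <= K.
Proof.
move=> tj K0 h; have [->|v0] := eqVneq v 0; first by rewrite Nm0.
have vN := Nm_gt0 v0; apply: Nm_eps => e e0.
have D0 : 0 < Nm v + K by lra.
have d0 : 0 < e * Nm v / (Nm v + K) by rewrite divr_gt0 // mulr_gt0.
have [s hs] := tj v _ d0; set d := e * Nm v / _ in d0 hs.
have dE : d * (Nm v + K) = e * Nm v by rewrite /d divfK // gt_eqF.
have h1 : Nm (⟨v, v⟩ : R[i]) <= Nm (⟨v, v - comb j s⟩ : R[i]) + Nm (⟨v, comb j s⟩ : R[i]).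
  have <- : ⟨v, v - comb j s⟩ + ⟨v, comb j s⟩ = ⟨v, v⟩ by rewrite -innerDr subrK.
  exact: NmD.
rewrite inner_Nm Nm_real ger0_norm ?exprn_ge0 ?Nm_ge0 // in h1.
have h2 := CauchySchwarz v (v - comb j s).
have h3 := h s; have h4 := NmD (comb j s - v) v; rewrite subrK NmC in h4.
have h5 : K * Nm (comb j s) <= K * (d + Nm v) by rewrite ler_wpM2l //; lra.
have h6 : Nm v * Nm (v - comb j s) <= Nm v * d by rewrite ler_wpM2l ?Nm_ge0.
by rewrite -(ler_pM2l vN); nra.
Qed.

Definition norm_dense (R : realType) (V : normedModType R[i]) (D : set V) :=
  forall v (e : R), 0 < e -> exists2 x, D x & Nm (v - x) <= e.

Section Dense.
Variables (R : realType) (V W : normedModType R[i]) (D : set V).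
Hypothesis dD : norm_dense D.
Lemma dens_csub (P : set V) : csub P -> (forall x, D x -> P x) -> forall v, P v.
Proof. by move=> cP h v; apply: cP.2 => e /(dD v)[x /h Px hx]; exists x. Qed.
Lemma dens_eq (f g : V -> W) : blin f -> blin g -> (forall x, D x -> f x = g x) -> f =1 g.
Proof. by move=> bf bg h; apply: dens_csub; first exact: csub_eq. Qed.
End Dense.

Lemma dens_inner (R : realType) (H : hilbertType R) (D : set H) (v w : H) : norm_dense D ->
  (forall x, D x -> ⟨x, v⟩ = ⟨x, w⟩) -> v = w.
Proof.
move=> dD h; apply: inner_ext => z; rewrite innerC [RHS]innerC; congr (_^*).
apply: (@dens_eq R H (R[i]^o) D dD (inner v) (inner w)); try exact: inner_blin.
by move=> x Dx; rewrite innerC h // -innerC.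
Qed.

Lemma unitary_Nm (R : realType) (H : hilbertType R) (U : Bop H) x : U^⋆ ⋅ U = aone (hpairing H) -> Nm (af U x) = Nm x.
Proof.
move=> U1; apply/eqP; rewrite -(@eqrXn2 _ 2) ?Nm_ge0 //; apply/eqP.
by rewrite !NmRe Bop_adj -af_comp U1 af_one.
Qed.
Lemma unitaryK (R : realType) (H : hilbertType R) (U : Bop H) x : U^⋆ ⋅ U = aone (hpairing H) -> af U^⋆ (af U x) = x.
Proof. by move=> U1; rewrite -af_comp U1 af_one. Qed.

Section Selfadj.
Variables (R : realType) (H K L : hilbertType R) (h : H -> K -> L) (Qh : set (H * H)) (Q : set (K * K)).
Hypotheses (hh : hilbert_tensor h) (sQh : inj_pos_selfadj Qh) (sQ : inj_pos_selfadj Q).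

Lemma graph_tensor_sym g k : graph_tensor h Qh Q g -> graph_tensor h Qh Q k -> ⟨g.1, k.2⟩ = ⟨g.2, k.1⟩.
Proof.
have b1 : blin (fun g : L * L => g.1) by split=> //; exists 1 => v; rewrite mul1r; exact: (Nm_pair v).1.
have b2 : blin (fun g : L * L => g.2) by split=> //; exists 1 => v; rewrite mul1r; exact: (Nm_pair v).2.
have cs (k' : L * L) : csub [set g : L * L | ⟨k'.1, g.2⟩ = ⟨k'.2, g.1⟩].
  by apply: (@csub_eq _ _ (R[i]^o)); [exact: (blin_comp (inner_blin _) b2)|exact: (blin_comp (inner_blin _) b1)].
have e1 k' g' : graph_tensor h Qh Q g' -> [set (h p.1 q.1, h p.2 q.2) | p in Qh & q in Q] k' -> ⟨k'.1, g'.2⟩ = ⟨k'.2, g'.1⟩.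
  move=> Gg [p Qp [q Qq <-]]; move: g' Gg; apply: (cspan_min (cs _)) => _ [p' Qp' [q' Qq' <-]] /=.
  rewrite !(ht_inner hh); case: p p' q q' Qp Qp' Qq Qq' => [x x'] [y y'] [z z'] [w w'] /= Qx Qy Qz Qw.
  by case: sQh => _ /(_ y y') s _ _; rewrite (s.1 Qy x x' Qx); case: sQ => _ /(_ w w') s' _ _; rewrite (s'.1 Qw z z' Qz).
move=> Gg; move: k; apply: (cspan_min (cs _)) => k Gk /=.
by have := e1 _ _ Gg Gk; rewrite innerC => /esym; rewrite innerC => /(can_inj (@conjcK _)).
Qed.
End Selfadj.

Section LeftLeg.
Variables (R : realType) (H L : hilbertType R) (h : H -> H -> L) (hh : hilbert_tensor h) (U : Bop L).
(* [s |-> (y^* (x) 1) U (s (x) v)] *)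
Fact lsl_adj y v x z : ⟨ctr (ht_flip hh) y (af U (h x v)), z⟩ = ⟨x, ctr hh v (af U^⋆ (h y z))⟩.
Proof. by rewrite ctrE innerC ctrE -innerC Bop_adj. Qed.
Fact lsl_b y v : exists M : R, forall x, Nm (ctr (ht_flip hh) y (af U (h x v))) <= M * Nm x.
Proof. exact: (blin_comp (ctr_blin (ht_flip hh) y) (blin_comp (af_blin U) (ht_blinl hh v))).2. Qed.
Definition lsl y v : Bop H := @Aop _ _ (hpairing H) _ _ (lsl_adj y v) (lsl_b y v).
Lemma lslE y v q s : ⟨q, af (lsl y v) s⟩ = ⟨h y q, af U (h s v)⟩.
Proof. exact: ctrE. Qed.
Lemma Nm_lsl y v : Nm (lsl y v) <= Nm U * Nm y * Nm v.
Proof.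
apply: aop_lub => [|x]; first by rewrite !mulr_ge0 ?Nm_ge0.
apply: (le_trans (Nm_ctr _ _ _)).
have -> : Nm U * Nm y * Nm v * Nm x = Nm y * (Nm U * (Nm x * Nm v)) by ring.
by rewrite ler_wpM2l ?Nm_ge0 // -(ht_Nm hh) aop_le.
Qed.
End LeftLeg.

Lemma bar_inv_ex (R : realType) (H Hb : hilbertType R) (bar : H -> Hb) : conjugate_hilbert bar ->
  exists g, cancel bar g /\ cancel g bar.
Proof. by case=> -[g *]; exists g. Qed.

Section Modular.
Variables (R : realType) (H L Hb Lb : hilbertType R) (h : H -> H -> L) (hb : Hb -> H -> Lb) (bar : H -> Hb).
Variables (U : Bop L) (V : Bop Lb) (Qh Q : set (H * H)).
Hypotheses (hh : hilbert_tensor h) (hhb : hilbert_tensor hb) (cj : conjugate_hilbert bar).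
Hypotheses (U1 : U^⋆ ⋅ U = aone (hpairing L)) (V1 : V^⋆ ⋅ V = aone (hpairing Lb)) (V2 : V ⋅ V^⋆ = aone (hpairing Lb)).
Hypotheses (sQh : inj_pos_selfadj Qh) (sQ : inj_pos_selfadj Q).
Hypothesis comm : [set (af U g.1, af U g.2) | g in graph_tensor h Qh Q] = graph_tensor h Qh Q.
Hypothesis modE : forall x z u Qu y Qiy, Q (u, Qu) -> Q (Qiy, y) ->
  ⟨h x u, af U (h z y)⟩ = ⟨hb (bar z) Qu, af V (hb (bar x) Qiy)⟩.
Hypothesis pent : Defs.multiplicative h (af U).

Let r := rsl hh U.
Let rt := rsl hhb V.
Let hhf := ht_flip hh.
Let hhbf := ht_flip hhb.
Let barV := projT1 (cid (bar_inv_ex cj)).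

Lemma bar_inner x y : ⟨bar x, bar y⟩ = ⟨y, x⟩. Proof. by case: cj. Qed.
Lemma bar_anti (z : R[i]) x y : bar (z *: x + y) = z^* *: bar x + bar y. Proof. by case: cj. Qed.
Lemma barK : cancel barV bar. Proof. by rewrite /barV; case: (cid _) => g []. Qed.
Lemma barVK : cancel bar barV. Proof. by rewrite /barV; case: (cid _) => g []. Qed.
Lemma Nm_bar x : Nm (bar x) = Nm x.
Proof. by apply/eqP; rewrite -(@eqrXn2 _ 2) ?Nm_ge0 // !NmRe bar_inner. Qed.
Lemma barB x y : bar (x - y) = bar x - bar y.
Proof. by have := bar_anti (-1) y x; rewrite !scaleN1r cjN cj1 scaleN1r !(addrC (- _)). Qed.
Lemma barV_inner x y : ⟨barV x, barV y⟩ = ⟨y, x⟩. Proof. by rewrite -bar_inner !barK. Qed.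
Lemma bar_dens (D : set H) : norm_dense D -> norm_dense [set bar x | x in D].
Proof.
move=> dD v e e0; have [x Dx hx] := dD (barV v) _ e0; exists (bar x); first by exists x.
by rewrite -[v]barK -barB Nm_bar.
Qed.
Let dQ : norm_dense [set q.1 | q in Q].
Proof. by move=> v e /(selfadj_dom sQ v)[x [y [Qxy ?]]]; exists x => //; exists (x, y). Qed.
Let rQ : norm_dense [set q.2 | q in Q].
Proof. by move=> v e /(selfadj_ran sQ v)[x [y [Qxy ?]]]; exists y => //; exists (x, y). Qed.
Let dQh : norm_dense [set q.1 | q in Qh].
Proof. by move=> v e /(selfadj_dom sQh v)[x [y [Qxy ?]]]; exists x => //; exists (x, y). Qed.
Let rQh : norm_dense [set q.2 | q in Qh].
Proof. by move=> v e /(selfadj_ran sQh v)[x [y [Qxy ?]]]; exists y => //; exists (x, y). Qed.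

Let A := lsl hh U.

(* For [u] in the range and [y] in the domain of [Q] this is [modE], because [Qh (x) Q] is
   symmetric and commutes with [U]. *)
Lemma mod_swap x x' z z' u y : Qh (x, x') -> Qh (z, z') ->
  ⟨x', af (r u y) z⟩ = ⟨bar z', af (rt u y) (bar x)⟩.
Proof.
move=> Qx Qz; rewrite !rslE.
suff E y' : af (A x' y') z = ctr hhbf (bar z') (af V (hb (bar x) y')).
  have E' : af (lsl hh U x' y) z = _ := E y.
  by rewrite -lslE E' ctrE.
move: y'; apply: (dens_eq dQ).
- exact: (blin_comp (ctr_blin hhf x') (blin_comp (af_blin U) (ht_blinr hh z))).
- exact: (blin_comp (ctr_blin hhbf _) (blin_comp (af_blin V) (ht_blinr hhb _))).
move=> _ [[y1 y1'] Qy <-] /=; apply: (dens_inner rQ) => _ [[u1 u1'] Qu <-] /=.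
rewrite !ctrE -(modE x z' Qu Qy).
have g1 : graph_tensor h Qh Q (h x u1, h x' u1') by apply: sub_cspan; exists (x, x') => //; exists (u1, u1').
have g2 : graph_tensor h Qh Q (af U (h z y1), af U (h z' y1')).
  rewrite -comm; exists (h z y1, h z' y1') => //.
  by apply: sub_cspan; exists (z, z') => //; exists (y1, y1').
exact/esym/(graph_tensor_sym hh sQh sQ g1 g2).
Qed.

(** By [mod_swap], this pair satisfies the adjoint relation against every pair of [Qh], and [Qh] is
    its own adjoint. *)
Lemma mod_dom x x' u y : Qh (x, x') -> Qh (barV (af (rt u y) (bar x)), af (r u y)^⋆ x').
Proof.
move=> Qx; case: (sQh) => _ s _ _; apply/s => z z' Qz.
by rewrite -Bop_adj -[in RHS]bar_inner barK innerC (mod_swap u y Qx Qz) -innerC.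
Qed.

Lemma pent_functional (f : L -> R[i]) x' y t z u v : blin (f : L -> R[i]^o) ->
  (forall p q, f (h p q) = ⟨x', af (r y p) (af (r t q) z)⟩) ->
  f (af U (h u v)) = ⟨h x' (af (A y v)^⋆ t), af U (h z u)⟩.
Proof.
move=> bf fE; have [H3 [l [rr [m [[hl hr hm hlrm] [W12 [W13 [W23 [[b12 e12] [b13 e13] [b23 e23] P]]]]]]]]] := pent.
have lE x1 y1 z1 : rr x1 (h y1 z1) = l (h x1 y1) z1 by exact: (hlrm _ _ _).1.
have mE x1 y1 z1 : m y1 (h x1 z1) = l (h x1 y1) z1 by exact: (hlrm _ _ _).2.
have B (w : H3 -> H3) : bounded_linear w -> blin w by move/bounded_linearE.
have X p q : ⟨l (h x' y) t, W12 (W13 (rr z (h p q)))⟩ = f (h p q).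
  rewrite fE lE -(mE z p q) e13.
  have K w : ⟨l (h x' y) t, W12 (m p w)⟩ = ⟨x', af (r y p) (ctr hh t w)⟩.
    rewrite rslE; apply: (total_eq (ht_total hh) (f := fun w => ⟨_, W12 (m p w)⟩ : R[i]^o) (g := fun w => ⟨h x' y, af U (h (ctr hh t w) p)⟩ : R[i]^o)).
    - exact: (blin_comp (inner_blin _) (blin_comp (B _ b12) (ht_blinr hm p))).
    - exact: (blin_comp (inner_blin _) (blin_comp (af_blin U) (blin_comp (ht_blinl hh p) (ctr_blin hh t)))).
    by move=> [a b] /=; rewrite mE e12 (ht_inner hl) ctr_h (linZ (htl hh p)) afZ innerZr mulrC.
  by rewrite K.
have Y w : ⟨l (h x' y) t, W12 (W13 (rr z w))⟩ = f w.
  apply: (total_eq (ht_total hh) (f := fun w => ⟨_, W12 (W13 (rr z w))⟩ : R[i]^o) (g := f : L -> R[i]^o)) => //.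
    exact: (blin_comp (inner_blin _) (blin_comp (B _ b12) (blin_comp (B _ b13) (ht_blinr hr z)))).
rewrite -Y -e23 -P lE e12.
have Z w : ⟨l (h x' y) t, W23 (l w v)⟩ = ⟨h x' (af (A y v)^⋆ t), w⟩.
  apply: (total_eq (ht_total hh) (f := fun w => ⟨_, W23 (l w v)⟩ : R[i]^o) (g := fun w => ⟨_, w⟩ : R[i]^o)).
  - exact: (blin_comp (inner_blin _) (blin_comp (B _ b23) (ht_blinl hl v))).
  - exact: inner_blin.
  move=> [a b] /=; rewrite -!lE e23 (ht_inner hr) (ht_inner hh) -(lslE hh).
  by rewrite (Bop_adj' (A y v)).
exact: Z.
Qed.
(* The pentagon equation of [U], carried over to [V] by [mod_swap]. *)
Lemma mod_pent al be y v w u :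
  ⟨af V (hb al w), af (otens hhb (aone (hpairing Hb)) (A y v)) (af V (hb be u))⟩ = ⟨al, af (rt y (af (r w v) u)) be⟩.
Proof.
set O := otens _ _ _.
apply: (dens_eq (bar_dens dQh) (f := fun be => ⟨_, af O (af V (hb be u))⟩ : R[i]^o) (g := fun be => ⟨_, af _ be⟩ : R[i]^o)).
- exact: (blin_comp (inner_blin _) (blin_comp (af_blin O) (blin_comp (af_blin V) (ht_blinl hhb u)))).
- exact: (blin_comp (inner_blin _) (af_blin _)).
move=> _ [x [[x0 x'] Qx <-] <-] /=; move: (x0) Qx => {}x Qx {x0}.
have bf : blin (fun p => af (rt y p) (bar x)).
  exact: (blin_comp (ctr_blin hhb y) (blin_comp (af_blin V) (ht_blinr hhb (bar x)))).
have bg : blin (fun a => ctr hhbf (bar x) (af V^⋆ (hb a y))).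
  exact: (blin_comp (ctr_blin hhbf _) (blin_comp (af_blin V^⋆) (ht_blinl hhb y))).
(* [F] maps [p (x) q] to [rt y p (bar x) (x) q]; the chain of equalities exhibits the adjoint of its
   first factor. *)
have [F [bF FE]] := tens_map_ex hh hhb bf bg (fun a p => etrans (innerC _ _) (etrans (congr1 _ (ctrE _ _ _ _)) 
   (etrans (esym (innerC _ _)) (etrans (Bop_adj' _ _ _) (esym (rslE hhb V y p a (bar x))))))).
have -> : af O (af V (hb (bar x) u)) = af V (F (af U (h u v))).
  apply: (total_inner (ht_total hhb)) => -[a t] /=; rewrite -!(ctrE hhb t a).
  move: a; suff -> : ctr hhb t (af O (af V (hb (bar x) u))) = ctr hhb t (af V (F (af U (h u v)))) by [].
  apply: (dens_inner (bar_dens rQh)) => _ [_ [[z z'] Qz <-] <-] /=; rewrite !ctrE.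
  rewrite -Bop_adj' otens_star otensE.
  have -> : af (aone (hpairing Hb))^⋆ (bar z') = bar z' by [].
  rewrite (@pent_functional (fun xi => ⟨hb (bar z') t, af V (F xi)⟩) x' y t z u v).
  - by have := mod_swap (af (A y v)^⋆ t) u Qx Qz; rewrite !rslE.
  - exact: (blin_comp (inner_blin _) (blin_comp (af_blin V) bF)).
  move=> p q; rewrite FE.
  have := mod_swap t q (mod_dom y p Qx) Qz.
  by rewrite barK (Bop_adj' (r y p)) [X in _ = X -> _]rslE => ->.
rewrite Bop_adj unitaryK // -ctrE; congr (⟨_, _⟩).
apply: (total_eq (ht_total hh) (f := fun xi => ctr hhb w (F xi)) (g := fun xi => af (rt y (ctr hh w xi)) (bar x))).
- exact: (blin_comp (ctr_blin hhb w) bF).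
- exact: (blin_comp bf (ctr_blin hh w)).
by move=> [p q] /=; rewrite FE !ctr_h; exact: esym (linZ bf.1 _ _).
Qed.
(* the transpose [bar c^* bar^-1] of [c] *)
Fact sg_adj (c : Bop H) x y : ⟨bar (af c^⋆ (barV x)), y⟩ = ⟨x, bar (af c (barV y))⟩.
Proof. by rewrite -{1}[y]barK -{2}[x]barK !bar_inner -Bop_adj. Qed.
Fact sg_b (c : Bop H) : exists M : R, forall x, Nm (bar (af c^⋆ (barV x))) <= M * Nm x.
Proof. by exists (Nm c^⋆) => x; rewrite Nm_bar -{2}[x]barK Nm_bar; exact: aop_le. Qed.
Definition sg c : Bop Hb := @Aop _ _ (hpairing Hb) _ _ (sg_adj c) (sg_b c).
Lemma sgE c x z : ⟨bar z, af (sg c) (bar x)⟩ = ⟨x, af c z⟩.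
Proof. by rewrite /= bar_inner barVK Bop_adj'. Qed.
Lemma sg_star c : sg c^⋆ = (sg c)^⋆.
Proof. exact: aop_ext. Qed.
Lemma sg_lin : linear sg.
Proof.
move=> z c c'; apply: aop_ext => x; apply: inner_ext => y.
rewrite af_add af_scale innerDr innerZr -[x]barK -[y]barK !sgE.
by rewrite af_add af_scale innerDr innerZr.
Qed.
Lemma Nm_sg c : Nm (sg c) = Nm c.
Proof.
apply/eqP; rewrite eq_le; apply/andP; split; last rewrite -(sstar_Nm c).
  apply: aop_lub => [|x]; first exact: Nm_ge0.
  by rewrite Nm_bar -{2}[x]barK Nm_bar -(sstar_Nm c); exact: aop_le.
apply: aop_lub => [|x]; first exact: Nm_ge0.
by have := aop_le (sg c) (bar x); rewrite /= !Nm_bar barVK.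
Qed.
Lemma mod_sg u u' s s' : Q (u, u') -> Q (s, s') -> rt u' s = sg (r u s').
Proof.
move=> Qu Qs; apply: aop_ext => x; apply: inner_ext => z; rewrite -[x]barK -[z]barK sgE !rslE.
by rewrite (modE _ _ Qu Qs).
Qed.

Definition conj_coefs (X : Type) (s : seq (R[i] * X)) := [seq (p.1^*, p.2) | p <- s].
Lemma inner_conj_coefs (X : Type) (K : hilbertType R) (j : X -> K) (s : seq (R[i] * X)) v :
  ⟨comb j (conj_coefs s), v⟩ = \sum_(p <- s) p.1 * ⟨j p.2, v⟩.
Proof. by rewrite /comb /conj_coefs big_map inner_suml; apply: eq_bigr => p _; rewrite innerZl /= cjK. Qed.
(** The flip [a (x) s ↦ bar s (x) barV a] is isometric but antilinear, which is the reason for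
    [conj_coefs]. *)
Lemma flip_isom s : Nm (comb (fun p : Hb * H => hb (bar p.2) (barV p.1)) (conj_coefs s)) = Nm (comb (fun p : Hb * H => hb p.1 p.2) s).
Proof.
apply/eqP; rewrite -(@eqrXn2 _ 2) ?Nm_ge0 // !NmRe inner_conj_coefs; apply/eqP; congr (complex.Re _).
rewrite {3}/comb inner_sumr; apply: eq_bigr => p _; rewrite innerZr; congr (_ * _).
rewrite /comb /conj_coefs big_map inner_sumr inner_suml; apply: eq_bigr => q _.
by rewrite /= innerZr innerZl !(ht_inner hhb) bar_inner barV_inner [⟨q.2.2, _⟩ * _]mulrC.
Qed.

Section Estimate.
Variables (w w' u : H).
Hypothesis Qw : Q (w, w').
Let X := ((H * {q | Q q}) + (H * H))%type.
(** Paired with [mod_op]: the assignment [mod_dom_vec x ↦ mod_op x] will extend to one bounded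
    linear map. Its left family consists of slices of [V], its right family of products of an
    adjoint with a slice of [V]. *)
Definition mod_dom_vec (x : X) : Lb :=
  match x with inl a => af V (hb (bar a.1) (sval a.2).1) | inr a => hb (bar a.1) a.2 end.
Definition mod_op (x : X) : Bop Hb :=
  match x with inl a => rt a.1 (af (r w (sval a.2).2) u) | inr a => (sg (r a.2 w'))^⋆ ⋅ rt a.1 u end.
Let Om x0 (x : X) : Lb :=
  match x with inl a => af (otens hhb (aone (hpairing Hb)) (A a.1 (sval a.2).2))^⋆ (af V (hb (bar x0) w))
    | inr a => hb (af (sg (r a.2 w')) (bar x0)) a.1 end.
Let Om1 x0 be x : ⟨Om x0 x, af V (hb be u)⟩ = ⟨bar x0, af (mod_op x) be⟩.
Proof.
case: x => [[y q]|[p q]]; rewrite /Om /mod_op.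
  by rewrite Bop_adj' mod_pent.
by rewrite af_comp -Bop_adj (rslE hhb V).
Qed.
(** The vectors [T] and [S] lie in the domain of [Q], by [modE] and selfadjointness; the identity is
    the symmetry of [Q] on them. *)
Let slab x0 psi y q (Qq : Q q) s :
  ⟨af V (hb (bar x0) w), hb (bar psi) (af (A y q.2) s)⟩ = ⟨hb (bar s) (af (A x0 w') psi), af V (hb (bar y) q.1)⟩.
Proof.
pose T := ctr hhbf (bar psi) (af V (hb (bar x0) w)).
pose S := ctr hhbf (bar s) (af V (hb (bar y) q.1)).
have QT : Q (T, af (A x0 w') psi).
  case: (sQ) => _ /(_ T (af (A x0 w') psi)) s0 _ _; apply/s0 => t t' Qt.
  by rewrite lslE ctrE (modE _ _ Qt Qw).
have QS : Q (S, af (A y q.2) s).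
  case: (sQ) => _ /(_ S (af (A y q.2) s)) s0 _ _; apply/s0 => t t' Qt.
  by rewrite lslE ctrE; case: q {S s0} Qq => q q' Qq; rewrite (modE _ _ Qt Qq).
case: (sQ) => _ /(_ _ _) s0 _ _; have := (s0 _ _).1 QS _ _ QT.
have TE z : ⟨z, T⟩ = ⟨hb (bar psi) z, af V (hb (bar x0) w)⟩ by exact: ctrE.
have SE z : ⟨z, S⟩ = ⟨hb (bar s) z, af V (hb (bar y) q.1)⟩ by exact: ctrE.
by rewrite SE => <-; rewrite innerC -TE -innerC.
Qed.
Let Om2 x0 psi s x : ⟨Om x0 x, hb (bar psi) s⟩ = ⟨hb (bar s) (af (A x0 w') psi), mod_dom_vec x⟩.
Proof.
case: x => [[y [q Qq]]|[p q]]; rewrite /Om /mod_dom_vec.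
  by rewrite Bop_adj' otensE; exact: (slab x0 psi y Qq s).
have e : ⟨af (sg (r q w')) (bar x0), bar psi⟩ = ⟨af (A x0 w') psi, q⟩.
  by rewrite [LHS]innerC [RHS]innerC sgE rslE lslE.
by rewrite !(ht_inner hhb) bar_inner mulrC; congr (_ * _).
Qed.
(** [Om1] expresses matrix coefficients of the operator sum through the vectors [Om]; [Om2] bounds
    the sum of these vectors by duality, the antilinear flip being isometric. *)
Lemma mod_estimate s : Nm (comb mod_op s) <= Nm w' * Nm u * Nm (comb mod_dom_vec s).
Proof.
have NV x : Nm (af V x) = Nm x by exact: unitary_Nm.
have NA x0 : Nm (A x0 w') <= Nm x0 * Nm w'.
  apply: (le_trans (Nm_lsl _ _ _ _)); rewrite -[leRHS]mul1r -mulrA ler_wpM2r ?mulr_ge0 ?Nm_ge0 //.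
  by apply: aop_lub => // x; rewrite mul1r unitary_Nm.
have NO x0 : Nm (comb (Om x0) (conj_coefs s)) <= Nm x0 * Nm w' * Nm (comb mod_dom_vec s).
  apply: (Nm_dual (ht_total hhb)) => [|z]; first by rewrite !mulr_ge0 ?Nm_ge0.
  have -> : ⟨comb (Om x0) (conj_coefs s), comb (fun p : Hb * H => hb p.1 p.2) z⟩ =
     ⟨af (otens hhb (aone (hpairing Hb)) (A x0 w')) (comb (fun p : Hb * H => hb (bar p.2) (barV p.1)) (conj_coefs z)), comb mod_dom_vec s⟩.
    rewrite (comb_lin _ _ (af_lin (otens hhb (aone (hpairing Hb)) (A x0 w')))) inner_conj_coefs [X in inner _ X]/comb inner_sumr; apply: eq_bigr => p _; rewrite innerZr; congr (_ * _).
    rewrite inner_conj_coefs /comb inner_sumr; apply: eq_bigr => q _; rewrite innerZr; congr (_ * _).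
    by rewrite -{1}[q.2.1]barK Om2 /comp otensE.
  apply: (le_trans (CauchySchwarz _ _)); rewrite mulrAC ler_wpM2r ?Nm_ge0 // -flip_isom.
  apply: (le_trans (aop_le _ _)); rewrite ler_wpM2r ?Nm_ge0 //; apply: (le_trans (Nm_otens _ _ _)).
  apply: le_trans (NA x0); rewrite -[leRHS]mul1r ler_wpM2r ?Nm_ge0 //.
  by apply: aop_lub => // x; rewrite mul1r af_one.
apply: aop_lub => [|be]; first by rewrite !mulr_ge0 ?Nm_ge0.
set a := af _ be; have [a0|a0] := eqVneq a 0; first by rewrite a0 Nm0 !mulr_ge0 ?Nm_ge0.
rewrite -(ler_pM2l (Nm_gt0 a0)).
have -> : Nm a * Nm a = Nm (⟨comb (Om (barV a)) (conj_coefs s), af V (hb be u)⟩ : R[i]).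
  suff <- : ⟨a, a⟩ = ⟨comb (Om (barV a)) (conj_coefs s), af V (hb be u)⟩ by rewrite inner_Nm Nm_real ger0_norm ?exprn_ge0 ?Nm_ge0.
  rewrite inner_conj_coefs {2}/a af_comb /comb inner_sumr; apply: eq_bigr => p _.
  by rewrite innerZr Om1 barK.
apply: (le_trans (CauchySchwarz _ _)); rewrite NV (ht_Nm hhb).
have := NO (barV a); rewrite -Nm_bar barK => h1.
have -> : Nm a * (Nm w' * Nm u * Nm (comb mod_dom_vec s) * Nm be) = Nm a * Nm w' * Nm (comb mod_dom_vec s) * (Nm be * Nm u) by ring.
by rewrite ler_wpM2r ?mulr_ge0 ?Nm_ge0.
Qed.
(** If the vectors of one family are total, any other vector is a limit of their combinations, and
    by [mod_estimate] the operators follow. *)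
Lemma mod_transfer (Y : Type) (k : Y -> X) (P : set (Bop Hb)) z : csub P -> total (fun y => mod_dom_vec (k y)) ->
  (forall y, P (mod_op (k y))) -> P (mod_op z).
Proof.
move=> cP tk hk; apply: cP.2 => e e0; set K := Nm w' * Nm u.
have K0 : 0 < K + 1 by have := mulr_ge0 (Nm_ge0 w') (Nm_ge0 u); rewrite /K; lra.
have [s hs] := tk (mod_dom_vec z) _ (divr_gt0 e0 K0); pose s' := [seq (p.1, k p.2) | p <- s].
have cE (V' : lmodType R[i]) (f : X -> V') : comb f s' = comb (fun y => f (k y)) s by rewrite /comb big_map.
exists (comb mod_op s').
  rewrite cE /comb; elim: s {hs s' cE} => [|p s IH]; first by rewrite big_nil; exact: cP.1.1.
  by rewrite big_cons; apply: lsubD cP.1 _ _ _ IH; apply: lsubZ cP.1 _ _ (hk _).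
have := mod_estimate ((1, z) :: cneg (-1) s').
have h1 (V' : lmodType R[i]) (f : X -> V') : comb f ((1, z) :: cneg (-1) s') = f z - comb f s'.
  by rewrite -cat1s comb_cat comb_scale /comb big_seq1 /= scale1r scaleN1r.
rewrite !h1 => h2; apply: (le_trans h2); rewrite cE.
rewrite ler_pdivlMr // mulrC in hs; apply: le_trans hs.
by rewrite ler_wpM2r ?Nm_ge0 // -/K; lra.
Qed.
End Estimate.
Hypothesis U2 : U ⋅ U^⋆ = aone (hpairing L).

Let total_onto (T : Type) (K : hilbertType R) (j : T -> K) (D : set K) : norm_dense D -> (forall x, D x -> exists t, j t = x) -> total j.
Proof.
move=> dD hj v e e0; have [x Dx hx] := dD v e e0; have [t jt] := hj x Dx.
by exists [:: (1, t)]; rewrite /comb big_seq1 scale1r jt.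
Qed.
Let total_inr : total (fun p : H * H => hb (bar p.1) p.2).
Proof.
apply: (ht_total2 hhb (j := bar) (k := id)).
  apply: (@total_onto _ _ _ setT) => [v e e0|x _]; last by exists (barV x); rewrite barK.
  by exists v => //; rewrite subrr Nm0 ltW.
apply: (@total_onto _ _ _ setT) => [v e e0|x _]; last by exists x.
by exists v => //; rewrite subrr Nm0 ltW.
Qed.
Let total_inl : total (fun a : H * {q | Q q} => af V (hb (bar a.1) (sval a.2).1)).
Proof.
have t1 : total (fun a : H * {q | Q q} => hb (bar a.1) (sval a.2).1).
  apply: (ht_total2 hhb (j := bar) (k := fun q : {q | Q q} => (sval q).1)).
    apply: (@total_onto _ _ _ setT) => [v e e0|x _]; last by exists (barV x); rewrite barK.
    by exists v => //; rewrite subrr Nm0 ltW.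
  by apply: (total_onto dQ) => _ [q Qq <-]; exists (exist _ q Qq).
move=> v e e0; have [s hs] := t1 (af V^⋆ v) e e0; exists s.
have -> : comb (fun a : H * {q | Q q} => af V (hb (bar a.1) (sval a.2).1)) s = af V (comb (fun a : H * {q | Q q} => hb (bar a.1) (sval a.2).1) s).
  exact/esym/(comb_lin _ _ (af_lin V)).
have -> : v = af V (af V^⋆ v) by rewrite -af_comp V2 af_one.
by rewrite -(linB (af_lin V)) unitary_Nm.
Qed.

Let Xt := cspan [set rt p.1 p.2 | p in @setT (H * H)].
Let cX : csub Xt. Proof. exact: cspan_csub. Qed.
Let sg_blin : blin sg. Proof. by split; [exact: sg_lin|exists 1 => x; rewrite mul1r Nm_sg]. Qed.
Let rX u y : Xt (rt u y). Proof. by apply: sub_cspan; exists (u, y). Qed.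
Let sX u y : Xt (sg (r u y)).
Proof.
apply: (rsl_csub (P := [set c | Xt (sg c)]) u y (csub_pre sg_blin cX) dQ rQ).
by move=> _ _ [[u1 u1'] Qu <-] [[y1 y1'] Qy <-] /=; rewrite -(mod_sg Qu Qy).
Qed.
Let Xs : Xt `<=` cspan [set sg (r p.1 p.2) | p in @setT (H * H)].
Proof.
apply: (cspan_min (cspan_csub _)) => _ [[u y] _ <-] /=.
apply: (rsl_csub u y (cspan_csub _) rQ dQ) => _ _ [[u1 u1'] Qu <-] [[y1 y1'] Qy <-] /=.
by have -> : rsl hhb V u1' y1 = sg (r u1 y1') by [exact: mod_sg]; apply: sub_cspan; exists (u1, y1').
Qed.
(** Transfer along the total right family puts every [rt u (r w v x)] into the span of products;
    since [U] is unitary, the vectors [r w v x] are total. *)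
Let span_prod u y : cspan [set (sg (r a.1 a.2))^⋆ ⋅ rt b.1 b.2 | a in @setT (H * H) & b in @setT (H * H)] (rt u y).
Proof.
set Y := cspan _; have cY : csub Y by exact: cspan_csub.
have cY1 : csub [set y | Y (rt u y)] by exact: (csub_pre (rsl_blinr hhb V u)).
have h1 w v x : Y (rt u (af (r w v) x)).
  have b x' : blin (fun c : Bop H => af c x') by exact: af_blinl.
  apply: (rsl_csub (P := [set c | Y (rt u (af c x))]) w v _ dQ rQ); first exact: (csub_pre (b x) cY1).
  move=> _ _ [[w1 w1'] Qw <-] [q Qq <-] /=.
  apply: (mod_transfer Qw (k := @inr _ _) (inl (u, exist _ q Qq)) cY) => [|[p a]]; first exact: total_inr.
  by apply: sub_cspan; exists (a, w1') => //; exists (p, x).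
have h2 w xi : Y (rt u (ctr hh w xi)).
  have -> : xi = af U (af U^⋆ xi) by rewrite -af_comp U2 af_one.
  move: (af U^⋆ xi) => {}xi; apply: (total_ind (P := [set xi | Y (rt u (ctr hh w (af U xi)))]) (ht_total hh)).
    exact: (csub_pre (blin_comp (ctr_blin hh w) (af_blin U)) cY1).
  by move=> [x v]; exact: h1.
have [->|y0] := eqVneq y 0; first exact: cY1.1.1.
have -> : y = ⟨y, y⟩^-1 *: ctr hh y (h y y).
  by rewrite ctr_h scalerA mulVf ?scale1r //; apply: contra_neq y0 => /inner_eq0.
exact: lsubZ cY1.1 _ _ (h2 _ _).
Qed.
(** The converse transfer, along the total left family, whose operators are slices of [V]. *)
Let XX a b : Xt a -> Xt b -> Xt (a^⋆ ⋅ b).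
Proof.
move=> /Xs Xa; move: b; apply: cspan_min; first exact: (csub_pre (blin_smull a^⋆) cX).
move=> _ [[p u] _ <-] /=.
have cc : csub [set d | Xt (d ⋅ rt p u)] by exact: (csub_pre (blin_smulr _) cX).
move: a Xa; apply: (cspan_min (csub_star cc)).
move=> _ [[q v] _ <-] /=; rewrite -sg_star.
suff : [set c | [set d | Xt (sg d ⋅ rt p u)] c^⋆] (r q v) by [].
have ce : csub [set d | Xt (sg d ⋅ rt p u)] by exact: (csub_pre sg_blin cc).
apply: (rsl_csub q v (csub_star ce) dQ rQ) => x _ _ [[w w'] Qw <-] /=; rewrite sg_star.
apply: (mod_transfer Qw (k := @inl _ _) (inr (p, x)) cX) => [|[y b]]; first exact: total_inl.
exact: rX.
Qed.

(* If [X] is the closed span of the slices of [V], then [X^* X] is contained in [X] and spans it,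
   so [X] is selfadjoint. *)
Lemma modular_slice_star u y : cspan [set r p.1 p.2 | p in @setT (H * H)] (r u y)^⋆.
Proof.
apply: (@cspan_iso _ _ _ sg); [exact: sg_lin|exact: Nm_sg|].
have -> : sg @` [set r p.1 p.2 | p in @setT (H * H)] = [set sg (r p.1 p.2) | p in @setT (H * H)].
  by rewrite image_comp.
apply: Xs; rewrite sg_star.
suff st : forall c, Xt c -> Xt c^⋆ by exact/st/sX.
apply: cspan_min; first exact: csub_star.
move=> _ [[p q] _ <-] /=.
have := @span_prod p q; apply: (cspan_min (csub_star cX)) => _ [a _ [b _ <-]] /=.
by rewrite sstarM sstarK; apply: XX; [exact: rX|exact: sX].
Qed.
End Modular.

(** * Quantum groups *)

Section QuantumGroup.
Variables (R : realType) (A : cstarBialg R).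

Lemma single_square_sum (V : hilbertType R) (x : V) (n : nat) : \sum_(k < n) `|if k == 0%N :> nat then x else 0| ^+ 2 <= `|x| ^+ 2.
Proof.
case: n => [|n]; first by rewrite big_ord0 exprn_ge0.
rewrite big_ord_recl /= big1 ?addr0 // => i _.
by rewrite /= normr0 expr0n.
Qed.

Lemma cvg_single (f : nat -> R[i]^o) (l : R[i]) : f 0%N = l -> (forall k, f k.+1 = 0) ->
  (\sum_(k < n) f k : R[i]^o) @[n --> \oo] --> (l : R[i]^o).
Proof.
move=> f0 fS; apply/cvg_Nm => e e0; exists 1%N => // -[//|n] _ /=.
by rewrite big_ord_recl big1 => [|i _]; [rewrite addr0 f0 subrr Nm0 ltW|exact: fS].
Qed.

Lemma impl_left (T : cstarAlgType R) (L : hilbertType R) (s : T -> Bop L) m F : star_hom s ->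
  (forall x, s (ml m x) = F ⋅ s x) -> (forall x, s (ml m^⋆ x) = F^⋆ ⋅ s x) -> impl s m F.
Proof.
move=> hs h h'; split=> // x; have := h' x^⋆; rewrite mstarE sstarK (shS hs) (shS hs).
by move=> /(congr1 sstar); rewrite !sstarK sstarM !sstarK.
Qed.

(** The last clause is what modularity contributes: the closed span of the right slices of [U] is
    selfadjoint. *)
Definition qg_data (H L : hilbertType R) (h : H -> H -> L) (hh : hilbert_tensor h)
    (SA : A -> Bop H) (P2 : bAA A -> Bop L) (U : Bop L) : Prop :=
  [/\ [/\ star_hom SA, injective SA & nondeg SA],
      star_hom P2 /\ forall a b, P2 (bt a b) = otens hh (SA a) (SA b),
      [/\ U^⋆ ⋅ U = aone (hpairing L), U ⋅ U^⋆ = aone (hpairing L) & Defs.multiplicative h (af U)],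
      forall a, impl P2 (Delta a) (U ⋅ otens hh (SA a) (aone (hpairing H)) ⋅ U^⋆)
    & forall u y, cspan [set rsl hh U p.1 p.2 | p in @setT (H * H)] (rsl hh U u y)^⋆].

Lemma cqg_data : cstar_quantum_group A ->
  exists H L h hh SA P2 U, @qg_data H L h hh SA P2 U.
Proof.
move=> [H [L [h [W [p [p2 [[hh uW mW mod] [fp rp [rp2 p2E] DE]]]]]]]].
have {mod} [Qh [Q [sQh sQ comm [Hb [Lb [bar [hb [Wt [cj hhb uWt modE]]]]]]]]] : modular h W.
  by case: mod => // -[Q ?]; exists Q, Q.
have [U [UE U1 U2]] := unitary_op uW; have [V [VE V1 V2]] := unitary_op uWt.
have [SA [hS Si SE]] := faithful_hom fp; have [P2 [hP PE]] := rep_hom rp2.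
exists H, L, h, hh, SA, P2, U.
have P2E a b : P2 (bt a b) = otens hh (SA a) (SA b).
  apply: (Bop_total (ht_total hh)) => -[x y] /=.
  by rewrite PE p2E otensE !SE.
(* The represented algebra contains the slices of [U] by pairs of vectors in the first leg;
   unitarity of [U] makes their ranges total. *)
have ndS : nondeg SA.
  pose P := cspan (range (fun q : A * H => af (SA q.1) q.2)).
  have cP : csub P by exact: cspan_csub.
  have h1 x0 y0 v : P (ctr (ht_flip hh) x0 (W (h y0 v))).
    have [a _ aE] : range p (fun v => ctr (ht_flip hh) x0 (W (h y0 v))).
      rewrite rp => e e0; exists (fun v => ctr (ht_flip hh) x0 (W (h y0 v))); last by move=> z; rewrite subrr normr0 mulr_ge0 // ltW.
      exists 1, (fun _ => 1), (fun _ => (fun v => ctr (ht_flip hh) x0 (W (h y0 v)))); split; last by rewrite big_ord1 scale1r.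
      move=> _; split.
        by apply/bounded_linearE; rewrite -UE; exact: (blin_comp (ctr_blin (ht_flip hh) x0) (blin_comp (af_blin U) (ht_blinr hh y0))).
      (* A single pair of vectors, viewed as square summable sequences supported at [0]. *)
      exists (fun k => if k == 0%N then x0 else 0), (fun k => if k == 0%N then y0 else 0); split.
      - exists (`|x0| ^+ 2); exact: single_square_sum.
      - exists (`|y0| ^+ 2); exact: single_square_sum.
      move=> u z; apply: (@cvg_single (fun k => ⟨h (if k == 0%N then x0 else 0) u, W (h (if k == 0%N then y0 else 0) z)⟩)) => [|k] /=.
        by rewrite ctrE.
      by rewrite (lin0 (htl hh _)) inner0l.
    by rewrite -(congr1 (@^~ v) aE) -SE; apply: sub_cspan; exists (a, v).
  have h2 x0 xi : P (ctr (ht_flip hh) x0 xi).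
    have -> : xi = af U (af U^⋆ xi) by rewrite -af_comp U2 af_one.
    move: (af U^⋆ xi) => {}xi; apply: (total_ind (P := [set xi | P (ctr (ht_flip hh) x0 (af U xi))]) (ht_total hh)).
      exact: (csub_pre (blin_comp (ctr_blin (ht_flip hh) x0) (af_blin U)) cP).
    by move=> [x v]; rewrite /= UE; exact: h1.
  apply/totalE/seteqP; split=> // y _; change (P y).
  have [->|y0] := eqVneq y 0; first exact: cP.1.1.
  have -> : y = ⟨y, y⟩^-1 *: ctr (ht_flip hh) y (h y y).
    by rewrite (ctr_h (ht_flip hh)) scalerA mulVf ?scale1r //; apply: contra_neq y0 => /inner_eq0.
  exact: lsubZ cP.1 _ _ (h2 _ _).
split=> //; first by split; rewrite // UE.
  have i2 a x : P2 (ml (Delta a) x) = U ⋅ otens hh (SA a) (aone (hpairing H)) ⋅ U^⋆ ⋅ P2 x.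
    apply: aop_ext => v; rewrite PE DE !af_comp PE -SE -UE hadj_op.
    by have /= -> := ht_op_tensor hh (SA a) (aone (hpairing H)).
  move=> a.
  apply: impl_left => // x; rewrite -(shS (@Delta_hom R A)) i2 !sstarM sstarK otens_star (shS hS).
  by have -> : (aone (hpairing H))^⋆ = aone _ by [exact: aop_ext]; rewrite !smulA.
move=> u y; rewrite -UE -VE in comm modE mW.
exact: (@modular_slice_star _ _ _ _ _ _ _ _ _ _ _ _ hh hhb cj U1 V1 V2 sQh sQ comm modE mW U2 u y).
Qed.

Section Legs.
Variables (H L : hilbertType R) (h : H -> H -> L) (hh : hilbert_tensor h).
Variables (SA : A -> Bop H) (P2 : bAA A -> Bop L) (U : Bop L).
Hypothesis qg : qg_data hh SA P2 U.

Section ThreeLegs.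
Variables (K0 K2 K3 : hilbertType R) (h2 : K0 -> H -> K2) (h3 : K0 -> L -> K3) (hr : K2 -> H -> K3).
Hypotheses (hh2 : hilbert_tensor h2) (hh3 : hilbert_tensor h3) (hhr : hilbert_tensor hr).
Hypothesis assoc : forall x y z, hr (h2 x y) z = h3 x (h y z).
Local Notation one K := (aone (hpairing K)).

Definition W23 : Bop K3 := otens hh3 (one K0) U.
Lemma aone_star (K : hilbertType R) : (one K)^⋆ = one K. Proof. exact: aop_ext. Qed.
Lemma W23U : W23^⋆ ⋅ W23 = one K3.
Proof. by case: qg => _ _ [U1 _ _] _ _; rewrite /W23 otens_star otensM U1 aone_star a1mul' otens1. Qed.
Lemma W23V : W23 ⋅ W23^⋆ = one K3.
Proof. by case: qg => _ _ [_ U2 _] _ _; rewrite /W23 otens_star otensM U2 aone_star a1mul' otens1. Qed.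

(* On [K2 = K0 (x) H] this implements [id (x) Delta]. *)
Definition beta (X : Bop K2) : Bop K3 := W23 ⋅ otens hhr X (one H) ⋅ W23^⋆.
Lemma beta_hom : star_hom beta.
Proof.
split=> [z x y|x y|x]; rewrite /beta.
- by rewrite otens_linl smulDr smulDl smulZr smulZl.
- rewrite -[one H in LHS]a1mul' -otensM !smulA -[_ ⋅ W23^⋆ ⋅ W23]smulA W23U.
  by rewrite amul1'.
by rewrite !sstarM sstarK otens_star aone_star smulA.
Qed.
Lemma beta_inj X : beta X = 0 -> X = 0.
Proof.
move=> /(congr1 (fun Y => W23^⋆ ⋅ Y ⋅ W23)).
rewrite /beta smul0r smul0l -!smulA W23U amul1' smulA W23U a1mul' => X0.
(* If [H] is zero, then so is [K2]; otherwise a nonzero vector of [H] detects [X]. *)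
have [y0|] := pselect (forall y : H, y = 0).
  apply: (Bop_total (ht_total hh2)) => -[x y] /=.
  by rewrite (y0 y) (lin0 (htr hh2 x)) af0.
move=> /existsNP[y /eqP y0]; apply: aop_ext => x; rewrite af_zero.
have : hr (af X x) y = 0 by rewrite -[y]af_one -otensE X0 af_zero.
move=> /(congr1 (@Nm _ _)); rewrite (ht_Nm hhr) Nm0 => /eqP; rewrite mulf_eq0 => /orP[/eqP/Nm_eq0 //|/eqP /Nm_eq0 ye].
by rewrite ye eqxx in y0.
Qed.

Section IdDelta.
Variables (B : cstarAlgType R) (s : B -> Bop K0) (T : tensorA A B) (S2 : tA T -> Bop K2) (S3 : tAA T -> Bop K3).
Hypotheses (hs : star_hom s) (tr : tensorA_rep hh2 hh3 hhr s SA P2 S2 S3).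

(** [W_23] commutes with operators on the first leg, and conjugation by [U] implements [Delta] on
    the others. *)
Lemma beta_leg X a z : beta (otens hh2 X (SA a)) ⋅ otens hh3 (one K0) (P2 z) = otens hh3 X (P2 (ml (Delta a) z)).
Proof.
have [_ _ _ D _] := qg; rewrite (D a).1 /beta (otens_assoc hh2 hh hh3 hhr assoc) /W23 !otens_star !otensM aone_star.
by rewrite !amul1' a1mul'.
Qed.

Lemma idD_impl x : impl S3 (idD x) (beta (S2 x)).
Proof.
have [[hS2 i2] [hS3 i3] E2 E3 E3'] := tr; have [[hSA _ _] [hP PE] _ D _] := qg.
apply: (tens_mhom_impl (@tt_min _ _ _ T) _ (memb_hom B) (@Delta_hom R A) hS3 i3 (S := fun x => beta (S2 x))).
- by have [] := @tlr_min _ _ _ T.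
- exact: (sh_blin (sh_comp beta_hom hS2)).
move=> b a; rewrite E2 /beta (otens_assoc hh2 hh hh3 hhr assoc).
have -> : W23 ⋅ otens hh3 (s b) (otens hh (SA a) (one H)) ⋅ W23^⋆ = otens hh3 (s b) (U ⋅ otens hh (SA a) (one H) ⋅ U^⋆).
  by rewrite /W23 otens_star !otensM aone_star amul1' a1mul'.
have mtr : min_tensor (Defs.tr T) by have [] := @tlr_min _ _ _ T.
exact: (mtens_impl mtr hS3 i3 E3' (impl_memb hs b) (D a)).
Qed.

(** [id_Delta m] is determined by its effect on the total set of elements [ml (idD x) y], where
    [beta F] acts in the same way. *)
Lemma id_Delta_impl m F : impl S2 m F -> impl S3 (id_Delta m) (beta F).
Proof.
have [[hS2 i2] [hS3 i3] E2 E3 E3'] := tr.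
have main n G : impl S2 n G -> forall z, S3 (ml (id_Delta n) z) = beta G ⋅ S3 z.
  move=> nG; apply: (@id_Delta_ext _ A B T).
  - exact: (blin_comp (sh_blin hS3) (ml_blin _)).
  - exact: (blin_comp (blin_smull _) (sh_blin hS3)).
  move=> x y; have e := id_DeltaM n x.
  rewrite -[ml (id_Delta n) _]/(ml (id_Delta n ⋅ idD x) y) e (idD_impl _).1 (idD_impl x).1.
  by rewrite nG.1 (shM beta_hom) smulA.
move=> mF; apply: impl_left => //; first exact: main.
rewrite -(shS (@id_Delta_hom _ A B T)) -(shS beta_hom); apply: main.
exact: implS.
Qed.
End IdDelta.

Section FourLegs.
Variables (K4 : hilbertType R) (h3' : K2 -> L -> K4) (hr4 : K3 -> H -> K4).
Hypotheses (hh3' : hilbert_tensor h3') (hhr4 : hilbert_tensor hr4).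
Hypothesis assoc4 : forall x y z, hr4 (hr x y) z = h3' x (h y z).

Definition W34 : Bop K4 := otens hh3' (one K2) U.

(** Conjugation by [F] turns [W_23] into [W_24], so this is [W_34 W_23 = W_23 W_24 W_34] on
    [K0 (x) H (x) H (x) H]. The given equation lives on some triple product of [H]; the map [J]
    inserts a vector of [K0] in front of it. *)
Lemma pentagon4 (F : Bop K4) : (forall x y z, af F (hr4 (hr x y) z) = hr4 (hr x z) y) ->
  W34 ⋅ otens hhr4 W23 (one H) = otens hhr4 W23 (one H) ⋅ F ⋅ otens hhr4 W23 (one H) ⋅ F ⋅ W34.
Proof.
move=> FE; have [_ _ [_ _ pent] _ _] := qg.
have [H3 [l [rr [m [[hl hm hmm hlrm] [W12 [W13 [W23' [[b12 e12] [b13 e13] [b23 e23] P]]]]]]]]] := pent.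
have lE x1 y1 z1 : rr x1 (h y1 z1) = l (h x1 y1) z1 by exact: (hlrm _ _ _).1.
have mE x1 y1 z1 : m y1 (h x1 z1) = l (h x1 y1) z1 by exact: (hlrm _ _ _).2.
have {b12} b12 := (bounded_linearE _).1 b12.
have {b13} b13 := (bounded_linearE _).1 b13.
have {b23} b23 := (bounded_linearE _).1 b23.
set V := otens hhr4 W23 (one H).
have VE v z : af V (hr4 v z) = hr4 (af W23 v) z by rewrite otensE.
have W23E x v : af W23 (h3 x v) = h3 x (af U v) by rewrite otensE.
have W34E x v : af W34 (h3' x v) = h3' x (af U v) by rewrite otensE.
have idt (V' : hilbertType R) : total (@id V').
  by apply/totalE/seteqP; split=> // v _; apply: sub_cspan; exists v.
have tl := triple_total hh hl.
have [J bJ JE] : exists2 J : K0 -> H3 -> K4, forall x, blin (J x) & forall x y z w, J x (l (h y z) w) = hr4 (hr (h2 x y) z) w.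
  have [L' [h' hh']] := hilbert_tensor_ex K0 H3.
  have [Th [Thl Thi Thh]] := isom_ex (F := fun p : K0 * (H * H * H) => hr4 (hr (h2 p.1 p.2.1.1) p.2.1.2) p.2.2)
    (ht_total2 hh' (idt K0) tl)
    (fun p q => ltac:(by rewrite /= !(ht_inner hh') !(ht_inner hl) !(ht_inner hh) !(ht_inner hhr4) !(ht_inner hhr) !(ht_inner hh2) !mulrA)).
  exists (fun x v => Th (h' x v)) => [x|x y z w]; last by rewrite -(Thh (x, (y, z, w))).
  apply: (blin_comp (f := Th) _ (ht_blinr hh' x)); split=> //; exists 1 => v.
  rewrite mul1r -(@ler_pXn2r _ 2) ?nnegrE ?Nm_ge0 //.
  by rewrite !NmRe Thi.
have Jl x v z : J x (l v z) = hr4 (h3 x v) z.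
  apply: (total_eq (ht_total hh) (f := fun v => J x (l v z)) (g := fun v => hr4 (h3 x v) z)).
  - exact: (blin_comp (bJ x) (ht_blinl hl z)).
  - exact: (blin_comp (ht_blinl hhr4 z) (ht_blinr hh3 x)).
  by move=> [a b] /=; rewrite JE assoc.
have Jr x y v : J x (rr y v) = h3' (h2 x y) v.
  apply: (total_eq (ht_total hh) (f := fun v => J x (rr y v)) (g := fun v => h3' (h2 x y) v)).
  - exact: (blin_comp (bJ x) (ht_blinr hm y)).
  - exact: (ht_blinr hh3' _).
  by move=> [a b] /=; rewrite lE JE assoc4.
have Jm x y v : af F (J x (m y v)) = hr4 (h3 x v) y.
  apply: (total_eq (ht_total hh) (f := fun v => af F (J x (m y v))) (g := fun v => hr4 (h3 x v) y)).
  - exact: (blin_comp (af_blin F) (blin_comp (bJ x) (ht_blinr hmm y))).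
  - exact: (blin_comp (ht_blinl hhr4 y) (ht_blinr hh3 x)).
  by move=> [a b] /=; rewrite mE JE FE assoc.
have FF : F ⋅ F = one K4.
  by apply: (Bop_total (triple_total hhr hhr4)) => -[[a b] c]; rewrite af_comp !FE.
have J12 x v : af V (J x v) = J x (W12 v).
  apply: (total_eq (ht_total hl) (f := fun v => af V (J x v)) (g := fun v => J x (W12 v))).
  - exact: (blin_comp (af_blin V) (bJ x)).
  - exact: (blin_comp (bJ x) b12).
  by move=> [a b] /=; rewrite e12 !Jl VE W23E.
have J23 x v : af W34 (J x v) = J x (W23' v).
  apply: (total_eq (ht_total hm) (f := fun v => af W34 (J x v)) (g := fun v => J x (W23' v))).
  - exact: (blin_comp (af_blin W34) (bJ x)).
  - exact: (blin_comp (bJ x) b23).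
  by move=> [a b] /=; rewrite e23 !Jr W34E.
have J13 x v : af F (af V (af F (J x v))) = J x (W13 v).
  apply: (total_eq (ht_total hmm) (f := fun v => af F (af V (af F (J x v)))) (g := fun v => J x (W13 v))).
  - exact: (blin_comp (af_blin F) (blin_comp (af_blin V) (blin_comp (af_blin F) (bJ x)))).
  - exact: (blin_comp (bJ x) b13).
  move=> [a b] /=; rewrite e13 Jm VE W23E -Jm -af_comp FF.
  by rewrite af_one.
apply: (Bop_total (ht_total2 hhr4 (triple_total hh2 hhr) (idt H))) => -[[[x y] z] w] /=.
by rewrite -JE J12 !J23 J13 J12 P.
Qed.

(** [beta X (x) 1] is [V Y V^⋆], where [Y = X (x) 1 (x) 1] commutes with [F] and [W34]. The pentagon
    equation moves [W34] next to [Y], where it cancels against its adjoint. *)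
Lemma beta_coassoc (F : Bop K4) X : F ⋅ F = one K4 -> (forall x y z, af F (hr4 (hr x y) z) = hr4 (hr x z) y) ->
  otens hhr4 W23 (one H) ⋅ F ⋅ otens hhr4 (beta X) (one H) ⋅ F ⋅ (otens hhr4 W23 (one H))^⋆ =
  W34 ⋅ otens hhr4 (beta X) (one H) ⋅ W34^⋆.
Proof.
move=> FF FE; set V := otens hhr4 W23 (one H); set Y := otens hhr4 (otens hhr X (one H)) (one H).
have FS : F^⋆ = F.
  apply: (Bop_total (triple_total hhr hhr4)) => -[[a b] c] /=.
  apply: (total_inner (triple_total hhr hhr4)) => -[[a' b'] c'] /=.
  by rewrite -Bop_adj !FE !(ht_inner hhr4) !(ht_inner hhr) -!mulrA [⟨c', b⟩ * _]mulrC.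
have FY : F ⋅ Y = Y ⋅ F.
  by apply: (Bop_total (triple_total hhr hhr4)) => -[[a b] c]; rewrite /= FE /Y !otensE !af_one FE.
have WY : W34 ⋅ Y = Y ⋅ W34.
  rewrite /Y (otens_assoc hhr hh hh3' hhr4 assoc4) otens1 /W34 !otensM.
  by rewrite a1mul' amul1' amul1' a1mul'.
have bE : otens hhr4 (beta X) (one H) = V ⋅ Y ⋅ V^⋆ by rewrite /V /Y otens_star !otensM aone_star !a1mul'.
have V1 : V^⋆ ⋅ V = one K4 by rewrite /V otens_star otensM W23U aone_star a1mul' otens1.
have pe : W34 ⋅ V = V ⋅ F ⋅ V ⋅ F ⋅ W34 := pentagon4 FE.
have pe' : V^⋆ ⋅ W34^⋆ = W34^⋆ ⋅ F ⋅ V^⋆ ⋅ F ⋅ V^⋆.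
  by rewrite -sstarM pe !sstarM FS !smulA.
have W1 : W34 ⋅ W34^⋆ = one K4.
  by case: qg => _ _ [_ U2 _] _ _; rewrite /W34 otens_star otensM U2 aone_star a1mul' otens1.
rewrite bE; transitivity (W34 ⋅ V ⋅ Y ⋅ (V^⋆ ⋅ W34^⋆)); last by rewrite !smulA.
rewrite pe pe' !smulA; congr (_ ⋅ V^⋆); congr (_ ⋅ F); congr (_ ⋅ V^⋆).
rewrite -[V ⋅ F ⋅ V ⋅ F ⋅ W34 ⋅ Y]smulA WY !smulA -[_ ⋅ W34 ⋅ W34^⋆]smulA W1 amul1'.
rewrite -[_ ⋅ Y ⋅ F]smulA -FY smulA -[_ ⋅ F ⋅ F]smulA FF amul1' //.
Qed.
End FourLegs.
End ThreeLegs.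
End Legs.
End QuantumGroup.

(** * Existence *)

Lemma blinB (R : realType) (V W : normedModType R[i]) (f g : V -> W) : blin f -> blin g -> blin (fun x => f x - g x).
Proof.
move=> bf bg; have := blin_lin (-1) bg bf.
by have -> // : (fun x => f x - g x) = (fun x => -1 *: g x + f x) by apply/funext => x; rewrite scaleN1r addrC.
Qed.

Lemma mnorm_leE (R : realType) (A : cstarAlgType R) (m : multiplier A) (e : R) : 0 <= e -> mnorm_le m e%:C%C -> Nm (mlop m) <= e.
Proof.
by move=> e0 h; apply: aop_lub => // x; have := h x; rewrite !NmE -rcM lecR.
Qed.

Lemma functional_factorl (R : realType) (B : cstarAlgType R) (w : B -> R[i]) (d : R) :
  represented B -> bounded_functional w -> 0 < d -> exists u : B, forall y, Nm (w y - w (u ⋅ y)) <= d * Nm y.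
Proof.
move=> rB bw d0; have [u [_ hu]] := functional_factor rB (bf_conj bw) d0.
exists u^⋆ => y; have := hu y^⋆; rewrite sstarM !sstarK sstar_Nm -[X in X <= _ -> _]Nm_conj.
by rewrite cjD cjN !cjK.
Qed.

Lemma iso_image_csub (R : realType) (V W : completeNormedModType R[i]) (f : V -> W) (P : set V) :
  linear f -> (forall v, Nm (f v) = Nm v) -> csub P -> csub [set w | exists2 v, f v = w & P v].
Proof.
move=> lf fN cP; have cr := iso_range lf fN; split.
  split; first by exists 0; [exact: lin0|exact: cP.1.1].
  move=> z _ _ [v <- Pv] [v' <- Pv']; exists (z *: v + v'); first by rewrite lf.
  exact: cP.1.2.
move=> w hw; have [v _ vw] : range f w.
  by apply: cr.2 => e /hw[_ [v <- _] ?]; exists (f v) => //; exists v.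
exists v => //; apply: cP.2 => e /hw[_ [v' <- Pv'] h]; exists v' => //.
by rewrite -fN (linB lf) vw.
Qed.

Section Existence.
Variables (R : realType) (A : cstarBialg R).
Variables (H L : hilbertType R) (h : H -> H -> L) (hh : hilbert_tensor h).
Variables (SA : A -> Bop H) (P2 : bAA A -> Bop L) (U : Bop L).
Hypothesis qg : qg_data hh SA P2 U.
Hypothesis smp : slice_map_property (bA A).
Variables (C : cstarAlgType R) (T : tensorA A C) (d : C -> multiplier (tA T)).
Hypotheses (pcd : partial_coaction d) (injd : injective d) (regd : regular d).
Variables (K0 K2 K3 K4 : hilbertType R) (h2 : K0 -> H -> K2) (h3 : K0 -> L -> K3) (hr : K2 -> H -> K3).
Variables (h3' : K2 -> L -> K4) (hr4 : K3 -> H -> K4).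
Hypotheses (hh2 : hilbert_tensor h2) (hh3 : hilbert_tensor h3) (hhr : hilbert_tensor hr).
Hypothesis assoc : forall x y z, hr (h2 x y) z = h3 x (h y z).
Hypotheses (hh3' : hilbert_tensor h3') (hhr4 : hilbert_tensor hr4).
Hypothesis assoc4 : forall x y z, hr4 (hr x y) z = h3' x (h y z).
Variables (s0 : C -> Bop K0) (S2 : tA T -> Bop K2) (S3 : tAA T -> Bop K3).
Hypotheses (hs0 : star_hom s0) (trep : tensorA_rep hh2 hh3 hhr s0 SA P2 S2 S3) (nd2 : nondeg S2) (nd3 : nondeg S3).
Variables (T2 : cstarAlgType R) (t2 : Bop K2 -> A -> T2) (ST : T2 -> Bop K3).
Hypotheses (mt2 : min_tensor t2) (hST : star_hom ST) (STi : injective ST) (STE : forall X a, ST (t2 X a) = otens hhr X (SA a)).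
Variables (T4 : cstarAlgType R) (t4 : Bop K3 -> A -> T4) (SW : T4 -> Bop K4).
Hypotheses (mt4 : min_tensor t4) (hSW : star_hom SW) (SWi : injective SW) (SWE : forall X a, SW (t4 X a) = otens hhr4 X (SA a)).
Local Notation one K := (aone (hpairing K)).
Local Notation bt2 := (beta U hh3 hhr).
Local Notation bt4 := (beta U hh3' hhr4).

Let hS2 : star_hom S2. Proof. by case: trep => -[]. Qed.
Let S2i : injective S2. Proof. by case: trep => -[]. Qed.
Let hS3 : star_hom S3. Proof. by case: trep => _ []. Qed.
Let S3i : injective S3. Proof. by case: trep => _ []. Qed.
Let hSA : star_hom SA. Proof. by case: qg => -[]. Qed.
Let SAi : injective SA. Proof. by case: qg => -[]. Qed.
Let hP2 : star_hom P2. Proof. by case: qg => _ []. Qed.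
Let P2E a b : P2 (bt a b) = otens hh (SA a) (SA b). Proof. by case: qg => _ []. Qed.
Let P2i : injective P2. Proof. exact: (P2_inj hSA SAi hP2 P2E). Qed.
Let mtt := @tt_min _ _ _ T.
Let mtl : min_tensor (@tl _ _ _ T). Proof. by have [] := @tlr_min _ _ _ T. Qed.
Let hd : star_hom d. Proof. by case: pcd. Qed.

Let sb := projT1 (cid (bar_ex hS2 S2i nd2)).
Let sb_hom : star_hom sb. Proof. by rewrite /sb; case: cid => f []. Qed.
Let sbI m : impl S2 m (sb m). Proof. by rewrite /sb; case: cid => f []. Qed.
Let de c := sb (d c).
Let de_hom : star_hom de. Proof. exact: (sh_comp sb_hom hd). Qed.
Let de_inj : injective de.
Proof. by move=> c c' e; apply: injd; apply: (impl_uniq S2i (sbI _)); rewrite -/(de c) e. Qed.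

Let one2 a := otens hhr (one K2) (SA a).
(** Regularity approximates the multiplier by sums of [m (x) b], whose operators lie in the range of
    [ST]; this range is closed because [ST] is isometric. *)
Let reg_x c a : exists x, ST x = bt2 (de c) ⋅ one2 a.
Proof.
have [sb3 [hsb3 sb3I]] := bar_ex hS3 S3i nd3.
have cR : csub (range ST) by exact: (iso_range (sh_lin hST) (rep_iso hST STi)).
have E : sb3 (id_Delta (d c) ⋅ one_one_tens T a) = bt2 (de c) ⋅ one2 a.
  apply: (impl_uniqF nd3 (sb3I _)); apply: implM => //.
    exact: (id_Delta_impl qg assoc hs0 trep (sbI _)).
  case: trep => _ _ _ E3 _; apply: (mtens_impl mtl hS3 S3i E3 (impl_one _)).
  exact: impl_memb.
suff [x _ xE] : range ST (sb3 (id_Delta (d c) ⋅ one_one_tens T a)) by exists x; rewrite xE.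
apply: cR.2 => e e0; have e0' : (0 : R[i]) < e%:C%C by rewrite ltcR.
have [n nX nE] := regd c a e0'.
exists (sb3 n).
  have lR : lsub [set m | range ST (sb3 m)].
    split; first by rewrite /= (lin0 (sh_lin hsb3)); exact: cR.1.1.
    by move=> z m m' /= rm rm'; rewrite (sh_lin hsb3); exact: cR.1.2.
  apply: (lspan_min lR) nX => _ [m _ [b _ <-]]; exists (t2 (sb m) b) => //; rewrite STE.
  apply: (impl_uniqF nd3 _ (sb3I _)); case: trep => _ _ _ E3 _.
  exact: (mtens_impl mtl hS3 S3i E3 (sbI m) (impl_memb hSA b)).
rewrite -(linB (sh_lin hsb3)) -[_ - _]mopK.
apply: le_trans (mnorm_leE (ltW e0) nE).
exact: (sh_contr (sh_comp hsb3 (mop_hom _))).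
Qed.

(* [B0] will carry the dilation; it is generated by [delta(C)] and by the slices of
   [(1 (x) a1) beta(delta c) (1 (x) a)], a set that is stable under adjoints. *)
Let X1 := [set b | exists w a1 c a y, [/\ bounded_functional w, ST y = one2 a1 ⋅ bt2 (de c) ⋅ one2 a & b = slice t2 w y]].
Let B0 := cstar_generated (range de `|` X1).
Let cB0 : csub B0. Proof. by have /sub_cstarE[] := cstar_generated_sub (range de `|` X1). Qed.
Let B0M x y : B0 x -> B0 y -> B0 (x ⋅ y). Proof. by have /sub_cstarE[_ + _] := cstar_generated_sub (range de `|` X1); apply. Qed.
Let D1 : set (Bop K3) := cspan [set otens hhr b (SA a) | b in B0 & a in setT].
Let cD1 : csub D1. Proof. exact: cspan_csub. Qed.

Let one2_impl a : impl ST (mtens t2 (mone (Bop K2)) (memb a)) (one2 a).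
Proof. exact: (mtens_impl mt2 hST STi STE (impl_one _) (impl_memb hSA a)). Qed.

(** The slice map property is applied to [B0] inside [Bop K2]. A slice by an arbitrary [w] is a norm
    limit of slices by [w (u .)], and those belong to [X1]. *)
Let x_D1 c a x : ST x = bt2 (de c) ⋅ one2 a -> D1 (ST x).
Proof.
move=> xE; have : cspan [set t2 b a | b in B0 & a in setT] x.
  apply: (smp mt2 (cstar_generated_sub _)) => w bw; apply: cB0.2 => e e0.
  have K0' : 0 < Nm x + 1 by have := Nm_ge0 x; lra.
  have [u hu] := functional_factorl (mt_repr mt2) bw (divr_gt0 e0 K0').
  have bw' := bf_mull u bw.
  exists (slice t2 (fun a => w (u ⋅ a)) x).
    apply: sub_cstar_generated; right; exists w, u, c, a, (ml (mtens t2 (mone _) (memb u)) x); split=> //.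
      by rewrite (one2_impl u).1 xE smulA.
    by rewrite slice_onel.
  have bd : bounded_functional (fun a => w a - w (u ⋅ a)).
    apply/bounded_functionalE; have /bounded_functionalE b1 := bw; have /bounded_functionalE b2 := bw'.
    split; last by exists (e / (Nm x + 1)).
    by move=> z p q; rewrite b1.1 b2.1 scalerBr; zmod.
  have sE : slice t2 w x - slice t2 (fun a => w (u ⋅ a)) x = slice t2 (fun a => w a - w (u ⋅ a)) x.
    apply: (slice_uniq mt2 bd (s := fun x => slice t2 w x - slice t2 (fun a => w (u ⋅ a)) x)) => [|b a'].
      exact: blinB (slice_blin mt2 bw) (slice_blin mt2 bw').
    by rewrite !sliceE // scalerBl.
  rewrite sE; apply: (le_trans (slice_Nm mt2 bd (ltW (divr_gt0 e0 K0')) hu x)).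
  by rewrite mulrAC ler_pdivrMr // ler_wpM2l ?(ltW e0) //; lra.
move=> /(cspan_image (sh_blin hST)); apply: cspan_mono => _ [_ [b B0b [a' _ <-]] <-].
by rewrite STE; exists b => //; exists a'.
Qed.

(* [beta(b)] is a left multiplier of [B0 (x) A] *)
Let Good b := forall a, D1 (bt2 b ⋅ one2 a).
Let Good_de c : Good (de c).
Proof. by move=> a; have [x xE] := reg_x c a; rewrite -xE; exact: x_D1 xE. Qed.
Let bt2_hom : star_hom bt2. Proof. exact: (beta_hom qg). Qed.
Let bt4_hom : star_hom bt4. Proof. exact: (beta_hom qg). Qed.
Let cGood : csub Good.
Proof.
apply: csub_all => a; apply: (csub_pre (f := fun b => bt2 b ⋅ one2 a) _ cD1).
exact: (blin_comp (blin_smulr _) (sh_blin bt2_hom)).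
Qed.
Let D1r Y b : D1 Y -> B0 b -> D1 (Y ⋅ otens hhr b (one H)).
Proof.
move=> DY Bb; move: Y DY; apply: (cspan_min (csub_pre (blin_smulr _) cD1)) => _ [b' Bb' [a _ <-]] /=.
by rewrite otensM amul1'; apply: sub_cspan; exists (b' ⋅ b); [exact: B0M|exists a].
Qed.
Let Good_D1 b Y : Good b -> D1 Y -> D1 (bt2 b ⋅ Y).
Proof.
move=> gb; move: Y; apply: (cspan_min (csub_pre (blin_smull _) cD1)) => _ [b' Bb' [a _ <-]] /=.
have -> : otens hhr b' (SA a) = one2 a ⋅ otens hhr b' (one H) by rewrite otensM a1mul' amul1'.
by rewrite smulA; exact: D1r.
Qed.
Let GoodM b b' : Good b -> Good b' -> Good (b ⋅ b').
Proof. by move=> gb gb' a; rewrite (shM bt2_hom) -smulA; exact: Good_D1. Qed.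

(** Casts the goal for slices as membership in a closed subspace of operators on [K4], so that it
    can be checked on dense sets. *)
Let G4 w := [set X | exists2 x4, SW x4 = X & D1 (slice t4 w x4)].
Let cG4 w : bounded_functional w -> csub (G4 w).
Proof.
move=> bw; apply: (iso_image_csub (sh_lin hSW) (rep_iso hSW SWi)).
exact: (csub_pre (slice_blin mt4 bw) cD1).
Qed.
Let G4_elem w b z : bounded_functional w -> B0 b -> G4 w (otens hh3' b (P2 z)).
Proof.
move=> bw Bb; apply: (cspan_all (P := [set z | G4 w (otens hh3' b (P2 z))]) (mt_cspan (@bt_min _ A))).
  exact: (csub_pre (blin_comp (otens_blinr _ _) (sh_blin hP2)) (cG4 bw)).
move=> _ [a5 _ [a6 _ <-]] /=; exists (t4 (otens hhr b (SA a5)) a6).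
  by rewrite SWE P2E (otens_assoc hhr hh hh3' hhr4 assoc4).
rewrite sliceE //; apply: lsubZ cD1.1 _ _ _.
by apply: sub_cspan; exists b => //; exists a5.
Qed.
Let one4 a := otens hhr4 (one K3) (SA a).
Let G4_one w a b z : bounded_functional w -> B0 b -> G4 w (one4 a ⋅ otens hh3' b (P2 z)).
Proof.
move=> bw Bb; have -> : one4 a ⋅ otens hh3' b (P2 z) = otens hh3' b (P2 (ml (mtens (@bt _ A) (mone A) (memb a)) z)).
  rewrite /one4 -(otens1 hhr) (otens_assoc hhr hh hh3' hhr4 assoc4) otensM a1mul'.
  by rewrite (mtens_impl (@bt_min _ A) hP2 P2i P2E (impl_one _) (impl_memb hSA a)).1.
exact: G4_elem.
Qed.
Let G4_D1 w a Z z : bounded_functional w -> D1 Z -> G4 w (one4 a ⋅ (bt4 Z ⋅ otens hh3' (one K2) (P2 z))).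
Proof.
move=> bw; move: Z; apply: cspan_min.
  apply: (csub_pre _ (cG4 bw) (f := fun Z => one4 a ⋅ (bt4 Z ⋅ otens hh3' (one K2) (P2 z)))).
  exact: (blin_comp (blin_smull _) (blin_comp (blin_smulr _) (sh_blin bt4_hom))).
move=> _ [b Bb [a' _ <-]] /=.
by rewrite (beta_leg qg hhr hh3' hhr4 assoc4); exact: G4_one.
Qed.
Let G4_de w a c z : bounded_functional w -> G4 w (one4 a ⋅ (bt4 (bt2 (de c)) ⋅ otens hh3' (one K2) (P2 z))).
Proof.
move=> bw; apply: (cspan_all (P := [set z | G4 w (one4 a ⋅ (bt4 (bt2 (de c)) ⋅ otens hh3' (one K2) (P2 z)))]) (@Delta_nondeg _ A)).
  apply: (csub_pre _ (cG4 bw) (f := fun z => one4 a ⋅ (bt4 (bt2 (de c)) ⋅ otens hh3' (one K2) (P2 z)))).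
  exact: (blin_comp (blin_smull _) (blin_comp (blin_smull _) (blin_comp (otens_blinr _ _) (sh_blin hP2)))).
move=> _ [a3 _ [y _ <-]] /=.
(* For [z = Delta(a3) y] the factor [1 (x) z] is [beta(1 (x) a3) (1 (x) y)], and
   [beta(delta c) (1 (x) a3)] lies in [D1] already. *)
rewrite -(beta_leg qg hhr hh3' hhr4 assoc4) [bt4 _ ⋅ (_ ⋅ _)]smulA -(shM bt4_hom).
by apply: G4_D1 => //; exact: Good_de.
Qed.

Let F := projT1 (cid (flip_ex hhr hhr4)).
Let FF : F ⋅ F = one K4. Proof. by rewrite /F; case: cid => f []. Qed.
Let FE x y z : af F (hr4 (hr x y) z) = hr4 (hr x z) y. Proof. by rewrite /F; case: cid => f []. Qed.
Let V := otens hhr4 (W23 U hh3) (one H).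
Let VV : V^⋆ ⋅ V = one K4.
Proof. by rewrite /V otens_star otensM (W23U qg) aone_star a1mul' otens1. Qed.
(** [beta] applied to the first leg of an element of [B(K2) (x) A]: the flip moves the last leg out
    of the way of [W_23]. *)
Let Gm (Z : Bop K3) : Bop K4 := V ⋅ F ⋅ otens hhr4 Z (one H) ⋅ F ⋅ V^⋆.
Let Gm_blin : blin Gm.
Proof.
exact: (blin_comp (blin_smulr V^⋆) (blin_comp (blin_smulr F) (blin_comp (blin_smull (V ⋅ F)) (otens_blinl hhr4 _)))).
Qed.
Let GmM Z Z' : Gm (Z ⋅ Z') = Gm Z ⋅ Gm Z'.
Proof.
rewrite /Gm -[one H in LHS]a1mul' -otensM !smulA -[_ ⋅ V^⋆ ⋅ V]smulA VV amul1'.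
by rewrite -[_ ⋅ F ⋅ F]smulA FF amul1'.
Qed.
Let Gm_elem X a : Gm (otens hhr X (SA a)) = otens hhr4 (bt2 X) (SA a).
Proof.
have -> : Gm (otens hhr X (SA a)) = V ⋅ (F ⋅ otens hhr4 (otens hhr X (SA a)) (one H) ⋅ F) ⋅ V^⋆ by rewrite /Gm !smulA.
have -> : F ⋅ otens hhr4 (otens hhr X (SA a)) (one H) ⋅ F = otens hhr4 (otens hhr X (one H)) (SA a).
  by apply: (Bop_total (triple_total hhr hhr4)) => -[[x y] z] /=; rewrite FE !otensE !af_one FE.
by rewrite /V otens_star !otensM aone_star a1mul' amul1'.
Qed.
Let Gm_one a : Gm (one2 a) = one4 a.
Proof.
rewrite /one2 Gm_elem /one4; congr (otens _ _ _).
by rewrite /beta otens1 amul1' (W23V qg).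
Qed.
Let Gm_beta X : Gm (bt2 X) = bt4 (bt2 X).
Proof. exact: (beta_coassoc qg hh2 hh3 hhr assoc hh3' hhr4 assoc4 X FF FE). Qed.

(* By coassociativity, [beta] of a slice is a slice of [W_34 (beta(delta c) (x) 1) W_34^*]; the
   density of [Delta(A) (A (x) A)] in [A (x) A] reduces this to elements of [B0 (x) A]. *)
Let Good_slice b : X1 b -> Good b.
Proof.
move=> [w [a1 [c [a [y [bw yE ->]]]]]] a2.
have [bT [hbT bTE _]] := tens_hom_ex mt2 mt4 bt2_hom.
have SbT x : SW (bT x) = Gm (ST x).
  move: x; apply: (mt_ext mt2).
  - exact: (blin_comp (sh_blin hSW) (sh_blin_rep (mt_rep mt4) hbT)).
  - exact: (blin_comp Gm_blin (sh_blin hST)).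
  by move=> X a'; rewrite bTE SWE STE Gm_elem.
have slb x : slice t4 w (bT x) = bt2 (slice t2 w x).
  move: x; apply: (mt_ext mt2).
  - exact: (blin_comp (slice_blin mt4 bw) (sh_blin_rep (mt_rep mt4) hbT)).
  - exact: (blin_comp (sh_blin bt2_hom) (slice_blin mt2 bw)).
  by move=> X a'; rewrite bTE !sliceE // (linZ (sh_lin bt2_hom)).
rewrite -slb -(slice_mulr mt4 (one2 a2) (bT y) bw).
set x4 := mr _ _.
have x4E : SW x4 = one4 a1 ⋅ (bt4 (bt2 (de c)) ⋅ otens hh3' (one K2) (P2 (bt a2 a))).
  have hid : star_hom (@id (Bop K3)) by [].
  rewrite (mtens_impl mt4 hSW SWi SWE (impl_memb hid _) (impl_one _)).2 SbT yE (GmM _ (one2 a)) (GmM (one2 a1)) Gm_beta !Gm_one.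
  rewrite -[_ ⋅ one4 a ⋅ _]smulA -smulA; congr (_ ⋅ (_ ⋅ _)).
  by rewrite /one4 /one2 otensM a1mul' amul1' P2E (otens_assoc hhr hh hh3' hhr4 assoc4).
have [x4' e Dx] := G4_de a1 c (bt a2 a) bw.
by have -> : x4 = x4' by apply: SWi; rewrite x4E e.
Qed.

Let X1S b : X1 b -> X1 b^⋆.
Proof.
move=> [w [a1 [c [a [y [bw yE ->]]]]]]; exists (fun a => (w a^⋆)^*), a^⋆, c^⋆, a1^⋆, y^⋆.
have bw' := bf_conj bw; split=> //.
  have one2S a' : (one2 a')^⋆ = one2 a'^⋆ by rewrite /one2 otens_star aone_star (shS hSA).
  rewrite (shS hST) yE [(_ ⋅ one2 a)^⋆]sstarM [(one2 a1 ⋅ _)^⋆]sstarM !one2S.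
  by rewrite (shS de_hom) (shS bt2_hom) smulA.
pose g x := (slice t2 (fun a => (w a^⋆)^*) x^⋆)^⋆.
have bg : blin g.
  have [M M0 hM] := blin_bound (slice_blin mt2 bw').
  split; last by exists M => x; rewrite /g sstar_Nm -(sstar_Nm x).
  by move=> z p q; rewrite /g sstar_antilinear (slice_blin mt2 bw').1 sstar_antilinear cjK.
suff <- : g y = slice t2 w y by rewrite /g sstarK.
apply: (slice_uniq mt2 bw bg) => b' a'.
by rewrite /g (mt_star mt2) sliceE // sstarK sstarZ cjK sstarK.
Qed.

Let GoodB b : B0 b -> Good b /\ Good b^⋆.
Proof.
move: b; apply: cstar_generated_min.
  apply/sub_cstarE; split; first exact: csubI cGood (csub_star cGood).
    by move=> x y [Gx Gx'] [Gy Gy']; split; [exact: GoodM|rewrite sstarM; exact: GoodM].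
  by move=> x [Gx Gx']; split; rewrite ?sstarK.
move=> x [[c _ <-]|Xx]; first by split; [|rewrite -(shS de_hom)]; exact: Good_de.
by split; apply: Good_slice => //; exact: X1S.
Qed.

Let hB0 := cstar_generated_sub (range de `|` X1).
Local Notation B := (subc hB0).
Let svb : B -> Bop K2 := @sv _ _ _ hB0.
Let svh : star_hom svb. Proof. exact: sv_hom. Qed.
Let svi : injective svb. Proof. exact: sv_inj. Qed.
Let svB (b : B) : B0 (svb b). Proof. exact: svP. Qed.

Section Dilate.
Variables (TB : tensorA A B) (S2B : tA TB -> Bop K3) (S3B : tAA TB -> Bop K4).
Hypothesis trB : tensorA_rep hhr hh3' hhr4 svb SA P2 S2B S3B.

Let hS2B : star_hom S2B. Proof. by case: trB => -[]. Qed.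
Let S2Bi : injective S2B. Proof. by case: trB => -[]. Qed.
Let hS3B : star_hom S3B. Proof. by case: trB => _ []. Qed.
Let S3Bi : injective S3B. Proof. by case: trB => _ []. Qed.
Let S2BE b a : S2B (tt TB b a) = otens hhr (svb b) (SA a). Proof. by case: trB. Qed.
Let S3BE x a : S3B (tl x a) = otens hhr4 (S2B x) (SA a). Proof. by case: trB. Qed.
Let mttB := @tt_min _ _ _ TB.
Let mtlB : min_tensor (@tl _ _ _ TB). Proof. by have [] := @tlr_min _ _ _ TB. Qed.

Let D1_range Y : D1 Y -> range S2B Y.
Proof.
move: Y; apply: (cspan_min (iso_range (sh_lin hS2B) (rep_iso hS2B S2Bi))) => _ [b Bb [a _ <-]].
by exists (tt TB (Subc hB0 Bb) a) => //; rewrite S2BE.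
Qed.
Let range_D1 x : D1 (S2B x).
Proof.
apply: (cspan_all (P := [set x | D1 (S2B x)]) (mt_cspan mttB)); first exact: (csub_pre (sh_blin hS2B) cD1).
by move=> _ [b _ [a _ <-]] /=; rewrite S2BE; apply: sub_cspan; exists (svb b); [exact: svB|exists a].
Qed.
Let dd_ex : exists k : B -> multiplier (tA TB), star_hom k /\ forall b, impl S2B (k b) (bt2 (svb b)).
Proof.
apply: (impl_hom hS2B S2Bi (S := bt2 \o svb) (sh_comp bt2_hom svh)) => b; apply: (impl_op hS2B S2Bi) => x.
  by apply: D1_range; apply: Good_D1 => //; exact: (GoodB (svB b)).1.
(* Right multiplication comes from left multiplication by [b^⋆], which is why [GoodB] speaks of
   adjoints as well. *)
have [y _ yE] : range S2B (bt2 (svb b)^⋆ ⋅ S2B x^⋆).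
  by apply: D1_range; apply: Good_D1 => //; exact: (GoodB (svB b)).2.
by exists y^⋆ => //; rewrite (shS hS2B) yE sstarM -(shS hS2B) sstarK -(shS bt2_hom) sstarK.
Qed.
Let dd0 := projT1 (cid dd_ex).
Let dd0_hom : star_hom dd0. Proof. by rewrite /dd0; case: cid => k []. Qed.
Let dd0I b : impl S2B (dd0 b) (bt2 (svb b)). Proof. by rewrite /dd0; case: cid => k []. Qed.

Let one_tB a : impl S2B (one_tens TB a) (one2 a).
Proof. exact: (mtens_impl mttB hS2B S2Bi S2BE (impl_one _) (impl_memb hSA a)). Qed.
Let dd0_E b a : exists x, dd0 b ⋅ one_tens TB a = memb x /\ S2B x = bt2 (svb b) ⋅ one2 a.
Proof.
have [x _ xE] := D1_range ((GoodB (svB b)).1 a).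
exists x; split=> //; apply: (impl_uniq S2Bi (F := S2B x)); last exact: impl_memb.
by rewrite xE; apply: implM => //; exact: dd0I.
Qed.
Let dd0_range : coaction_range dd0.
Proof. by move=> b a; have [x [xE _]] := dd0_E b a; exists x. Qed.
Let dd0_inj : injective dd0.
Proof.
suff h0 b : dd0 b = 0 -> b = 0.
  by move=> b b' e; apply/subr0_eq/h0; rewrite (linB (sh_lin dd0_hom)) e subrr.
move=> b0; apply: svi; rewrite (sh0 svh); apply: (beta_inj qg hh2 (hh3 := hh3) (hhr := hhr)).
have z a : bt2 (svb b) ⋅ one2 a = 0.
  have [x _ xE] := D1_range ((GoodB (svB b)).1 a); rewrite -xE.
  suff -> : x = 0 by rewrite (sh0 hS2B).
  apply: cstar_injr => y; rewrite smul0l; apply: S2Bi; rewrite (shM hS2B) xE (sh0 hS2B).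
  have e : dd0 b ⋅ one_tens TB a = 0 by rewrite b0 smul0l.
  by rewrite -((implM (dd0I b) (one_tB a)).1 y) e; exact: sh0 hS2B.
have ndA : nondeg SA by case: qg => -[].
apply: (Bop_total (ht_total2 hhr (j := id) (k := fun p : A * H => af (SA p.1) p.2) _ ndA)) => [|[x [a y]]].
  by apply/totalE/seteqP; split=> // v _; apply: sub_cspan; exists v.
have := congr1 (fun Z => af Z (hr x y)) (z a).
by rewrite af_comp /one2 otensE.
Qed.
Let dd0_id b a x : dd0 b ⋅ one_tens TB a = memb x -> coact_id dd0 x = id_Delta (dd0 b) ⋅ one_one_tens TB a.
Proof.
move=> e.
have xE : S2B x = bt2 (svb b) ⋅ one2 a.
  have [x' [e' <-]] := dd0_E b a; congr (S2B _).
  by apply: (@memb_inj R (tA TB)); rewrite -e -e'.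
apply: (impl_uniq S3Bi (F := bt4 (bt2 (svb b)) ⋅ one4 a)); last first.
  apply: implM => //; first exact: (id_Delta_impl qg assoc4 svh trB (dd0I b)).
  exact: (mtens_impl mtlB hS3B S3Bi S3BE (impl_one _) (impl_memb hSA a)).
have -> : bt4 (bt2 (svb b)) ⋅ one4 a = Gm (S2B x) by rewrite xE (GmM _ (one2 a)) Gm_beta Gm_one.
apply: (tens_mhom_impl mttB mtlB dd0_hom (memb_hom A) hS3B S3Bi (S := fun x => Gm (S2B x))).
  exact: (blin_comp Gm_blin (sh_blin hS2B)).
move=> b' a'; rewrite S2BE Gm_elem.
exact: (mtens_impl mtlB hS3B S3Bi S3BE (dd0I b') (impl_memb hSA a')).
Qed.
Let dd0_coaction : coaction dd0.
Proof. by split; [exact: dd0_hom|exact: dd0_inj|exact: dd0_range|exact: dd0_id]. Qed.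

Let Bde c : B0 (de c). Proof. by apply: sub_cstar_generated; left; exists c. Qed.
Let di0 (c : C) : B := Subc hB0 (Bde c).
Let di0_hom : star_hom di0.
Proof.
split=> [z x y|x y|x]; apply: svi.
- by rewrite (sh_lin svh) -(sh_lin de_hom).
- by rewrite (shM svh) -(shM de_hom).
by rewrite (shS svh) -(shS de_hom).
Qed.
Let di0_inj : injective di0. Proof. by move=> c c' /(congr1 svb) /de_inj. Qed.
Let di0_equiv c c' (a : A) :
  ml (dd0 (di0 c)) (tt TB (di0 c') a) = tens_hom (@tt _ _ _ T) (@tt _ _ _ TB) di0 (ml (d c) (tt T c' a)).
Proof.
apply: S2Bi; rewrite (dd0I _).1 S2BE.
have [hth thE] := tens_hom_spec mtt mttB di0_hom.
have E3 : forall x a, S3 (tl x a) = otens hhr (S2 x) (SA a) by case: trep.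
have cI x : impl S3 (coact_id d x) (S2B (tens_hom (@tt _ _ _ T) (@tt _ _ _ TB) di0 x)).
  apply: (tens_mhom_impl mtt mtl hd (memb_hom A) hS3 S3i (S := fun x => S2B (tens_hom _ _ di0 x))).
    exact: (blin_comp (sh_blin hS2B) (sh_blin_rep (mt_rep mttB) hth)).
  move=> c1 a1; rewrite thE S2BE.
  exact: (mtens_impl mtl hS3 S3i E3 (sbI _) (impl_memb hSA a1)).
apply/esym/(impl_uniqF nd3 (cI _)); rewrite (partial_coactE pcd).
apply: implM; first exact: (id_Delta_impl qg assoc hs0 trep (sbI _)).
exact: (mtens_impl mtl hS3 S3i E3 (sbI _) (impl_memb hSA a)).
Qed.
Let D0 : dilation d := Dilation dd0_coaction di0_hom di0_inj di0_equiv.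

(** By [mslice_two], the two-sided slices in [X1] are the values of [act] for the functionals
    [w (a1 . a)], so the generators of [B0] are among those allowed by minimality. *)
Lemma spatial_dilation_minimal : minimal_dilation D0.
Proof.
rewrite /minimal_dilation; set G := range _ `|` _; apply/seteqP; split=> // b _.
suff h0 : forall b0, B0 b0 -> exists2 b', svb b' = b0 & cstar_generated G b'.
  by have [b' /svi <-] := h0 _ (svB b).
have /sub_cstarE[cG GM GS] := cstar_generated_sub G.
apply: cstar_generated_min.
  apply/sub_cstarE; split.
  - exact: (iso_image_csub (sh_lin svh) (fun=> erefl) cG).
  - by move=> _ _ [x <- Gx] [y <- Gy]; exists (x ⋅ y); [rewrite (shM svh)|exact: GM].
  by move=> _ [x <- Gx]; exists x^⋆; [rewrite (shS svh)|exact: GS].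
move=> _ [[c _ <-]|[w [a1 [c [a [y [bw yE ->]]]]]]].
  by exists (di0 c) => //; apply: sub_cstar_generated; left; exists c.
have [x [xE S2x]] := dd0_E (di0 c) a.
pose y' := ml (one_tens TB a1) x.
have [J [hJ JE _]] := tens_hom_ex mttB mt2 svh.
have SJ z : ST (J z) = S2B z.
  move: z; apply: (mt_ext mttB); [exact: (blin_comp (sh_blin hST) (sh_blin_rep (mt_rep mt2) hJ))|exact: sh_blin|].
  by move=> b' a'; rewrite JE STE S2BE.
have yJ : y = J y' by apply: STi; rewrite SJ yE (one_tB a1).1 S2x smulA.
exists (slice (tt TB) w y').
  rewrite yJ; move: y' {yJ} => y'; move: y'; apply: (mt_ext mttB).
  - exact: (blin_comp (sh_blin svh) (slice_blin mttB bw)).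
  - exact: (blin_comp (slice_blin mt2 bw) (sh_blin_rep (mt_rep mt2) hJ)).
  by move=> b' a'; rewrite JE !sliceE // (linZ (sh_lin svh)).
apply: sub_cstar_generated; right; exists (fun x => w (a1 ⋅ (x ⋅ a))), c; split; first exact: bf_two.
by rewrite /act (mslice_two mttB a1 bw xE).
Qed.
End Dilate.

Lemma spatial_dilation_ex : exists D : dilation d, minimal_dilation D.
Proof.
have [TB [S2B [S3B trB]]] := @tensorA_ex _ _ _ _ _ _ _ _ _ _ hhr hh hh3' hhr4 assoc4 A _ _ _ _ svh svi hSA SAi hP2 P2E.
by eexists; exact: (spatial_dilation_minimal trB).
Qed.
End Existence.

Theorem minimal_dilation_ex (R : realType) (A : cstarBialg R) (C : cstarAlgType R) (T : tensorA A C)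
    (d : C -> multiplier (tA T)) : cstar_quantum_group A -> slice_map_property (bA A) ->
  partial_coaction d -> injective d -> regular d -> exists D : dilation d, minimal_dilation D.
Proof.
move=> /cqg_data[H [L [h [hh [SA [P2 [U qg]]]]]]] smp pcd injd regd.
have [[hSA SAi ndA] [hP2 P2E] _ _ _] := qg.
have [K0 [s0 [hs0 s0i nd0]]] := nondeg_rep_ex (mt_repl (tt_min T)).
have [K2 [h2 hh2]] := hilbert_tensor_ex K0 H.
have [K3 [h3 hh3]] := hilbert_tensor_ex K0 L.
have [hr [hhr assoc]] := ht_assoc hh2 hh hh3.
have [K4 [h3' hh3']] := hilbert_tensor_ex K2 L.
have [hr4 [hhr4 assoc4]] := ht_assoc hhr hh hh3'.
have [S2 [S3 tr]] := tensorA_rep_ex hh2 (hh := hh) hh3 hhr assoc hs0 s0i hSA SAi hP2 P2E T.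
have [[hS2 S2i] [hS3 S3i] E2 E3 _] := tr.
have nd2 := nondeg_otens E2 nd0 ndA.
have mtl : min_tensor (@tl _ _ _ T) by have [] := @tlr_min _ _ _ T.
have nd3 := nondeg_otens E3 nd2 ndA.
have hid (K : hilbertType R) : star_hom (@id (Bop K)) by [].
have iid (K : hilbertType R) : injective (@id (Bop K)) by [].
have [T2 [t2 [ST [mt2 hST STi STE]]]] := min_tensor_ex hhr (hid K2) (iid K2) hSA SAi.
have [T4 [t4 [SW [mt4 hSW SWi SWE]]]] := min_tensor_ex hhr4 (hid K3) (iid K3) hSA SAi.
exact: (spatial_dilation_ex qg smp pcd injd regd assoc hh3' assoc4 hs0 tr nd2 nd3 mt2 hST STi STE mt4 hSW SWi SWE).
Qed.

(** * Uniqueness *)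

Lemma Nm_le_mul (R : realType) (B : cstarAlgType R) (x : B) (e : R) : 0 <= e ->
  (forall b, Nm (x ⋅ b) <= e * Nm b) -> Nm x <= e.
Proof.
move=> e0 h; have [->|x0] := eqVneq x 0; first by rewrite Nm0.
have := h x^⋆; have := cstar_Nm x^⋆; rewrite sstarK sstar_Nm => ->.
by rewrite expr2 ler_pM2r ?Nm_gt0.
Qed.

Lemma slice_near (R : realType) (B A T : cstarAlgType R) (t : B -> A -> T) (w w' : A -> R[i]) (K : R) x : min_tensor t ->
  bounded_functional w -> bounded_functional w' -> 0 <= K -> (forall a, Nm (w a - w' a) <= K * Nm a) ->
  Nm (slice t w x - slice t w' x) <= K * Nm x.
Proof.
move=> mt bw bw' K0 hK.
have bd : bounded_functional (fun a => w a - w' a).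
  apply/bounded_functionalE; have /bounded_functionalE b1 := bw; have /bounded_functionalE b2 := bw'.
  by split; [move=> z p q; rewrite b1.1 b2.1 scalerBr; zmod|exists K].
have -> : slice t w x - slice t w' x = slice t (fun a => w a - w' a) x.
  apply: (slice_uniq mt bd (s := fun x => slice t w x - slice t w' x)) => [|b a'].
    exact: blinB (slice_blin mt bw) (slice_blin mt bw').
  by rewrite !sliceE // scalerBl.
exact: (slice_Nm mt bd).
Qed.

(** * Restriction of a minimal dilation to the original algebra *)

Section Dilation.
Variables (R : realType) (A : cstarBialg R) (C : cstarAlgType R) (T : tensorA A C) (d : C -> multiplier (tA T)).
Variable D : dilation d.
Local Notation B := (dB D).
Local Notation TB := (dT D).
Local Notation dd := (@dd _ _ _ _ _ D).
Let mt := tt_min T.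
Let mtB := tt_min TB.
Lemma tl_min (C' : cstarAlgType R) (T' : tensorA A C') : min_tensor (@tl _ _ _ T').
Proof. by have [] := @tlr_min _ _ _ T'. Qed.
Lemma tr_min (C' : cstarAlgType R) (T' : tensorA A C') : min_tensor (@tr _ _ _ T').
Proof. by have [] := @tlr_min _ _ _ T'. Qed.
Lemma tlrE (C' : cstarAlgType R) (T' : tensorA A C') c a a' : tl (tt T' c a) a' = tr T' c (bt a a').
Proof. by have [] := @tlr_min _ _ _ T'. Qed.
Let hdi := @di_hom _ _ _ _ _ D.
Let hdd : star_hom dd. Proof. by have [] := dd_coaction D. Qed.

Definition dJ : tA T -> tA TB := tens_hom (@tt _ _ _ T) (@tt _ _ _ TB) (@di _ _ _ _ _ D).
Definition dJ3 : tAA T -> tAA TB := tens_hom (@tl _ _ _ T) (@tl _ _ _ TB) dJ.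
Lemma dJ_hom : star_hom dJ. Proof. by have [] := tens_hom_spec mt mtB hdi. Qed.
Lemma dJE c a : dJ (tt T c a) = tt TB (di D c) a. Proof. by rewrite /dJ; have [_ ->] := tens_hom_spec mt mtB hdi. Qed.
Lemma dJ_inj : injective dJ. Proof. exact: (tens_hom_inj mt mtB hdi (@di_inj _ _ _ _ _ D)). Qed.
Lemma dJ3_hom : star_hom dJ3. Proof. by have [] := tens_hom_spec (tl_min T) (tl_min TB) dJ_hom. Qed.
Lemma dJ3E x a : dJ3 (tl x a) = tl (dJ x) a. Proof. by rewrite /dJ3; have [_ ->] := tens_hom_spec (tl_min T) (tl_min TB) dJ_hom. Qed.
Lemma dJ3_inj : injective dJ3. Proof. exact: (tens_hom_inj (tl_min T) (tl_min TB) dJ_hom dJ_inj). Qed.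
Let bJ : blin dJ. Proof. exact: (sh_blin_rep (mt_rep mtB) dJ_hom). Qed.
Let bJ3 : blin dJ3. Proof. exact: (sh_blin_rep (mt_rep (tl_min TB)) dJ3_hom). Qed.

Lemma dJ3_tr c z : dJ3 (tr T c z) = tr TB (di D c) z.
Proof.
apply: (mt_ext (@bt_min _ A) (f := fun z => dJ3 (tr T c z)) (g := tr TB (di D c))).
- exact: (blin_comp bJ3 (mt_blinr (tr_min T) c)).
- exact: (mt_blinr (tr_min TB) _).
by move=> a a'; rewrite -!tlrE dJ3E dJE.
Qed.

Lemma dJ3_idD y v : dJ3 (ml (idD y) v) = ml (idD (dJ y)) (dJ3 v).
Proof.
move: y; apply: (mt_ext mt).
- exact: (blin_comp bJ3 (msh_blinl _ (idD_hom T))).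
- exact: (blin_comp (msh_blinl (dJ3 v) (idD_hom TB)) bJ).
move=> c a; rewrite dJE !idDE; move: v; apply: (mt_ext (tr_min T)).
- exact: (blin_comp bJ3 (ml_blin _)).
- exact: (blin_comp (ml_blin _) bJ3).
move=> c' z; rewrite (mtensE (tr_min T)) !dJ3_tr (mtensE (tr_min TB)).
by rewrite /= (shM hdi).
Qed.

Lemma id_Delta_dJ m n : (forall y, dJ (ml n y) = ml m (dJ y)) ->
  forall v, dJ3 (ml (id_Delta n) v) = ml (id_Delta m) (dJ3 v).
Proof.
move=> e; apply: (@id_Delta_ext _ A C T).
- exact: (blin_comp bJ3 (ml_blin _)).
- exact: (blin_comp (ml_blin _) bJ3).
move=> y v; rewrite -[ml (id_Delta n) _]/(ml (id_Delta n ⋅ idD y) v) id_DeltaM dJ3_idD e -id_DeltaM.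
by rewrite dJ3_idD.
Qed.

Section Minimal.
Hypothesis min : minimal_dilation D.
Let one_t a := one_tens TB a.

Lemma slice_span w c a x : bounded_functional w -> dd (di D c) ⋅ one_t a = memb x ->
  clos [set slice (tt TB) w' (ml (one_t u) x) | w' in @bounded_functional R A & u in setT] (slice (tt TB) w x).
Proof.
move=> bw xE e e0; have K0' : 0 < Nm x + 1 by have := Nm_ge0 x; lra.
have [u hu] := functional_factorl (mt_repr mtB) bw (divr_gt0 e0 K0').
exists (slice (tt TB) w (ml (one_t u) x)); first by exists w => //; exists u.
rewrite slice_onel //; apply: (le_trans (slice_near x mtB bw (bf_mull u bw) (ltW (divr_gt0 e0 K0')) hu)).
by rewrite mulrAC ler_pdivrMr // ler_wpM2l ?(ltW e0) //; lra.
Qed.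

(** The generators [act dd w (di D c)] are defined through [mslice]; [mslice_near] and [slice_span]
    approximate them by two-sided slices, for which explicit formulas hold. *)
Lemma minimal_ind (P : set B) : sub_cstar P -> (forall c, P (di D c)) ->
  (forall w a1 c a x, bounded_functional w -> dd (di D c) ⋅ one_t a = memb x -> P (slice (tt TB) w (ml (one_t a1) x))) ->
  forall b, P b.
Proof.
move=> sP Pd Ps b; have cP : csub P by have /sub_cstarE[] := sP.
have hb : setT b by [].
rewrite -min in hb; move: b hb; apply: cstar_generated_min => // b [[c _ <-]|[w [c [bw bE]]]]; first exact: Pd.
apply: cP.2 => e e0; have e2 : 0 < e / 2 by rewrite divr_gt0.
have cr : coaction_range dd by have [] := dd_coaction D.
have [w' [a [x [bw' xE hx]]]] := mslice_near mtB bw e2 (cr (di D c)).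
have Px : P (slice (tt TB) w' x).
  apply: cP.2 => e' /(slice_span bw' xE)[_ [w2 bw2 [u _ <-]] ?].
  by exists (slice (tt TB) w2 (ml (one_t u) x)) => //; apply: Ps xE.
exists (slice (tt TB) w' x) => //.
apply: (le_trans (Nm_le_mul (ltW e2) _)); last by lra.
move=> b'; have := hx b'; rewrite -[mslice _ _ _]/(act dd w (di D c)) -bE.
by rewrite smulDl smulNl.
Qed.

Let range_dJ : csub (range dJ).
Proof.
have [H [s [hs si]]] := mt_rep mtB.
apply: (iso_range (sh_lin dJ_hom)) => x.
have [H' [s' [hs' si']]] := mt_rep mt.
by rewrite -(rep_iso hs si) (rep_iso (sh_comp hs dJ_hom) (inj_comp si dJ_inj)).
Qed.
Let Q b := forall y, range dJ (ml (dd b) (dJ y)).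
Let cQ : csub Q.
Proof.
apply: csub_all => y; apply: (csub_pre (f := fun b => ml (dd b) (dJ y)) _ range_dJ).
exact: msh_blinl.
Qed.
Let QM b b' : Q b -> Q b' -> Q (b ⋅ b').
Proof. by move=> Qb Qb' y; rewrite (shM hdd) /=; have [y' _ <-] := Qb' y; exact: Qb. Qed.
Lemma dd_di c y : ml (dd (di D c)) (dJ y) = dJ (ml (d c) y).
Proof.
move: y; apply: (mt_ext mt); [exact: (blin_comp (ml_blin _) bJ)|exact: (blin_comp bJ (ml_blin _))|].
by move=> c' a; rewrite dJE di_equiv.
Qed.
Let Q_di c : Q (di D c). Proof. by move=> y; rewrite dd_di; exists (ml (d c) y). Qed.
Lemma dd_slice_mulr w a1 x z : bounded_functional w ->
  ml (dd (slice (tt TB) (fun a => w (a ⋅ a1)) x)) z = slice (@tl _ _ _ TB) w (ml (coact_id dd x) (tl z a1)).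
Proof.
move=> bw; have bw' := bf_mulr a1 bw; move: x; apply: (mt_ext mtB).
- exact: (blin_comp (msh_blinl z hdd) (slice_blin mtB bw')).
- exact: (blin_comp (slice_blin (tl_min TB) bw) (msh_blinl _ (coact_id_hom hdd))).
move=> b a; rewrite sliceE // coact_idE // (mtensE (tl_min TB)) (sliceE (tl_min TB)) //.
by rewrite (linZ (sh_lin hdd)).
Qed.
(** [dd] of a slice is a slice of [dd (x) id] of the element; the coaction identity replaces this by
    [id (x) Delta] of [dd (di D c)], which on [C (x) A (x) A] is [id (x) Delta] of [d c]. *)
Let Q_slice w c a x : bounded_functional w -> dd (di D c) ⋅ one_tens TB a = memb x -> Q (slice (tt TB) w x).
Proof.
move=> bw xE; apply: cQ.2 => e e0.
have K0' : 0 < Nm x + 1 by have := Nm_ge0 x; lra.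
have [u [_ hu]] := functional_factor (mt_repr mtB) bw (divr_gt0 e0 K0').
exists (slice (tt TB) (fun a => w (a ⋅ u)) x); last first.
  apply: (le_trans (slice_near x mtB bw (bf_mulr u bw) (ltW (divr_gt0 e0 K0')) hu)).
  by rewrite mulrAC ler_pdivrMr // ler_wpM2l ?(ltW e0) //; lra.
move=> y; rewrite dd_slice_mulr //.
have [_ _ _ ci] := dd_coaction D; rewrite (ci _ _ _ xE).
rewrite -[ml (_ ⋅ _) _]/(ml (id_Delta (dd (di D c))) (ml (one_one_tens TB a) (tl (dJ y) u))) (mtensE (tl_min TB)).
rewrite -dJ3E -(@id_Delta_dJ _ (d c)); last by move=> y'; rewrite dd_di.
set v := ml (id_Delta _) _; exists (slice (@tl _ _ _ T) w v) => //.
move: v; apply: (mt_ext (tl_min T)).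
- exact: (blin_comp bJ (slice_blin (tl_min T) bw)).
- exact: (blin_comp (slice_blin (tl_min TB) bw) bJ3).
by move=> y' a'; rewrite dJ3E (sliceE (tl_min T)) // (sliceE (tl_min TB)) // (linZ (sh_lin dJ_hom)).
Qed.

Lemma slice_onel_star w a1 c a x : bounded_functional w -> dd (di D c) ⋅ one_tens TB a = memb x ->
  exists w' x', [/\ bounded_functional w', dd (di D c^⋆) ⋅ one_tens TB a1^⋆ = memb x' &
    (slice (tt TB) w (ml (one_tens TB a1) x))^⋆ = slice (tt TB) w' (ml (one_tens TB a^⋆) x')].
Proof.
move=> bw xE; have [_ _ cr _] := dd_coaction D; have [x' xE'] := cr (di D c^⋆) a1^⋆.
exists (fun a => (w a^⋆)^*), x'; split=> //; first exact: bf_conj.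
have -> : ml (one_tens TB a^⋆) x' = (ml (one_tens TB a1) x)^⋆.
  apply: (@memb_inj R (tA TB)).
  have mb (m : multiplier (tA TB)) z : memb (ml m z) = m ⋅ memb z by apply: ml_inj => v; rewrite /= ml_mul.
  rewrite mb (shS (memb_hom _)) mb -xE -xE' !sstarM -(shS hdd) -(shS hdi) /one_tens !(mtens_star mtB).
  have -> : (mone B)^⋆ = mone B by apply: ml_inj => v; rewrite /= sstarK.
  by rewrite -!(shS (memb_hom A)) smulA.
move: (ml _ x) => z; apply: (inj_comp (@sstar_inj R B) (@inj_id _)); rewrite /= sstarK.
pose g z := (slice (tt TB) (fun a => (w a^⋆)^*) z^⋆)^⋆.
have bw' := bf_conj bw.
have bg : blin g.
  have [M M0 hM] := blin_bound (slice_blin mtB bw').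
  split; last by exists M => q; rewrite /g sstar_Nm -(sstar_Nm q).
  by move=> k p q; rewrite /g sstar_antilinear (slice_blin mtB bw').1 sstar_antilinear cjK.
suff : g z = slice (tt TB) w z by [].
apply: (slice_uniq mtB bw bg) => b' a'.
by rewrite /g (mt_star mtB) sliceE // sstarK sstarZ cjK sstarK.
Qed.

Lemma dd_range b y : exists y', dJ y' = ml (dd b) (dJ y).
Proof.
suff [h _] : Q b /\ Q b^⋆ by have [y' _ ?] := h y; exists y'.
move: b {y}; apply: minimal_ind.
- apply/sub_cstarE; split; first exact: csubI cQ (csub_star cQ).
    by move=> x y [Gx Gx'] [Gy Gy']; split; [exact: QM|rewrite sstarM; exact: QM].
  by move=> x [Gx Gx']; split; rewrite ?sstarK.
- by move=> c; split; rewrite -?(shS hdi); exact: Q_di.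
have hs w a1 c a x : bounded_functional w -> dd (di D c) ⋅ one_t a = memb x -> Q (slice (tt TB) w (ml (one_t a1) x)).
  by move=> bw xE; rewrite slice_onel //; apply: Q_slice xE; exact: bf_mull.
move=> w a1 c a x bw xE; split; first exact: hs xE.
have [w' [x' [bw' xE' ->]]] := slice_onel_star a1 bw xE; exact: hs xE'.
Qed.

(** Invariance under [dd b] and under [dd b^⋆] makes the restriction a double centralizer. *)
Lemma restrict_ex : exists k : B -> multiplier (tA T), star_hom k /\ forall b y, dJ (ml (k b) y) = ml (dd b) (dJ y).
Proof.
have [K [S [hS Si ndS]]] := nondeg_rep_ex (mt_rep mtB).
have [sb [hsb sbI]] := bar_ex hS Si ndS.
have hSJ := sh_comp hS dJ_hom; have SJi := inj_comp Si dJ_inj.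
have [k [hk kI]] : exists k : B -> multiplier (tA T), star_hom k /\ forall b, impl (S \o dJ) (k b) (sb (dd b)).
  apply: (impl_hom hSJ SJi (sh_comp hsb hdd)) => b; apply: (impl_op hSJ SJi) => y /=.
    by rewrite -(sbI _).1; have [y' <-] := dd_range b y; exists y'.
  have [y' yE] := dd_range b^⋆ y^⋆; exists y'^⋆ => //=.
  by rewrite (shS dJ_hom) yE (shS hS) (sbI _).1 sstarM -(shS hS) -(shS dJ_hom) sstarK (shS hdd) (shS hsb) sstarK.
exists k; split=> // b y; apply: Si.
by have /= -> := (kI b).1 y; rewrite (sbI _).1.
Qed.
End Minimal.
End Dilation.

(** * Exchanging the multiplicative unitary and its adjoint *)

Section Transfer.
Variables (R : realType) (A : cstarBialg R).
Variables (H L : hilbertType R) (h : H -> H -> L) (hh : hilbert_tensor h).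
Variables (SA : A -> Bop H) (P2 : bAA A -> Bop L) (U : Bop L).
Hypothesis qg : qg_data hh SA P2 U.
Variables (K0 K2 K3 : hilbertType R) (h2 : K0 -> H -> K2) (h3 : K0 -> L -> K3) (hr : K2 -> H -> K3).
Hypotheses (hh2 : hilbert_tensor h2) (hh3 : hilbert_tensor h3) (hhr : hilbert_tensor hr).
Hypothesis assoc : forall x y z, hr (h2 x y) z = h3 x (h y z).
Local Notation one K := (aone (hpairing K)).
Local Notation r := (rsl hh U).
Local Notation W := (W23 U hh3).

Lemma leg_slice xi eta u y : ⟨hr xi u, af W (hr eta y)⟩ = ⟨xi, af (otens hh2 (one K0) (r u y)) eta⟩.
Proof.
rewrite -(ctrE hhr u xi); congr (⟨_, _⟩).
apply: (total_eq (ht_total hh2) (f := fun eta => ctr hhr u (af W (hr eta y)))).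
- exact: (blin_comp (ctr_blin hhr u) (blin_comp (af_blin _) (ht_blinl hhr y))).
- exact: af_blin.
move=> [x z] /=; apply: (total_inner (ht_total hh2)) => -[x' z'] /=.
by rewrite ctrE !assoc otensE /W23 otensE !af_one (ht_inner hh3) (ht_inner hh2) rslE.
Qed.

Lemma leg_sandwich F S xi eta u y : ⟨hr xi u, af (otens hhr F (one H) ⋅ W ⋅ otens hhr S (one H)) (hr eta y)⟩ =
  ⟨xi, af (F ⋅ otens hh2 (one K0) (r u y) ⋅ S) eta⟩.
Proof.
rewrite !af_comp -(Bop_adj' (otens hhr F _)) otens_star aone_star !otensE !af_one leg_slice.
exact: Bop_adj'.
Qed.

Lemma sandwich_zero F S : otens hhr F (one H) ⋅ W ⋅ otens hhr S (one H) = 0 <->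
  forall u y, F ⋅ otens hh2 (one K0) (r u y) ⋅ S = 0.
Proof.
split=> [e0 u y|e0].
  by apply: Bop_zero => xi eta; rewrite -leg_sandwich e0 af_zero inner0r.
apply: (Bop_total (ht_total hhr)) => -[eta y].
apply: (total_inner (ht_total hhr)) => -[xi u].
by rewrite leg_sandwich e0 !af_zero !inner0r.
Qed.

(** Vanishing of the product means [F (1 (x) c) S = 0] for every slice [c] of the middle factor.
    Slices of [W^⋆] are adjoints of slices of [W], and by the last clause of [qg_data] both families
    have the same closed span. *)
Lemma slice_transfer (F S : Bop K2) :
  otens hhr F (one H) ⋅ W^⋆ ⋅ otens hhr S (one H) = 0 -> otens hhr F (one H) ⋅ W ⋅ otens hhr S (one H) = 0.
Proof.
move=> e0; have [_ _ _ _ modular] := qg.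
pose Z := [set c | F ⋅ otens hh2 (one K0) c ⋅ S = 0].
have cZ : csub Z.
  apply: (@csub_eq _ _ _ (fun c => F ⋅ otens hh2 (one K0) c ⋅ S) (fun=> 0)); last exact: blin0.
  exact: (blin_comp (blin_smulr S) (blin_comp (blin_smull F) (otens_blinr hh2 _))).
have h1 u y : Z (r u y)^⋆.
  have e1 : otens hhr S^⋆ (one H) ⋅ W ⋅ otens hhr F^⋆ (one H) = 0.
    apply: sstar_inj; rewrite !sstarM sstar0 !otens_star !sstarK aone_star smulA -e0.
    by rewrite -[otens hh3 _ _]otens_star.
  have := (sandwich_zero _ _).1 e1 u y => /(congr1 sstar).
  by rewrite !sstarM !sstarK otens_star aone_star sstar0 smulA.
apply/sandwich_zero => u y.
suff : Z (r u y) by [].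
rewrite -[r u y]sstarK; apply: (cspan_min (csub_star cZ)) (modular u y) => _ [[a b] _ <-].
exact: h1.
Qed.
End Transfer.

(** Weak continuity makes [c] a norm limit of combinations of [act d w c1], and each of these is
    approximated by slices of elements [d(c1) (1 (x) a)]. *)
Lemma act_lcancel (R : realType) (A : cstarBialg R) (C : cstarAlgType R) (T : tensorA A C)
    (d : C -> multiplier (tA T)) (V : normedModType R[i]) (f : C -> V) :
  coaction_range d -> weakly_continuous d -> blin f ->
  (forall w c c' a x, bounded_functional w -> d c ⋅ one_tens T a = memb x -> f (slice (tt T) w x ⋅ c') = 0) ->
  forall c c', f (c ⋅ c') = 0.
Proof.
move=> cr wc bf h c c'.
have z v : (forall e : R, 0 < e -> Nm (f v) <= e) -> f v = 0.
  by move=> hv; apply/Nm_eq0/eqP; rewrite eq_le Nm_ge0 andbT; apply: Nm_eps => e e0; rewrite add0r; exact: hv.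
have [K K0 hK] := blin_bound bf.
have ar (e : R) : 0 < e -> K * (e / (K * (Nm c' + 1)) * Nm c') <= e.
  move=> e0; have N0 := Nm_ge0 c'; have N1 : 0 < Nm c' + 1 by lra.
  have -> : K * (e / (K * (Nm c' + 1)) * Nm c') = e * Nm c' / (Nm c' + 1) by field; rewrite !gt_eqF.
  by rewrite ler_pdivrMr // ler_wpM2l ?(ltW e0) //; lra.
have h1 w c1 : bounded_functional w -> f (ml (act d w c1) c') = 0.
  move=> bw; apply: z => e e0.
  have D0 : 0 < K * (Nm c' + 1) by rewrite mulr_gt0 //; have := Nm_ge0 c'; lra.
  have [w' [a [x [bw' xE hx]]]] := mslice_near (tt_min T) bw (divr_gt0 e0 D0) (cr c1).
  have := hx c'; rewrite -/(act d w c1) => h2.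
  rewrite -[f _]subr0 -(h _ _ c' _ _ bw' xE) -(linB bf.1); apply: (le_trans (hK _)).
  apply: (le_trans (ler_wpM2l (ltW K0) h2)).
  exact: ar.
have : mcspan [set act d w c | w in @bounded_functional R A & c in setT] (memb c) by rewrite wc; exists c.
move=> hm; apply: z => e e0.
have D0 : 0 < K * (Nm c' + 1) by rewrite mulr_gt0 //; have := Nm_ge0 c'; lra.
have e1 : (0 : R[i]) < (e / (K * (Nm c' + 1)))%:C%C by rewrite ltcR divr_gt0.
have [n nX nE] := hm _ e1.
have fn : f (ml n c') = 0.
  have lP : lsub [set n | f (ml n c') = 0].
    split; first by rewrite /= (lin0 bf.1).
    by move=> k p q /= hp hq; rewrite -[X in f X]/(k *: ml p c' + ml q c') bf.1 hp hq scaler0 addr0.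
  by apply: (lspan_min lP) nX => _ [w bw [c1 _ <-]]; exact: h1.
rewrite -[f _]subr0 -fn -(linB bf.1); apply: (le_trans (hK _)).
have := nE c'; rewrite !NmE -rcM lecR => h2.
apply: (le_trans (ler_wpM2l (ltW K0) h2)).
exact: ar.
Qed.

(** * Vanishing products under a coaction *)

Section Kernel.
Variables (R : realType) (A : cstarBialg R).
Variables (H L : hilbertType R) (h : H -> H -> L) (hh : hilbert_tensor h).
Variables (SA : A -> Bop H) (P2 : bAA A -> Bop L) (U : Bop L).
Hypothesis qg : qg_data hh SA P2 U.
Variables (B : cstarAlgType R) (TB : tensorA A B) (dd : B -> multiplier (tA TB)).
Hypothesis cdd : coaction dd.
Local Notation one K := (aone (hpairing K)).

(* With [F] and [S] implementing [dd b] and [dd b'], the hypothesis gives [F_12 W_23^* S_12 = 0]. *)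
Lemma coaction_annihilate b b' : (forall a, ml (dd b) (tt TB b' a) = 0) ->
  forall w a x, bounded_functional w -> dd b' ⋅ one_tens TB a = memb x -> b ⋅ slice (tt TB) w x = 0.
Proof.
move=> b0 w a x bw xE; rewrite -(slice_mull (tt_min TB) b x bw).
set z := ml _ x; suff -> : z = 0 by rewrite (lin0 (slice_blin (tt_min TB) bw).1).
have [hdd idd cr ci] := cdd; have [[hSA SAi ndA] [hP2 P2E] [U1 U2 _] _ _] := qg.
have [K0 [s0 [hs0 s0i nd0]]] := nondeg_rep_ex (mt_repl (tt_min TB)).
have [K2 [h2 hh2]] := hilbert_tensor_ex K0 H.
have [K3 [h3 hh3]] := hilbert_tensor_ex K0 L.
have [hr [hhr assoc]] := ht_assoc hh2 hh hh3.
have [S2 [S3 tr]] := tensorA_rep_ex hh2 (hh := hh) hh3 hhr assoc hs0 s0i hSA SAi hP2 P2E TB.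
have [[hS2 S2i] [hS3 S3i] E2 E3 _] := tr.
have nd2 := nondeg_otens E2 nd0 ndA.
have nd3 := nondeg_otens E3 nd2 ndA.
have [sb [hsb sbI]] := bar_ex hS2 S2i nd2.
have mtl := tl_min TB.
pose F := sb (dd b); pose S := sb (dd b').
have tI c : impl S3 (tens_one (dd c)) (otens hhr (sb (dd c)) (one H)).
  exact: (mtens_impl mtl hS3 S3i E3 (sbI _) (impl_one _)).
have idI c : impl S3 (id_Delta (dd c)) (beta U hh3 hhr (sb (dd c))).
  exact: (id_Delta_impl qg assoc hs0 tr (sbI _)).
have [SS [hSS SSE]] := spatial_ex (tt_min TB) hhr (sh_comp hsb hdd) hSA.
have SSi : injective SS.
  apply: (spatial_iso (tt_min TB) (sh_comp hsb hdd) hSA _ SAi hSS SSE).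
  by move=> c c' e; apply: idd; apply: (impl_uniq S2i (sbI _)); rewrite [sb _]e.
have cI v : impl S3 (coact_id dd v) (SS v).
  apply: (tens_mhom_impl (tt_min TB) mtl hdd (memb_hom A) hS3 S3i (sh_blin hSS)) => c a'.
  rewrite SSE; exact: (mtens_impl mtl hS3 S3i E3 (sbI _) (impl_memb hSA a')).
have rE c v a' : dd c ⋅ one_tens TB a' = memb v -> SS v = beta U hh3 hhr (sb (dd c)) ⋅ otens hhr (one K2) (SA a').
  move=> vE; apply: (impl_uniqF nd3 (cI v)); rewrite (ci _ _ _ vE); apply: implM => //.
  exact: (mtens_impl mtl hS3 S3i E3 (impl_one _) (impl_memb hSA a')).
(* For [v = dd b (1 (x) a1)] the product [v ⋅ tt TB b' a2] is zero by assumption. [SS], which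
   implements [dd (x) id], maps it to [beta F] times [S] with [SA (a1 ⋅ a2)] in the last leg;
   nondegeneracy of [SA] removes that leg. *)
have step1 : beta U hh3 hhr F ⋅ otens hhr S (one H) = 0.
  have e a1 a2 : beta U hh3 hhr F ⋅ otens hhr S (SA (a1 ⋅ a2)) = 0.
    have [v vE] := cr b a1.
    have -> : otens hhr S (SA (a1 ⋅ a2)) = otens hhr (one K2) (SA a1) ⋅ otens hhr S (SA a2).
      by rewrite otensM a1mul' (shM hSA).
    rewrite smulA -(rE _ _ _ vE) -[otens hhr S _]/(otens hhr ((sb \o dd) b') (SA a2)) -SSE -(shM hSS).
    have -> : v ⋅ tt TB b' a2 = 0.
      by rewrite -[LHS]/(ml (memb v) _) -vE /= (mtensE (tt_min TB)) /= b0.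
    exact: sh0 hSS.
  have z1 x' v : af (beta U hh3 hhr F ⋅ otens hhr S (one H)) (hr x' v) = 0.
    apply: (total_eq ndA (f := fun v => af _ (hr x' v)) (g := fun=> 0)); [exact: (blin_comp (af_blin _) (ht_blinr hhr x'))|exact: blin0|].
    move=> [a1 v1] /=; move: v1.
    apply: (total_eq ndA (f := fun v1 => af (beta U hh3 hhr F) (af (otens hhr S (one H)) (hr x' (af (SA a1) v1)))) (g := fun=> 0)); [|exact: blin0|].
      exact: (blin_comp (af_blin _) (blin_comp (af_blin _) (blin_comp (ht_blinr hhr x') (af_blin _)))).
    move=> [a2 v2] /=; have := congr1 (fun Z => af Z (hr x' v2)) (e a1 a2).
    by rewrite af_comp !otensE (shM hSA) af_comp af_zero.
  by apply: (Bop_total (ht_total hhr)) => -[x' v]; rewrite z1 af_zero.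
(* Cancelling the left factor [W_23] of [beta F] leaves the hypothesis of [slice_transfer]. *)
have step2 : otens hhr F (one H) ⋅ beta U hh3 hhr S = 0.
  have e1 : otens hhr F (one H) ⋅ (W23 U hh3)^⋆ ⋅ otens hhr S (one H) = 0.
    have := congr1 (smul (W23 U hh3)^⋆) step1.
    by rewrite /beta !smulA (W23U qg) a1mul' smul0r.
  by rewrite /beta !smulA (slice_transfer qg hh2 assoc e1) smul0l.
apply: SSi; rewrite (sh0 hSS).
have -> : SS z = otens hhr F (one H) ⋅ SS x.
  rewrite /z; move: (x); apply: (mt_ext (tt_min TB)).
  - exact: (blin_comp (sh_blin hSS) (ml_blin _)).
  - exact: (blin_comp (blin_smull _) (sh_blin hSS)).
  move=> c a'; rewrite (mtensE (tt_min TB)) !SSE otensM a1mul'.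
  by rewrite /= (shM hdd) (shM hsb).
by rewrite (rE _ _ _ xE) smulA step2 smul0l.
Qed.
End Kernel.

Section Uniqueness.
Variables (R : realType) (A : cstarBialg R).
Variables (H L : hilbertType R) (h : H -> H -> L) (hh : hilbert_tensor h).
Variables (SA : A -> Bop H) (P2 : bAA A -> Bop L) (U : Bop L).
Hypothesis qg : qg_data hh SA P2 U.
Variables (C : cstarAlgType R) (T : tensorA A C) (d : C -> multiplier (tA T)).
Hypotheses (crd : coaction_range d) (wcd : weakly_continuous d).
Local Notation one K := (aone (hpairing K)).

Lemma minimal_kernel (D : dilation d) : minimal_dilation D ->
  forall b, (forall c a, ml (dd b) (tt (dT D) (di D c) a) = 0) -> b = 0.
Proof.
move=> min b b0; have [hdd _ cr _] := dd_coaction D.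
have mtB := tt_min (dT D); have mt := tt_min T.
have z1 w c a x : bounded_functional w -> dd (di D c) ⋅ one_tens (dT D) a = memb x -> b ⋅ slice (tt (dT D)) w x = 0.
  by move=> bw xE; apply: (coaction_annihilate qg (dd_coaction D) (b0 c) bw xE).
have hdi := di_hom D.
have z2 c c' : b ⋅ di D (c ⋅ c') = 0.
  apply: (act_lcancel (f := fun c => b ⋅ di D c) crd wcd).
    exact: (blin_comp (blin_smull b) (sh_blin_rep (mt_repl mtB) hdi)).
  move=> w {}c {}c' a x bw xE; have [xB xBE] := cr (di D c) a.
  have -> : di D (slice (tt T) w x ⋅ c') = slice (tt (dT D)) w xB ⋅ di D c'.
    rewrite -(slice_mulr mt c' x bw) -(slice_mulr mtB (di D c') xB bw).
    rewrite (mr_range mt c' xE) (mr_range mtB (di D c') xBE) di_equiv -/(dJ D).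
    move: (ml _ _); apply: (mt_ext mt).
    - exact: (blin_comp (sh_blin_rep (mt_repl mtB) hdi) (slice_blin mt bw)).
    - exact: (blin_comp (slice_blin mtB bw) (sh_blin_rep (mt_rep mtB) (dJ_hom D))).
    by move=> c1 a1; rewrite dJE !sliceE // (linZ (sh_lin hdi)).
  by rewrite smulA (z1 _ _ _ _ bw xBE) smul0l.
(* The product of [b ⋅ di D c] with its adjoint is [b ⋅ di D (c ⋅ c^⋆) ⋅ b^⋆], so products in [C]
   suffice. *)
have z3 c : b ⋅ di D c = 0.
  apply: sstar_inj; rewrite sstar0; apply: cstar_eq0.
  by rewrite sstarK sstarM -(shS hdi) smulA -[b ⋅ _ ⋅ _]smulA -(shM hdi) z2 smul0l.
have [_ z4] : b ⋅ b = 0 /\ b ⋅ b^⋆ = 0.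
  have cz : csub [set b' | b ⋅ b' = 0] by apply: csub_eq; [exact: blin_smull|exact: blin0].
  apply: (minimal_ind min (P := [set b' | b ⋅ b' = 0 /\ b ⋅ b'^⋆ = 0])).
  - apply/sub_cstarE; split; first exact: csubI cz (csub_star cz).
      by move=> x y /= [x1 x2] [y1 y2]; rewrite sstarM !smulA x1 y2 !smul0l.
    by move=> x /= [x1 x2]; rewrite sstarK.
  - by move=> c; split=> //=; rewrite -(shS hdi).
  have zs w a1 c a x : bounded_functional w -> dd (di D c) ⋅ one_tens (dT D) a = memb x ->
      b ⋅ slice (tt (dT D)) w (ml (one_tens (dT D) a1) x) = 0.
    by move=> bw xE; rewrite slice_onel //; apply: z1 xE; exact: bf_mull.
  move=> w a1 c a x bw xE; split; first exact: zs xE.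
  by have [w' [x' [bw' xE' ->]]] := slice_onel_star a1 bw xE; exact: zs xE'.
by apply: sstar_inj; rewrite sstar0; apply: cstar_eq0; rewrite sstarK.
Qed.

Variables (K0 K2 K3 : hilbertType R) (h2 : K0 -> H -> K2) (h3 : K0 -> L -> K3) (hr : K2 -> H -> K3).
Hypotheses (hh2 : hilbert_tensor h2) (hh3 : hilbert_tensor h3) (hhr : hilbert_tensor hr).
Hypothesis assoc : forall x y z, hr (h2 x y) z = h3 x (h y z).
Variables (s0 : C -> Bop K0) (S2 : tA T -> Bop K2) (S3 : tAA T -> Bop K3).
Hypotheses (hs0 : star_hom s0) (trep : tensorA_rep hh2 hh3 hhr s0 SA P2 S2 S3) (nd3 : nondeg S3).
Variable sb : multiplier (tA T) -> Bop K2.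
Hypotheses (hsb : star_hom sb) (sbI : forall m, impl S2 m (sb m)).
Variables (T2 : cstarAlgType R) (t2 : Bop K2 -> A -> T2) (ST : T2 -> Bop K3).
Hypotheses (mt2 : min_tensor t2) (hST : star_hom ST) (STi : injective ST) (STE : forall X a, ST (t2 X a) = otens hhr X (SA a)).

(** A faithful copy of the dilation inside [B(K2)] in which the coaction is [beta]; its values on
    the generators depend on [d] alone. *)
Definition realization (D : dilation d) (Phi : dB D -> Bop K2) : Prop :=
  [/\ star_hom Phi, injective Phi, forall c, Phi (di D c) = sb (d c)
    & forall b a x, dd b ⋅ one_tens (dT D) a = memb x ->
        ST (tens_hom (@tt _ _ _ (dT D)) t2 Phi x) = beta U hh3 hhr (Phi b) ⋅ otens hhr (one K2) (SA a)].

Lemma realization_ex D : minimal_dilation D -> exists Phi, @realization D Phi.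
Proof.
move=> min; have [[hS2 S2i] [hS3 S3i] E2 E3 _] := trep.
have [[hSA SAi _] _ _ _ _] := qg.
have [hdd _ cr ci] := dd_coaction D.
have mtB := tt_min (dT D); have mt := tt_min T; have mtl := tl_min T.
have [k [hk kE]] := restrict_ex min.
have k_di c : k (di D c) = d c.
  by apply: ml_inj => y; apply: (@dJ_inj _ _ _ _ _ D); rewrite kE dd_di.
have k0 b : k b = 0 -> b = 0.
  move=> kb; apply: (minimal_kernel min) => c a.
  by rewrite -dJE -kE kb; exact: (lin0 (sh_lin (dJ_hom D))).
pose Phi b := sb (k b).
have hPhi : star_hom Phi by exact: (sh_comp hsb hk).
have Phii : injective Phi.
  move=> b b' e; apply/subr0_eq/k0; rewrite (linB (sh_lin hk)).
  have -> : k b = k b' by apply: (impl_uniq S2i (sbI _)); rewrite -[sb _]/(Phi b) e.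
  by rewrite subrr.
exists Phi; split=> //; first by move=> c; rewrite /Phi k_di.
move=> b a x xE; have [hJ2 J2E] := tens_hom_spec mtB mt2 hPhi.
set J2 := tens_hom _ _ _ in hJ2 J2E *.
pose K := tens_mhom (@tt _ _ _ (dT D)) (@tl _ _ _ T) k (@memb R A).
have hK : star_hom K by exact: (tens_mhom_hom mtB mtl hk (memb_hom A)).
have bJ3 : blin (dJ3 D) by exact: (sh_blin_rep (mt_rep (tl_min (dT D))) (dJ3_hom D)).
have KE v z : dJ3 D (ml (K z) v) = ml (coact_id (@dd _ _ _ _ _ D) z) (dJ3 D v).
  move: z; apply: (mt_ext mtB).
  - exact: (blin_comp bJ3 (msh_blinl _ hK)).
  - exact: (msh_blinl _ (coact_id_hom hdd)).
  move=> b1 a1; rewrite coact_idE // /K (tens_mhomE mtB mtl hk (memb_hom A)).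
  move: v; apply: (mt_ext mtl).
  - exact: (blin_comp bJ3 (ml_blin _)).
  - exact: (blin_comp (ml_blin _) bJ3).
  by move=> y a2; rewrite (mtensE mtl) !dJ3E (mtensE (tl_min (dT D))) kE.
have oE v : ml (one_one_tens (dT D) a) (dJ3 D v) = dJ3 D (ml (one_one_tens T a) v).
  move: v; apply: (mt_ext mtl).
  - exact: (blin_comp (ml_blin _) bJ3).
  - exact: (blin_comp bJ3 (ml_blin _)).
  by move=> y a2; rewrite (mtensE mtl) !dJ3E (mtensE (tl_min (dT D))).
(* The coaction identity, pulled back to [C (x) A (x) A] along the injection [dJ3]. *)
have Kx : K x = id_Delta (k b) ⋅ one_one_tens T a.
  apply: ml_inj => v; apply: (@dJ3_inj _ _ _ _ _ D); rewrite KE (ci _ _ _ xE).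
  by rewrite /= oE (id_Delta_dJ (kE b)).
have KI : impl S3 (K x) (ST (J2 x)).
  apply: (tens_mhom_impl mtB mtl hk (memb_hom A) hS3 S3i (S := ST \o J2)).
    exact: (blin_comp (sh_blin hST) (sh_blin_rep (mt_rep mt2) hJ2)).
  move=> b1 a1 /=; rewrite J2E STE.
  exact: (mtens_impl mtl hS3 S3i E3 (sbI _) (impl_memb hSA a1)).
apply: (impl_uniqF nd3 KI); rewrite Kx; apply: implM.
  exact: (id_Delta_impl qg assoc hs0 trep (sbI _)).
exact: (mtens_impl mtl hS3 S3i E3 (impl_one _) (impl_memb hSA a)).
Qed.

Lemma realization_slice D Phi w x : @realization D Phi -> bounded_functional w ->
  Phi (slice (tt (dT D)) w x) = slice t2 w (tens_hom (@tt _ _ _ (dT D)) t2 Phi x).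
Proof.
move=> [hPhi _ _ _] bw; have mtB := tt_min (dT D); have [hJ2 J2E] := tens_hom_spec mtB mt2 hPhi.
move: x; apply: (mt_ext mtB).
- exact: (blin_comp (sh_blin hPhi) (slice_blin mtB bw)).
- exact: (blin_comp (slice_blin mt2 bw) (sh_blin_rep (mt_rep mt2) hJ2)).
by move=> b a; rewrite J2E !sliceE // (linZ (sh_lin hPhi)).
Qed.

(** The range of [Psi] is closed under the operations and contains the images of the generators of
    [D], hence the range of [Phi]; [phi] is [Phi] followed by the inverse of [Psi]. *)
Lemma realization_le D E Phi Psi : minimal_dilation D -> @realization D Phi -> @realization E Psi ->
  exists phi, dilation_morphism phi /\ forall b, Psi (phi b) = Phi b.
Proof.
move=> min rD rE; have [hPhi Phii Phid PhiE] := rD; have [hPsi Psii Psid PsiE] := rE.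
have [_ _ cr _] := dd_coaction E.
have mtD := tt_min (dT D); have mtE := tt_min (dT E).
have rg b : exists b', Psi b' = Phi b.
  suff [b' _ ?] : range Psi (Phi b) by exists b'.
  move: b; apply: (minimal_ind min (P := [set b | range Psi (Phi b)])).
  - apply/sub_cstarE; split.
    + exact: (csub_pre (sh_blin hPhi) (iso_range (sh_lin hPsi) (rep_iso hPsi Psii))).
    + by move=> x y /= [x' _ x'E] [y' _ y'E]; exists (x' ⋅ y') => //; rewrite (shM hPsi) (shM hPhi) x'E y'E.
    by move=> x /= [x' _ x'E]; exists x'^⋆ => //; rewrite (shS hPsi) (shS hPhi) x'E.
  - by move=> c; exists (di E c) => //; rewrite Phid Psid.
  move=> w a1 c a x bw xE; have [x' x'E] := cr (di E c) a.
  rewrite slice_onel //; have bw' := bf_mull a1 bw; exists (slice (tt (dT E)) (fun a => w (a1 ⋅ a)) x') => //.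
  rewrite (realization_slice _ rD) // (realization_slice _ rE) //; congr (slice _ _ _).
  by apply: STi; rewrite (PhiE _ _ _ xE) (PsiE _ _ _ x'E) Phid Psid.
have [phi [hphi phiE]] := hom_factor hPhi hPsi Psii rg.
exists phi; split=> //; split=> //; first by move=> c; apply: Psii; rewrite phiE Phid Psid.
move=> b a x xE; have [x' x'E] := cr (phi b) a; rewrite x'E; congr memb.
apply: (tens_hom_inj mtE mt2 hPsi Psii).
have -> : tens_hom (tt (dT E)) t2 Psi x' = tens_hom (tt (dT D)) t2 Phi x.
  by apply: STi; rewrite (PsiE _ _ _ x'E) (PhiE _ _ _ xE) phiE.
have [h1 h1E] := tens_hom_spec mtD mtE hphi; have [h2' h2E] := tens_hom_spec mtE mt2 hPsi.
apply/esym/(tens_hom_uniq mtD mt2 hPhi (sh_comp h2' h1)) => b1 a1.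
by rewrite /= h1E h2E phiE.
Qed.

Lemma realization_iso D E Phi Psi : minimal_dilation D -> minimal_dilation E ->
  @realization D Phi -> @realization E Psi -> dilation_isomorphic D E.
Proof.
move=> minD minE rD rE; have [_ Phii _ _] := rD; have [_ Psii _ _] := rE.
have [phi [mphi phiE]] := realization_le minD rD rE.
have [psi [mpsi psiE]] := realization_le minE rE rD.
exists phi, psi; split=> // b; first by apply: Phii; rewrite psiE phiE.
by apply: Psii; rewrite phiE psiE.
Qed.
End Uniqueness.

Theorem minimal_dilation_uniq (R : realType) (A : cstarBialg R) (C : cstarAlgType R) (T : tensorA A C)
    (d : C -> multiplier (tA T)) (D E : dilation d) : cstar_quantum_group A ->
  coaction_range d -> weakly_continuous d ->
  minimal_dilation D -> minimal_dilation E -> dilation_isomorphic D E.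
Proof.
move=> /cqg_data[H [L [h [hh [SA [P2 [U qg]]]]]]] crd wcd minD minE.
have [[hSA SAi ndA] [hP2 P2E] _ _ _] := qg.
have [K0 [s0 [hs0 s0i nd0]]] := nondeg_rep_ex (mt_repl (tt_min T)).
have [K2 [h2 hh2]] := hilbert_tensor_ex K0 H.
have [K3 [h3 hh3]] := hilbert_tensor_ex K0 L.
have [hr [hhr assoc]] := ht_assoc hh2 hh hh3.
have [S2 [S3 tr]] := tensorA_rep_ex hh2 (hh := hh) hh3 hhr assoc hs0 s0i hSA SAi hP2 P2E T.
have [[hS2 S2i] [hS3 S3i] E2 E3 _] := tr.
have nd2 := nondeg_otens E2 nd0 ndA.
have nd3 := nondeg_otens E3 nd2 ndA.
have [sb [hsb sbI]] := bar_ex hS2 S2i nd2.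
have hid : star_hom (@id (Bop K2)) by [].
have iid : injective (@id (Bop K2)) by [].
have [T2 [t2 [ST [mt2 hST STi STE]]]] := min_tensor_ex hhr hid iid hSA SAi.
have [Phi rD] := realization_ex qg crd wcd assoc hs0 tr nd3 hsb sbI mt2 hST STE minD.
have [Psi rE] := realization_ex qg crd wcd assoc hs0 tr nd3 hsb sbI mt2 hST STE minE.
exact: (realization_iso mt2 STi minD minE rD rE).
Qed.

Theorem mainTheorem1 :
  forall (R : realType) (A : cstarBialg R),
    cstar_quantum_group A ->
    slice_map_property (bA A) ->
    forall (C : cstarAlgType R) (T : tensorA A C) (d : C -> multiplier (tA T)),
      partial_coaction d -> injective d -> weakly_continuous d -> regular d ->
      (exists D : dilation d, minimal_dilation D) /\
      (forall D E : dilation d,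
         minimal_dilation D -> minimal_dilation E -> dilation_isomorphic D E).
Proof.
move=> R A qgA smp C T d pcd injd wcd regd; split; first exact: minimal_dilation_ex.
by have [_ _ crd _] := pcd => D E minD minE; exact: minimal_dilation_uniq.
Qed.
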